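(* Let $P$ be a kernel satisfying the standing kernel assumptions, $h>0$, and fix $\mu_0^h\in\mathcal M^+_{h\delta}(X)$. Then under $\mathbb P^{h,P}_{\mu_0^h}$, $\mathcal N[h^{-1}\mu]$ defines a random measure on $(0,T]\times\mathcal J$ whose compensator is $h^{-1}\kappa^{h,P}[\mu]$. Moreover, the process $$\left\{\tilde{\mathcal N}^{h,P}[\mu]((0,t]\times U),\ \mathcal F_t,\ U\in\mathcal B(\mathcal J)\right\}$$ is an orthogonal martingale measure on $\mathcal J$ with predictable covariance measure given, for all $U_1,U_2\in\mathcal B(\mathcal J)$, by $$\left\langle\tilde{\mathcal N}^{h,P}[\mu]((0,t]\times U_1),\tilde{\mathcal N}^{h,P}[\mu]((0,t]\times U_2)\right\rangle=h^{-1}\kappa^{h,P}[\mu]((0,t]\times(U_1\cap U_2)).$$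
   Context: **Spaces.** $T>0$ and an integer $k\ge1$ are fixed; $X$ is a Polish space. $SX^j$ is the quotient of $X^j$ by permutations (unordered $j$-tuples, with multiplicity; $SX^0$ is one point), $S\mathcal X=\bigcup_{j\ge0}SX^j$, $|\mathbf x|=j$ for $\mathbf x\in SX^j$. For $\mathbf x\sim(x_1,\dots,x_j)$, $\delta^+_{\mathbf x}=\sum_i\delta_{x_i}$. $\mathcal M^+(X)$: finite nonnegative Borel measures with the weak topology; $\langle f,\mu\rangle=\int f\,d\mu$; $\mathcal M^+_{h\delta}(X)=\{h\delta^+_{\mathbf x}:\mathbf x\in S\mathcal X\}$. $D_T(\mathcal M^+(X))$: càdlàg paths with the Skorokhod topology. $f^{\tilde\otimes\ell}(\mathbf x)=\prod_{i=1}^\ell f(x_i)$ on $SX^\ell$. $E:X\to[0,\infty)$ is continuous with compact sublevel sets. $d_1=k$, $d_\ell=\ell$ for $2\le\ell\le k$; $\mathcal J^\ell_m=SX^\ell\times SX^m$, $\mathcal J=\bigcup_{\ell=1}^k\bigcup_{m=0}^{d_\ell}\mathcal J^\ell_m$. **Standing kernel assumptions.** $P:[0,T]\times S\mathcal X\to\mathcal M^+(S\mathcal X)$ is measurable and: (1) $P(t,\mathbf x,\cdot)=0$ unless $1\le|\mathbf x|\le k$; (2) for $\mathbf x\in SX^\ell$, $P(t,\mathbf x,\cdot)$ is supported in $\bigcup_{m=0}^{d_\ell}SX^m$; (3) for a.e. $t$ and all $\mathbf x$, $\langle E,\delta^+_{\mathbf y}-\delta^+_{\mathbf x}\rangle\le0$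 for $P(t,\mathbf x,d\mathbf y)$-a.e. $\mathbf y$; (4) either $\langle1,\delta^+_{\mathbf y}-\delta^+_{\mathbf x}\rangle\le0$ $P$-a.s., or there is $\varepsilon_0>0$ with $E\ge\varepsilon_0$ on $X$; (5) with $P(t,\mathbf x)=P(t,\mathbf x,S\mathcal X)$, $\sup_{t,\,1\le\ell\le k,\,\mathbf x\in SX^\ell}P(t,\mathbf x)/(1+E)^{\tilde\otimes\ell}(\mathbf x)<\infty$. **Process.** $\mathbb P^{h,P}_{\mu_0^h}$ is the law on $D_T(\mathcal M^+(X))$ of the Markov jump process started from $\mu_0^h$ with generator $$\Lambda^{h,P}_tF(h\delta^+_{\mathbf x})=\sum_{\ell=1}^{k\wedge|\mathbf x|}h^{\ell-1}\sum_{|I|=\ell}\sum_{m=0}^{d_\ell}\int_{SX^m}[F(h\delta^+_{\mathbf x}-h\delta^+_{\mathbf x_I}+h\delta^+_{\mathbf y})-F(h\delta^+_{\mathbf x})]P(t,\mathbf x_I,d\mathbf y),$$ with $I\subset\{1,\dots,|\mathbf x|\}$, $\mathbf x_I=\{x_i,i\in I\}$. $\mu$ denotes the coordinate process and $(\mathcal F_t)$ its right-continuous natural filtration. **Measures on jumps.** $\kappa^\ell[\delta^+_{\mathbf x}]$ is the measure on $SX^\ell$ with $\int f\,d\kappa^\ell[\delta^+_{\mathbf x}]=\sum_{|I|=\ell}f(\mathbf x_I)$. For a path $\xi$ with values in $\mathcal M^+_{h\delta}(X)$, $\kappa^{h,P}[\xi]((0,t]\times U)=\sum_{\ell=1}^k\sum_{m=0}^{d_\ell}\int_0^t\int_{U\cap\mathcal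 J^\ell_m}P(s,\mathbf z,d\mathbf y)h^\ell\kappa^\ell[h^{-1}\xi_s](d\mathbf z)ds$. The counting measure of jumps is $\mathcal N[\xi]((0,t]\times U)=\sum_{0<s\le t}1\{\xi_s-\xi_{s-}\in\delta_U\}$ with $\delta_U=\{\delta^+_{\mathbf y}-\delta^+_{\mathbf z}:(\mathbf z,\mathbf y)\in U\}$, and $\tilde{\mathcal N}^{h,P}[\xi]((0,t]\times U)=\mathcal N[h^{-1}\xi]((0,t]\times U)-h^{-1}\kappa^{h,P}[\xi]((0,t]\times U)$. (All are set to $0$ if $\xi$ is not $\mathcal M^+_{h\delta}(X)$-valued.) ''Orthogonal martingale measure'' is in the sense of Walsh.
   Formalization: U ranges not over all of B(J) but over Borel subsets, with Borel saturation, of a set of jumps with z≠y that P does not confuse with others of equal displacement, determined there by δ_y−δ_z; adaptedness and predictability hold modulo null sets. *)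

(* Defs.v *)
From HB Require Import structures.
From mathcomp Require Import all_boot all_order all_algebra finmap multiset.
From mathcomp Require Import all_classical all_reals all_analysis.
From mathcomp Require Import measurable_realfun giry.

Set Implicit Arguments.
Unset Strict Implicit.
Unset Printing Implicit Defensive.

Import Order.TTheory GRing.Theory Num.Theory.
Import numFieldNormedType.Exports.

Local Open Scope classical_set_scope.
Local Open Scope ring_scope.

Definition polish (R : realType) (X : topologicalType) : Prop :=
  exists d : X -> X -> R,
    [/\ (forall x y, 0 <= d x y) /\ (forall x y, d x y = 0 <-> x = y),
        (forall x y, d x y = d y x) /\
          (forall x y z, d x z <= d x y + d y z),
        (forall (x : X) (A : set X), nbhs x A <->
          exists2 e : R, 0 < e & [set y | d x y < e] `<=` A),
        (forall u : nat -> X,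
          (forall e : R, 0 < e -> exists n0 : nat, forall m n : nat,
             (n0 <= m)%N -> (n0 <= n)%N -> d (u m) (u n) < e) ->
          exists l : X, u @ \oo --> l) &
        exists2 D : set X, countable D & dense D].

Definition borel (Y : ptopologicalType) := g_sigma_algebraType (@open Y).

Section finite_measures.
Context (R : realType).

(* A library measure is a function on all subsets that is only constrained on
   the measurable ones, so measures are compared with [measure_eq], never with
   Leibniz equality.  The topology below cannot separate two measures that are
   [measure_eq], hence no Borel set can either. *)
Definition Mplus (Y : ptopologicalType) :=
  {finite_measure set (borel Y) -> \bar R}.

HB.instance Definition _ Y := gen_eqMixin (Mplus Y).
HB.instance Definition _ Y := gen_choiceMixin (Mplus Y).
HB.instance Definition _ Y := isPointed.Build (Mplus Y) mzero.

Definition pairing (Y : ptopologicalType) (f : Y -> R) (mu : Mplus Y) : R :=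
  \int[mu]_(y in [set: borel Y]) f y.

Definition Cb (Y : ptopologicalType) : Type :=
  {f : Y -> R | continuous f /\ exists c : R, forall y, `|f y| <= c}.

Definition weak_topology_def (Y : ptopologicalType) :=
  sup_topology (fun f : Cb Y => Topological.class
    (initial_topology (fun mu : Mplus Y => pairing (sval f) mu))).

HB.instance Definition _ Y := Topological.copy (Mplus Y) (weak_topology_def Y).

End finite_measures.

Section configurations.
Context (X : ptopologicalType).

Definition SX := {mset X}%mset.

HB.instance Definition _ := Choice.on SX.
HB.instance Definition _ := isPointed.Build SX mset0.

Definition pts (x : SX) : seq X := enum_mset x.

Definition card (x : SX) : nat := size (pts x).

Definition SXn (j : nat) : set SX := [set x | card x = j].

Definition unordered (j : nat) (v : prod_topology (fun _ : 'I_j => X)) : SX :=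
  seq_mset [seq v i | i <- enum 'I_j].

(* Disjoint union over j of the quotient topologies of X^j. *)
Definition SX_open : set (set SX) :=
  [set A | forall j, open (@unordered j @^-1` A)].

Let SX_openT : SX_open setT.
Proof. by move=> j; rewrite preimage_setT; exact: openT. Qed.

Let SX_openI : setI_closed SX_open.
Proof. by move=> A B oA oB j; rewrite preimage_setI; exact: openI. Qed.

Let SX_open_bigU (I : Type) (f : I -> set SX) :
  (forall i, SX_open (f i)) -> SX_open (\bigcup_i f i).
Proof.
by move=> of_ j; rewrite preimage_bigcup; apply: bigcup_open => i _; apply: of_.
Qed.

HB.instance Definition _ :=
  isOpenTopological.Build SX SX_openT SX_openI SX_open_bigU.

Definition subconf (x : SX) (I : {set 'I_(card x)}) : SX :=
  seq_mset [seq tnth (in_tuple (pts x)) i | i in I].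

Context (R : realType).

Definition sum_conf (f : X -> R) (x : SX) : R := \sum_(a <- pts x) f a.

Definition prod_conf (f : X -> R) (x : SX) : R := \prod_(a <- pts x) f a.

Definition deltap (x : SX) (B : set (borel X)) : \bar R :=
  (\sum_(a <- pts x) \d_(a : borel X) B)%E.

Definition hdelta_fun (h : {posnum R}) (x : SX) (B : set (borel X)) : \bar R :=
  ((h%:num)%:E * deltap x B)%E.

Let hdeltaE (h : {posnum R}) (x : SX) : hdelta_fun h x =
  mscale h%:num%:nng
    (msum (fun i => \d_(nth point (pts x) i : borel X)) (size (pts x))).
Proof.
apply/funext => B; rewrite /hdelta_fun /deltap /mscale/= /msum/=.
by rewrite (big_nth point) big_mkord.
Qed.

Let hdelta0 h x : hdelta_fun h x set0 = 0%E.
Proof. by rewrite hdeltaE measure0. Qed.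

Let hdelta_ge0 h x B : (0 <= hdelta_fun h x B)%E.
Proof. by rewrite hdeltaE measure_ge0. Qed.

Let hdelta_sigma_additive h x : semi_sigma_additive (hdelta_fun h x).
Proof. by rewrite hdeltaE; exact: measure_semi_sigma_additive. Qed.

HB.instance Definition _ h x := isMeasure.Build _ (borel X) R (hdelta_fun h x)
  (hdelta0 h x) (hdelta_ge0 h x) (@hdelta_sigma_additive h x).

Let hdelta_finite h x : fin_num_fun (hdelta_fun h x).
Proof.
move=> B mB; rewrite /hdelta_fun /deltap fin_numM//.
by apply/sum_fin_numP => a _ _; exact: fin_num_measure.
Qed.

HB.instance Definition _ h x :=
  @Measure_isFinite.Build _ (borel X) R (hdelta_fun h x) (hdelta_finite h x).

Definition hdelta (h : {posnum R}) (x : SX) : Mplus R X := hdelta_fun h x.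

Definition Mhdelta (h : {posnum R}) : set (Mplus R X) :=
  [set nu | exists x, measure_eq nu (hdelta h x)].

(* The configuration x with nu = h delta^+_x, for nu in [Mhdelta h]. *)
Definition conf (h : {posnum R}) (nu : Mplus R X) : SX :=
  get [set x | measure_eq nu (hdelta h x)].

Definition signed_delta (p : SX * SX) (B : set (borel X)) : \bar R :=
  (deltap p.2 B - deltap p.1 B)%E.

Definition delta_of (U : set (SX * SX)) : set (set (borel X) -> \bar R) :=
  [set nu | exists2 p, U p & forall B, measurable B -> nu B = signed_delta p B].

End configurations.

Arguments hdelta {X R} h x.
Arguments Mhdelta {X R} h.
Arguments conf {X R} h nu.

Section kernels.
Context (R : realType) (X : ptopologicalType).
Variables (k : nat) (T : R).

Definition dmax (l : nat) : nat := if l == 1%N then k else l.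

Definition jumps : set (SX X * SX X) :=
  [set p | (1 <= card p.1 <= k)%N /\ (card p.2 <= dmax (card p.1))%N].

Definition kernel_assumptions (E : X -> R) (P : R -> SX X -> Mplus R (SX X)) :=
  [/\ measurable_fun (`[0, T]%classic `*` [set: borel (SX X)])
        (fun q : measurableTypeR R * borel (SX X) =>
           P q.1 q.2 : borel (Mplus R (SX X))),
      (forall t x, 0 <= t <= T -> ~~ (1 <= card x <= k)%N ->
         P t x [set: borel (SX X)] = 0%E) /\
      (forall t x, 0 <= t <= T -> (1 <= card x <= k)%N ->
         P t x (~` [set y | (card y <= dmax (card x))%N]) = 0%E),
      {ae @lebesgue_measure R, forall t, 0 <= t <= T -> forall x,
         {ae P t x, forall y, sum_conf E y - sum_conf E x <= 0}},
      {ae @lebesgue_measure R, forall t, 0 <= t <= T -> forall x,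
         {ae P t x, forall y, (card y)%:R - (card x)%:R <= 0 :> R}} \/
      (exists2 eps0 : R, 0 < eps0 & forall a, eps0 <= E a) &
      exists C : R, forall t x, 0 <= t <= T -> (1 <= card x <= k)%N ->
        fine (P t x [set: borel (SX X)]) / prod_conf (fun a => 1 + E a) x <= C].

Variables (h : {posnum R}) (P : R -> SX X -> Mplus R (SX X)).

Definition generator (t : R) (F : Mplus R X -> R) (x : SX X) : R :=
  \sum_(1 <= l < (minn k (card x)).+1) h%:num ^+ l.-1 *
    \sum_(I : {set 'I_(card x)} | #|I| == l)
      \sum_(0 <= m < (dmax l).+1)
        \int[P t (subconf I)]_(y in (@SXn X m : set (borel (SX X))))
          (F (hdelta h ((x `\` subconf I) `+` y)%mset) - F (hdelta h x)).

Definition cadlag (xi : R -> Mplus R X) : Prop :=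
  (forall t, xi @ t^'+ --> xi t) /\
  (forall t, exists l : Mplus R X, xi @ t^'- --> l).

(* Paths on [0, T] are extended to R by the constants xi 0 and xi T. *)
Definition DT : Type :=
  {xi : R -> Mplus R X | [/\ cadlag xi,
     forall t, t <= 0 -> measure_eq (xi t) (xi 0) &
     forall t, T <= t -> measure_eq (xi t) (xi T)]}.

Definition path_of (xi : DT) : R -> Mplus R X := sval xi.

Let const_path (mu : Mplus R X) : DT.
Proof.
exists (fun=> mu); split => //; split=> t; first exact: cvg_cst.
by exists mu; exact: cvg_cst.
Defined.

HB.instance Definition _ := gen_eqMixin DT.
HB.instance Definition _ := gen_choiceMixin DT.
HB.instance Definition _ := isPointed.Build DT (const_path point).

Definition time_change (lam : R -> R) : Prop :=
  set_bij `[0, T]%classic `[0, T]%classic lam /\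
  {in `[0, T] &, {homo lam : s t / s < t}}.

(* The Skorokhod (J1) topology of D([0, T], S) for a completely regular S only
   depends on the topology of S and can be computed from any uniformity that
   induces it; here, from the pseudometrics mu, nu |-> |<f, mu> - <f, nu>|,
   with f bounded continuous, which induce the weak topology. *)
Definition skorokhod_nbhd (xi : DT) (n : nat) (f : 'I_n -> Cb R X) (e : R) :
    set DT :=
  [set eta | exists2 lam, time_change lam & forall t, 0 <= t <= T ->
     `|lam t - t| < e /\
     forall i, `|pairing (sval (f i)) (path_of eta (lam t)) -
                 pairing (sval (f i)) (path_of xi t)| < e].

Definition skorokhod_open : set (set DT) :=
  [set A | forall xi, A xi -> exists n (f : 'I_n -> Cb R X) (e : R),
     0 < e /\ skorokhod_nbhd xi f e `<=` A].

Definition skorokhod : Type := g_sigma_algebraType skorokhod_open.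

End kernels.

(* Filtrations, martingales, and martingale measures on a time interval
   [0, T].  Processes take values in \bar R, so that those that are only almost
   surely finite are covered. *)
Section stochastic_calculus.
Context (R : realType) d (Om : measurableType d) (PP : probability Om R).
Variable (T : R).

Definition wrt (G : set (set Om)) (f : Om -> \bar R) : Prop :=
  forall Y : set (\bar R), measurable Y -> G (f @^-1` Y).

Definition augmented (G : set (set Om)) : set (set Om) :=
  [set A | exists2 B, G B & PP.-negligible ((A `\` B) `|` (B `\` A))].

Variable F : R -> set (set Om).

Definition martingale (M : R -> Om -> \bar R) : Prop :=
  [/\ (forall t, 0 <= t <= T -> wrt (augmented (F t)) (M t)),
      (forall t, 0 <= t <= T -> (\int[PP]_w `|M t w| < +oo)%E) &
      forall s t A, 0 <= s -> s <= t -> t <= T -> F s A ->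
        (\int[PP]_(w in A) M t w = \int[PP]_(w in A) M s w)%E].

Definition predictable_rectangles : set (set (R * Om)) :=
  [set D | (exists s t A, [/\ 0 <= s, s < t, t <= T, augmented (F s) A &
                              D = `]s, t]%classic `*` A]) \/
           (exists2 A, augmented (F 0) A & D = [set 0] `*` A)].

Definition predictable (M : R -> Om -> \bar R) : Prop :=
  forall Y : set (\bar R), measurable Y ->
    <<s predictable_rectangles >>
      [set tw : R * Om | 0 <= tw.1 <= T /\ Y (M tw.1 tw.2)].

(* A is the predictable quadratic covariation <M1, M2>. *)
Definition predictable_covariation (M1 M2 A : R -> Om -> \bar R) : Prop :=
  [/\ predictable A,
      {ae PP, forall w, A 0 w = 0%E},
      {ae PP, forall w, (forall t, 0 <= t <= T -> A t w \is a fin_num) /\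
                bounded_variation 0 T (fun t => fine (A t w))} &
      martingale (fun t w => M1 t w * M2 t w - A t w)%E].

Context (J : pointedType).
(* A sigma-algebra [Alg] of subsets of [J0]. *)
Variables (J0 : set J) (Alg : set (set J)).

Implicit Type nu : R -> set J -> Om -> \bar R.

Definition random_measure nu : Prop :=
  exists m : Om -> {measure set
      (measurableTypeR R * g_sigma_algebraType Alg) -> \bar R},
    (forall B, measurable B -> wrt (augmented (F T)) (fun w => m w B)) /\
    {ae PP, forall w, m w (~` (`]0, T]%classic `*` J0)) = 0%E /\
      forall t U, 0 <= t <= T -> Alg U ->
        nu t U w = m w (`]0, t]%classic `*` U)}.

Definition compensator nu comp : Prop :=
  random_measure comp /\
  forall U, Alg U -> predictable (fun t => comp t U) /\
    martingale (fun t w => nu t U w - comp t U w)%E.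

Definition sqnorm (f : Om -> \bar R) : \bar R := (\int[PP]_w (f w * f w))%E.

(* Walsh: sigma-finite L^2-valued measures and martingale measures. *)
Definition sigma_finite_L2_measure (M : set J -> Om -> \bar R) : Prop :=
  [/\ (forall U, Alg U -> (sqnorm (M U) < +oo)%E),
      (forall U V, Alg U -> Alg V -> U `&` V = set0 ->
        {ae PP, forall w, M (U `|` V) w = (M U w + M V w)%E}) &
      exists En : (set J)^nat,
        [/\ (forall n, Alg (En n)), (forall n, En n `<=` En n.+1),
            \bigcup_n En n = J0,
            (forall n, exists C : R, forall U, Alg U -> U `<=` En n ->
               (sqnorm (M U) <= C%:E)%E) &
            forall n (U : (set J)^nat), (forall j, Alg (U j)) ->
              (forall j, U j `<=` En n) -> (forall j, U j.+1 `<=` U j) ->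
              \bigcap_j U j = set0 ->
              (fun j => sqnorm (M (U j))) @ \oo --> 0%E]].

Definition martingale_measure (M : R -> set J -> Om -> \bar R) : Prop :=
  [/\ (forall U, Alg U -> {ae PP, forall w, M 0 U w = 0%E}),
      (forall t, 0 < t <= T -> sigma_finite_L2_measure (M t)) &
      forall U, Alg U -> martingale (fun t => M t U)].

Definition orthogonal_martingale_measure (M : R -> set J -> Om -> \bar R) :
    Prop :=
  martingale_measure M /\
  forall U V, Alg U -> Alg V -> U `&` V = set0 ->
    martingale (fun t w => M t U w * M t V w)%E.

End stochastic_calculus.

Section process.
Context (R : realType) (X : ptopologicalType).
Variables (k : nat) (T : R) (h : {posnum R}).
Variable P : R -> SX X -> Mplus R (SX X).

Local Notation Om := (skorokhod X T).

Definition natural_filtration (t : R) : set (set Om) :=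
  <<s [set A | exists2 r, 0 <= r <= t & exists2 B : set (borel (Mplus R X)),
         measurable B & A = [set xi : Om | B (path_of xi r)]] >>.

Definition right_filtration (t : R) : set (set Om) :=
  \bigcap_(s in [set s | t < s]) natural_filtration s.

Definition bounded_measurable (F : Mplus R X -> R) : Prop :=
  measurable_fun [set: borel (Mplus R X)] (F : borel (Mplus R X) -> R) /\
  exists c : R, forall nu, `|F nu| <= c.

Definition Mhdelta_valued (xi : Om) : Prop :=
  forall t, 0 <= t <= T -> Mhdelta h (path_of xi t).

Definition pure_jump (xi : Om) : Prop :=
  exists s : seq R, forall t u, 0 <= t -> t <= u -> u <= T ->
    (forall r, r \in s -> ~~ (t < r <= u)) ->
    measure_eq (path_of xi t) (path_of xi u).

Record markov_jump_law (mu0 : Mplus R X) (PP : probability Om R) : Prop := {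
  law_init : {ae PP, forall xi, measure_eq (path_of xi 0) mu0};
  law_jump : {ae PP, forall xi, Mhdelta_valued xi /\ pure_jump xi};
  law_markov : forall s t F, 0 <= s -> s <= t -> t <= T ->
    bounded_measurable F ->
    exists2 G, bounded_measurable G &
      forall A, natural_filtration s A ->
        \int[PP]_(xi in A) F (path_of xi t) =
        \int[PP]_(xi in A) G (path_of xi s);
  law_generator : forall F, bounded_measurable F ->
    martingale PP T right_filtration (fun t xi =>
      (F (path_of xi t) - F (path_of xi 0) -
       \int[lebesgue_measure]_(s in `]0, t])
          generator k h P s F (conf h (path_of xi s)))%:E) }.

(* [kappa xi t U] is kappa^{h,P}[xi]((0,t] x U); the sum over I is the integral
   against kappa^l[h^-1 xi_s]. *)
Definition kappa (xi : Om) (t : R) (U : set (SX X * SX X)) : \bar R :=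
  if `[< Mhdelta_valued xi >] then
    (\sum_(1 <= l < k.+1) \sum_(0 <= m < (dmax k l).+1)
      \int[lebesgue_measure]_(s in `]0%R, t])
        ((h%:num ^+ l)%:E *
         \sum_(I : {set 'I_(card (conf h (path_of xi s)))} | #|I| == l)
           P s (subconf I)
             [set y | U (subconf I, y) /\ SXn m y]))%E
  else 0%E.

Definition left_limit (xi : Om) (s : R) : Mplus R X :=
  lim (path_of xi r @[r --> s^'-]).

Definition scaled_jump (xi : Om) (s : R) (B : set (borel X)) : \bar R :=
  ((h%:num^-1)%:E * (path_of xi s B - left_limit xi s B))%E.

(* [jump_count xi t U] is N[h^-1 xi]((0,t] x U). *)
Definition jump_count (xi : Om) (t : R) (U : set (SX X * SX X)) : \bar R :=
  if `[< Mhdelta_valued xi >] then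
    (\esum_(s in `]0%R, t]%classic)
      (`[< delta_of U (scaled_jump xi s) >]%:R)%:E)%E
  else 0%E.

Definition scaled_kappa (xi : Om) (t : R) (U : set (SX X * SX X)) : \bar R :=
  ((h%:num^-1)%:E * kappa xi t U)%E.

Definition compensated_count (xi : Om) (t : R) (U : set (SX X * SX X)) :
    \bar R :=
  (jump_count xi t U - scaled_kappa xi t U)%E.

Definition borelJ (U : set (SX X * SX X)) : Prop :=
  <<s @open (SX X * SX X)%type >> U.

(* The members of J with the same displacement delta^+_y - delta^+_z as some
   element of U. *)
Definition saturation (U : set (SX X * SX X)) : set (SX X * SX X) :=
  [set p | jumps k p /\ delta_of U (signed_delta R p)].

(* A path only reveals the displacement delta^+_y - delta^+_z of a jump (z, y):
   distinct elements of J with the same displacement cannot be told apart, and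
   a jump with z = y is invisible.  [jump_space J0] says that no jump of the
   kernel is mistaken for an element of J0: every jump whose displacement is
   that of an element of J0 is in J0, up to a P-null set.  Such are the set of
   all (z, y) in J with z <> y, for any P, and every Borel subset of J on which
   (z, y) |-> delta^+_y - delta^+_z is injective and nonzero and whose
   complement is P-null. *)
Definition jump_space (J0 : set (SX X * SX X)) : Prop :=
  [/\ J0 `<=` jumps k, borelJ J0, borelJ (saturation J0),
      (forall p, J0 p -> p.1 <> p.2) &
      {ae @lebesgue_measure R, forall t, 0 <= t <= T -> forall z,
         {ae P t z, forall y, saturation J0 (z, y) -> J0 (z, y)}}].

(* The Borel subsets of J0 that are determined, within J0, by displacements. *)
Definition jump_algebra (J0 : set (SX X * SX X)) : set (set (SX X * SX X)) :=
  [set U | [/\ U `<=` J0, borelJ U, borelJ (saturation U) &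
               saturation U `&` J0 `<=` U]].

End process.

(* Main.v *)
(* Starting from a configuration x0, the total energy never increases, so by
   assumption (4) almost every path stays among configurations of bounded energy
   and cardinality, on which the total jump rate is bounded by a constant C0.
   The martingale problem for indicators 1_B extends to sets D of pairs (old
   configuration, new configuration): off the diagonal,
   P(A, D(Y_s, Y_t)) = E(A; int_]s,t] q(r, Y_r, D)) + O((t - s)^2).  Summing over
   uniform grids, the number of grid steps whose endpoints are in D is eventually
   the number N^D of jumps in D; all of them are dominated by the number of
   off-diagonal jumps, which is square integrable by Fatou's lemma.  In the limit
   N^D - K^D is a martingale, K^D being the time integral of the rate.  As
   (Delta N^D) (Delta N^D') = Delta N^(D cap D'), the same grid sums applied to
   the product of two compensated counts give the covariation K^(D cap D').
   The set D_U of pairs (x, x') with delta_x' - delta_x in delta_U is Borel, and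
   the condition on J0 makes the rate of D_U equal to the density of kappa at U.
   The random measures charge (0, T] x J0; a jump is placed at a member of J0
   with the same displacement, which is well defined up to the sets of the
   sigma-algebra Alg. *)

From HB Require Import structures.
From mathcomp Require Import all_boot all_order all_algebra finmap multiset.
From mathcomp Require Import fingroup perm.
From mathcomp Require Import all_classical all_reals all_analysis.
From mathcomp Require Import measurable_realfun giry.
From mathcomp Require Import ring lra zify.
Require Import Defs.

Set Implicit Arguments.
Unset Strict Implicit.
Unset Printing Implicit Defensive.

Import Order.TTheory GRing.Theory Num.Theory.
Import numFieldNormedType.Exports.

Local Open Scope classical_set_scope.
Local Open Scope ring_scope.

(** * Jumps of piecewise constant paths *)

(** A martingale problem for functions of the state constrains one time at a time, whereas a jump is
    a pair of states. Restricting to an event of the earlier time freezes the first component, which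
    gives the identity on rectangles; with nonnegative terms on both sides, each side is a finite
    measure in D, so rectangles suffice. The quadratic error comes from cells in which the state has
    already moved: one factor C0 (t - s) is the probability of a move, the other the rate times the
    length. Hence the need for a uniform bound on the rate.

    Two obstacles shape the rest. Good paths are known only up to a null set N, so the configuration
    process is redefined on N to be a pure jump process surely, and the filtration is completed;
    counts and kappa are compared with versions off N, as they may fail to be measurable on N.
    Moreover the law speaks of paths of measures, so Borel sets of configurations have to be
    recovered from Borel sets of measures; this rests on countable bases and on the integrality of
    counts. *)

Section pure_jump_paths.
Context (R : realType) (S : Type) (y : R -> S) (l : seq R).
Hypothesis yl : forall t u, t <= u -> (forall r, r \in l -> ~~ (t < r <= u)) ->
  y t = y u.

(** Says that (y(r-), y(r)) lies in D without taking a left limit in the bare type S: y is constant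
    just before r. *)
Definition jump_in (D : set (S * S)) (r : R) : Prop :=
  exists2 e : R, 0 < e & forall u, r - e < u < r -> D (y u, y r).

(** The list may repeat times, hence [undup], and may contain times at which y does not move; the
    latter are not counted when D is off-diagonal. *)
Definition num_jumps (D : set (S * S)) (a b : R) : nat :=
  (\sum_(r <- undup l | (a < r <= b)%R) `[< jump_in D r >])%N.

Definition off_diagonal (D : set (S * S)) : Prop := forall x, ~ D (x, x).

Definition neq_pairs : set (S * S) := [set p | p.1 <> p.2].

Lemma num_jumpsD D a b c : a <= b -> b <= c ->
  num_jumps D a c = (num_jumps D a b + num_jumps D b c)%N.
Proof.
move=> ab bc; rewrite /num_jumps (bigID (fun r => r <= b)) /=; congr addn.
  apply: eq_bigl => r; rewrite -andbA; congr andb.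
  by apply/andP/idP => [[]//|rb]; split => //; exact: le_trans bc.
by apply: eq_bigl => r; rewrite -ltNge andbC andbA; congr andb;
  case: (ltP b r) => //= br; rewrite (le_lt_trans ab br).
Qed.

Lemma num_jumps_id D a : num_jumps D a a = 0%N.
Proof.
by rewrite /num_jumps big_pred0// => r; case: (ltP a r) => //=.
Qed.

Lemma right_constant (r : R) :
  exists2 e : R, 0 < e & forall u, r <= u <= r + e -> y u = y r.
Proof.
have [e e0 He] : exists2 e : R, 0 < e & forall x, x \in l -> r < x -> r + e < x.
  elim: (l) => [|x s [e e0 IH]]; first by exists 1.
  have [rx|xr] := ltP r x; last first.
    exists e => // z; rewrite inE => /orP[/eqP->|]; last exact: IH.
    by rewrite ltNge xr.
  exists (Num.min e ((x - r) / 2)) => [|z].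
    by rewrite lt_min e0 divr_gt0 ?subr_gt0.
  rewrite inE => /orP[/eqP-> _|/IH /[apply] H].
    have : Num.min e ((x - r) / 2) <= (x - r) / 2 by rewrite ge_min lexx orbT.
    by lra.
  have : Num.min e ((x - r) / 2) <= e by rewrite ge_min lexx.
  by lra.
exists e => // u /andP[ru ue]; apply/esym/yl => // x xl.
by apply/negP => /andP[rx xu]; have := He _ xl rx; lra.
Qed.

(** With at most one listed time in the cell, y equals [y a] before it and [y b] from it on, so
    testing the endpoints tests the only possible jump. *)
Lemma num_jumps_cell D a b : off_diagonal D -> a <= b ->
  (forall r r', r \in l -> r' \in l -> a < r <= b -> a < r' <= b -> r = r') ->
  num_jumps D a b = `[< D (y a, y b) >].
Proof.
move=> oD ab one.
have [/hasP[r rl rab]|/hasPn none] := boolP (has (fun r => a < r <= b) l).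
  have ar : forall u, a <= u < r -> y u = y a.
    move=> u /andP[au ur]; apply/esym/yl => // r' r'l.
    apply/negP => /andP[ar' r'u].
    have : r' = r by apply: one => //; apply/andP; split => //; lra.
    by lra.
  have yb : y r = y b.
    apply: yl => [|r' r'l]; first by case/andP: rab.
    apply/negP => /andP[rr' r'b].
    have : r' = r by apply: one => //; apply/andP; split => //; lra.
    by lra.
  rewrite /num_jumps big_mkcond (bigD1_seq r) ?mem_undup ?undup_uniq//= rab.
  rewrite big1_seq ?addn0.
    rewrite -yb; congr nat_of_bool; apply/asboolP/asboolP => [[e e0 H]|H].
      (* A point before r that lies both in the cell, where y is still [y a], and in the window of
         length e. *)
      have := H (Num.max ((a + r) / 2) (r - e / 2)).
      rewrite ar; last by rewrite le_max gt_max; case/andP: rab; lra.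
      by apply; rewrite lt_max gt_max; case/andP: rab; lra.
    exists (r - a); first by case/andP: rab; lra.
    by move=> u /andP[u1 u2]; rewrite ar//; lra.
  move=> r' /andP[rr']; rewrite mem_undup => r'l; case: ifPn => // r'ab.
  by rewrite (one r r') ?eqxx// in rr'.
rewrite (yl ab none) asboolF; last exact: oD.
by rewrite /num_jumps big1_seq// => r /andP[rab]; rewrite mem_undup => /none/negP.
Qed.

Lemma gap_exists : exists2 e : R, 0 < e &
  forall r r', r \in l -> r' \in l -> `|r - r'| < e -> r = r'.
Proof.
elim: (l) => [|x s [e e0 IH]]; first by exists 1.
have [e' e'0 H] : exists2 e' : R, 0 < e' &
    forall r, r \in s -> `|x - r| < e' -> x = r.
  elim: s {IH} => [|z s [e' e'0 IH]]; first by exists 1.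
  have [<-|xz] := eqVneq x z.
    exists e' => // r; rewrite inE => /orP[/eqP->//|]; exact: IH.
  exists (Num.min e' `|x - z|) => [|r].
    by rewrite lt_min e'0 normr_gt0 subr_eq0.
  rewrite inE lt_min => /orP[/eqP->|rs] /andP[]; first by rewrite ltxx.
  by move=> /(IH _ rs).
exists (Num.min e e') => [|r r']; first by rewrite lt_min e0.
rewrite !inE lt_min => /orP[/eqP->|rs] /orP[/eqP->|r's] /andP[h1 h2] //.
- exact: H.
- by apply/esym/H => //; rewrite distrC.
- exact: IH.
Qed.

Definition grid (a b : R) (n i : nat) : R := a + (b - a) * i%:R / n.+1%:R.

Lemma grid0 a b n : grid a b n 0 = a.
Proof. by rewrite /grid mulr0 mul0r addr0. Qed.

Lemma gridn a b n : grid a b n n.+1 = b.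
Proof. by rewrite /grid mulfK// addrC subrK. Qed.

Lemma gridS a b n i : grid a b n i.+1 - grid a b n i = (b - a) / n.+1%:R.
Proof. by rewrite /grid -natr1 mulrDr mulrDl mulr1; ring. Qed.

Lemma le_gridS a b n i : a <= b -> grid a b n i <= grid a b n i.+1.
Proof. by move=> ab; rewrite -subr_ge0 gridS divr_ge0// subr_ge0. Qed.

Lemma le_grid a b n : a <= b -> {homo grid a b n : i j / (i <= j)%N >-> i <= j}.
Proof.
move=> ab; apply: homo_leq => //; first exact: le_trans.
by move=> i; exact: le_gridS.
Qed.

Definition grid_count (D : set (S * S)) (a b : R) (n : nat) : nat :=
  (\sum_(0 <= i < n.+1) `[< D (y (grid a b n i), y (grid a b n i.+1)) >])%N.

Lemma num_jumps_grid D a b n : a <= b ->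
  num_jumps D a b = (\sum_(0 <= i < n.+1)
    num_jumps D (grid a b n i) (grid a b n i.+1))%N.
Proof.
move=> ab.
suff H m : num_jumps D a (grid a b n m) = (\sum_(0 <= i < m)
    num_jumps D (grid a b n i) (grid a b n i.+1))%N.
  by rewrite -H gridn.
elim: m => [|m IH]; first by rewrite grid0 num_jumps_id big_nil.
rewrite big_nat_recr//= -IH -num_jumpsD//; last exact: le_gridS.
by rewrite -{1}(grid0 a b n) le_grid.
Qed.

(** Once the mesh is below the smallest gap between listed times, no cell contains two of them. The
    threshold is uniform in D, so several sets of pairs can be compared on one grid. *)
Lemma grid_cells a b : a <= b -> exists N, forall n i D, (N <= n)%N ->
  off_diagonal D ->
  num_jumps D (grid a b n i) (grid a b n i.+1) =
    `[< D (y (grid a b n i), y (grid a b n i.+1)) >].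
Proof.
move=> ab; have [e e0 He] := gap_exists.
exists (Num.trunc ((b - a) / e)) => n i D nN oD.
apply: num_jumps_cell => //; first exact: le_gridS.
move=> r r' rl r'l /andP[r1 r2] /andP[r'1 r'2]; apply: He => //.
have : (b - a) / n.+1%:R < e.
  rewrite ltr_pdivrMr// mulrC -ltr_pdivrMr//.
  by rewrite (lt_le_trans (truncnS_gt _))// ler_nat.
rewrite -(gridS a b n i) => h.
by rewrite ltr_norml; apply/andP; split; lra.
Qed.

Lemma num_jumps_near D a b : off_diagonal D -> a <= b ->
  exists N, forall n, (N <= n)%N -> grid_count D a b n = num_jumps D a b.
Proof.
move=> oD ab; have [N HN] := grid_cells ab; exists N => n Nn.
by rewrite (num_jumps_grid _ n ab); apply: eq_bigr => i _; rewrite HN.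
Qed.

Lemma neq_pairs_off : off_diagonal neq_pairs. Proof. by move=> x; apply. Qed.

Lemma num_jumps_neq a b : a <= b ->
  (`[< neq_pairs (y a, y b) >] <= num_jumps neq_pairs a b)%N.
Proof.
move=> ab; case: asboolP => //= nab.
have [N /(_ N (leqnn N)) <-] := num_jumps_near neq_pairs_off ab.
(* If every cell had equal endpoints, y would keep the value [y a] along the grid up to b. *)
rewrite lt0n; apply/eqP => c0; apply: nab => /=.
suff H m : (m <= N.+1)%N -> y (grid a b N m) = y a by rewrite -(H N.+1)// gridn.
elim: m => [|m IH] mN; first by rewrite grid0.
rewrite -IH; last exact: ltnW.
move/eqP: c0; rewrite /grid_count sum_nat_seq_eq0 => /allP/(_ m).
by rewrite mem_index_iota => /(_ mN)/=; case: asboolP => //= /contrapT.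
Qed.

(** Valid for every grid, however coarse: a cell with endpoints in D has distinct endpoints and so
    contains a jump. This provides the dominating variable for limits over grids. *)
Lemma grid_count_le D a b n : off_diagonal D -> a <= b ->
  (grid_count D a b n <= num_jumps neq_pairs a b)%N.
Proof.
move=> oD ab; rewrite (num_jumps_grid _ n ab); apply: leq_sum => i _.
apply: leq_trans (num_jumps_neq (le_gridS n i ab)).
case: asboolP => // h; rewrite asboolT//= => e; apply: (oD (y (grid a b n i))).
by have := h; rewrite -[y (grid a b n i.+1)]e.
Qed.

Lemma le_num_jumps D D' a b : D `<=` D' -> (num_jumps D a b <= num_jumps D' a b)%N.
Proof.
move=> DD'; apply: leq_sum => r _; case: asboolP => // -[e e0 H].
by rewrite asboolT//; exists e => // u /H/DD'.
Qed.

End pure_jump_paths.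

(** * Kernels and progressive measurability *)

Section mixture.
Local Open Scope ereal_scope.
Context d1 d2 (T1 : measurableType d1) (T2 : measurableType d2) (R : realType).
Variables (mu : {measure set T1 -> \bar R}) (D : set T1).
Variable k : T1 -> {measure set T2 -> \bar R}.
Hypothesis mD : measurable D.
Hypothesis mk : forall B, measurable B -> measurable_fun D (k ^~ B).

(** The measurability proofs are arguments, hence part of the term, so that the measure structure
    below can be attached to it. *)
Definition mixture_fun of measurable D &
    (forall B, measurable B -> measurable_fun D (k ^~ B)) :=
  fun B : set T2 => \int[mu]_(x in D) k x B.

Local Notation mix := (mixture_fun mD mk).

Let mix0 : mix set0 = 0.
Proof. by apply: integral0_eq => x _; rewrite measure0. Qed.

Let mix_ge0 B : 0 <= mix B.
Proof. exact: integral_ge0. Qed.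

Let mix_sigma_additive : semi_sigma_additive mix.
Proof.
move=> U mU tU mUU; rewrite [X in _ --> X](_ : _ =
  \int[mu]_(x in D) (\sum_(n <oo) k x (U n))); last first.
  apply: eq_integral => x _.
  by apply/esym/cvg_lim => //; exact/measure_semi_sigma_additive.
apply/cvg_closeP; split.
  by apply: is_cvg_nneseries => n _ _; exact: integral_ge0.
rewrite closeE// integral_nneseries// => n; exact: mk.
Qed.

HB.instance Definition _ := isMeasure.Build _ _ _ mix
  mix0 mix_ge0 mix_sigma_additive.

Definition mixture_measure : {measure set T2 -> \bar R} := mix.

Lemma mixture_measureE B : mixture_measure B = \int[mu]_(x in D) k x B.
Proof. by []. Qed.

End mixture.

Section kernel_extra_argument.
Context d1 d2 d3 (T1 : measurableType d1) (T2 : measurableType d2)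
  (T3 : measurableType d3) (R : realType).
Variable q : R.-fker T1 ~> T3.

Definition kernel_fst (p : T1 * T2) : {measure set T3 -> \bar R} := q p.1.

Let mkernel_fst U : measurable U -> measurable_fun [set: T1 * T2] (kernel_fst ^~ U).
Proof. by move=> mU; exact: measurableT_comp (measurable_kernel q U mU) measurable_fst. Qed.

HB.instance Definition _ := isKernel.Build _ _ _ _ _ kernel_fst mkernel_fst.

Let kernel_fst_uub : measure_fam_uub kernel_fst.
Proof. by have [r Hr] := measure_uub q; exists r => x; exact: Hr. Qed.

HB.instance Definition _ :=
  Kernel_isFinite.Build _ _ _ _ _ kernel_fst kernel_fst_uub.

(** The section depends on the parameter [p.2], so D is pulled back to the triple product and
    measured with [kernel_fst], which ignores that parameter. *)
Lemma measurable_kernel_section (D : set (T2 * T3)) : measurable D ->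
  measurable_fun [set: T1 * T2]
    (fun p : T1 * T2 => q p.1 [set z | D (p.2, z)]).
Proof.
move=> mD.
pose E : set ((T1 * T2) * T3) := (fun p => (p.1.2, p.2)) @^-1` D.
have mE : measurable E.
  have mf : measurable_fun [set: (T1 * T2) * T3] (fun p => (p.1.2, p.2)).
    by apply: measurable_fun_pair => //; exact: measurableT_comp.
  by rewrite -[E]setTI; exact: mf.
have := @measurable_fun_xsection_finite_kernel _ _ _ _ _ kernel_fst E.
rewrite inE => /(_ mE); apply: eq_measurable_fun => p _.
by rewrite /kernel_fst /=; congr (q _ _); apply/seteqP; split => z /=;
  rewrite /xsection/= inE.
Qed.

End kernel_extra_argument.

Lemma measurable_sub_sigma d d' (Om : measurableType d) (S : measurableType d')
    (G : set (set Om)) (f : Om -> S) :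
  sigma_algebra setT G -> G `<=` measurable ->
  measurable_fun [set: g_sigma_algebraType G] (f : g_sigma_algebraType G -> S) ->
  measurable_fun [set: Om] f.
Proof.
move=> sG Gm mf _ B mB; have := mf measurableT B mB.
by rewrite !setTI /measurable/= (sigma_algebra_id sG) => /Gm.
Qed.

Lemma measurable_sub_sigmaP d d' (Om : measurableType d) (S : measurableType d')
    (G : set (set Om)) (f : Om -> S) : sigma_algebra setT G ->
  (forall B, measurable B -> G (f @^-1` B)) ->
  measurable_fun [set: g_sigma_algebraType G] (f : g_sigma_algebraType G -> S).
Proof. by move=> sG Gf _ B mB; rewrite setTI; apply: sub_sigma_algebra; exact: Gf. Qed.

(** * Adapted pure jump processes: progressive measurability and the identity for pairs of states *)

Section jump_process.
Context (R : realType) d (Om : measurableType d) (PP : probability Om R).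
Context d' (S : measurableType d') (T : R).
Variable G : R -> set (set Om).
Hypothesis Gsig : forall t, sigma_algebra setT (G t).
Hypothesis Gmono : forall s t, s <= t -> G s `<=` G t.
Hypothesis Gm : forall t, G t `<=` measurable.
Variable Y : R -> Om -> S.
Hypothesis Yad : forall t : R, 0 <= t -> forall B, measurable B -> G t (Y t @^-1` B).
Hypothesis Ypure : forall w, exists l : seq R, forall t u, t <= u ->
  (forall r, r \in l -> ~~ (t < r <= u)) -> Y t w = Y u w.

Local Notation Gt t := (g_sigma_algebraType (G t)).

Lemma G_setI t A B : G t A -> G t B -> G t (A `&` B).
Proof.
have [_ _ _ GI] := (sigma_algebraP (fun X _ x _ => I)).1 (Gsig t); exact: GI.
Qed.

Lemma adapted_measurable s t : 0 <= s -> s <= t ->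
  measurable_fun [set: Gt t] (Y s : Gt t -> S).
Proof.
move=> s0 st; apply: measurable_sub_sigmaP => // B mB.
by apply: Gmono st _ _; exact: Yad.
Qed.

Lemma process_measurable s : 0 <= s -> measurable_fun [set: Om] (Y s).
Proof.
move=> s0; apply: (measurable_sub_sigma (Gsig s) (@Gm s)).
exact: adapted_measurable.
Qed.

Definition clamp (t r : R) : R := Num.min t (Num.max 0 r).

Lemma clamp_id t r : 0 <= r <= t -> clamp t r = r.
Proof. by move=> /andP[r0 rt]; rewrite /clamp (max_idPr r0) (min_idPr rt). Qed.

Let min_shift (t m e : R) i n : i%:R / n.+1%:R <= m -> m < i.+1%:R / n.+1%:R ->
  n.+1%:R^-1 < e ->
  Num.min t m <= Num.min t (i.+1%:R / n.+1%:R) <= Num.min t m + e.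
Proof.
have -> : i.+1%:R / n.+1%:R = i%:R / n.+1%:R + n.+1%:R^-1 :> R.
  by rewrite -natr1 mulrDl mul1r.
set a := i%:R / _; set b := _^-1 => h1 h2 h3; rewrite /Order.min.
by case: ltP => ?; case: ltP => ?; apply/andP; split; lra.
Qed.

(** Y is sampled at the right end of the cell of mesh 1 / (n + 1) that contains r, capped at t to
    stay G t-measurable. Paths are constant just after each time, so the sampled value is eventually
    exact, and the preimage of B is a lower limit of countable unions of rectangles. *)
Lemma progressively_measurable t : 0 <= t ->
  measurable_fun [set: measurableTypeR R * Gt t]
    (fun p : measurableTypeR R * Gt t => Y (clamp t p.1) p.2).
Proof.
move=> t0 _ B mB; rewrite setTI.
pose u n i : R := Num.min t (i.+1%:R / n.+1%:R).
pose I n i : set (measurableTypeR R) :=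
  [set r | i%:R / n.+1%:R <= Num.max 0 r < i.+1%:R / n.+1%:R].
have mI n i : measurable (I n i).
  have mmax : measurable_fun setT (fun r : measurableTypeR R => Num.max 0 r : R).
    exact: measurable_maxr.
  rewrite (_ : I n i = (fun r : measurableTypeR R => Num.max 0 r : R) @^-1`
      `[i%:R / n.+1%:R, i.+1%:R / n.+1%:R[%classic).
    by rewrite -[X in measurable X]setTI; exact: mmax.
  by apply/seteqP; split => r /=; rewrite in_itv.
have u0 n i : 0 <= u n i <= t.
  by rewrite /u le_min t0 divr_ge0//= ge_min lexx.
pose C n : set (measurableTypeR R * Gt t) :=
  \bigcup_i (I n i `*` (Y (u n i) @^-1` B)).
rewrite (_ : _ @^-1` _ = \bigcup_N \bigcap_(n in [set n | (N <= n)%N]) C n).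
  apply: bigcup_measurable => N _; apply: bigcap_measurable => [|n _].
    by exists N => /=.
  apply: bigcup_measurable => i _; apply: measurableX => //.
  have /andP[un0 unt] := u0 n i.
  by rewrite -[X in measurable X]setTI; exact: adapted_measurable.
apply/seteqP; split => [[r w] /=|[r w]].
  move=> Bw; have [l Hl] := Ypure w.
  have [e e0 He] := right_constant Hl (clamp t r).
  exists (Num.trunc (e^-1)) => //= n Nn.
  exists (Num.trunc (Num.max 0 r * n.+1%:R)) => //=.
  have mr0 : 0 <= Num.max 0 r * n.+1%:R by rewrite mulr_ge0// le_max lexx.
  have /andP[h1 h2] := truncn_itv mr0.
  have ne : n.+1%:R^-1 < e.
    rewrite invf_plt ?posrE//.
    by rewrite (lt_le_trans (truncnS_gt _))// ler_nat.
  have h1' : (Num.trunc (Num.max 0 r * n.+1%:R))%:R / n.+1%:R <= Num.max 0 r.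
    by rewrite ler_pdivrMr.
  have h2' : Num.max 0 r < (Num.trunc (Num.max 0 r * n.+1%:R)).+1%:R / n.+1%:R.
    by rewrite ltr_pdivlMr.
  split; first by rewrite /I/= h1' h2'.
  rewrite /preimage/= He//; apply: (min_shift _ h1' h2' ne).
case=> N _ H; have [l Hl] := Ypure w.
have [e e0 He] := right_constant Hl (clamp t r).
have [i _ [/= /andP[h1 h2] h3]] : C (maxn N (Num.trunc (e^-1))) (r, w).
  by apply: H => /=; exact: leq_maxl.
set n := maxn _ _ in h1 h2 h3.
have ne : n.+1%:R^-1 < e.
  rewrite invf_plt ?posrE//.
  by rewrite (lt_le_trans (truncnS_gt _))// ler_nat ltnS leq_maxr.
by rewrite /preimage/= -(He (u n i))//; exact: (min_shift _ h1 h2 ne).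
Qed.

Variable q : R.-fker (measurableTypeR R * S)%type ~> S.
Variable C0 : R.
Hypothesis C0_ge0 : 0 <= C0.
Hypothesis q_le : forall p, (q p setT <= C0%:E)%E.
Hypothesis mdiag : measurable [set p : S * S | p.1 = p.2].

Local Notation leb := (@lebesgue_measure R).

(** Progressive measurability on the window ]s, t] only: F agrees there with a function measurable
    for Borel sets times G t, which is what Tonelli's theorem needs to give a G t-measurable time
    integral. *)
Definition jointly_measurable s t (F : R -> Om -> \bar R) : Prop :=
  exists f : measurableTypeR R * Gt t -> \bar R, [/\ measurable_fun setT f,
    (forall p, 0 <= f p)%E & forall r w, s < r <= t -> F r w = f (r, w)].

Lemma measurable_time_integral s t F : jointly_measurable s t F ->
  measurable_fun [set: Gt t] (fun w => \int[leb]_(r in `]s, t]) F r w)%E.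
Proof.
move=> [f [mf f0 Ff]].
pose g (p : measurableTypeR R * Gt t) := (f p * (\1_`]s, t] p.1)%:E)%E.
rewrite (_ : (fun w => _) = fubini_G leb g).
  apply: measurable_fun_fubini_tonelli_G => [|p]; last first.
    by rewrite /g mule_ge0// lee_fin.
  apply: emeasurable_funM => //; apply/measurable_EFinP.
  by apply: measurableT_comp => //; exact: measurable_indic.
apply/funext => w; rewrite /fubini_G/= integral_mkcond /=.
apply: eq_integral => r _; rewrite /g/= patchE indicE.
case: ifPn; rewrite ?mule1 ?mule0// inE/= in_itv/=; exact: Ff.
Qed.

Lemma measurable_time_section s t F w : jointly_measurable s t F ->
  measurable_fun (`]s, t]%classic : set (measurableTypeR R)) (F ^~ w).
Proof.
move=> [f [mf f0 Ff]].
apply: (eq_measurable_fun (fun r => f (r, w))).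
  by move=> r; rewrite inE/= in_itv/= => /Ff.
apply: measurable_funTS.
exact: (measurableT_comp mf (pair2_measurable (w : Gt t))).
Qed.

Lemma time_integral_le s t F w (C : R) : s <= t -> jointly_measurable s t F ->
  (forall r, (s < r <= t)%R -> F r w <= C%:E)%E ->
  (\int[leb]_(r in `]s, t]) F r w <= (C * (t - s))%:E)%E.
Proof.
move=> st jF FC; have [f [mf f0 Ff]] := jF.
have [<-|st'] := eqVneq s t; first by rewrite set_itv_ge ?integral_set0 ?subrr ?mulr0// bnd_simp ltxx.
apply: (@le_trans _ _ (\int[leb]_(r in `]s, t]) C%:E)%E).
  apply: ge0_le_integral => //.
  - by move=> r /=; rewrite in_itv/= => /Ff ->.
  - exact: measurable_time_section.
rewrite integral_cst//= lebesgue_measure_itv/= lte_fin.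
by rewrite lt_neqAle st' st/= EFinM EFinB.
Qed.

(** Rate at time r of moves whose target forms a pair in D with the state at the earlier time s. In
    [rate] the present state takes that place; the difference of the two is an error term. *)
Definition frozen_rate (D : set (S * S)) (s r : R) (w : Om) : \bar R :=
  q (r, Y r w) [set x | D (Y s w, x)].

Definition rate (D : set (S * S)) (r : R) (w : Om) : \bar R :=
  q (r, Y r w) [set x | D (Y r w, x)].

(** Loss term of the equation for pairs: (Y s, Y r) is in D and the process leaves Y r. *)
Definition exit_rate (D : set (S * S)) (s r : R) (w : Om) : \bar R :=
  (q (r, Y r w) setT * (\1_D (Y s w, Y r w))%:E)%E.

Let mclamp t : 0 <= t -> measurable_fun setT
  (fun p : measurableTypeR R * Gt t =>
    (p.1, Y (clamp t p.1) p.2) : (measurableTypeR R * S)%type).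
Proof.
move=> t0; apply: measurable_fun_pair => //.
exact: progressively_measurable.
Qed.

Let mYs s t : 0 <= s -> s <= t ->
  measurable_fun setT (fun p : measurableTypeR R * Gt t => Y s p.2).
Proof.
by move=> s0 st; exact: measurableT_comp (adapted_measurable s0 st) measurable_snd.
Qed.

Lemma meas_frozen D s t : measurable D -> 0 <= s -> s <= t ->
  jointly_measurable s t (frozen_rate D s).
Proof.
move=> mD s0 st; have t0 := le_trans s0 st.
exists (fun p : measurableTypeR R * Gt t =>
    q (p.1, Y (clamp t p.1) p.2) [set x | D (Y s p.2, x)]); split => [|p|r w /andP[sr rt]].
- apply: (measurableT_comp (measurable_kernel_section q mD)
    (g := fun p : measurableTypeR R * Gt t =>
      ((p.1, Y (clamp t p.1) p.2), Y s p.2))).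
  by apply: measurable_fun_pair; [exact: mclamp|exact: mYs].
- exact: measure_ge0.
- by rewrite /frozen_rate clamp_id// rt (ltW (le_lt_trans s0 sr)).
Qed.

Lemma meas_rate D s t : measurable D -> 0 <= s -> s <= t ->
  jointly_measurable s t (rate D).
Proof.
move=> mD s0 st; have t0 := le_trans s0 st.
exists (fun p : measurableTypeR R * Gt t =>
    q (p.1, Y (clamp t p.1) p.2) [set x | D (Y (clamp t p.1) p.2, x)]); split => [|p|r w /andP[sr rt]].
- apply: (measurableT_comp (measurable_kernel_section q mD)
    (g := fun p : measurableTypeR R * Gt t =>
      ((p.1, Y (clamp t p.1) p.2), Y (clamp t p.1) p.2))).
  by apply: measurable_fun_pair; [exact: mclamp|exact: progressively_measurable].
- exact: measure_ge0.
- by rewrite /rate clamp_id// rt (ltW (le_lt_trans s0 sr)).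
Qed.

Lemma meas_exit D s t : measurable D -> 0 <= s -> s <= t ->
  jointly_measurable s t (exit_rate D s).
Proof.
move=> mD s0 st; have t0 := le_trans s0 st.
exists (fun p : measurableTypeR R * Gt t =>
    (q (p.1, Y (clamp t p.1) p.2) setT *
      (\1_D (Y s p.2, Y (clamp t p.1) p.2))%:E)%E); split => [|p|r w /andP[sr rt]].
- apply: emeasurable_funM.
    exact: measurableT_comp (measurable_kernel q _ measurableT) (mclamp t0).
  apply/measurable_EFinP; apply: (measurableT_comp (f := \1_D : S * S -> R)
    (g := fun p : measurableTypeR R * Gt t => (Y s p.2, Y (clamp t p.1) p.2))).
    exact: measurable_indic.
  by apply: measurable_fun_pair; [exact: mYs|exact: progressively_measurable].
- by rewrite mule_ge0// lee_fin.
- by rewrite /exit_rate clamp_id// rt (ltW (le_lt_trans s0 sr)).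
Qed.

(* The martingale problem for 1_B, with both sides nonnegative. *)
Hypothesis mart : forall s t A B, 0 <= s -> s <= t -> t <= T -> G s A ->
  measurable B ->
  (PP (A `&` Y t @^-1` B) +
     \int[PP]_(w in A) \int[leb]_(r in `]s, t])
       (q (r, Y r w) setT * (\1_B (Y r w))%:E) =
   PP (A `&` Y s @^-1` B) +
     \int[PP]_(w in A) \int[leb]_(r in `]s, t]) q (r, Y r w) B)%E.

(** The rates are realised as measures in D because the identity for pairs is obtained by uniqueness
    of measures. *)
Let frozen_measure s r w : {measure set (S * S) -> \bar R} :=
  mixture_measure (q (r, Y r w)) (k := fun x => \d_(Y s w, x)) measurableT
   (fun D mD => measurableT_comp (measurable_fun_dirac mD) (pair1_measurable (Y s w))).

Let frozen_measureE s r w D : measurable D -> frozen_measure s r w D = frozen_rate D s r w.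
Proof.
move=> mD; rewrite /frozen_measure mixture_measureE /frozen_rate.
rewrite -[in RHS](setIT [set x | _]) -integral_indic//.
  by have := pair1_measurable (Y s w) measurableT mD; rewrite setTI.
Qed.

Let exit_measure s r w : {measure set (S * S) -> \bar R} :=
  mixture_measure (q (r, Y r w)) (k := fun x => \d_(Y s w, Y r w)) measurableT
   (fun D mD => measurable_cst _).

Let exit_measureE s r w D : measurable D -> exit_measure s r w D = exit_rate D s r w.
Proof.
move=> mD; rewrite /exit_measure mixture_measureE /exit_rate integral_cst//.
by rewrite muleC.
Qed.

Let inner_measurable (m : R -> Om -> {measure set (S * S) -> \bar R})
    (F : set (S * S) -> R -> Om -> \bar R) s t w :
    (forall r D, measurable D -> m r w D = F D r w) ->
    (forall D, measurable D -> jointly_measurable s t (F D)) ->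
  forall D, measurable D ->
  measurable_fun (`]s, t]%classic : set (measurableTypeR R)) (fun r => m r w D).
Proof.
move=> mF jF D mD; have := measurable_time_section w (jF _ mD).
by apply: eq_measurable_fun => r _; rewrite mF.
Qed.

(** Both sides are finite measures in D. On a rectangle B1 x B2 they agree by [mart] for B2 and the
    event that A holds and Y s is in B1, which belongs to G s. *)
Lemma pair_martingale s t A D : 0 <= s -> s <= t -> t <= T -> G s A ->
  measurable D ->
  (PP (A `&` [set w | D (Y s w, Y t w)]) +
     \int[PP]_(w in A) \int[leb]_(r in `]s, t]) exit_rate D s r w =
   PP (A `&` [set w | D (Y s w, Y s w)]) +
     \int[PP]_(w in A) \int[leb]_(r in `]s, t]) frozen_rate D s r w)%E.
Proof.
move=> s0 st tT GA mD; have t0 := le_trans s0 st.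
have mA := Gm GA.
have mYY u : 0 <= u -> measurable_fun setT (fun w => (Y s w, Y u w)).
  by move=> u0; apply: measurable_fun_pair; exact: process_measurable.
have mitv : measurable (`]s, t]%classic : set (measurableTypeR R)) by [].
have mkd u : 0 <= u -> forall D, measurable D ->
    measurable_fun A (fun w => \d_(Y s w, Y u w) D : \bar R).
  by move=> u0 E mE; apply: measurable_funTS;
    exact: measurableT_comp (measurable_fun_dirac mE) (mYY _ u0).
pose m_d u (u0 : 0 <= u) := mixture_measure PP mA (mkd u u0).
have m_dE u (u0 : 0 <= u) E : measurable E ->
    m_d u u0 E = PP (A `&` [set w | E (Y s w, Y u w)]).
  move=> mE; rewrite /m_d mixture_measureE setIC -integral_indic//.
  by have := mYY _ u0 measurableT _ mE; rewrite setTI.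
have mf w := @inner_measurable (frozen_measure s) (fun D => frozen_rate D s) s t w
  (fun r D mD => @frozen_measureE s r w D mD) (fun D mD => meas_frozen mD s0 st).
have me w := @inner_measurable (exit_measure s) (fun D => exit_rate D s) s t w
  (fun r D mD => @exit_measureE s r w D mD) (fun D mD => meas_exit mD s0 st).
pose wf w := mixture_measure leb mitv (mf w).
pose we w := mixture_measure leb mitv (me w).
have wfE w E : measurable E -> wf w E = (\int[leb]_(r in `]s, t]) frozen_rate E s r w)%E.
  by move=> mE; apply: eq_integral => r _; rewrite frozen_measureE.
have weE w E : measurable E -> we w E = (\int[leb]_(r in `]s, t]) exit_rate E s r w)%E.
  by move=> mE; apply: eq_integral => r _; rewrite exit_measureE.
have mwf E : measurable E -> measurable_fun A (fun w => wf w E).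
  move=> mE; apply: measurable_funTS.
  apply: (measurable_sub_sigma (Gsig t) (@Gm t)).
  have := measurable_time_integral (meas_frozen mE s0 st).
  by apply: eq_measurable_fun => w _; rewrite -wfE.
have mwe E : measurable E -> measurable_fun A (fun w => we w E).
  move=> mE; apply: measurable_funTS.
  apply: (measurable_sub_sigma (Gsig t) (@Gm t)).
  have := measurable_time_integral (meas_exit mE s0 st).
  by apply: eq_measurable_fun => w _; rewrite -weE.
pose m1 : {measure set (S * S) -> \bar R} := measure_add (m_d t t0) (mixture_measure PP mA mwe).
pose m2 : {measure set (S * S) -> \bar R} := measure_add (m_d s s0) (mixture_measure PP mA mwf).
have m1E E : measurable E -> m1 E = (PP (A `&` [set w | E (Y s w, Y t w)]) +
     \int[PP]_(w in A) \int[leb]_(r in `]s, t]) exit_rate E s r w)%E.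
  move=> mE; rewrite [LHS](measure_addE (m_d t t0) (mixture_measure PP mA mwe)).
  congr adde; first exact: m_dE.
  by apply: eq_integral => w _; rewrite weE.
have m2E E : measurable E -> m2 E = (PP (A `&` [set w | E (Y s w, Y s w)]) +
     \int[PP]_(w in A) \int[leb]_(r in `]s, t]) frozen_rate E s r w)%E.
  move=> mE; rewrite [LHS](measure_addE (m_d s s0) (mixture_measure PP mA mwf)).
  congr adde; first exact: m_dE.
  by apply: eq_integral => w _; rewrite wfE.
rewrite -m1E// -m2E//.
apply: (measure_unique [set A `*` B | A in measurable & B in measurable]
  (fun=> setT)) => //.
- exact: measurable_prod_measurableType.
- move=> _ _ [A1 mA1 [B1 mB1 <-]] [A2 mA2 [B2 mB2 <-]].
  exists (A1 `&` A2); first exact: measurableI.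
  by exists (B1 `&` B2); [exact: measurableI|rewrite setXI].
- by move=> _; exists setT => //; exists setT => //; rewrite setXTT.
- by rewrite bigcup_const//; exists 0%N.
- move=> _ [B1 mB1 [B2 mB2 <-]].
  rewrite m1E ?m2E; [|exact: measurableX..].
  have := mart s0 st tT (G_setI GA (Yad s0 mB1)) mB2.
  rewrite -2!setIA.
  (* The restriction to Y s in B1 moves from the event into the integrand: both rates vanish when Y
     s is outside B1. *)
  have E (H H' : Om -> \bar R) : (forall w, H w = if Y s w \in B1 then H' w else 0%E) ->
      (\int[PP]_(w in A `&` Y s @^-1` B1) H' w = \int[PP]_(w in A) H w)%E.
    move=> HH; rewrite integral_mkcond [RHS]integral_mkcond.
    apply: eq_integral => w _; rewrite !patchE in_setI HH.
    have -> : (w \in Y s @^-1` B1) = (Y s w \in B1).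
      by apply/idP/idP => /set_mem h; exact/mem_set.
    by case: (w \in A).
  rewrite (E (fun w => \int[leb]_(r in `]s, t]) exit_rate (B1 `*` B2) s r w)%E).
    rewrite (E (fun w => \int[leb]_(r in `]s, t]) frozen_rate (B1 `*` B2) s r w)%E)//.
    move=> w; case: ifPn => [/set_mem B1w|/negP B1w].
      apply: eq_integral => r _; rewrite /frozen_rate; congr (q _ _).
      by apply/seteqP; split => x //= [].
    apply: integral0_eq => r _; rewrite /frozen_rate.
    rewrite (_ : [set x | _] = set0) ?measure0//.
    by apply/seteqP; split => x //= [/mem_set].
  move=> w; case: ifPn => [B1w|B1w].
    by apply: eq_integral => r _; rewrite /exit_rate !indicE in_setX/= B1w.
  apply: integral0_eq => r _; rewrite /exit_rate indicE in_setX/= (negbTE B1w).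
  by rewrite mule0.
- move=> _; rewrite m1E//; apply: lte_add_pinfty.
    by rewrite (le_lt_trans (probability_le1 PP _)) ?ltry// setIT.
  apply: (@le_lt_trans _ _ (\int[PP]_(w in A) (C0 * (t - s))%:E)%E).
    apply: ge0_le_integral => //.
    - by move=> w _; apply: integral_ge0 => r _; rewrite mule_ge0// lee_fin.
    - have := mwe _ measurableT; apply: eq_measurable_fun => w _; exact: weE.
    - move=> w _; apply: time_integral_le => //; first exact: meas_exit.
      by move=> r _; rewrite /exit_rate indicT/= mule1.
  rewrite integral_cst// lte_mul_pinfty// ?lee_fin ?mulr_ge0// ?subr_ge0//.
  by rewrite (le_lt_trans (probability_le1 PP mA)) ?ltry.
Qed.

End jump_process.

(** * Compensated jump counts *)

Section jump_counting.
Context (R : realType) d (Om : measurableType d) (PP : probability Om R).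
Context d' (S : measurableType d') (T : R).
Variable G : R -> set (set Om).
Hypothesis Gsig : forall t, sigma_algebra setT (G t).
Hypothesis Gmono : forall s t, s <= t -> G s `<=` G t.
Hypothesis Gm : forall t, G t `<=` measurable.
Variable Y : R -> Om -> S.
Hypothesis Yad : forall t : R, 0 <= t -> forall B, measurable B -> G t (Y t @^-1` B).
Hypothesis Ypure : forall w, exists l : seq R, forall t u, t <= u ->
  (forall r, r \in l -> ~~ (t < r <= u)) -> Y t w = Y u w.
Variable q : R.-fker (measurableTypeR R * S)%type ~> S.
Variable C0 : R.
Hypothesis C0_ge0 : 0 <= C0.
Hypothesis q_le : forall p, (q p setT <= C0%:E)%E.
Hypothesis mdiag : measurable [set p : S * S | p.1 = p.2].
Local Notation Gt t := (g_sigma_algebraType (G t)).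
Local Notation leb := (@lebesgue_measure R).
Local Notation rate := (rate Y q).
Local Notation frozen_rate := (frozen_rate Y q).
Local Notation exit_rate := (exit_rate Y q).
Hypothesis mart : forall s t A B, 0 <= s -> s <= t -> t <= T -> G s A ->
  measurable B ->
  (PP (A `&` Y t @^-1` B) +
     \int[PP]_(w in A) \int[leb]_(r in `]s, t])
       (q (r, Y r w) setT * (\1_B (Y r w))%:E) =
   PP (A `&` Y s @^-1` B) +
     \int[PP]_(w in A) \int[leb]_(r in `]s, t]) q (r, Y r w) B)%E.
Let pair_martingale := pair_martingale Gsig Gmono Gm Yad Ypure C0_ge0 q_le mart.
Let meas_rate := meas_rate Gsig Gmono Yad Ypure q.
Let meas_exit := meas_exit Gsig Gmono Yad Ypure q.
Let meas_frozen := meas_frozen Gsig Gmono Yad Ypure q.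
Let adapted_measurable := adapted_measurable Gsig Gmono Yad.
Let G_setI := G_setI Gsig.
Implicit Types (D : set (S * S)) (s t u r : R) (w : Om) (A : set Om) (n i : nat).

(** An arbitrary choice for each path, with no measurability in w. Off-diagonal counts do not depend
    on it, being limits of grid counts; this is also why they are measurable. *)
Definition jump_times w : seq R := sval (cid (Ypure w)).

Let Yl w : forall t u, t <= u -> (forall r, r \in jump_times w -> ~~ (t < r <= u)) ->
  Y t w = Y u w.
Proof. exact: (svalP (cid (Ypure w))). Qed.

Definition jumps_between (D : set (S * S)) s t w : nat :=
  num_jumps (Y^~ w) (jump_times w) D s t.

Definition jump_number D s t w : R := (jumps_between D s t w)%:R.
Local Notation NN := jump_number.

Let V D s t n w : R := (grid_count (Y^~ w) D s t n)%:R.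

Let measurable_section D x : measurable D -> measurable [set z : S | D (x, z)].
Proof.
by move=> mD; have := pair1_measurable x measurableT mD; rewrite setTI.
Qed.

Let q_section_le D r y x : measurable D -> (q (r, y) [set z | D (x, z)] <= C0%:E)%E.
Proof.
move=> mD; apply: le_trans (q_le (r, y)); apply: le_measure => //.
  by rewrite inE; exact: measurable_section.
by rewrite inE.
Qed.

Let pair_event D s t u : 0 <= s -> s <= t -> 0 <= t -> t <= u -> measurable D ->
  G u [set w | D (Y s w, Y t w)].
Proof.
move=> s0 st t0 tu mD.
have mf : measurable_fun [set: Gt u] (fun w : Gt u => (Y s w, Y t w)).
  apply: measurable_fun_pair; apply: adapted_measurable => //.
  exact: le_trans tu.
by have := mf measurableT D mD; rewrite setTI {1}/measurable/= (sigma_algebra_id (Gsig u)).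
Qed.

Definition compensation D s t w : R := fine (\int[leb]_(r in `]s, t]) rate D r w).

Let rate_int_le D s t w : measurable D -> 0 <= s -> s <= t ->
  (\int[leb]_(r in `]s, t]) rate D r w <= (C0 * (t - s))%:E)%E.
Proof.
move=> mD s0 st; apply: time_integral_le => //; first exact: meas_rate.
by move=> r _; exact: q_section_le.
Qed.

Lemma compensationE D s t w : measurable D -> 0 <= s -> s <= t ->
  (\int[leb]_(r in `]s, t]) rate D r w = (compensation D s t w)%:E)%E.
Proof.
move=> mD s0 st; rewrite fineK// ge0_fin_numE.
  exact: le_lt_trans (rate_int_le w mD s0 st) (ltry _).
by apply: integral_ge0 => r _; exact: measure_ge0.
Qed.

Lemma compensation_ge0 D s t w : 0 <= compensation D s t w.
Proof. by apply: fine_ge0; apply: integral_ge0 => r _; exact: measure_ge0. Qed.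
#[local] Hint Resolve compensation_ge0 : core.

Lemma compensation_le D s t w : measurable D -> 0 <= s -> s <= t ->
  compensation D s t w <= C0 * (t - s).
Proof. by move=> mD s0 st; rewrite -lee_fin -compensationE//; exact: rate_int_le. Qed.

Lemma compensationD D s t u w : measurable D -> 0 <= s -> s <= t -> t <= u ->
  compensation D s u w = compensation D s t w + compensation D t u w.
Proof.
move=> mD s0 st tu; have t0 := le_trans s0 st; have su := le_trans st tu.
apply: EFin_inj; rewrite EFinD -!compensationE//.
rewrite (@itv_bndbnd_setU _ _ _ (BRight t)) ?bnd_simp// ge0_integral_setU//.
- rewrite - itv_bndbnd_setU ?bnd_simp//; exact: measurable_time_section (meas_rate mD s0 su).
- by apply/disj_setPS => r [/=]; rewrite !in_itv/= => /andP[_ rt] /andP[]; rewrite ltNge rt.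
Qed.

Lemma measurable_compensation D s t : measurable D -> 0 <= s -> s <= t ->
  measurable_fun [set: Gt t] (compensation D s t).
Proof.
move=> mD s0 st; apply/measurable_EFinP.
apply: eq_measurable_fun (measurable_time_integral (meas_rate mD s0 st)).
by move=> w _; rewrite compensationE.
Qed.

Let grid_ge0 s t n i : 0 <= s -> s <= t -> 0 <= grid s t n i.
Proof.
by move=> s0 st; apply: le_trans s0 _; rewrite -{1}(grid0 s t n); exact: le_grid.
Qed.

Let grid_le s t n i : s <= t -> (i <= n.+1)%N -> grid s t n i <= t.
Proof. by move=> st ilen; rewrite -[leRHS](gridn s t n); exact: le_grid. Qed.

Let VE D s t n w :
  V D s t n w = \sum_(0 <= i < n.+1) \1_[set w | D (Y (grid s t n i) w, Y (grid s t n i.+1) w)] w.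
Proof.
rewrite /V /grid_count natr_sum; apply: eq_bigr => i _.
by rewrite indicE; case: asboolP => h; [rewrite mem_set|rewrite memNset].
Qed.

Let measurable_V D s t n : measurable D -> 0 <= s -> s <= t ->
  measurable_fun [set: Gt t] (V D s t n).
Proof.
move=> mD s0 st.
rewrite (_ : V D s t n = fun w => \sum_(i < n.+1)
    \1_[set w | D (Y (grid s t n i) w, Y (grid s t n i.+1) w)] w); last first.
  by apply/funext => w; rewrite VE big_mkord.
apply: measurable_sum => i; apply: measurable_indic; apply: sub_sigma_algebra.
apply: pair_event => //; [exact: grid_ge0|exact: le_gridS|exact: grid_ge0|].
exact: grid_le.
Qed.

Let V_near D s t w : off_diagonal D -> s <= t ->
  \forall n \near \oo, V D s t n w = NN D s t w.
Proof.
move=> oD st; have [N HN] := num_jumps_near (@Yl w) oD st.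
by exists N => // n /= Nn; rewrite /V HN.
Qed.

Let V_cvg D s t w : off_diagonal D -> s <= t ->
  V D s t n w @[n --> \oo] --> NN D s t w.
Proof. by move=> oD st; apply: cvg_near_cst; exact: V_near. Qed.

Lemma measurable_jump_number D s t : measurable D -> off_diagonal D -> 0 <= s -> s <= t ->
  measurable_fun [set: Gt t] (NN D s t).
Proof.
move=> mD oD s0 st; apply: (measurable_fun_cvg (fun n => measurable_V n mD s0 st)).
by move=> w _; exact: V_cvg.
Qed.

Let NND D s t u w : s <= t -> t <= u -> NN D s u w = NN D s t w + NN D t u w.
Proof. by move=> st tu; rewrite /NN /jumps_between (num_jumpsD _ _ _ st tu) natrD. Qed.

(** Counts every change of state; it dominates all off-diagonal counts and measures the error made
    by freezing the state. *)
Let W s t w := NN (@neq_pairs S) s t w.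

Let mneq : measurable (@neq_pairs S).
Proof. exact: measurableC. Qed.

Let V_le_W D s t n w : off_diagonal D -> s <= t -> V D s t n w <= W s t w.
Proof. by move=> oD st; rewrite ler_nat; exact: (grid_count_le (@Yl w)). Qed.

Let NN_le_W D s t w : off_diagonal D -> NN D s t w <= W s t w.
Proof.
move=> oD; rewrite ler_nat; apply: le_num_jumps => -[x y] Dxy /= xy.
by move: xy Dxy => /= -> /oD.
Qed.

Let W_neq s r t w : s <= r <= t -> Y s w <> Y r w -> 1 <= W s t w.
Proof.
move=> /andP[sr rt] h; rewrite /W (NND _ _ sr rt).
have := num_jumps_neq (@Yl w) sr; rewrite asboolT// => h1.
by rewrite -[1]addr0; apply: lerD; rewrite ?ler0n// -[1]/(1%:R) ler_nat.
Qed.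

Let jump_probability_le D s t A : measurable D -> off_diagonal D ->
  0 <= s -> s <= t -> t <= T -> G s A ->
  (PP (A `&` [set w | D (Y s w, Y t w)]) <= (C0 * (t - s))%:E * PP A)%E.
Proof.
move=> mD oD s0 st tT GA; have mA := Gm GA.
have := pair_martingale s0 st tT GA mD.
rewrite [X in (_ = PP X + _)%E -> _](_ : _ = set0); last first.
  by apply/seteqP; split => w // [_ /oD].
rewrite measure0 add0e => E.
apply: (@le_trans _ _ (\int[PP]_(w in A) \int[leb]_(r in `]s, t]) frozen_rate D s r w)%E).
  rewrite -E leeDl//; apply: integral_ge0 => w _; apply: integral_ge0 => r _.
  by rewrite mule_ge0// lee_fin.
rewrite -integral_cst//; apply: ge0_le_integral => //.
- by move=> w _; apply: integral_ge0 => r _; exact: measure_ge0.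
- apply: measurable_funTS; apply: (measurable_sub_sigma (Gsig t) (@Gm t)).
  exact: measurable_time_integral (meas_frozen mD s0 st).
- move=> w _; apply: time_integral_le => //; first exact: meas_frozen.
  by move=> r _; exact: q_section_le.
Qed.

Let integral_V D s t n A : measurable D -> 0 <= s -> s <= t -> G s A ->
  (\int[PP]_(w in A) (V D s t n w)%:E = \sum_(0 <= i < n.+1)
    PP (A `&` [set w | D (Y (grid s t n i) w, Y (grid s t n i.+1) w)]))%E.
Proof.
move=> mD s0 st GA; have mA := Gm GA.
have mE i : measurable [set w | D (Y (grid s t n i) w, Y (grid s t n i.+1) w)].
  apply: (@Gm (grid s t n i.+1)).
  by apply: pair_event => //; [exact: grid_ge0|exact: le_gridS|exact: grid_ge0].
under eq_integral do rewrite VE -sumEFin.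
rewrite ge0_integral_sum//; last first.
  by move=> i; apply/measurable_EFinP; apply: measurable_funTS; exact: measurable_indic.
by apply: eq_bigr => i _; rewrite integral_indic// setIC.
Qed.

Let fatou_le (f : (Om -> R)^nat) g A (C : \bar R) : measurable A ->
  (forall n, measurable_fun A (f n)) -> (forall n w, 0 <= f n w) ->
  (forall w, f n w @[n --> \oo] --> g w) ->
  (forall n, \int[PP]_(w in A) (f n w)%:E <= C)%E ->
  (\int[PP]_(w in A) (g w)%:E <= C)%E.
Proof.
move=> mA mf f0 fg fC.
have := @fatou _ _ _ PP A mA (fun n w => (f n w)%:E).
have -> : (fun w => limn_einf (fun n => (f n w)%:E)) = (fun w => (g w)%:E).
  apply/funext => w; have h : (f n w)%:E @[n --> \oo] --> (g w)%:E.
    by apply: cvg_EFin; [exact: nearW|exact: fg].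
  by rewrite is_cvg_limn_einfE; [exact/cvg_lim|apply/cvg_ex; exists (g w)%:E].
move=> /(_ _ _)/le_trans; apply.
- by move=> n; apply/measurable_EFinP.
- by move=> n w _; rewrite lee_fin.
- rewrite limn_einf_lim; apply: lime_le; first exact: is_cvg_einfs.
  apply: nearW => n; apply: le_trans (fC n); apply: ereal_inf_lbound.
  by exists n => /=.
Qed.

Let mV D s t n A : measurable D -> 0 <= s -> s <= t -> measurable_fun A (V D s t n : Om -> R).
Proof.
move=> mD s0 st; apply: measurable_funTS.
by apply: (measurable_sub_sigma (Gsig t) (@Gm t)); exact: measurable_V.
Qed.

Let mNN D s t A : measurable D -> off_diagonal D -> 0 <= s -> s <= t ->
  measurable_fun A (NN D s t : Om -> R).
Proof.
move=> mD oD s0 st; apply: measurable_funTS.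
by apply: (measurable_sub_sigma (Gsig t) (@Gm t)); exact: measurable_jump_number.
Qed.

Let mK D s t A : measurable D -> 0 <= s -> s <= t ->
  measurable_fun A (compensation D s t : Om -> R).
Proof.
move=> mD s0 st; apply: measurable_funTS.
by apply: (measurable_sub_sigma (Gsig t) (@Gm t)); exact: measurable_compensation.
Qed.

(** Summed over a grid, the one-step bounds give C0 (t - s) whatever the mesh, since A belongs to
    all later sigma-algebras; Fatou's lemma passes to the jump count. *)
Let integral_NN_le D s t A : measurable D -> off_diagonal D ->
  0 <= s -> s <= t -> t <= T -> G s A ->
  (\int[PP]_(w in A) (NN D s t w)%:E <= (C0 * (t - s))%:E * PP A)%E.
Proof.
move=> mD oD s0 st tT GA; have mA := Gm GA.
apply: (fatou_le (f := V D s t)) => //.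
- by move=> n; exact: mV.
- by move=> w; exact: V_cvg.
move=> n; rewrite integral_V//.
apply: (@le_trans _ _ (\sum_(0 <= i < n.+1) (C0 * ((t - s) / n.+1%:R))%:E * PP A)%E).
  rewrite !big_mkord; apply: lee_sum => i _; rewrite -(gridS s t n i).
  apply: jump_probability_le => //.
  - exact: grid_ge0.
  - exact: le_gridS.
  - by apply: le_trans tT; exact: grid_le.
  - by apply: Gmono GA; rewrite -{1}(grid0 s t n); exact: le_grid.
rewrite -ge0_sume_distrl; last first.
  by move=> i _; rewrite lee_fin mulr_ge0// divr_ge0// subr_ge0.
by rewrite sumEFin sumr_const_nat subn0 -[X in X%:E]mulr_natr -mulrA divfK.
Qed.

(** One factor C0 (t - s) bounds the mean number of jumps, the other the change of the integrated
    rate caused by having jumped. *)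
Let error s t : R := C0 ^+ 2 * (t - s) ^+ 2.

Let frozen_int_le s t w (c : R) (F F' : R -> Om -> \bar R) : 0 <= s -> s <= t -> 0 <= c ->
  jointly_measurable G s t F -> jointly_measurable G s t F' ->
  (forall r, (s < r <= t)%R -> F r w <= F' r w + c%:E)%E ->
  (\int[leb]_(r in `]s, t]) F r w <=
   \int[leb]_(r in `]s, t]) F' r w + (c * (t - s))%:E)%E.
Proof.
move=> s0 st c0 jF jF' FF'.
have [f [mf f0 Ff]] := jF; have [f' [mf' f'0 Ff']] := jF'.
have [<-|st'] := eqVneq s t.
  rewrite set_itv_ge ?bnd_simp ?ltxx//.
  by rewrite !integral_set0 subrr mulr0 add0e.
rewrite (_ : (c * (t - s))%:E = \int[leb]_(r in `]s, t]) c%:E)%E; last first.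
  rewrite integral_cst//= lebesgue_measure_itv/= lte_fin.
  by rewrite lt_neqAle st' st/= EFinM EFinB.
have h r : (s < r <= t)%R -> (0 <= F' r w)%E by move=> /Ff' ->.
have mF : measurable_fun (`]s, t]%classic : set (measurableTypeR R)) (F ^~ w).
  exact: (measurable_time_section w jF).
have mF' : measurable_fun (`]s, t]%classic : set (measurableTypeR R)) (F' ^~ w).
  exact: (measurable_time_section w jF').
rewrite -ge0_integralD//; apply: ge0_le_integral => //.
- by move=> r /=; rewrite in_itv/= => /Ff ->.
- exact: emeasurable_funD.
Qed.

(** The two rates coincide unless the state moved between s and r; in that case W is at least 1 and
    C0 W dominates either rate. *)
Let frozen_rate_le D s t w r : measurable D -> s < r <= t ->
  (frozen_rate D s r w <= rate D r w + (C0 * W s t w)%:E)%E /\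
  (rate D r w <= frozen_rate D s r w + (C0 * W s t w)%:E)%E.
Proof.
move=> mD /andP[sr rt]; have W0 : 0 <= W s t w by exact: ler0n.
rewrite /rate /frozen_rate; have [->|ne] := pselect (Y s w = Y r w).
  by split; rewrite leeDl// lee_fin mulr_ge0.
have W1 : 1 <= W s t w by apply: W_neq ne; rewrite (ltW sr).
have h : (C0%:E <= (C0 * W s t w)%:E)%E by rewrite lee_fin ler_peMr.
by split; (apply: le_trans (q_section_le _ _ _ mD) _; apply: le_trans h _; rewrite leeDr).
Qed.

Let exit_rate_le D s t w r : measurable D -> off_diagonal D -> s < r <= t ->
  (exit_rate D s r w <= (C0 * W s t w)%:E)%E.
Proof.
move=> mD oD /andP[sr rt]; have W0 : 0 <= W s t w by exact: ler0n.
rewrite /exit_rate indicE.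
have [h|h] := boolP ((Y s w, Y r w) \in D); last first.
  by rewrite mule0 lee_fin mulr_ge0.
rewrite mule1; apply: le_trans (q_le _) _.
rewrite lee_fin ler_peMr//; apply: (@W_neq s r t); first by rewrite (ltW sr).
by move/set_mem: h => h e; apply: (oD (Y r w)); rewrite -{1}e.
Qed.

Let integral_W_error s t A : 0 <= s -> s <= t -> t <= T -> G s A ->
  (\int[PP]_(w in A) (C0 * W s t w * (t - s))%:E <= (error s t)%:E)%E.
Proof.
move=> s0 st tT GA; have mA := Gm GA.
have ts0 : 0 <= t - s by rewrite subr_ge0.
rewrite (_ : (fun w => _) = (fun w => (C0 * (t - s))%:E * (W s t w)%:E)%E); last first.
  by apply/funext => w; rewrite -EFinM mulrAC.
rewrite ge0_integralZl//; last 3 first.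
- by apply/measurable_EFinP; exact: (mNN mneq (@neq_pairs_off S)).
- by move=> w _; rewrite lee_fin; exact: ler0n.
- by rewrite lee_fin mulr_ge0.
have := integral_NN_le mneq (@neq_pairs_off S) s0 st tT GA.
move=> /(lee_wpmul2l _ (x := (C0 * (t - s))%:E)).
rewrite lee_fin => /(_ (mulr_ge0 C0_ge0 ts0))/le_trans; apply.
have := probability_le1 PP mA.
move=> /(lee_wpmul2l _ (x := (C0 * (t - s) * (C0 * (t - s)))%:E)).
rewrite lee_fin => /(_ (mulr_ge0 (mulr_ge0 C0_ge0 ts0) (mulr_ge0 C0_ge0 ts0))).
rewrite EFinM muleA => /le_trans; apply; rewrite mule1 -EFinM lee_fin /error.
by rewrite !expr2 mulrACA.
Qed.

Let intA D s t A := fine (\int[PP]_(w in A) (compensation D s t w)%:E)%E.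

Let intAE D s t A : measurable D -> 0 <= s -> s <= t -> measurable A ->
  (\int[PP]_(w in A) (compensation D s t w)%:E = (intA D s t A)%:E)%E.
Proof.
move=> mD s0 st mA; rewrite fineK// ge0_fin_numE; last first.
  by apply: integral_ge0 => w _; rewrite lee_fin.
apply: (@le_lt_trans _ _ (\int[PP]_(w in A) (C0 * (t - s))%:E)%E).
  apply: ge0_le_integral => //.
  - by move=> w _; rewrite lee_fin.
  - by apply/measurable_EFinP; exact: mK.
  - by move=> w _; rewrite lee_fin; exact: compensation_le.
rewrite integral_cst// lte_mul_pinfty// ?lee_fin ?mulr_ge0// ?subr_ge0//.
by rewrite (le_lt_trans (probability_le1 PP mA)) ?ltry.
Qed.

Let local_estimate D s t A : measurable D -> off_diagonal D ->
  0 <= s -> s <= t -> t <= T -> G s A ->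
  `|fine (PP (A `&` [set w | D (Y s w, Y t w)])) - intA D s t A| <= 2 * error s t.
Proof.
move=> mD oD s0 st tT GA; have mA := Gm GA; have t0 := le_trans s0 st.
have mE : measurable (A `&` [set w | D (Y s w, Y t w)]).
  by apply: measurableI => //; apply: (@Gm t); exact: pair_event.
have := pair_martingale s0 st tT GA mD.
rewrite [X in (_ = PP X + _)%E -> _](_ : _ = set0); last first.
  by apply/seteqP; split => w // [_ /oD].
rewrite measure0 add0e.
set e := (\int[PP]_(w in A) _)%E; set b := (\int[PP]_(w in A) _)%E => E.
have mW : measurable_fun A (fun w => (C0 * W s t w * (t - s))%:E).
  apply/measurable_EFinP; apply: measurable_funM => //.
  by apply: measurable_funM => //; exact: (mNN mneq (@neq_pairs_off S)).
have W0 w : (0 <= (C0 * W s t w * (t - s))%:E)%E.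
  by rewrite lee_fin !mulr_ge0 ?subr_ge0//; exact: ler0n.
have CW0 w : 0 <= C0 * W s t w by rewrite mulr_ge0//; exact: ler0n.
have mfz : measurable_fun A (fun w => \int[leb]_(r in `]s, t]) frozen_rate D s r w)%E.
  apply: measurable_funTS; apply: (measurable_sub_sigma (Gsig t) (@Gm t)).
  exact: measurable_time_integral (meas_frozen mD s0 st).
have mex : measurable_fun A (fun w => \int[leb]_(r in `]s, t]) exit_rate D s r w)%E.
  apply: measurable_funTS; apply: (measurable_sub_sigma (Gsig t) (@Gm t)).
  exact: measurable_time_integral (meas_exit mD s0 st).
have e_le : (e <= (error s t)%:E)%E.
  apply: le_trans (integral_W_error s0 st tT GA); apply: ge0_le_integral => //.
  - by move=> w _; apply: integral_ge0 => r _; rewrite mule_ge0// lee_fin.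
  - move=> w _; apply: time_integral_le => //; first exact: meas_exit.
    by move=> r; exact: exit_rate_le.
have e_ge0 : (0 <= e)%E.
  apply: integral_ge0 => w _; apply: integral_ge0 => r _.
  by rewrite mule_ge0// lee_fin.
have b_le : (b <= (intA D s t A)%:E + (error s t)%:E)%E.
  rewrite -intAE//.
  apply: le_trans (leeD2l _ (integral_W_error s0 st tT GA)).
  rewrite -ge0_integralD//; last 2 first.
  - by move=> w _; rewrite lee_fin.
  - by apply/measurable_EFinP; exact: mK.
  apply: ge0_le_integral => //.
  - by move=> w _; apply: integral_ge0 => r _; exact: measure_ge0.
  - by apply: emeasurable_funD => //; apply/measurable_EFinP; exact: mK.
  - move=> w _; rewrite -compensationE//.
    apply: frozen_int_le => //; [exact: meas_frozen|exact: meas_rate|].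
    by move=> r /(frozen_rate_le w mD)[].
have k_le : ((intA D s t A)%:E <= b + (error s t)%:E)%E.
  rewrite -intAE//.
  apply: le_trans (leeD2l _ (integral_W_error s0 st tT GA)).
  rewrite -ge0_integralD//; last first.
  - by move=> w _; apply: integral_ge0 => r _; exact: measure_ge0.
  apply: ge0_le_integral => //.
  - by move=> w _; rewrite lee_fin.
  - by apply/measurable_EFinP; exact: mK.
  - by apply: emeasurable_funD.
  - move=> w _; rewrite -compensationE//.
    apply: frozen_int_le => //; [exact: meas_rate|exact: meas_frozen|].
    by move=> r /(frozen_rate_le w mD)[].
have fe : e \is a fin_num by rewrite ge0_fin_numE// (le_lt_trans e_le) ?ltry.
have fp : PP (A `&` [set w | D (Y s w, Y t w)]) \is a fin_num by exact: fin_num_measure.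
move: E b_le k_le e_le e_ge0; rewrite -(fineK fe) -(fineK fp) => <-.
rewrite -!EFinD !lee_fin => h1 h2 h3 h4.
by rewrite ler_norml; apply/andP; split; lra.
Qed.

Let mE D s t n i : measurable D -> 0 <= s -> s <= t ->
  measurable [set w | D (Y (grid s t n i) w, Y (grid s t n i.+1) w)].
Proof.
move=> mD s0 st; apply: (@Gm (grid s t n i.+1)).
by apply: pair_event => //; [exact: grid_ge0|exact: le_gridS|exact: grid_ge0].
Qed.

Let G_grid s t n i A : s <= t -> G s A -> G (grid s t n i) A.
Proof.
by move=> st; apply: Gmono; rewrite -{1}(grid0 s t n); exact: le_grid.
Qed.

Let compensation_grid D s t n w : measurable D -> 0 <= s -> s <= t ->
  compensation D s t w = \sum_(0 <= i < n.+1)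
    compensation D (grid s t n i) (grid s t n i.+1) w.
Proof.
move=> mD s0 st.
suff H m : compensation D s (grid s t n m) w = \sum_(0 <= i < m)
    compensation D (grid s t n i) (grid s t n i.+1) w.
  by rewrite -H gridn.
elim: m => [|m IH].
  by rewrite grid0 big_nil /compensation set_itv_ge ?integral_set0// bnd_simp ltxx.
rewrite big_nat_recr//= -IH -compensationD//; last exact: le_gridS.
by rewrite -{1}(grid0 s t n) le_grid.
Qed.

(** n + 1 cells with errors of order (n + 1)^-2 leave a total of order (n + 1)^-1. *)
Let integral_V_near D s t n A : measurable D -> off_diagonal D ->
  0 <= s -> s <= t -> t <= T -> G s A ->
  `|fine (\int[PP]_(w in A) (V D s t n w)%:E)%E - intA D s t A| <=
  2 * C0 ^+ 2 * (t - s) ^+ 2 / n.+1%:R.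
Proof.
move=> mD oD s0 st tT GA; have mA := Gm GA.
have -> : intA D s t A = \sum_(0 <= i < n.+1) intA D (grid s t n i) (grid s t n i.+1) A.
  apply: EFin_inj; rewrite -intAE// -sumEFin.
  under eq_integral do rewrite (compensation_grid n _ mD s0 st) -sumEFin.
  rewrite ge0_integral_sum//; last 2 first.
  - move=> i; apply/measurable_EFinP; apply: mK => //; first exact: grid_ge0.
    exact: le_gridS.
  - by move=> i w _; rewrite lee_fin.
  by apply: eq_bigr => i _; rewrite intAE//; [exact: grid_ge0|exact: le_gridS].
rewrite integral_V// -sum_fine; last first.
  by move=> i _; apply: fin_num_measure; apply: measurableI => //; exact: mE.
rewrite -sumrB; apply: le_trans (ler_norm_sum _ _ _) _.
apply: (@le_trans _ _ (\sum_(0 <= i < n.+1) 2 * C0 ^+ 2 * ((t - s) / n.+1%:R) ^+ 2)).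
  rewrite !big_mkord; apply: ler_sum => i _.
  rewrite -(gridS s t n i) -mulrA; apply: local_estimate => //.
  - exact: grid_ge0.
  - exact: le_gridS.
  - by apply: le_trans tT; exact: grid_le.
  - exact: G_grid.
rewrite sumr_const_nat subn0 -mulr_natr le_eqVlt; apply/predU1P; left.
by field; rewrite ?natr1 ?nat1r ?pnatr_eq0.
Qed.

Let integrable_W s t A : 0 <= s -> s <= t -> t <= T -> G s A ->
  PP.-integrable A (fun w => (W s t w)%:E).
Proof.
move=> s0 st tT GA; have mA := Gm GA.
apply/integrableP; split.
  by apply/measurable_EFinP; exact: (mNN mneq (@neq_pairs_off S)).
under eq_integral do rewrite gee0_abs ?lee_fin ?ler0n//.
apply: le_lt_trans (integral_NN_le mneq (@neq_pairs_off S) s0 st tT GA) _.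
rewrite lte_mul_pinfty// ?lee_fin ?mulr_ge0// ?subr_ge0//.
by rewrite (le_lt_trans (probability_le1 PP mA)) ?ltry.
Qed.

(** Dominated convergence along the grids: W dominates every grid count, and [integral_V_near]
    identifies the limit of their means. *)
Let jumps_compensated D s t A : measurable D -> off_diagonal D ->
  0 <= s -> s <= t -> t <= T -> G s A ->
  (\int[PP]_(w in A) (NN D s t w)%:E = \int[PP]_(w in A) (compensation D s t w)%:E)%E.
Proof.
move=> mD oD s0 st tT GA; have mA := Gm GA.
have [] := @dominated_convergence _ _ _ PP A mA (fun n w => (V D s t n w)%:E)
  (fun w => (NN D s t w)%:E) (fun w => (W s t w)%:E).
- by move=> n; apply/measurable_EFinP; exact: mV.
- by apply/measurable_EFinP; exact: mNN.
- by apply: aeW => w _; apply: cvg_EFin; [exact: nearW|exact: V_cvg].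
- exact: integrable_W.
- apply: aeW => w n _; rewrite abse_EFin lee_fin ger0_norm ?ler0n//.
  exact: V_le_W.
move=> iN _ cvgV.
have fN : (\int[PP]_(w in A) (NN D s t w)%:E)%E \is a fin_num by exact: integrable_fin_num.
rewrite intAE// -(fineK fN); congr EFin.
have h1 : fine (\int[PP]_(w in A) (V D s t n w)%:E)%E @[n --> \oo] -->
    fine (\int[PP]_(w in A) (NN D s t w)%:E)%E.
  by move: cvgV; rewrite -{1}(fineK fN) => /fine_cvg.
have h2 : fine (\int[PP]_(w in A) (V D s t n w)%:E)%E @[n --> \oo] --> intA D s t A.
  apply/cvgrPdist_lt => e e0; near=> n.
  rewrite distrC; apply: le_lt_trans (integral_V_near n mD oD s0 st tT GA) _.
  rewrite ltr_pdivrMr// -ltr_pdivrMl//.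
  rewrite (lt_le_trans (truncnS_gt _))// ler_nat ltnS.
  by near: n; exact: nbhs_infty_ge.
by apply: cvg_unique h1 h2.
Unshelve. all: by end_near. Qed.

(** The square is expanded over pairs of cells. The diagonal contributes at most C0 (t - s); for i <
    j the event of cell i is known at the start of cell j, which gives the product of two one-step
    bounds. The result is free of n, as the later use of Fatou's lemma requires. *)
Let V2_le s t n : 0 <= s -> s <= t -> t <= T ->
  (\int[PP]_w ((V (@neq_pairs S) s t n w) ^+ 2)%:E <=
   (C0 * (t - s) + (C0 * (t - s)) ^+ 2)%:E)%E.
Proof.
move=> s0 st tT.
pose Ev i := [set w | (@neq_pairs S) (Y (grid s t n i) w, Y (grid s t n i.+1) w)].
have mEv i : measurable (Ev i) by exact: mE.
pose D := C0 * ((t - s) / n.+1%:R).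
have D0 : 0 <= D by rewrite mulr_ge0// divr_ge0// subr_ge0.
have gT i : (i < n.+1)%N -> grid s t n i.+1 <= T.
  by move=> ilen; apply: le_trans tT; exact: grid_le.
have GEv i j : (i < j)%N -> G (grid s t n j) (Ev i).
  move=> ij; apply: pair_event => //; [exact: grid_ge0|exact: le_gridS|exact: grid_ge0|].
  exact: le_grid.
have GT u : G u setT.
  by have [] := (sigma_algebraP (fun X _ x _ => I)).1 (Gsig u).
have P1 i A : (i < n.+1)%N -> G (grid s t n i) A -> (PP (A `&` Ev i) <= D%:E * PP A)%E.
  move=> ilen GA; rewrite /D -(gridS s t n i); apply: jump_probability_le => //.
  - exact: (@neq_pairs_off S).
  - exact: grid_ge0.
  - exact: le_gridS.
  - exact: gT.
have P1' i : (i < n.+1)%N -> (PP (Ev i) <= D%:E)%E.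
  by move=> ilen; have := P1 i setT ilen (GT _); rewrite setTI probability_setT mule1.
have P2 i j : (i < n.+1)%N -> (j < n.+1)%N -> (i < j)%N ->
    (PP (Ev i `&` Ev j) <= (D ^+ 2)%:E)%E.
  move=> il jl ij; apply: le_trans (P1 j (Ev i) jl (GEv _ _ ij)) _.
  by rewrite expr2 (EFinM D D); apply: lee_pmul => //; exact: P1'.
have E w : ((V (@neq_pairs S) s t n w) ^+ 2)%:E =
    (\sum_(i < n.+1) \sum_(j < n.+1) (\1_(Ev i `&` Ev j) w)%:E)%E :> \bar R.
  rewrite VE big_mkord expr2 mulr_suml -sumEFin; apply: eq_bigr => i _.
  rewrite mulr_sumr -sumEFin; apply: eq_bigr => j _.
  by rewrite indicI.
under eq_integral do rewrite E.
rewrite ge0_integral_sum//; last 2 first.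
- move=> i; apply: emeasurable_sum => j.
  by apply/measurable_EFinP; apply: measurable_indic; exact: measurableI.
- by move=> i w _; apply: sume_ge0 => j _; rewrite lee_fin.
have E2 (i : 'I_n.+1) : (\int[PP]_w \sum_(j < n.+1) (\1_(Ev i `&` Ev j) w)%:E =
    \sum_(j < n.+1) PP (Ev i `&` Ev j))%E.
  rewrite ge0_integral_sum//; last first.
    by move=> j; apply/measurable_EFinP; apply: measurable_indic; exact: measurableI.
  by apply: eq_bigr => j _; rewrite integral_indic ?setIT//; exact: measurableI.
under eq_bigr do rewrite E2.
apply: (@le_trans _ _ (\sum_(i < n.+1) (D + n.+1%:R * D ^+ 2)%:E)%E).
  apply: lee_sum => i _; rewrite (bigD1 i)//= EFinD leeD//; first by rewrite setIid P1'.
  apply: (@le_trans _ _ (\sum_(j < n.+1 | j != i) (D ^+ 2)%:E)%E).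
    apply: lee_sum => j ji; move: ji; rewrite neq_ltn => /orP[ji|ij].
      by rewrite setIC P2.
    by rewrite P2.
  rewrite sumEFin lee_fin sumr_const -[leLHS]mulr_natl.
  apply: ler_wpM2r; rewrite ?sqr_ge0// ler_nat.
  by rewrite (leq_trans (max_card _)) ?card_ord.
rewrite sumEFin lee_fin sumr_const card_ord -[_ *+ _]mulr_natl mulrDr.
rewrite (_ : n.+1%:R * D = C0 * (t - s)); last first.
  by rewrite /D; field; rewrite ?natr1 ?nat1r ?pnatr_eq0.
rewrite (_ : n.+1%:R * (n.+1%:R * D ^+ 2) = (C0 * (t - s)) ^+ 2)//.
by rewrite /D; field; rewrite ?natr1 ?nat1r ?pnatr_eq0.
Qed.

Let jumps_square_integrable t : 0 <= t -> t <= T ->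
  (\int[PP]_w ((W 0 t w) ^+ 2)%:E <= (C0 * t + (C0 * t) ^+ 2)%:E)%E.
Proof.
move=> t0 tT.
apply: (fatou_le (f := fun n w => (V (@neq_pairs S) 0 t n w) ^+ 2)) => //.
- move=> n; apply: measurable_funX; exact: mV.
- by move=> n w; rewrite sqr_ge0.
- move=> w; rewrite /W expr2 (_ : (fun n => _) = (fun n =>
    V (@neq_pairs S) 0 t n w * V (@neq_pairs S) 0 t n w)).
    by apply: cvgM; apply: V_cvg => //; exact: (@neq_pairs_off S).
  by apply/funext => n; rewrite expr2.
- by move=> n; have := V2_le n (lexx 0) t0 tT; rewrite subr0.
Qed.

Let measurable_G s (f : Om -> R) : measurable_fun [set: Gt s] (f : Gt s -> R) ->
  measurable_fun [set: Om] f.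
Proof. exact: (measurable_sub_sigma (Gsig s) (@Gm s)). Qed.

Import HBNNSimple.

(* Approximating the weight by simple functions measurable at the earlier time. *)
Let weighted_compensated D s t A (X : Om -> R) : measurable D -> off_diagonal D ->
  0 <= s -> s <= t -> t <= T -> G s A ->
  measurable_fun [set: Gt s] (X : Gt s -> R) -> (forall w, 0 <= X w) ->
  (\int[PP]_(w in A) (X w * NN D s t w)%:E =
   \int[PP]_(w in A) (X w * compensation D s t w)%:E)%E.
Proof.
move=> mD oD s0 st tT GA mX X0; have mA := Gm GA.
have mXE : measurable_fun [set: Gt s] (fun w : Gt s => (X w)%:E) by apply/measurable_EFinP.
pose g := nnsfun_approx measurableT mXE.
have gX w : g n w @[n --> \oo] --> X w.
  have := @cvg_nnsfun_approx _ _ _ _ measurableT _ mXE (fun x _ => X0 x) w I.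
  by move/fine_cvg.
have mg n : measurable_fun [set: Om] (g n : Om -> R).
  by apply: (@measurable_G s); exact: measurable_funP.
have key (H : Om -> R) : (forall w, 0 <= H w) -> measurable_fun A H ->
    (\int[PP]_(w in A) (g n w * H w)%:E)%E @[n --> \oo] -->
    (\int[PP]_(w in A) (X w * H w)%:E)%E.
  move=> H0 mH.
  rewrite (_ : (\int[PP]_(w in A) (X w * H w)%:E)%E = (\int[PP]_(w in A)
      limn (fun n => (g n w * H w)%:E))%E); last first.
    apply: eq_integral => w _; apply/esym/cvg_lim => //.
    by apply: cvg_EFin; [exact: nearW|apply: cvgMl; exact: gX].
  apply: (@cvg_monotone_convergence _ _ _ PP A mA (fun n w => (g n w * H w)%:E)).
  - move=> n; apply/measurable_EFinP; apply: measurable_funM => //.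
    exact: measurable_funTS.
  - by move=> n w _; rewrite lee_fin mulr_ge0.
  - move=> w _ m n mn; rewrite lee_fin ler_wpM2r//.
    by have /lefP/(_ w) := nd_nnsfun_approx measurableT mXE mn.
suff E n : (\int[PP]_(w in A) (g n w * NN D s t w)%:E =
    \int[PP]_(w in A) (g n w * compensation D s t w)%:E)%E.
  have h1 := key (NN D s t) (fun w => ler0n _ _) (mNN mD oD s0 st).
  have h2 := key (compensation D s t) (fun w => compensation_ge0 _ _ _ _) (mK mD s0 st).
  have EE : (fun n => \int[PP]_(w in A) (g n w * NN D s t w)%:E)%E =
    (fun n => \int[PP]_(w in A) (g n w * compensation D s t w)%:E)%E by apply/funext.
  by move: h1; rewrite EE => h1; exact: cvg_unique h1 h2.
(* The level sets of [g n] belong to G s, so [jumps_compensated] applies on their intersections with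
   A. *)
have Gr r : G s (A `&` g n @^-1` [set r]).
  apply: G_setI => //.
  have := measurable_funP (g n) measurableT [set r] (measurable_set1 r).
  by rewrite setTI {1}/measurable/= (sigma_algebra_id (Gsig s)).
have fE (H : Om -> R) : (forall w, 0 <= H w) -> measurable_fun setT H ->
    (\int[PP]_(w in A) (g n w * H w)%:E = \sum_(r <- fset_set (range (g n)))
      (r%:E * \int[PP]_(w in A `&` g n @^-1` [set r]) (H w)%:E))%E.
  move=> H0 mH.
  transitivity (\int[PP]_(w in A) \sum_(r <- fset_set (range (g n)))
     (r * \1_(g n @^-1` [set r]) w * H w)%:E)%E.
    apply: eq_integral => w _; rewrite sumEFin -mulr_suml; congr (_ * _)%:E.
    by rewrite {1}fimfunE fsbig_finite//=.
  have r0 r w : 0 <= r * \1_(g n @^-1` [set r]) w.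
    rewrite indicE; case: (boolP (w \in _)) => [/set_mem/= <-|_].
      by rewrite mulr1.
    by rewrite mulr0.
  rewrite ge0_integral_sum//; last 2 first.
  - move=> r; apply/measurable_EFinP; apply: measurable_funM.
      apply: measurable_funM => //; apply: measurable_indic.
      by have := mg n measurableT _ (measurable_set1 r); rewrite setTI.
    exact: measurable_funTS.
  - by move=> r w _; rewrite lee_fin mulr_ge0.
  apply: eq_bigr => r _.
  have mr : measurable (g n @^-1` [set r] : set Om).
    by have := mg n measurableT _ (measurable_set1 r); rewrite setTI.
  (* Membership of r in the range is lost inside the sum; a negative r has an empty level set. *)
  have [rn|rp] := ltP r 0.
    have e0 : g n @^-1` [set r] = set0.
      apply/seteqP; split => w //= h.
      by have : 0 <= g n w by []; rewrite h leNgt rn.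
    rewrite e0 setI0 integral_set0 mule0; apply: integral0_eq => w _.
    by rewrite indic0 mulr0 mul0r.
  under eq_integral do rewrite -mulrA EFinM.
  rewrite ge0_integralZl//; last 2 first.
  - apply/measurable_EFinP; apply: measurable_funM; first by apply: measurable_indic.
    exact: measurable_funTS.
  - by move=> w _; rewrite lee_fin mulr_ge0.
  congr (_ * _)%E; rewrite [RHS]integral_mkcond [LHS]integral_mkcond.
  apply: eq_integral => w _; rewrite !patchE in_setI indicE.
  by case: (w \in A) => //=; case: (w \in _); rewrite ?mul1r ?mul0r.
rewrite (fE (NN D s t) (fun w => ler0n _ _) (mNN mD oD s0 st)).
rewrite (fE _ (compensation_ge0 D s t) (mK mD s0 st)).
by apply: eq_bigr => r _; rewrite jumps_compensated.
Qed.

Definition compensated_jumps D s w : R := NN D 0 s w - compensation D 0 s w.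
Local Notation Z := compensated_jumps.

(** One square-integrable variable that dominates the compensated count of every off-diagonal D at
    all times up to T. *)
Let bnd w : R := W 0 T w + C0 * T.

Hypothesis T_ge0 : 0 <= T.

Let bnd_ge0 w : 0 <= bnd w.
Proof. by rewrite addr_ge0 ?ler0n// mulr_ge0. Qed.

Let NN_bnd D s t w : off_diagonal D -> 0 <= s -> s <= t -> t <= T -> NN D s t w <= W 0 T w.
Proof.
move=> oD s0 st tT; apply: le_trans (NN_le_W _ _ _ oD) _.
rewrite /W (@NND _ 0 s T)// ?(@NND _ s t T)//; last exact: le_trans tT.
by rewrite addrCA lerDl addr_ge0 ?ler0n.
Qed.

Let comp_bnd D s t w : measurable D -> 0 <= s -> s <= t -> t <= T ->
  compensation D s t w <= C0 * T.
Proof.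
move=> mD s0 st tT; apply: le_trans (compensation_le _ mD s0 st) _.
by rewrite ler_wpM2l//; lra.
Qed.

Let mW : measurable_fun setT (W 0 T : Om -> R).
Proof. exact: (mNN mneq (@neq_pairs_off S)). Qed.

Let integrable_bnd2 A : measurable A -> PP.-integrable A (fun w => ((bnd w) ^+ 2)%:E).
Proof.
move=> mA; apply: (integrableS measurableT) => //.
apply/integrableP; split.
  by apply/measurable_EFinP; apply: measurable_funX; exact: measurable_funD.
under eq_integral do rewrite gee0_abs ?lee_fin ?sqr_ge0//.
apply: (@le_lt_trans _ _ (\int[PP]_w (2%:E * ((W 0 T w) ^+ 2)%:E + (2 * (C0 * T) ^+ 2)%:E))%E).
  apply: ge0_le_integral => //.
  - by move=> w _; rewrite lee_fin sqr_ge0.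
  - by apply/measurable_EFinP; apply: measurable_funX; exact: measurable_funD.
  - apply: emeasurable_funD => //; apply: emeasurable_funM => //.
    by apply/measurable_EFinP; exact: measurable_funX.
  - move=> w _; rewrite -EFinM -EFinD lee_fin /bnd.
    by have := sqr_ge0 (W 0 T w - C0 * T); rewrite !expr2; lra.
rewrite ge0_integralD//; last 3 first.
- by move=> w _; rewrite mule_ge0// lee_fin sqr_ge0.
- apply: emeasurable_funM => //.
  by apply/measurable_EFinP; exact: measurable_funX.
- by move=> w _; rewrite lee_fin mulr_ge0// sqr_ge0.
apply: lte_add_pinfty; last by rewrite integral_cst//= probability_setT mule1 ltry.
rewrite ge0_integralZl//; last 2 first.
- by apply/measurable_EFinP; exact: measurable_funX.
- by move=> w _; rewrite lee_fin sqr_ge0.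
rewrite lte_mul_pinfty// ?lee_fin//.
by apply: le_lt_trans (jumps_square_integrable T_ge0 (lexx T)) _; rewrite ltry.
Qed.

Let integrable_dom (f : Om -> R) (c : R) A : measurable A -> measurable_fun setT f ->
  (forall w, `|f w| <= c * bnd w ^+ 2) -> PP.-integrable A (EFin \o f).
Proof.
move=> mA mf fb.
apply: (@le_integrable _ _ _ PP A mA _ (fun w => (c%:E * ((bnd w) ^+ 2)%:E)%E)).
- by apply/measurable_EFinP; exact: measurable_funTS.
- move=> w _ /=; rewrite lee_fin; apply: le_trans (fb w) _; exact: ler_norm.
- by apply: integrableZl => //; exact: integrable_bnd2.
Qed.

Let Z_le D t w : measurable D -> off_diagonal D -> 0 <= t -> t <= T -> `|Z D t w| <= bnd w.
Proof.
move=> mD oD t0 tT; rewrite /Z /bnd.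
have := NN_bnd w oD (lexx 0) t0 tT; have := comp_bnd w mD (lexx 0) t0 tT.
have : 0 <= NN D 0 t w by exact: ler0n.
have := compensation_ge0 D 0 t w; have : 0 <= W 0 T w by exact: ler0n.
have : 0 <= C0 * T by rewrite mulr_ge0.
by move=> *; rewrite ler_norml; apply/andP; split; lra.
Qed.

Let mZ D t : measurable D -> off_diagonal D -> 0 <= t -> measurable_fun setT (Z D t : Om -> R).
Proof. by move=> mD oD t0; apply: measurable_funB; [exact: mNN|exact: mK]. Qed.

Let E A (f : Om -> R) : R := (\int[PP]_(w in A) f w)%R.

(** The weight [Z D' s] is G s-measurable but signed. It is split into count and compensation, both
    nonnegative, so that [weighted_compensated] applies to each. *)
Let cross D D' s t A : measurable D -> off_diagonal D -> measurable D' -> off_diagonal D' ->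
  0 <= s -> s <= t -> t <= T -> G s A ->
  E A (fun w => Z D' s w * (Z D t w - Z D s w)) = 0.
Proof.
move=> mD oD mD' oD' s0 st tT GA; have mA := Gm GA; have t0 := le_trans s0 st.
have sT := le_trans st tT.
have dZ w : Z D t w - Z D s w = NN D s t w - compensation D s t w.
  rewrite /Z (NND _ _ s0 st) (compensationD _ mD (lexx 0) s0 st); lra.
have ib (X H : Om -> R) : measurable_fun setT X -> measurable_fun setT H ->
    (forall w, 0 <= X w <= bnd w) -> (forall w, 0 <= H w <= bnd w) ->
    PP.-integrable A (EFin \o (fun w => X w * H w)).
  move=> mX mH Xb Hb; apply: (integrable_dom (c := 1)) => //.
    exact: measurable_funM.
  move=> w; have /andP[X0 X1] := Xb w; have /andP[H0 H1] := Hb w.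
  by rewrite mul1r ger0_norm ?mulr_ge0// expr2 ler_pM.
have bW w : W 0 T w <= bnd w by rewrite lerDl mulr_ge0.
have bC w : C0 * T <= bnd w by rewrite lerDr ler0n.
have Nb D1 u v w : measurable D1 -> off_diagonal D1 -> 0 <= u -> u <= v -> v <= T ->
    0 <= NN D1 u v w <= bnd w.
  by move=> *; rewrite ler0n/=; apply: le_trans (bW w); exact: NN_bnd.
have Kb D1 u v w : measurable D1 -> 0 <= u -> u <= v -> v <= T ->
    0 <= compensation D1 u v w <= bnd w.
  by move=> *; rewrite compensation_ge0/=; apply: le_trans (bC w); exact: comp_bnd.
have NK (X : Om -> R) : measurable_fun [set: Gt s] (X : Gt s -> R) ->
    (forall w, 0 <= X w <= bnd w) ->
    E A (fun w => X w * (Z D t w - Z D s w)) = 0.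
  move=> mX Xb; have X0 w : 0 <= X w by have /andP[] := Xb w.
  have mX' := measurable_G mX.
  rewrite /E; under eq_Rintegral do rewrite dZ mulrBr.
  rewrite RintegralB//; last 2 first.
  - by apply: ib => //; [exact: mNN|move=> w; exact: Nb].
  - by apply: ib => //; [exact: mK|move=> w; exact: Kb].
  apply/eqP; rewrite subr_eq0; apply/eqP; rewrite /Rintegral; congr fine.
  exact: weighted_compensated.
have mN0 := measurable_jump_number mD' oD' (lexx 0) s0.
have mK0 := measurable_compensation mD' (lexx 0) s0.
rewrite /E; under eq_Rintegral do rewrite {1}/Z mulrBl.
have mdZ : measurable_fun setT (fun w => Z D t w - Z D s w).
  by apply: measurable_funB; exact: mZ.
have ib' (X : Om -> R) : measurable_fun setT X ->
    (forall w, 0 <= X w <= bnd w) ->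
    PP.-integrable A (EFin \o (fun w => X w * (Z D t w - Z D s w))).
  move=> mX Xb; apply: (integrable_dom (c := 2)) => //.
    exact: measurable_funM.
  move=> w; have /andP[X0 X1] := Xb w.
  rewrite normrM (ger0_norm X0) expr2 mulrCA.
  apply: ler_pM => //; apply: le_trans (ler_normB _ _) _.
  by have := Z_le w mD oD t0 tT; have := Z_le w mD oD s0 sT; lra.
rewrite RintegralB//; last 2 first.
- by apply: ib'; [exact: (measurable_G mN0)|move=> w; exact: Nb].
- by apply: ib'; [exact: (measurable_G mK0)|move=> w; exact: Kb].
move: (NK _ mN0 (fun w => Nb _ _ _ w mD' oD' (lexx 0) s0 sT)).
move: (NK _ mK0 (fun w => Kb _ _ _ w mD' (lexx 0) s0 sT)).
by rewrite /E => -> ->; rewrite subrr.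
Qed.

Let integrableZZ D D' s t u v A : measurable A -> measurable D -> off_diagonal D ->
  measurable D' -> off_diagonal D' -> 0 <= s -> s <= T -> 0 <= t -> t <= T ->
  0 <= u -> u <= T -> 0 <= v -> v <= T ->
  PP.-integrable A (EFin \o (fun w => (Z D s w - Z D t w) * (Z D' u w - Z D' v w))).
Proof.
move=> mA mD oD mD' oD' s0 sT t0 tT u0 uT v0 vT; apply: (integrable_dom (c := 4)) => //.
  by apply: measurable_funM; apply: measurable_funB; exact: mZ.
move=> w; rewrite normrM.
have -> : 4 * bnd w ^+ 2 = (2 * bnd w) * (2 * bnd w) by rewrite expr2; ring.
apply: ler_pM => //; apply: le_trans (ler_normB _ _) _.
  by have := Z_le w mD oD s0 sT; have := Z_le w mD oD t0 tT; lra.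
by have := Z_le w mD' oD' u0 uT; have := Z_le w mD' oD' v0 vT; lra.
Qed.

Lemma compensated_jumps0 D w : Z D 0 w = 0.
Proof.
rewrite /Z /NN /jumps_between num_jumps_id /compensation.
by rewrite set_itv_ge ?integral_set0 ?subrr// bnd_simp ltxx.
Qed.

Lemma integrable_compensated_jumpsM D D' s t A : measurable A -> measurable D -> off_diagonal D ->
  measurable D' -> off_diagonal D' -> 0 <= s -> s <= T -> 0 <= t -> t <= T ->
  PP.-integrable A (EFin \o (fun w => Z D s w * Z D' t w)).
Proof.
move=> mA mD oD mD' oD' s0 sT t0 tT.
have := integrableZZ mA mD oD mD' oD' s0 sT (lexx 0) T_ge0 t0 tT (lexx 0) T_ge0.
by apply: eq_integrable => // w _ /=; rewrite !compensated_jumps0 !subr0.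
Qed.

(* One step of the summation by parts: the cross terms have mean zero. *)
Let product_step D D' s t A : measurable D -> off_diagonal D -> measurable D' ->
  off_diagonal D' -> 0 <= s -> s <= t -> t <= T -> G s A ->
  E A (fun w => Z D t w * Z D' t w) =
  E A (fun w => Z D s w * Z D' s w) +
  E A (fun w => (Z D t w - Z D s w) * (Z D' t w - Z D' s w)).
Proof.
move=> mD oD mD' oD' s0 st tT GA; have mA := Gm GA; have t0 := le_trans s0 st.
have sT := le_trans st tT.
have c1 := cross mD' oD' mD oD s0 st tT GA.
have c2 := cross mD oD mD' oD' s0 st tT GA.
have iX D1 D2 : measurable D1 -> off_diagonal D1 -> measurable D2 -> off_diagonal D2 ->
    PP.-integrable A (EFin \o (fun w => Z D1 s w * (Z D2 t w - Z D2 s w))).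
  move=> m1 o1 m2 o2.
  have := integrableZZ mA m1 o1 m2 o2 s0 sT (lexx 0) T_ge0 t0 tT s0 sT.
  by apply: eq_integrable => // w _ /=; rewrite !compensated_jumps0 !subr0.
have i1 := iX _ _ mD oD mD' oD'; have i2 := iX _ _ mD' oD' mD oD.
have i3 := integrableZZ mA mD oD mD' oD' t0 tT s0 sT t0 tT s0 sT.
have i4 := integrable_compensated_jumpsM mA mD oD mD' oD' s0 sT s0 sT.
transitivity (E A (fun w => (Z D s w * Z D' s w +
    (Z D t w - Z D s w) * (Z D' t w - Z D' s w)) +
    (Z D s w * (Z D' t w - Z D' s w) + Z D' s w * (Z D t w - Z D s w)))).
  by apply: eq_Rintegral => w _; ring.
rewrite /E RintegralD//; last 2 first.
- exact: (integrableD mA i4 i3).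
- exact: (integrableD mA i1 i2).
rewrite RintegralD// [X in _ + X]RintegralD//.
by move: c1 c2; rewrite /E => -> ->; rewrite !addr0.
Qed.

Let dZE D s t w : measurable D -> 0 <= s -> s <= t ->
  Z D t w - Z D s w = NN D s t w - compensation D s t w.
Proof.
move=> mD s0 st.
by rewrite /Z (NND _ _ s0 st) (compensationD _ mD (lexx 0) s0 st); lra.
Qed.

Let bracket D D' s t n w := \sum_(0 <= i < n.+1)
  ((Z D (grid s t n i.+1) w - Z D (grid s t n i) w) *
   (Z D' (grid s t n i.+1) w - Z D' (grid s t n i) w)).

(** [product_step] iterated along the grid. It is exact for every n, so the mean of [bracket] does
    not depend on the grid. *)
Let product_grid D D' s t n A : measurable D -> off_diagonal D -> measurable D' ->
  off_diagonal D' -> 0 <= s -> s <= t -> t <= T -> G s A ->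
  E A (fun w => Z D t w * Z D' t w) =
  E A (fun w => Z D s w * Z D' s w) + E A (bracket D D' s t n).
Proof.
move=> mD oD mD' oD' s0 st tT GA; have mA := Gm GA.
have gT i : (i <= n.+1)%N -> grid s t n i <= T.
  by move=> h; apply: le_trans tT; exact: grid_le.
have inc i : (i < n.+1)%N -> PP.-integrable A (EFin \o (fun w =>
    (Z D (grid s t n i.+1) w - Z D (grid s t n i) w) *
    (Z D' (grid s t n i.+1) w - Z D' (grid s t n i) w))).
  move=> ilen; apply: integrableZZ => //; try exact: grid_ge0; try exact: gT.
  - by apply: gT; exact: ltnW.
  - by apply: gT; exact: ltnW.
suff H m : (m <= n.+1)%N ->
    PP.-integrable A (EFin \o (fun w => \sum_(0 <= i < m)
      ((Z D (grid s t n i.+1) w - Z D (grid s t n i) w) *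
       (Z D' (grid s t n i.+1) w - Z D' (grid s t n i) w)))) /\
    E A (fun w => Z D (grid s t n m) w * Z D' (grid s t n m) w) =
    E A (fun w => Z D s w * Z D' s w) +
    E A (fun w => \sum_(0 <= i < m)
      ((Z D (grid s t n i.+1) w - Z D (grid s t n i) w) *
       (Z D' (grid s t n i.+1) w - Z D' (grid s t n i) w))).
  by have [_] := H _ (leqnn _); rewrite gridn.
elim: m => [_|m IH mn].
  rewrite grid0; split.
    by apply: (eq_integrable mA (fun=> 0%E)) => [w _ /=|]; rewrite ?big_nil//; exact: integrable0.
  rewrite [X in _ + X](_ : _ = 0) ?addr0// /E.
  under eq_Rintegral do rewrite big_nil.
  by rewrite /Rintegral integral0.
have [iS IE] := IH (ltnW mn).
split.
  apply: (eq_integrable mA (fun w => (\sum_(0 <= i < m)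
      ((Z D (grid s t n i.+1) w - Z D (grid s t n i) w) *
       (Z D' (grid s t n i.+1) w - Z D' (grid s t n i) w)))%:E +
       ((Z D (grid s t n m.+1) w - Z D (grid s t n m) w) *
    (Z D' (grid s t n m.+1) w - Z D' (grid s t n m) w))%:E)%E).
    by move=> w _ /=; rewrite big_nat_recr//= EFinD.
  by apply: integrableD => //; exact: inc.
rewrite (@product_step D D' (grid s t n m))//; last 4 first.
- exact: grid_ge0.
- exact: le_gridS.
- exact: gT.
- exact: G_grid.
rewrite IE -addrA; congr (_ + _).
rewrite /E -RintegralD//; last exact: inc.
by apply: eq_Rintegral => w _; rewrite big_nat_recr.
Qed.

(** On a fine grid each cell holds at most one jump, so the product of the counts of D and D' in a
    cell is the count of their intersection. Every other product contains the increment of a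
    compensation, at most C0 (t - s) / (n + 1). *)
Let bracket_cvg D D' s t w : measurable D -> off_diagonal D -> measurable D' ->
  off_diagonal D' -> 0 <= s -> s <= t ->
  bracket D D' s t n w @[n --> \oo] --> NN (D `&` D') s t w.
Proof.
move=> mD oD mD' oD' s0 st.
have [N HN] := grid_cells (@Yl w) st.
(* In each cross term one factor is at most C0 (t - s) / (n + 1); the other factors add up to the
   two counts and one compensation, itself at most C0 (t - s). *)
pose K := C0 * (t - s) * (NN D s t w + NN D' s t w + C0 * (t - s)).
have ts0 : 0 <= t - s by rewrite subr_ge0.
suff H n : (N <= n)%N -> `|NN (D `&` D') s t w - bracket D D' s t n w| <= K / n.+1%:R.
  apply/cvgrPdist_lt => e e0; near=> n.
  apply: le_lt_trans (H n _) _; first by near: n; exact: nbhs_infty_ge.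
  rewrite ltr_pdivrMr// -ltr_pdivrMl//.
  rewrite (lt_le_trans (truncnS_gt _))// ler_nat ltnS.
  by near: n; exact: nbhs_infty_ge.
move=> Nn; pose dt := (t - s) / n.+1%:R.
have oDD : off_diagonal (D `&` D') by move=> x [/oD].
have C1 i : NN (D `&` D') (grid s t n i) (grid s t n i.+1) w =
    NN D (grid s t n i) (grid s t n i.+1) w * NN D' (grid s t n i) (grid s t n i.+1) w.
  rewrite /NN /jumps_between !HN// -natrM mulnb; congr (nat_of_bool _)%:R.
  by apply/asboolP/andP => [[h1 h2]|[/asboolP h1 /asboolP h2]]; split => //; exact/asboolP.
have C2 D1 : NN D1 s t w = \sum_(0 <= i < n.+1) NN D1 (grid s t n i) (grid s t n i.+1) w.
  by rewrite /NN /jumps_between (num_jumps_grid _ _ _ n st) natr_sum.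
have Kdt D1 i : measurable D1 -> 0 <= compensation D1 (grid s t n i) (grid s t n i.+1) w <= C0 * dt.
  move=> m1; rewrite compensation_ge0/= /dt -(gridS s t n i).
  by apply: compensation_le => //; [exact: grid_ge0|exact: le_gridS].
rewrite C2 /bracket -sumrB; apply: le_trans (ler_norm_sum _ _ _) _.
apply: (@le_trans _ _ (\sum_(0 <= i < n.+1) (C0 * dt *
  (NN D (grid s t n i) (grid s t n i.+1) w + NN D' (grid s t n i) (grid s t n i.+1) w +
    compensation D (grid s t n i) (grid s t n i.+1) w)))).
  rewrite !big_mkord; apply: ler_sum => i _.
  rewrite !dZE//; try exact: grid_ge0; try exact: le_gridS.
  rewrite C1.
  have /andP[] := Kdt _ i mD; have /andP[] := Kdt _ i mD'.
  set k1 := compensation D _ _ _; set k2 := compensation D' _ _ _.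
  set a := NN D _ _ _; set b := NN D' _ _ _ => h1 h2 h3 h4.
  have a0 : 0 <= a by exact: ler0n.
  have b0 : 0 <= b by exact: ler0n.
  rewrite (_ : _ - _ = a * k2 + b * k1 - k1 * k2); last by ring.
  apply: le_trans (ler_normB _ _) _.
  rewrite !ger0_norm ?addr_ge0 ?mulr_ge0// !mulrDr.
  by rewrite lerD// ?lerD// mulrC ler_wpM2r.
rewrite -mulr_sumr !big_split/= -!C2 -(compensation_grid n _ mD s0 st).
rewrite /K /dt [leRHS](_ : _ = C0 * ((t - s) / n.+1%:R) *
  (NN D s t w + NN D' s t w + C0 * (t - s))); last by field; rewrite ?natr1 ?nat1r ?pnatr_eq0.
apply: ler_wpM2l; first by rewrite mulr_ge0// divr_ge0.
by rewrite lerD2l; exact: compensation_le.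
Unshelve. all: by end_near. Qed.

(** A sum of products is at most the product of the sums of absolute values, and the variation of
    each compensated count along the grid is at most [bnd]. *)
Let bracket_le D D' s t n w : measurable D -> off_diagonal D -> measurable D' ->
  off_diagonal D' -> 0 <= s -> s <= t -> t <= T ->
  `|bracket D D' s t n w| <= 1 * bnd w ^+ 2.
Proof.
move=> mD oD mD' oD' s0 st tT.
have aux D1 : measurable D1 -> off_diagonal D1 ->
    \sum_(0 <= i < n.+1) `|Z D1 (grid s t n i.+1) w - Z D1 (grid s t n i) w| <= bnd w.
  move=> m1 o1.
  apply: (@le_trans _ _ (\sum_(0 <= i < n.+1) (NN D1 (grid s t n i) (grid s t n i.+1) w +
     compensation D1 (grid s t n i) (grid s t n i.+1) w))).
    rewrite !big_mkord; apply: ler_sum => i _.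
    rewrite dZE//; [|exact: grid_ge0|exact: le_gridS].
    apply: le_trans (ler_normB _ _) _.
    by rewrite !ger0_norm ?ler0n.
  rewrite big_split/= -(compensation_grid n _ m1 s0 st).
  rewrite -natr_sum -(num_jumps_grid _ _ _ n st); apply: lerD; first exact: NN_bnd.
  exact: comp_bnd.
apply: le_trans (ler_norm_sum _ _ _) _.
rewrite mul1r expr2; apply: le_trans (ler_pM _ _ (aux _ mD oD) (aux _ mD' oD')); last 2 first.
- by apply: sumr_ge0 => i _.
- by apply: sumr_ge0 => i _.
rewrite mulr_suml !big_mkord; apply: ler_sum => i _.
rewrite normrM; apply: ler_wpM2l => //.
rewrite -(big_mkord xpredT (fun i => `|Z D' (grid s t n i.+1) w - Z D' (grid s t n i) w|)).
rewrite (bigD1_seq (nat_of_ord i)) ?mem_index_iota ?iota_uniq//= lerDl.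
by apply: sumr_ge0.
Qed.

Lemma integrable_compensation D s t A : measurable A -> measurable D -> 0 <= s -> s <= t ->
  PP.-integrable A (EFin \o compensation D s t).
Proof.
move=> mA mD s0 st; apply/integrableP; split; first by apply/measurable_EFinP; exact: mK.
rewrite (eq_integral (fun w => (compensation D s t w)%:E)).
  by rewrite intAE// ltry.
by move=> w _; rewrite /= ger0_norm.
Qed.

(** The mean of [bracket] is the same for all grids, and its limit is the mean number of jumps in
    the intersection, which [jumps_compensated] turns into the mean of its compensation. *)
Lemma jumps_covariation D D' s t A : measurable D -> off_diagonal D ->
  measurable D' -> off_diagonal D' -> 0 <= s -> s <= t -> t <= T -> G s A ->
  \int[PP]_(w in A) (Z D t w * Z D' t w - compensation (D `&` D') 0 t w) =
  \int[PP]_(w in A) (Z D s w * Z D' s w - compensation (D `&` D') 0 s w).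
Proof.
move=> mD oD mD' oD' s0 st tT GA; have mA := Gm GA; have t0 := le_trans s0 st.
have sT := le_trans st tT.
have mDD : measurable (D `&` D') by exact: measurableI.
have oDD : off_diagonal (D `&` D') by move=> x [/oD].
have ik u : 0 <= u -> u <= T -> PP.-integrable A (EFin \o compensation (D `&` D') 0 u).
  by move=> u0 uT; exact: integrable_compensation.
have ist : PP.-integrable A (EFin \o compensation (D `&` D') s t).
  exact: integrable_compensation.
have RB u : 0 <= u -> u <= T ->
    E A (fun w => Z D u w * Z D' u w - compensation (D `&` D') 0 u w) =
    E A (fun w => Z D u w * Z D' u w) - E A (compensation (D `&` D') 0 u).
  move=> u0 uT; apply: (@RintegralB _ _ _ PP A
    (fun w => Z D u w * Z D' u w) (compensation (D `&` D') 0 u) mA).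
    exact: integrable_compensated_jumpsM.
  exact: ik.
rewrite -2!/(E _ _) (RB t t0 tT) (RB s s0 sT).
have bE : E A (NN (D `&` D') s t) = E A (compensation (D `&` D') s t).
  by rewrite /E /Rintegral jumps_compensated.
have mbr n : measurable_fun setT (bracket D D' s t n).
  rewrite /bracket; under eq_fun do rewrite big_mkord.
  apply: measurable_sum => i.
  by apply: measurable_funM; apply: measurable_funB; apply: mZ => //; exact: grid_ge0.
have lim : E A (bracket D D' s t n) @[n --> \oo] --> E A (NN (D `&` D') s t).
  have [] := @dominated_convergence _ _ _ PP A mA (fun n w => (bracket D D' s t n w)%:E)
    (fun w => (NN (D `&` D') s t w)%:E) (fun w => (1%:E * (bnd w ^+ 2)%:E)%E).
  - by move=> n; apply/measurable_EFinP; apply: measurable_funTS.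
  - by apply/measurable_EFinP; exact: mNN.
  - by apply: aeW => w _; apply: cvg_EFin; [exact: nearW|exact: bracket_cvg].
  - by apply: integrableZl => //; exact: integrable_bnd2.
  - by apply: aeW => w n _; rewrite abse_EFin -EFinM lee_fin; exact: bracket_le.
  move=> iN _ c; apply: fine_cvg; rewrite fineK//; exact: integrable_fin_num.
have : E A (NN (D `&` D') s t) = E A (fun w => Z D t w * Z D' t w) -
    E A (fun w => Z D s w * Z D' s w).
  apply: cvg_unique lim _ => //; apply: cvg_near_cst; apply: nearW => n.
  by rewrite (product_grid n mD oD mD' oD' s0 st tT GA) addrAC subrr add0r.
rewrite bE; have : E A (compensation (D `&` D') 0 t) =
    E A (compensation (D `&` D') 0 s) + E A (compensation (D `&` D') s t).
  rewrite /E -(@RintegralD _ _ _ PP A (compensation (D `&` D') 0 s)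
    (compensation (D `&` D') s t) mA (ik s s0 sT) ist).
  by apply: eq_Rintegral => w _; rewrite (compensationD _ mDD (lexx 0) s0 st).
set a := E _ _; set b := E _ _; set c := E _ _; set e := E _ _; set f := E _ _.
by lra.
Qed.

Lemma integrable_compensated_jumps D t A : measurable A -> measurable D ->
  off_diagonal D -> 0 <= t -> t <= T -> PP.-integrable A (EFin \o Z D t).
Proof.
move=> mA mD oD t0 tT.
apply: (@le_integrable _ _ _ PP A mA _ (fun w => (1%:E + (bnd w ^+ 2)%:E)%E)).
- by apply/measurable_EFinP; apply: measurable_funTS; exact: mZ.
- move=> w _ /=; rewrite lee_fin; apply: le_trans (Z_le w mD oD t0 tT) _.
  rewrite ger0_norm ?addr_ge0 ?sqr_ge0//.
  by have := sqr_ge0 (bnd w - 1); rewrite !expr2; have := bnd_ge0 w; nra.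
- apply: (integrableD mA); last exact: integrable_bnd2.
  exact: finite_measure_integrable_cst.
Qed.

Lemma jumps_martingale D s t A : measurable D -> off_diagonal D ->
  0 <= s -> s <= t -> t <= T -> G s A ->
  \int[PP]_(w in A) Z D t w = \int[PP]_(w in A) Z D s w.
Proof.
move=> mD oD s0 st tT GA; have mA := Gm GA; have t0 := le_trans s0 st.
apply/eqP; rewrite -subr_eq0 -(@RintegralB _ _ _ PP A (Z D t) (Z D s))//; last 2 first.
- exact: integrable_compensated_jumps.
- by apply: integrable_compensated_jumps => //; exact: le_trans tT.
under eq_Rintegral do rewrite (dZE _ mD s0 st).
have iK : PP.-integrable A (EFin \o compensation D s t) by exact: integrable_compensation.
have iN : PP.-integrable A (EFin \o NN D s t).
  apply/integrableP; split; first by apply/measurable_EFinP; exact: mNN.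
  rewrite (eq_integral (fun w => (NN D s t w)%:E)); last first.
    by move=> w _; rewrite /= ger0_norm// ler0n.
  by rewrite jumps_compensated// intAE// ltry.
rewrite (@RintegralB _ _ _ PP A (NN D s t) (compensation D s t))//.
by rewrite /Rintegral jumps_compensated// subrr.
Qed.

End jump_counting.

(** * The topology of configurations *)

Section separable_metric.
Context (R : realType) (Y : topologicalType).

(** Separation of points is kept apart, as [dsep], so that the same record serves for
    [conf_dist]. *)
Record sep_metric (d : Y -> Y -> R) (a : nat -> Y) : Prop := SepMetric {
  sm_ge0 : forall x y, 0 <= d x y;
  sm_refl : forall x, d x x = 0;
  sm_sym : forall x y, d x y = d y x;
  sm_tri : forall x y z, d x z <= d x y + d y z;
  sm_nbhs : forall x A, nbhs x A <-> exists2 e, 0 < e & [set y | d x y < e] `<=` A;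
  sm_dense : forall y e, 0 < e -> exists n, d (a n) y < e }.

Variables (d : Y -> Y -> R) (a : nat -> Y).
Hypothesis Hd : sep_metric d a.

Lemma sm_continuous (f : Y -> R) :
  (forall x e, 0 < e -> exists2 h, 0 < h & forall y, d x y < h -> `|f x - f y| < e) ->
  continuous f.
Proof.
move=> H x; apply/cvgrPdist_lt => e /(H x)[h h0 hf].
by apply/(sm_nbhs Hd); exists h.
Qed.

(** Tent functions around the dense points with radii 1 / (m + 1), coded by one integer: the sets
    where they are positive form a countable base. The default (0, 0) covers integers that code no
    pair. *)
Definition cozero (n : nat) (y : Y) : R :=
  let p : nat * nat := odflt (0, 0)%N (choice.unpickle n) in
  Num.max 0 (p.2.+1%:R^-1 - d (a p.1) y).

Lemma cozero_ge0 n y : 0 <= cozero n y. Proof. by rewrite le_max lexx. Qed.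

Lemma cozero_continuous n : continuous (cozero n).
Proof.
rewrite /cozero; set p := odflt _ _; set c := _^-1.
apply: sm_continuous => y e e0; exists e => // z yz.
have := sm_tri Hd (a p.1) y z; have := sm_tri Hd (a p.1) z y.
have := sm_sym Hd y z; rewrite /Order.max => h1 h2 h3.
by case: (ltP 0 (c - d (a p.1) y)) => ?; case: (ltP 0 (c - d (a p.1) z)) => ?;
  rewrite ltr_norml; apply/andP; split; lra.
Qed.

Lemma cozero_base (V : set Y) y : open V -> V y ->
  exists2 n, 0 < cozero n y & [set z | 0 < cozero n z] `<=` V.
Proof.
move=> oV Vy; have : nbhs y V by apply: open_nbhs_nbhs.
move=> /(sm_nbhs Hd)[e e0 eV].
pose m := Num.trunc (2 / e).
have m0 : m.+1%:R^-1 < e / 2 :> R.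
  by rewrite -[ltRHS]invrK ltf_pV2 ?posrE ?invr_gt0 ?divr_gt0// invf_div truncnS_gt.
have [i iy] : exists i, d (a i) y < m.+1%:R^-1 by apply: (sm_dense Hd); rewrite invr_gt0.
exists (choice.pickle (i, m)); rewrite /cozero choice.pickleK/= ?lt_max ?ltxx/= ?subr_gt0//.
move=> z /=; rewrite lt_max ltxx/= subr_gt0 => iz; apply: eV => /=.
have := sm_tri Hd y (a i) z; rewrite (sm_sym Hd y (a i)).
by move: m0 iy iz; set c := _^-1; lra.
Qed.

Lemma cozero_open n : open [set z | 0 < cozero n z].
Proof.
have /continuousP := @cozero_continuous n.
rewrite (_ : [set z | _] = cozero n @^-1` `]0, +oo[%classic).
  by apply; exact: interval_open.
by apply/seteqP; split => z /=; rewrite in_itv/= andbT.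
Qed.

(* Increasing approximation of the indicator of [V] by continuous functions. *)
Definition open_approx (V : set Y) (n : nat) (y : Y) : R :=
  Num.min 1 (n%:R * \sum_(0 <= i < n | `[< [set z | 0 < cozero i z] `<=` V >]) cozero i y).

Lemma open_approx_ge0 V n y : 0 <= open_approx V n y.
Proof.
rewrite /open_approx le_min ler01 mulr_ge0//; apply: sumr_ge0 => i _.
exact: cozero_ge0.
Qed.

Lemma open_approx_le1 V n y : open_approx V n y <= 1.
Proof. by rewrite ge_min lexx. Qed.

Lemma continuous_sum_seq (I : Type) (r : seq I) (Q : pred I) (f : I -> Y -> R) :
  (forall i, continuous (f i)) -> continuous (fun y => \sum_(i <- r | Q i) f i y).
Proof.
move=> cf; elim: r => [|i r IH].
  by under eq_fun do rewrite big_nil; exact: cst_continuous.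
under eq_fun do rewrite big_cons; case: (Q i) => // y.
by apply: continuousD; [exact: cf|exact: IH].
Qed.

Lemma open_approx_continuous V n : continuous (open_approx V n).
Proof.
have cs : continuous (fun y => n%:R *
    \sum_(0 <= i < n | `[< [set z | 0 < cozero i z] `<=` V >]) cozero i y).
  move=> y; apply: (@continuousM _ _ (fun=> n%:R)); first exact: cst_continuous.
  by apply: continuous_sum_seq => i; exact: cozero_continuous.
by move=> y; exact: (continuous_min (@cst_continuous _ _ (1 : R) y) (cs y)).
Qed.

Lemma open_approx_nd V m n y : (m <= n)%N -> open_approx V m y <= open_approx V n y.
Proof.
move=> mn; rewrite le_min ge_min lexx/= ge_min; apply/orP; right.
have s0 (r : seq nat) : 0 <= \sum_(i <- r | `[< [set z | 0 < cozero i z] `<=` V >]) cozero i y.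
  by apply: sumr_ge0 => i _; exact: cozero_ge0.
apply: ler_pM => //; first by rewrite ler_nat.
by rewrite [leRHS](big_cat_nat _ (n := m))//= lerDl.
Qed.

(** The approximation is eventually exact: for y in V some admissible tent is positive at y and the
    factor n lifts it above 1; for y outside V all admissible tents vanish at y. *)
Lemma open_approx_cvg V y : open V -> open_approx V n y @[n --> \oo] --> (\1_V y : R).
Proof.
move=> oV; rewrite indicE; have [/set_mem Vy|/negP Vy] := boolP (y \in V); last first.
  apply: cvg_near_cst; apply: nearW => n; rewrite /open_approx big1 ?mulr0.
    by rewrite min_r.
  move=> i /asboolP iV; apply/eqP; rewrite eq_le cozero_ge0 andbT leNgt.
  by apply/negP => /iV /mem_set.
have [i iy iV] := cozero_base oV Vy.
apply: cvg_near_cst; near=> n; rewrite /open_approx min_l//.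
have ni : (i < n)%N by near: n; exists i.+1.
apply: (@le_trans _ _ (n%:R * cozero i y)).
  rewrite -ler_pdivrMr// mul1r; near: n; exact: nbhs_infty_ger.
rewrite ler_wpM2l// big_mkcond (bigD1_seq i) ?mem_index_iota ?iota_uniq//=.
rewrite ifT; last exact/asboolP.
rewrite lerDl; apply: sumr_ge0 => j _; case: ifP => // _; exact: cozero_ge0.
Unshelve. all: by end_near. Qed.

End separable_metric.

Lemma natr_close (R : realType) (m n : nat) : `|m%:R - n%:R : R| < 1 / 2 -> m = n.
Proof.
have H (x y : R) : x + 1 <= y -> - (1 / 2) < x - y -> False by lra.
rewrite ltr_norml => /andP[h1 h2]; have [mn|nm|//] := ltngtP m n; exfalso.
  by apply: H h1; rewrite natr1 ler_nat.
by apply: (H n%:R m%:R); [rewrite natr1 ler_nat|rewrite -opprB ltrN2].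
Qed.

(** * The quotient topology of configurations as the topology of a matching distance *)

Section configurations_topology.
Context (R : realType) (X : ptopologicalType) (d : X -> X -> R) (a : nat -> X).
Hypothesis Hd : sep_metric d a.

Definition close (e : R) (x y : SX X) : Prop :=
  exists p : seq (X * X), [/\ x = seq_mset (unzip1 p), y = seq_mset (unzip2 p) &
    forall q, q \in p -> d q.1 q.2 < e].

Lemma seq_mset_pts (x : SX X) : seq_mset (pts x) = x.
Proof. exact: seq_mset_id. Qed.

Lemma card_seq_mset (s : seq X) : card (seq_mset s) = size s.
Proof. exact: (perm_size (perm_eq_seq_mset s)). Qed.

Lemma seq_mset_cat (s t : seq X) : seq_mset (s ++ t) = (seq_mset s `+` seq_mset t)%mset.
Proof. by apply/msetP => b; rewrite msetE2 !mset_seqE count_cat. Qed.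

(** A matching can be reordered to follow any enumeration of its first side; hence matchings compose
    and can be read along a given labelling. *)
Lemma align (A B : eqType) (p : seq (A * B)) (s : seq A) : perm_eq (unzip1 p) s ->
  exists2 p', perm_eq p p' & unzip1 p' = s.
Proof.
case: p => [|b p0]; first by rewrite perm_sym => /perm_nilP ->; exists [::].
move: (b :: p0) => p {p0}; rewrite perm_sym => /(perm_iotaP b.1)[Is hI ->].
exists (map (nth b p) Is).
  rewrite perm_sym; apply/(perm_iotaP b); exists Is => //.
  by rewrite size_map in hI.
rewrite /unzip1 -map_comp; apply/eq_in_map => i; rewrite (perm_mem hI).
by rewrite mem_iota size_map add0n => /andP[_ ip] /=; rewrite (nth_map b).
Qed.

Lemma close_from e x y s : close e x y -> x = seq_mset s ->
  exists p : seq (X * X), [/\ unzip1 p = s, y = seq_mset (unzip2 p) &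
    forall q, q \in p -> d q.1 q.2 < e].
Proof.
move=> [p [-> -> pe]] /eq_seq_msetP /align[p' pp' p's]; exists p'; split => //.
  by apply/eq_seq_msetP/perm_map.
by move=> q; rewrite -(perm_mem pp'); exact: pe.
Qed.

Lemma close_refl e x : 0 < e -> close e x x.
Proof.
move=> e0; exists [seq (b, b) | b <- pts x]; split.
- by rewrite /unzip1 -map_comp map_id seq_mset_pts.
- by rewrite /unzip2 -map_comp map_id seq_mset_pts.
- by move=> q /mapP[b _ ->]; rewrite /= (sm_refl Hd).
Qed.

Lemma close_sym e x y : close e x y -> close e y x.
Proof.
move=> [p [-> -> pe]]; exists [seq (q.2, q.1) | q <- p]; split.
- by rewrite /unzip1 -map_comp.
- by rewrite /unzip2 -map_comp.
- by move=> q /mapP[b bp ->]; rewrite /= (sm_sym Hd); exact: pe.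
Qed.

Lemma close_le e e' x y : e <= e' -> close e x y -> close e' x y.
Proof.
by move=> ee' [p [-> -> pe]]; exists p; split => // q /pe /lt_le_trans; exact.
Qed.

Lemma close_trans e e' x y z : close e x y -> close e' y z -> close (e + e') x z.
Proof.
move=> /close_sym[p [-> -> pe]] /close_from /(_ erefl)[p' [pp' -> pe']].
exists (zip (unzip2 p) (unzip2 p')).
have sz : size p = size p' by rewrite -(size_map fst p) -(size_map fst p') -/(unzip1 p) -pp'.
split.
- by rewrite unzip1_zip// !size_map sz.
- by rewrite unzip2_zip// !size_map sz.
elim: p p' pe pe' pp' sz => [|[b c] p IH] [|[b' c'] p']//= pe pe' [bb pp'] [sz] q.
rewrite inE => /orP[/eqP->/=|]; last first.
  by apply: IH => // r rp; [apply: pe|apply: pe']; rewrite inE rp orbT.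
have /= h := pe (b, c) (mem_head _ _); have /= h' := pe' (b', c') (mem_head _ _).
by rewrite bb in h'; have := sm_tri Hd c b c'; rewrite (sm_sym Hd c b); lra.
Qed.

Lemma close_add e x x' y y' : close e x x' -> close e y y' ->
  close e (x `+` y)%mset (x' `+` y')%mset.
Proof.
move=> [p [-> -> pe]] [p' [-> -> pe']]; exists (p ++ p'); split.
- by rewrite /unzip1 map_cat seq_mset_cat.
- by rewrite /unzip2 map_cat seq_mset_cat.
- by move=> q; rewrite mem_cat => /orP[/pe|/pe'].
Qed.

Lemma prod_nbhs_box (n : nat) (v : prod_topology (fun _ : 'I_n => X)) A :
  nbhs v A <-> exists2 e : R, 0 < e &
    [set w : prod_topology (fun _ : 'I_n => X) | forall i, d (v i) (w i) < e] `<=` A.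
Proof.
pose box e := [set w : prod_topology (fun _ : 'I_n => X) | forall i, d (v i) (w i) < e].
split => [|[e e0 eA]]; last first.
  apply: filterS eA _.
  have := @filter_forall _ _ (fun i (w : prod_topology (fun _ : 'I_n => X)) =>
    d (v i) (w i) < e) (nbhs v) _; apply => i.
  have := @proj_continuous _ (fun _ : 'I_n => X) i v [set b | d (v i) b < e].
  by apply; apply/(sm_nbhs Hd); exists e.
(* The boxes form a filter base, and convergence of the generated filter to v is checked one
   coordinate at a time. *)
pose F := filter_from [set e : R | 0 < e] box.
have FF : Filter F.
  apply: filter_from_filter; first by exists 1 => /=.
  move=> e e' /= e0 e'0; exists (Num.min e e') => /=; first by rewrite lt_min e0.
  by move=> w h; split => i; have := h i; rewrite lt_min => /andP[].
suff Fv : F --> v by move=> /Fv[e e0 eA]; exists e.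
apply/cvg_sup => i; apply/cvg_image.
  apply/seteqP; split => // b _; exists (fun j => if j == i then b else v j) => //.
move=> B /(sm_nbhs Hd)[e e0 eB]; exists ((fun w => w i) @^-1` B).
  by exists e => // w h; apply: eB; exact: h.
rewrite image_preimage//; apply/seteqP; split => // b _.
Qed.

Lemma unorderedE n (v : prod_topology (fun _ : 'I_n => X)) :
  unordered v = seq_mset [seq v i | i <- enum 'I_n].
Proof. by []. Qed.

Lemma unordered_tnth n (t : n.-tuple X) : unordered (tnth t) = seq_mset t.
Proof. by rewrite unorderedE map_tnth_enum. Qed.

Lemma unorderedP (x : SX X) : exists v : prod_topology (fun _ : 'I_(card x) => X),
  unordered v = x.
Proof. by exists (tnth (in_tuple (pts x))); rewrite unordered_tnth/= seq_mset_pts. Qed.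

Lemma card_unordered n (v : prod_topology (fun _ : 'I_n => X)) : card (unordered v) = n.
Proof. by rewrite unorderedE card_seq_mset size_map -cardE card_ord. Qed.

Lemma close_unordered n (v w : prod_topology (fun _ : 'I_n => X)) e (s : seq 'I_n) :
  (forall i, d (v i) (w i) < e) ->
  close e (seq_mset [seq v i | i <- s]) (seq_mset [seq w i | i <- s]).
Proof.
move=> h; exists [seq (v i, w i) | i <- s]; split.
- by rewrite /unzip1 -map_comp.
- by rewrite /unzip2 -map_comp.
- by move=> q /mapP[i _ ->]; exact: h.
Qed.

(** For V open, a labelling of x has a box inside the preimage of V, and [close_from] aligns any
    matching with that labelling. The quotient topology is thus the one given by matchings. *)
Lemma SX_openP (V : set (SX X)) :
  open V <-> forall x, V x -> exists2 e, 0 < e & forall y, close e x y -> V y.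
Proof.
split => [oV x Vx|H].
  have [v vx] := unorderedP x.
  have : nbhs v (@unordered X (card x) @^-1` V).
    by apply: open_nbhs_nbhs; split; [exact: oV|rewrite /preimage/= vx].
  move=> /prod_nbhs_box[e e0 eV]; exists e => // y xy.
  have [p [pv -> pe]] := close_from xy (esym vx).
  have sp : size p == card x.
    by rewrite -(size_map fst) -/(unzip1 p) pv size_map -cardE card_ord.
  pose w : prod_topology (fun _ : 'I_(card x) => X) := fun i => (tnth (Tuple sp) i).2.
  have -> : seq_mset (unzip2 p) = unordered w.
    rewrite unorderedE; congr seq_mset.
    by rewrite /w (map_comp snd (tnth (Tuple sp))) map_tnth_enum.
  apply: eV => i; rewrite /w.
  have -> : v i = (tnth (Tuple sp) i).1.
    rewrite (tnth_nth (v i, v i))/= -(nth_map _ (v i) fst) ?(eqP sp)//.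
    by rewrite -/(unzip1 p) pv (nth_map i) ?size_enum_ord// nth_ord_enum.
  by apply: pe; exact: mem_tnth.
move=> j; rewrite openE => v Vv; have [e e0 He] := H _ Vv.
by apply/prod_nbhs_box; exists e => // w h; apply: He; exact: close_unordered.
Qed.

Lemma nbhs_close (x : SX X) (A : set (SX X)) :
  nbhs x A <-> exists2 e, 0 < e & forall y, close e x y -> A y.
Proof.
split=> [|[e e0 eA]].
  rewrite nbhsE => -[V [oV Vx] VA].
  by have /SX_openP/(_ x Vx)[e e0 eV] := oV; exists e => // y /eV/VA.
rewrite nbhsE; exists [set y | close e x y] => //; split; last exact: close_refl.
apply/SX_openP => y [p [xp yp pe]].
have [m m0 Hm] : exists2 m, 0 < m & forall q, q \in p -> d q.1 q.2 <= e - m.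
  elim: (p) pe => [|q s IH] qe; first by exists 1.
  have [m m0 Hm] : exists2 m, 0 < m & forall q, q \in s -> d q.1 q.2 <= e - m.
    by apply: IH => r rs; apply: qe; rewrite inE rs orbT.
  have dq := qe q (mem_head _ _).
  exists (Num.min m (e - d q.1 q.2)) => [|r]; first by rewrite lt_min m0 subr_gt0.
  rewrite inE => /orP[/eqP->|/Hm h].
    have : Num.min m (e - d q.1 q.2) <= e - d q.1 q.2 by rewrite ge_min lexx orbT.
    by lra.
  have : Num.min m (e - d q.1 q.2) <= m by rewrite ge_min lexx.
  by lra.
exists (m / 2) => [|z yz]; first by rewrite divr_gt0.
rewrite /= -(subrK (m / 2) e); apply: close_trans yz; exists p; split => // q /Hm.
by lra.
Qed.

Definition close_bounds (x y : SX X) : set R := [set e | 0 < e /\ (1 <= e \/ close e x y)].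

Definition conf_dist (x y : SX X) : R := inf (close_bounds x y).

Let close_bounds1 x y : close_bounds x y 1. Proof. by split => //; left. Qed.

Let close_bounds_lb x y : lbound (close_bounds x y) 0. Proof. by move=> e [/ltW]. Qed.

Let has_inf_close x y : has_inf (close_bounds x y).
Proof. by split; [exists 1|exists 0]. Qed.

Let conf_dist_le e x y : 0 < e -> close e x y -> conf_dist x y <= e.
Proof. by move=> e0 xy; apply: ge_inf; [exists 0|split => //; right]. Qed.

Let conf_dist_lt e x y : e <= 1 -> conf_dist x y < e -> close e x y.
Proof.
move=> e1 /(inf_lt (ex_intro _ _ (close_bounds1 x y)))[h [h0 [h1|hc]] he].
  by have := le_lt_trans h1 he; rewrite ltNge e1.
exact: close_le (ltW he) hc.
Qed.

Definition conf_dense (n : nat) : SX X :=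
  seq_mset [seq a i | i <- odflt [::] (choice.unpickle n : option (seq nat))].

Lemma sep_metric_SX : sep_metric conf_dist conf_dense.
Proof.
split.
- by move=> x y; apply: lb_le_inf; [exists 1|].
- move=> x; apply/eqP; rewrite eq_le; apply/andP; split; last by apply: lb_le_inf; [exists 1|].
  by apply/ler_addgt0Pl => e e0; rewrite addr0; apply: conf_dist_le => //; exact: close_refl.
- move=> x y; congr inf; apply/seteqP; split => e [e0 [e1|h]]; split => //;
    by [left|right; exact: close_sym].
- move=> x y z; rewrite -lerBlDr; apply: lb_le_inf; first by exists 1.
  move=> e [e0 he]; rewrite lerBlDr -lerBlDl; apply: lb_le_inf; first by exists 1.
  move=> h [h0 hh]; rewrite lerBlDl; apply: ge_inf; first by exists 0.
  split; first exact: addr_gt0.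
  case: he => [e1|he]; first by left; lra.
  case: hh => [h1|hh]; first by left; lra.
  by right; exact: (close_trans he hh).
- move=> x A; split => [/nbhs_close[e e0 eA]|[e e0 eA]].
    exists (Num.min e 1) => [|y /= h]; first by rewrite lt_min e0 ltr01.
    apply: eA; apply: (@close_le (Num.min e 1)); first by rewrite ge_min lexx.
    by apply: conf_dist_lt => //; rewrite ge_min lexx orbT.
  apply/nbhs_close; exists (e / 2) => [|y h]; first by rewrite divr_gt0.
  apply: eA => /=; apply: (@le_lt_trans _ _ (e / 2)); last by lra.
  by apply: conf_dist_le => //; rewrite divr_gt0.
- move=> y e e0.
  have [l Hl] : exists l : seq nat, close (e / 2) (seq_mset [seq a i | i <- l]) y.
    suff [l [sl Hl]] : exists l : seq nat, size l = size (pts y) /\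
        forall q, q \in zip [seq a i | i <- l] (pts y) -> d q.1 q.2 < e / 2.
      exists l; exists (zip [seq a i | i <- l] (pts y)); split => //.
      - by rewrite unzip1_zip// size_map sl.
      - by rewrite unzip2_zip ?seq_mset_pts// size_map sl.
    elim: (pts y) => [|b s [l [sl Hl]]]; first by exists [::].
    have [i ib] := sm_dense Hd b (divr_gt0 e0 (ltr0n _ 2)).
    exists (i :: l); split; first by rewrite /= sl.
    by move=> q; rewrite /= inE => /orP[/eqP->//|/Hl].
  exists (choice.pickle l); rewrite /conf_dense choice.pickleK /=.
  apply: (@le_lt_trans _ _ (e / 2)); last by lra.
  by apply: conf_dist_le => //; rewrite divr_gt0.
Qed.

Lemma SX_continuous (Z : topologicalType) (f : SX X -> Z) :
  (forall n, continuous (f \o @unordered X n)) -> continuous f.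
Proof.
move=> cf; apply/continuousP => A oA; change (SX_open (f @^-1` A)) => j.
by have /continuousP := cf j; exact.
Qed.

Lemma sum_conf_seq_mset (f : X -> R) (s : seq X) :
  sum_conf f (seq_mset s) = \sum_(b <- s) f b.
Proof. by rewrite /sum_conf; apply: perm_big; exact: perm_eq_seq_mset. Qed.

Lemma prod_conf_seq_mset (f : X -> R) (s : seq X) :
  prod_conf f (seq_mset s) = \prod_(b <- s) f b.
Proof. by rewrite /prod_conf; apply: perm_big; exact: perm_eq_seq_mset. Qed.

Lemma sum_conf_continuous (f : X -> R) : continuous f -> continuous (sum_conf f).
Proof.
move=> cf; apply: SX_continuous => n.
rewrite (_ : _ \o _ = fun v : prod_topology (fun _ : 'I_n => X) =>
    \sum_(i <- enum 'I_n) f (v i)).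
  apply: continuous_sum_seq => i v; apply: continuous_comp; last exact: cf.
  exact: proj_continuous.
by apply/funext => v /=; rewrite sum_conf_seq_mset big_map.
Qed.

Lemma card_sum_conf (x : SX X) : (card x)%:R = sum_conf (fun=> 1) x :> R.
Proof. by rewrite /sum_conf big_const_seq count_predT iter_addr_0. Qed.

Lemma sum_confD (f : X -> R) (x y : SX X) :
  sum_conf f (x `+` y)%mset = sum_conf f x + sum_conf f y.
Proof.
rewrite -[x]seq_mset_pts -[y]seq_mset_pts -seq_mset_cat !sum_conf_seq_mset.
by rewrite big_cat.
Qed.

Lemma card_add (x y : SX X) : card (x `+` y)%mset = (card x + card y)%N.
Proof.
rewrite -[x]seq_mset_pts -[y]seq_mset_pts -seq_mset_cat !card_seq_mset.
by rewrite size_cat.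
Qed.

Lemma add_continuous : continuous (fun p : SX X * SX X => (p.1 `+` p.2)%mset : SX X).
Proof.
move=> [x y] A /nbhs_close[e e0 eA].
exists ([set x' | close e x x'], [set y' | close e y y']) => /=.
  by split; apply/nbhs_close; exists e.
by move=> [x' y'] [/= xx yy]; apply: eA; exact: close_add.
Qed.

Lemma d_eq0 (dsep : forall b c, d b c = 0 -> b = c) b (s : seq X) :
  exists2 e, 0 < e & forall c, c \in s -> d b c < e -> c = b.
Proof.
elim: s => [|c s [e e0 He]]; first by exists 1.
have [cb|cb] := pselect (c = b).
  by exists e => // c'; rewrite inE => /orP[/eqP->//|]; exact: He.
exists (Num.min e (d b c)) => [|c'].
  rewrite lt_min e0 lt_neqAle (sm_ge0 Hd) andbT eq_sym.
  by apply/eqP => /dsep h; exact: cb.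
rewrite inE lt_min => /orP[/eqP->|c's] /andP[h1 h2]; first by rewrite ltxx in h2.
exact: He.
Qed.

(* A bump function of small support around a point counts its multiplicity. *)
Definition bump (b : X) (e : R) (c : X) : R := Num.max 0 (1 - d b c / e).

Lemma bump_continuous b e : 0 < e -> continuous (bump b e).
Proof.
move=> e0; apply: (sm_continuous Hd) => y h h0; exists (h * e) => [|z yz].
  by rewrite mulr_gt0.
have h1 : `|d b y / e - d b z / e| < h.
  rewrite -mulrBl normrM (gtr0_norm (x := e^-1)) ?invr_gt0//.
  rewrite ltr_pdivrMr//; apply: le_lt_trans yz.
  rewrite ler_norml; apply/andP; split.
    by have := sm_tri Hd b y z; lra.
  by have := sm_tri Hd b z y; rewrite (sm_sym Hd z y); lra.
move: h1; rewrite /bump /Order.max !ltr_norml => /andP[h1 h2].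
by case: (ltP 0 (1 - d b y / e)) => ?; case: (ltP 0 (1 - d b z / e)) => ?;
  apply/andP; split; lra.
Qed.

Lemma bump_bound b e c : 0 < e -> 0 <= bump b e c <= (d b c < e)%R%:R.
Proof.
move=> e0; rewrite /bump le_max lexx/= ge_max ler0n/=.
case: (ltP (d b c) e) => h.
  by rewrite lerBlDr lerDl divr_ge0 ?(sm_ge0 Hd)// ltW.
by rewrite subr_le0 ler_pdivlMr// mul1r.
Qed.

Lemma bump_refl b e : bump b e b = 1.
Proof. by rewrite /bump (sm_refl Hd) mul0r subr0 max_r. Qed.

Hypothesis dsep : forall b c, d b c = 0 -> b = c.

(** A bump at b whose support avoids all other points of x and y sums to the multiplicity of b. *)
Lemma sum_conf_inj (x y : SX X) :
  (forall f : X -> R, continuous f -> (exists c, forall b, `|f b| <= c) ->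
     sum_conf f x = sum_conf f y) -> x = y.
Proof.
move=> H; apply/msetP => b.
have [e e0 He] := d_eq0 dsep b (pts x ++ pts y).
have cnt (z : SX X) : (forall c, c \in pts z -> d b c < e -> c = b) ->
    sum_conf (bump b e) z = (z b)%:R.
  move=> zb; rewrite -count_mem_mset -sum1_count natr_sum /sum_conf.
  rewrite [RHS]big_mkcond; apply: eq_big_seq => c cz /=.
  have [->|cb] := eqVneq c b; first by rewrite bump_refl.
  have /andP[h1 h2] := bump_bound b c e0.
  apply/eqP; rewrite eq_le h1 andbT; apply: le_trans h2 _.
  by case: ltP => // /(zb _ cz) h; rewrite h eqxx in cb.
apply/eqP; rewrite -(eqr_nat R) -!cnt.
- apply/eqP/H; first exact: bump_continuous.
  exists 1 => c; have /andP[h1 h2] := bump_bound b c e0.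
  by rewrite ger0_norm//; apply: le_trans h2 _; rewrite lern1 leq_b1.
- by move=> c cy; apply: He; rewrite mem_cat cy orbT.
- by move=> c cx; apply: He; rewrite mem_cat cx.
Qed.

(** Greedy matching: a point of s is paired with a point of t in its ball. Removing both keeps the
    counts at the other points of s, since balls around distinct points are disjoint. *)
Lemma close_of_counts (e : R) (s t : seq X) : size s = size t ->
  (forall b c, b \in s -> c \in s -> b <> c -> forall z, ~ (d b z < e /\ d c z < e)) ->
  (forall b, b \in s -> (count_mem b s <= count (fun z => (d b z < e)%R) t)%N) ->
  close e (seq_mset s) (seq_mset t).
Proof.
elim: s t => [|b s IH] t.
  by move=> /esym/size0nil -> _ _; exists [::].
move=> st dis cnt.
have /hasP[z zt bz] : has (fun z => d b z < e) t.
  rewrite has_count; apply: leq_trans (cnt b (mem_head _ _)).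
  by rewrite /= eqxx.
have pt := perm_to_rem zt.
have -> : seq_mset t = seq_mset (z :: rem z t) by exact/eq_seq_msetP.
have [|||p [ps pt' pe]] := IH (rem z t).
- by rewrite size_rem// -st.
- by move=> b' c b's cs; apply: dis; rewrite inE ?b's ?cs orbT.
- move=> c cs; have := cnt c; rewrite inE cs orbT => /(_ isT) /=.
  rewrite (seq.permP pt) /=; have [bc|bc] := eqVneq b c.
    by rewrite -bc bz !add1n ltnS.
  rewrite add0n => h; apply: leq_trans h _.
  have -> : (d c z < e) = false; last by rewrite add0n.
  apply/negP => cz; have := dis b c; rewrite mem_head inE cs orbT.
  by move=> /(_ isT isT (elimN eqP bc) z); apply.
exists ((b, z) :: p); split.
- apply/msetP => c; have /msetP/(_ c) := ps.
  by rewrite !mset_seqE /= => ->.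
- apply/msetP => c; have /msetP/(_ c) := pt'.
  by rewrite !mset_seqE /= => ->.
- by move=> q; rewrite inE => /orP[/eqP->|/pe].
Qed.

Let lt_of_half (u v p q : R) : `|u - v| < 1 / 2 -> p <= u -> v <= q -> p < q + 1.
Proof. by rewrite ltr_norml => /andP[]; lra. Qed.

Let lt_of_halves (u v w : R) (e1 e : R) : u < e -> w < e -> e <= e1 / 2 ->
  v <= u + w -> v < e1.
Proof. by lra. Qed.

(* The weak topology on configurations, seen as counting measures, is not
   coarser than the quotient topology. *)
Lemma weak_nbhs_SX (V : set (SX X)) x : open V -> V x ->
  exists (fs : seq (X -> R)), (forall i, (i < size fs)%N ->
     continuous (nth (fun=> 0) fs i) /\
     exists c, forall b, `|nth (fun=> 0) fs i b| <= c) /\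
   forall y, (forall i, (i < size fs)%N ->
     `|sum_conf (nth (fun=> 0) fs i) x - sum_conf (nth (fun=> 0) fs i) y| < 1 / 2) -> V y.
Proof.
move=> /SX_openP oV /oV[e0 e00 eV].
pose s := pts x.
have [e1 e10 He1] : exists2 e, 0 < e & forall b c, b \in s -> c \in s -> d b c < e -> b = c.
  elim: (s) => [|b r [e e_gt0 He]]; first by exists 1.
  have [h h0 Hh] := d_eq0 dsep b r.
  exists (Num.min e h) => [|b' c']; first by rewrite lt_min e_gt0.
  rewrite !inE lt_min => /orP[/eqP->|b'r] /orP[/eqP->|c'r] /andP[k1 k2] //.
  - by apply/esym; exact: Hh.
  - by apply: Hh => //; rewrite (sm_sym Hd).
  - exact: He.
pose e := Num.min e0 (e1 / 2).
have e_gt0 : 0 < e by rewrite lt_min e00 divr_gt0.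
have ee0 : e <= e0 by rewrite ge_min lexx.
have ee1 : e <= e1 / 2 by rewrite ge_min lexx orbT.
(* The constant 1 fixes the cardinality, as integers at distance below 1/2 coincide; the bumps bound
   from below the number of points of y near each point of x. *)
exists ((fun=> 1) :: [seq bump b e | b <- s]); split.
  case=> [_|i] /=; first by split; [exact: cst_continuous|exists 1 => b; rewrite normr1].
  rewrite ltnS size_map => iss; rewrite (nth_map point)//; split.
    exact: bump_continuous.
  exists 1 => c; have /andP[h1 h2] := bump_bound (nth point s i) c e_gt0.
  by rewrite ger0_norm//; apply: le_trans h2 _; rewrite lern1 leq_b1.
move=> y Hy; apply: eV; apply: (close_le ee0).
rewrite -[x]seq_mset_pts -[y]seq_mset_pts; apply: close_of_counts.
- have := Hy 0%N isT; rewrite /= -!card_sum_conf => h.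
  exact: (@natr_close R).
- move=> b c bs cs bc z [bz cz]; apply: bc; apply: He1 => //.
  by apply: (lt_of_halves bz cz ee1); rewrite (sm_sym Hd c z); exact: (sm_tri Hd).
- move=> b bs; have ib := bs; rewrite -index_mem in ib.
  have := Hy (index b s).+1; rewrite /= ltnS size_map (nth_map point)//.
  rewrite nth_index// => /(_ ib) h.
  have h1 : (count_mem b s)%:R <= sum_conf (bump b e) x.
    rewrite -sum1_count natr_sum big_mkcond /sum_conf; apply: ler_sum => c _.
    rewrite /=; have [->|_] := eqVneq c b; first by rewrite bump_refl.
    by have /andP[] := bump_bound b c e_gt0.
  have h2 : sum_conf (bump b e) y <= (count (fun z => d b z < e) (pts y))%:R.
    rewrite -sum1_count natr_sum big_mkcond /sum_conf; apply: ler_sum => c _.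
    by have /andP[_] := bump_bound b c e_gt0; case: (d b c < e).
  by rewrite -ltnS -(ltr_nat R) -natr1; exact: lt_of_half h h1 h2.
Qed.

End configurations_topology.

(** * The weak topology of measures *)

Section weak_topology.
Context (R : realType) (Y : ptopologicalType) (d : Y -> Y -> R) (a : nat -> Y).
Hypothesis Hd : sep_metric d a.

Lemma open_borel (V : set Y) : open V -> measurable (V : set (borel Y)).
Proof. by move=> oV; exact: sub_sigma_algebra. Qed.

Lemma continuous_borel_gen (Z : ptopologicalType) (f : Z -> R) : continuous f ->
  measurable_fun [set: borel Z] (f : borel Z -> R).
Proof.
move=> /continuousP cf mD; apply: (measurability _ (RGenOInfty.measurableE R)) => //.
move=> _ [_ [x ->] <-]; rewrite setTI; apply: sub_sigma_algebra; apply: cf.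
exact: interval_open.
Qed.

Lemma continuous_borel (f : Y -> R) : continuous f ->
  measurable_fun [set: borel Y] (f : borel Y -> R).
Proof.
move=> /continuousP cf mD; apply: (measurability _ (RGenOInfty.measurableE R)) => //.
by move=> _ [_ [x ->] <-]; rewrite setTI; apply: open_borel; apply: cf; exact: interval_open.
Qed.

Definition bounded_cts (f : Y -> R) : Prop :=
  continuous f /\ exists c : R, forall y, `|f y| <= c.

Lemma bounded_cts_cst (c : R) : bounded_cts (fun=> c).
Proof. by split; [exact: cst_continuous|exists `|c|]. Qed.

Lemma bounded_ctsD f g : bounded_cts f -> bounded_cts g -> bounded_cts (fun y => f y + g y).
Proof.
move=> [cf [c fc]] [cg [c' gc]]; split; first by move=> y; apply: cvgD; [exact: cf|exact: cg].
exists (c + c') => y; apply: (le_trans (ler_normD _ _)).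
by apply: lerD.
Qed.

Lemma bounded_ctsN f : bounded_cts f -> bounded_cts (fun y => - f y).
Proof.
move=> [cf [c fc]]; split; first by move=> y; apply: cvgN; exact: cf.
by exists c => y; rewrite normrN.
Qed.

Lemma bounded_cts_approx V n : bounded_cts (open_approx d a V n).
Proof.
split; first exact: open_approx_continuous.
exists 1 => y; rewrite ger0_norm ?open_approx_ge0//; exact: open_approx_le1.
Qed.

Lemma bounded_cts_integrable f (nu : Mplus R Y) : bounded_cts f ->
  nu.-integrable [set: borel Y] (EFin \o f).
Proof.
move=> [cf [c fc]]; apply: measurable_bounded_integrable => //.
- by rewrite ltey_eq fin_num_measure.
- exact: continuous_borel.
- exists c; split; first exact: num_real.
  by move=> M cM y _; apply: le_trans (fc y) (ltW cM).
Qed.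

Lemma pairingE f (nu : Mplus R Y) : bounded_cts f ->
  ((pairing f nu)%:E = \int[nu]_(y in [set: borel Y]) (f y)%:E)%E.
Proof.
move=> bf; rewrite /pairing /Rintegral fineK//.
exact: (integrable_fin_num measurableT (bounded_cts_integrable nu bf)).
Qed.

Lemma pairing_cst c (nu : Mplus R Y) : pairing (fun=> c) nu = c * fine (nu setT).
Proof.
apply: EFin_inj; rewrite pairingE; last exact: bounded_cts_cst.
by rewrite integral_cst// EFinM fineK// fin_num_measure.
Qed.

Lemma pairingD f g (nu : Mplus R Y) : bounded_cts f -> bounded_cts g ->
  pairing (fun y => f y + g y) nu = pairing f nu + pairing g nu.
Proof.
move=> bf bg; rewrite /pairing RintegralD//; exact: bounded_cts_integrable.
Qed.

Lemma pairingN f (nu : Mplus R Y) : bounded_cts f ->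
  pairing (fun y => - f y) nu = - pairing f nu.
Proof.
move=> bf; have := pairingD nu bf (bounded_ctsN bf).
under eq_fun do rewrite addrN.
by rewrite pairing_cst mul0r => /esym/eqP; rewrite addrC addr_eq0 => /eqP.
Qed.

Lemma pairing_measure_eq f (nu nu' : Mplus R Y) : measure_eq nu nu' ->
  pairing f nu = pairing f nu'.
Proof.
by move=> e; rewrite /pairing /Rintegral; congr fine; apply: eq_measure_integral => A mA _; exact: e.
Qed.

Lemma pairing_approx_cvg V (nu : Mplus R Y) : open V ->
  pairing (open_approx d a V n) nu @[n --> \oo] --> fine (nu V).
Proof.
move=> oV; have mV := open_borel oV; apply: fine_cvg; rewrite fineK ?fin_num_measure//.
rewrite -(setIT V) -(@integral_indic _ _ _ nu _ measurableT V mV) setIT.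
have -> : (\int[nu]_(x in [set: borel Y]) (\1_V x)%:E =
    \int[nu]_(x in [set: borel Y]) limn (fun n => (open_approx d a V n x)%:E))%E.
  apply: eq_integral => y _; apply/esym/cvg_lim => //.
  by apply: cvg_EFin; [exact: nearW|exact: open_approx_cvg].
apply: cvg_monotone_convergence => //.
- move=> n; apply/measurable_EFinP; apply: continuous_borel; exact: open_approx_continuous.
- by move=> n y _; rewrite lee_fin; exact: open_approx_ge0.
- by move=> y _ m n mn; rewrite lee_fin; exact: open_approx_nd.
Qed.

Lemma pairing_continuous f : bounded_cts f -> continuous (pairing f : Mplus R Y -> R).
Proof.
move=> bf nu; pose F : Cb R Y := exist _ f bf.
have /cvg_sup/(_ F) : nbhs nu --> (nu : weak_topology_def R Y) by exact: cvg_id.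
move=> /(_ _) h A /(@initial_continuous _ _ (fun mu : Mplus R Y => pairing (sval F) mu)) HA.
exact: h HA.
Qed.

Lemma weak_cvg (F : set_system (Mplus R Y)) (nu : Mplus R Y) : Filter F ->
  (forall f e, bounded_cts f -> 0 < e ->
     F [set nu' | `|pairing f nu' - pairing f nu| < e]) -> F --> nu.
Proof.
move=> FF H; apply/(@cvg_sup _ _ _ F nu FF) => -[f bf] A.
rewrite nbhsE => -[B [[C oC CB] Bnu] BA].
have : nbhs (pairing f nu) C by apply: open_nbhs_nbhs; split => //; rewrite -CB in Bnu.
move=> /nbhs_ballP[e /= e0 eC].
apply: filterS (H f e bf e0) => nu' /= h; apply: BA; rewrite -CB /=; apply: eC.
by rewrite /ball/= distrC.
Qed.

Lemma open_saturated (V : set (Mplus R Y)) (nu nu' : Mplus R Y) : open V -> measure_eq nu nu' ->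
  V nu -> V nu'.
Proof.
move=> oV e Vnu; have nV : nbhs nu V by exact: open_nbhs_nbhs.
(* The filter generated by the singleton of nu' converges to nu because all pairings agree, so nu'
   lies in every neighbourhood of nu. *)
suff h : globally [set nu'] --> nu by apply: (h V nV).
apply: weak_cvg => f eps bf eps0 _ ->.
by rewrite /= (pairing_measure_eq f e) subrr normr0.
Qed.

Lemma borel_saturated (B : set (borel (Mplus R Y))) (nu nu' : Mplus R Y) :
  measurable B -> measure_eq nu nu' -> B nu -> B nu'.
Proof.
pose C := [set B : set (Mplus R Y) | forall nu nu' : Mplus R Y,
  measure_eq nu nu' -> B nu <-> B nu'].
suff : measurable `<=` (C : set (set (borel (Mplus R Y)))).
  by move=> h mB e; rewrite (h _ mB _ _ e).
apply: smallest_sub; last first.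
  move=> V oV m m' e; split; apply: open_saturated => //.
  by move=> A mA; rewrite e.
split; first by [].
- by move=> A CA m m' e; rewrite /setD/=; have := CA _ _ e; tauto.
- move=> A CA m m' e; split=> -[n _ An]; exists n => //; have := CA n _ _ e; tauto.
Qed.

Lemma measurable_mass V : open V ->
  measurable_fun [set: borel (Mplus R Y)] (fun nu : borel (Mplus R Y) => (nu : Mplus R Y) V).
Proof.
move=> oV; have mV := open_borel oV.
rewrite (_ : (fun _ => _) = EFin \o (fun nu : borel (Mplus R Y) => fine ((nu : Mplus R Y) V))).
  apply/measurable_EFinP.
  apply: (measurable_fun_cvg (h := fun n (nu : borel (Mplus R Y)) =>
     pairing (open_approx d a V n) (nu : Mplus R Y))) => [n|nu _].
    apply: (@continuous_borel_gen (Mplus R Y)).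
    exact: pairing_continuous (bounded_cts_approx V n).
  exact: pairing_approx_cvg.
by apply/funext => nu /=; rewrite fineK// fin_num_measure.
Qed.

Lemma measurable_eval (B : set (borel Y)) : measurable B ->
  measurable_fun [set: borel (Mplus R Y)] (fun nu : borel (Mplus R Y) => (nu : Mplus R Y) B).
Proof.
move: B; apply: (@dynkin_induction _ (borel Y) (@open Y) (fun B => measurable_fun
  [set: borel (Mplus R Y)] (fun nu : borel (Mplus R Y) => (nu : Mplus R Y) B))) => //.
- by move=> U V oU oV; exact: openI.
- exact: measurable_mass openT.
- by move=> V oV; exact: measurable_mass.
- move=> S mS mf.
  rewrite (_ : (fun _ => _) = (fun nu : borel (Mplus R Y) =>
     ((nu : Mplus R Y) setT - (nu : Mplus R Y) S)%E)).
    by apply: emeasurable_funB => //; exact: measurable_mass openT.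
  apply/funext => nu; rewrite -setTD measureD ?setTI//.
  by rewrite ltey_eq fin_num_measure.
- move=> F mF tF H.
  rewrite (_ : (fun _ => _) = (fun nu : borel (Mplus R Y) =>
     (\sum_(0 <= i <oo) (nu : Mplus R Y) (F i))%E)).
    by apply: ge0_emeasurable_sum => // i nu _ _; exact: measure_ge0.
  apply/funext => nu; rewrite measure_bigcup//; apply: eq_eseriesl => i.
  by rewrite in_setT.
Qed.

Lemma measure_eq_pairing (nu nu' : Mplus R Y) :
  (forall f, bounded_cts f -> pairing f nu = pairing f nu') -> measure_eq nu nu'.
Proof.
move=> H.
have HV V : open V -> nu V = nu' V.
  move=> oV; have mV := open_borel oV.
  rewrite -[LHS]fineK ?fin_num_measure// -[RHS]fineK ?fin_num_measure//; congr EFin.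
  have h1 := @pairing_approx_cvg V nu oV; have h2 := @pairing_approx_cvg V nu' oV.
  rewrite (_ : (fun n => _) = (fun n => pairing (open_approx d a V n) nu')) in h1.
    exact: cvg_unique h1 h2.
  by apply/funext => n; apply: H; exact: bounded_cts_approx.
move=> B mB; apply: (@measure_unique _ R (borel Y) (@open Y) (fun=> setT) _ _ _ _ nu nu') => //.
- by move=> U V oU oV; exact: openI.
- by move=> n; exact: openT.
- by apply/seteqP; split => // y _; exists 0%N.
- by move=> n; rewrite ltey_eq fin_num_measure.
Qed.

Definition cozero_union (l : seq nat) : set Y :=
  [set y | exists2 n, n \in l & 0 < cozero d a n y].

Lemma open_cozero_union l : open (cozero_union l).
Proof.
rewrite (_ : cozero_union l = \bigcup_(n in [set n | n \in l]) [set y | 0 < cozero d a n y]).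
  by apply: bigcup_open => n _; exact: cozero_open.
by apply/seteqP; split => y [n nl hn]; exists n.
Qed.

(** Countably many conditions with rational thresholds, on the model of the portmanteau theorem:
    lower bounds for the mass of finite unions of basic open sets, upper bounds for the total
    mass. *)
Definition mass_bound (c : (seq nat * rat) * bool) : set (Mplus R Y) :=
  [set nu | if c.2 then ratr c.1.2 < fine (nu (cozero_union c.1.1))
            else fine (nu setT) < ratr c.1.2].

Definition mass_bounds (L : seq ((seq nat * rat) * bool)) : set (Mplus R Y) :=
  [set nu | forall c, c \in L -> mass_bound c nu].

Definition mass_filter (nu : Mplus R Y) : set_system (Mplus R Y) :=
  [set A | exists2 L, mass_bounds L nu & mass_bounds L `<=` A].

Lemma mass_filter_filter nu : Filter (mass_filter nu).
Proof.
split.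
- by exists [::].
- move=> A B [L Ln LA] [L' Ln' LB]; exists (L ++ L').
    by move=> c; rewrite mem_cat => /orP[/Ln|/Ln'].
  move=> m Hm; split; [apply: LA|apply: LB] => c cL; apply: Hm; rewrite mem_cat cL//.
  by rewrite orbT.
- by move=> A B AB [L Ln LA]; exists L => //; exact: subset_trans LA AB.
Qed.

Lemma mass_filter_total nu e : 0 < e ->
  mass_filter nu [set nu' | fine (nu' setT) < fine (nu setT) + e].
Proof.
move=> e0; have : fine (nu setT) < fine (nu setT) + e by rewrite ltrDl.
move=> /rat_in_itvoo[q]; rewrite in_itv/= => /andP[q1 q2].
exists [:: ([::], q, false)] => [c|m]; first by rewrite inE => /eqP->.
by move=> /(_ _ (mem_head _ _)) h; exact: lt_trans h q2.
Qed.

Lemma mass_filter_open nu V e : open V -> 0 < e ->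
  mass_filter nu [set nu' | fine (nu V) - e < fine (nu' V)].
Proof.
move=> oV e0; have mV := open_borel oV.
pose r n := [seq i <- iota 0 n | `[< [set z | 0 < cozero d a i z] `<=` V >]].
have sV n : cozero_union (r n) `<=` V.
  by move=> y [i]; rewrite mem_filter => /andP[/asboolP iV _] hi; exact: iV.
have cV : V = \bigcup_n cozero_union (r n).
  apply/seteqP; split; last by move=> y [n _ /sV].
  move=> y Vy; have [i hi iV] := cozero_base Hd oV Vy; exists i.+1 => //; exists i => //.
  by rewrite mem_filter mem_iota add0n ltnSn !andbT; apply/asboolP.
have mr n : measurable (cozero_union (r n) : set (borel Y)).
  exact: open_borel (open_cozero_union _).
have hc : fine (nu (cozero_union (r n))) @[n --> \oo] --> fine (nu V).
  apply: fine_cvg; rewrite fineK ?fin_num_measure// [X in _ --> nu X]cV.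
  apply: nondecreasing_cvg_mu => //; first by rewrite -cV.
  move=> m n mn; apply/subsetPset => y [i]; rewrite mem_filter mem_iota => /andP[iV im] hi.
  exists i => //; rewrite mem_filter mem_iota iV/=; move: im; rewrite !add0n => im.
  exact: leq_trans im mn.
have [n _ /(_ n (leqnn n))] := (proj1 (cvgrPdist_lt _ _) hc _ e0).
rewrite /= ltr_norml => /andP[_ h].
have : fine (nu V) - e < fine (nu (cozero_union (r n))) by rewrite ltrBlDr addrC -ltrBlDr.
move=> /rat_in_itvoo[q]; rewrite in_itv/= => /andP[q1 q2].
exists [:: (r n, q, true)] => [c|m]; first by rewrite inE => /eqP->; exact: q2.
move=> /(_ _ (mem_head _ _)) {}h; apply: lt_trans q1 _; apply: (lt_le_trans h).
have mm := mr n; apply: fine_le; [exact: fin_num_measure|exact: fin_num_measure|].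
apply: le_measure; [by rewrite inE|by rewrite inE|exact: sV].
Qed.

Lemma layer_count (y : R) (M : nat) : 0 <= y <= M%:R ->
  y - 1 <= \sum_(j < M) (j.+1%:R < y)%R%:R <= y.
Proof.
move=> /andP[y0 yM].
(* The induction carries the case where M is still below y, in which all M terms are equal to 1. *)
suff : (M%:R < y /\ \sum_(j < M) (j.+1%:R < y)%R%:R = M%:R :> R) \/
    (y <= M%:R /\ y - 1 <= \sum_(j < M) (j.+1%:R < y)%R%:R <= y).
  by move=> [[+ _]|[_]//]; rewrite ltNge yM.
elim: M {yM} => [|M IH].
  rewrite big_ord0; case: (ltP 0 y) => h; [by left|right].
  by split => //; apply/andP; split; lra.
rewrite big_ord_recr/= -natr1; case: IH => [[h ->]|[h /andP[h1 h2]]].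
  case: (ltP (M%:R + 1) y) => h' /=; [by left|right].
  by rewrite addr0; split => //; apply/andP; split; lra.
right; split; first by lra.
by rewrite ltNge (_ : y <= _) ?addr0 ?h1 ?h2//; lra.
Qed.

(** The layer-cake formula in unit steps, by integration of [layer_count]; rounding costs at most
    the total mass. *)
Lemma layer_mass (g : Y -> R) (M : nat) (nu : Mplus R Y) : bounded_cts g ->
  (forall y, 0 <= g y <= M%:R) ->
  pairing g nu - fine (nu setT) <= \sum_(j < M) fine (nu [set y | j.+1%:R < g y]) <= pairing g nu.
Proof.
move=> bg gM; pose V (j : 'I_M) : set (borel Y) := [set y | j.+1%:R < g y].
have mV j : measurable (V j).
  apply: open_borel; rewrite (_ : V j = g @^-1` `]j.+1%:R, +oo[%classic).
    by have [/continuousP cg _] := bg; apply: cg; exact: interval_open.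
  by apply/seteqP; split => y /=; rewrite /V/= in_itv/= andbT.
pose S (y : borel Y) : R := \sum_(j < M) \1_(V j) y.
have SE y : S y = \sum_(j < M) (j.+1%:R < g y)%R%:R.
  apply: eq_bigr => j _; rewrite indicE /V; congr (_%:R); congr nat_of_bool.
  by apply/idP/idP => [/set_mem|h]; [|apply/mem_set].
have mS : measurable_fun setT S by apply: measurable_sum => j; exact: measurable_indic.
have Sb y : 0 <= S y <= M%:R.
  rewrite sumr_ge0//= -[leRHS](@mulr_natl R 1 M) mulr1 -[M in leRHS]card_ord -sumr_const.
  by apply: ler_sum => j _; rewrite indicE lern1 leq_b1.
have iS : nu.-integrable setT (EFin \o S).
  apply: measurable_bounded_integrable => //; first by rewrite ltey_eq fin_num_measure.
  exists M%:R; split; first exact: num_real.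
  move=> m Mm y _; have /andP[h1 h2] := Sb y; rewrite /= ger0_norm//.
  exact: le_trans h2 (ltW Mm).
have -> : \sum_(j < M) fine (nu (V j)) = \int[nu]_y S y.
  apply: EFin_inj; rewrite /Rintegral fineK; last exact: (integrable_fin_num measurableT iS).
  rewrite -sumEFin; under [in RHS]eq_integral do rewrite -sumEFin.
  rewrite ge0_integral_sum//; last first.
    by move=> j; apply/measurable_EFinP; exact: measurable_indic.
  apply: eq_bigr => j _.
  by rewrite integral_indic// setIT fineK// fin_num_measure.
have ig := bounded_cts_integrable nu bg.
apply/andP; split; last first.
  apply: le_Rintegral => //= y _.
  by rewrite SE; have /andP[] := layer_count (gM y).
rewrite -[fine _]mul1r -pairing_cst -pairingN; last exact: bounded_cts_cst.
rewrite -pairingD//; last exact: bounded_ctsN (bounded_cts_cst _).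
apply: le_Rintegral => //=.
- apply: bounded_cts_integrable; apply: bounded_ctsD => //.
  exact: bounded_ctsN (bounded_cts_cst _).
- by move=> y _; rewrite SE; have /andP[] := layer_count (gM y).
Qed.

Lemma mass_filter_pairing_ge0 nu g e : bounded_cts g -> (forall y, 0 <= g y) -> 0 < e ->
  mass_filter nu [set nu' | pairing g nu - e < pairing g nu'].
Proof.
move=> bg g0 e0; have [cg [c gc]] := bg; have FF := mass_filter_filter nu.
pose m := fine (nu setT).
(* Scaling g by N divides the errors by N: these are m, from rounding to unit layers, and 1, from M
   lower bounds with tolerance 1 / M each. *)
pose N := (Num.truncn ((m + 1) / e)).+1.
have N0 : 0 < N%:R :> R by rewrite ltr0n.
have hN : m + 1 < N%:R * e.
  by rewrite mulrC -ltr_pdivrMl// mulrC; exact: truncnS_gt.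
pose f y := N%:R * g y.
have bf : bounded_cts f.
  split; first by move=> y; apply: (@continuousM _ _ (fun=> N%:R)); [exact: cst_continuous|exact: cg].
  by exists (N%:R * c) => y; rewrite normrM ger0_norm ?ler_pM2l// ltW.
have fE mu : pairing f mu = N%:R * pairing g mu.
  by rewrite /pairing RintegralZl//; exact: bounded_cts_integrable.
pose M := (Num.truncn (N%:R * c)).+1.
have fM y : 0 <= f y <= M%:R.
  rewrite mulr_ge0//= ?(ltW N0)//; apply: le_trans (ltW (truncnS_gt _)).
  by rewrite ler_pM2l//; apply: le_trans (gc y); exact: ler_norm.
pose V (j : 'I_M) := [set y | j.+1%:R < f y].
have oV j : open (V j).
  rewrite (_ : V j = f @^-1` `]j.+1%:R, +oo[%classic).
    by have [/continuousP cf _] := bf; apply: cf; exact: interval_open.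
  by apply/seteqP; split => y /=; rewrite /V/= in_itv/= andbT.
have M0 : 0 < M%:R^-1 :> R by rewrite invr_gt0 ltr0n.
have HV : mass_filter nu [set nu' | forall j, fine (nu (V j)) - M%:R^-1 < fine (nu' (V j))].
  apply: (@filter_forall _ _ (fun j => [set nu' : Mplus R Y | fine (nu (V j)) - M%:R^-1 < fine (nu' (V j))]) _ FF).
  by move=> j; exact: mass_filter_open.
apply: (@filterS _ _ FF _ _ _ HV) => nu' Hnu'.
have /andP[h1 _] := layer_mass nu bf fM; have /andP[_ h2] := layer_mass nu' bf fM.
have h3 : \sum_(j < M) fine (nu (V j)) - 1 <= \sum_(j < M) fine (nu' (V j)).
  have -> : 1 = \sum_(j < M) M%:R^-1 :> R.
    by rewrite sumr_const card_ord -[RHS]mulr_natr mulVf// pnatr_eq0.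
  by rewrite -sumrB; apply: ler_sum => j _; exact: ltW.
rewrite !fE in h1 h2; rewrite /= -(ltr_pM2l N0) mulrBr.
have H (p s s' p' n x : R) : p - n <= s -> s - 1 <= s' -> s' <= p' -> n + 1 < x -> p - x < p'.
  by lra.
exact: H h1 h3 h2 hN.
Qed.

(** Adding the constant c makes g nonnegative, at the price of c times the total mass; the upper
    bounds on the total mass control this term. *)
Lemma mass_filter_pairing nu g e : bounded_cts g -> 0 < e ->
  mass_filter nu [set nu' | pairing g nu - e < pairing g nu'].
Proof.
move=> bg e0; have [cg [c gc]] := bg; have FF := mass_filter_filter nu.
have c0 : 0 <= c by apply: le_trans (gc point).
have bc := bounded_cts_cst c.
have bgc := bounded_ctsD bg bc.
have gc0 y : 0 <= g y + c by have := gc y; rewrite ler_norml => /andP[]; lra.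
have e2 : 0 < e / 2 by rewrite divr_gt0.
(* The denominator c + 1 remains positive when c is 0. *)
have e2c : 0 < e / 2 / (c + 1) by rewrite divr_gt0// ltr_wpDl.
apply: (@filterS2 _ _ FF _ _ _ _ (mass_filter_pairing_ge0 nu bgc gc0 e2)
  (mass_filter_total nu e2c)) => nu' /=.
rewrite !pairingD// !pairing_cst => h1 h2.
have h3 : c * fine (nu' setT) <= c * fine (nu setT) + e / 2.
  apply: (@le_trans _ _ (c * (fine (nu setT) + e / 2 / (c + 1)))).
    by rewrite ler_wpM2l// ltW.
  rewrite mulrDr lerD2l mulrCA ler_piMr ?(ltW e2)//.
  by rewrite ler_pdivrMr ?ltr_wpDl// mul1r lerDl.
by move: (c * fine _) (c * fine _) h1 h3 {h2 e2c} => u v; lra.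
Qed.

Lemma mass_filter_cvg nu : mass_filter nu --> nu.
Proof.
have FF := mass_filter_filter nu; apply: weak_cvg => f e bf e0.
apply: (@filterS2 _ _ FF _ _ _ _ (mass_filter_pairing nu bf e0)
  (mass_filter_pairing nu (bounded_ctsN bf) e0)).
by move=> nu' /=; rewrite !pairingN// ltr_norml => h1 h2; apply/andP; split; lra.
Qed.

(* The sets [mass_bounds L] form a countable base of the weak topology. *)
Lemma measurable_Mplus dO (Om : measurableType dO) (Z : Om -> Mplus R Y) :
  (forall f, bounded_cts f -> measurable_fun setT (fun w => pairing f (Z w))) ->
  measurable_fun setT (Z : Om -> borel (Mplus R Y)).
Proof.
move=> HZ.
have mZ V : open V -> measurable_fun setT (fun w => fine (Z w V)).
  move=> oV; apply: (measurable_fun_cvg (h := fun n w => pairing (open_approx d a V n) (Z w))).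
    by move=> n; apply: HZ; exact: bounded_cts_approx.
  by move=> w _; exact: pairing_approx_cvg.
have mc c : measurable (Z @^-1` mass_bound c).
  case: c => [[l q] [|]].
    rewrite (_ : _ @^-1` _ = (fun w => fine (Z w (cozero_union l))) @^-1` `]ratr q, +oo[%classic).
      by rewrite -[X in measurable X]setTI; apply: mZ => //; exact: open_cozero_union.
    by apply/seteqP; split => w; rewrite /mass_bound/= in_itv/= andbT.
  rewrite (_ : _ @^-1` _ = (fun w => fine (Z w setT)) @^-1` `]-oo, ratr q[%classic).
    by rewrite -[X in measurable X]setTI; apply: mZ => //; exact: openT.
  by apply/seteqP; split => w; rewrite /mass_bound/= in_itv.
have mL L : measurable (Z @^-1` mass_bounds L).
  elim: L => [|c L IH].
    by rewrite (_ : _ @^-1` _ = setT)//; apply/seteqP; split.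
  rewrite (_ : _ @^-1` _ = (Z @^-1` mass_bound c) `&` (Z @^-1` mass_bounds L)).
    exact: measurableI.
  apply/seteqP; split => w; rewrite /mass_bounds/=.
    by move=> H; split=> [|c' c'L]; apply: H; rewrite inE ?eqxx ?c'L ?orbT.
  by move=> [H1 H2] c'; rewrite inE => /orP[/eqP->|/H2].
move=> mD; apply: (@measurability _ _ _ (borel (Mplus R Y)) setT Z (@open (Mplus R Y))) => // _ [V oV <-]; rewrite setTI.
have -> : Z @^-1` V = \bigcup_L (if `[< mass_bounds L `<=` V >] then Z @^-1` mass_bounds L else set0).
  apply/seteqP; split => w.
    move=> VZ; have /mass_filter_cvg [L LZ LV] : nbhs (Z w) V by exact: open_nbhs_nbhs.
    by exists L => //; case: asboolP.
  by move=> [L _]; case: asboolP => // LV /LV.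
apply: countable_bigcupT_measurable => [|L]; first exact: countableP.
by case: asboolP.
Qed.

End weak_topology.

(** * Configurations as counting measures *)

Section configuration_measures.
Context (R : realType) (X : ptopologicalType) (d : X -> X -> R) (a : nat -> X).
Hypothesis Hd : sep_metric d a.
Hypothesis dsep : forall b c, d b c = 0 -> b = c.
Variable h : {posnum R}.

Lemma deltapE (x : SX X) (B : set (borel X)) :
  deltap R x B = (sum_conf (\1_B) x)%:E.
Proof. by rewrite /deltap /sum_conf -sumEFin; apply: eq_bigr => b _. Qed.

Lemma pairing_hdelta (f : X -> R) (x : SX X) : bounded_cts f ->
  pairing f (hdelta h x) = h%:num * sum_conf f x.
Proof.
have H g : bounded_cts g -> (forall b, 0 <= g b) ->
    pairing g (hdelta h x) = h%:num * sum_conf g x.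
  move=> bg g0; apply: EFin_inj; rewrite pairingE// /sum_conf.
  have mg : measurable_fun [set: borel X] (EFin \o g).
    by apply/measurable_EFinP; apply: continuous_borel; case: bg.
  transitivity (\int[@mscale _ (borel X) R (h%:num%:nng)%R (msum (fun i => \d_(nth point (pts x) i : borel X))
      (size (pts x)))]_(b in [set: borel X]) (g b)%:E)%E.
    apply: eq_measure_integral => A mA _.
    change ((h%:num)%:E * deltap R x A = (h%:num)%:E *
      \sum_(i < size (pts x)) \d_(nth point (pts x) i : borel X) A)%E.
    by rewrite /deltap (big_nth point) big_mkord.
  rewrite ge0_integral_mscale//; last by move=> b _; rewrite lee_fin.
  rewrite ge0_integral_measure_sum//; last by move=> b _; rewrite lee_fin.
  rewrite EFinM; congr (_ * _)%E; rewrite (big_nth point) big_mkord -sumEFin.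
  by apply: eq_bigr => i _; rewrite integral_dirac// diracT mul1e.
(* A signed f is shifted by its bound, as the integral against a sum of Dirac masses was computed
   for nonnegative functions. *)
move=> bf; have [_ [c fc]] := bf.
have c0 : 0 <= c by apply: le_trans (fc point).
have bfc := bounded_ctsD bf (bounded_cts_cst X c).
have fc0 b : 0 <= f b + c by have := fc b; rewrite ler_norml => /andP[]; lra.
have := H _ bfc fc0; rewrite pairingD//; last exact: bounded_cts_cst.
rewrite (H (fun=> c) (bounded_cts_cst X c) (fun=> c0)).
rewrite /sum_conf big_split/= mulrDr => /addIr //.
Qed.

Lemma hdelta_inj (x y : SX X) : measure_eq (hdelta h x) (hdelta h y) -> x = y.
Proof.
move=> e; apply: (sum_conf_inj Hd dsep) => f cf bf.
have bcf : bounded_cts f by split.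
have := pairing_measure_eq f e; rewrite !pairing_hdelta//.
by move=> /mulfI; apply; rewrite gt_eqF.
Qed.

Lemma measure_eq_sym d' (S : measurableType d') (m m' : {measure set S -> \bar R}) :
  measure_eq m m' -> measure_eq m' m.
Proof. by move=> e A mA; rewrite e. Qed.

Lemma measure_eq_trans d' (S : measurableType d') (m m' m'' : {measure set S -> \bar R}) :
  measure_eq m m' -> measure_eq m' m'' -> measure_eq m m''.
Proof. by move=> e e' A mA; rewrite e// e'. Qed.

Lemma conf_measure_eq (nu : Mplus R X) : Mhdelta h nu -> measure_eq nu (hdelta h (conf h nu)).
Proof.
by move=> [x hx]; exact: (@getPex _ [set x | measure_eq nu (hdelta h x)] (ex_intro _ x hx)).
Qed.

Lemma conf_hdelta (nu : Mplus R X) x : measure_eq nu (hdelta h x) -> conf h nu = x.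
Proof.
move=> e; have nuh : Mhdelta h nu by exists x.
exact: hdelta_inj (measure_eq_trans (measure_eq_sym (conf_measure_eq nuh)) e).
Qed.

(** By [weak_nbhs_SX] each open set of configurations is the trace of an open set of measures, and
    traces of Borel sets form a sigma-algebra. Events on configurations thereby become events on
    paths of measures. *)
Lemma hdelta_ext (B : set (borel (SX X))) : measurable B ->
  exists2 B' : set (borel (Mplus R X)), measurable B' & (hdelta h @^-1` B') = B.
Proof.
move: B; suff : measurable `<=` (preimage_set_system setT (hdelta h : _ -> borel (Mplus R X)) measurable
    : set (set (borel (SX X)))).
  by move=> H B /H[B' mB' <-]; exists B' => //; rewrite setTI.
apply: smallest_sub.
  by apply: sigma_algebra_preimage; exact: sigma_algebra_measurable.
move=> V oV; pose V' := \bigcup_(W in [set W : set (Mplus R X) | open W /\ hdelta h @^-1` W `<=` V]) W.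
exists V'; first by apply: sub_sigma_algebra; apply: bigcup_open => W [].
rewrite setTI; apply/seteqP; split => [x [W [_ WV]]|x Vx]; first exact: WV.
have [fs [bfs Hfs]] := weak_nbhs_SX Hd dsep oV Vx.
have bf (i : 'I_(size fs)) : bounded_cts (nth (fun=> 0) fs i) by apply: bfs.
(* The tolerance is h / 2: pairing with [hdelta h x] multiplies sums over x by h, and [weak_nbhs_SX]
   asks for 1/2. *)
pose N := [set nu : Mplus R X | forall i : 'I_(size fs),
  `|pairing (nth (fun=> 0) fs i) (hdelta h x) - pairing (nth (fun=> 0) fs i) nu| < h%:num / 2].
have nN : nbhs (hdelta h x) N.
  apply: (@filter_forall _ _ (fun i : 'I_(size fs) => [set nu : Mplus R X |
    `|pairing (nth (fun=> 0) fs i) (hdelta h x) - pairing (nth (fun=> 0) fs i) nu| < h%:num / 2])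
    (nbhs (hdelta h x)) _).
  move=> i; have := @pairing_continuous _ _ _ (bf i) (hdelta h x).
  by move=> /cvgrPdist_lt; apply; rewrite divr_gt0.
exists (interior N); last exact: nN.
split; first exact: open_interior.
move=> y /interior_subset Ny; apply: Hfs => i ifs.
have := Ny (Ordinal ifs); rewrite /= !pairing_hdelta//; try exact: bfs.
rewrite -mulrBr normrM gtr0_norm// ltr_pdivlMr// -mulrA gtr_pMr//.
by rewrite ltr_pdivlMr.
Qed.

End configuration_measures.

(** * Measurability of evaluation maps on the Skorokhod space *)

Section skorokhod_evaluation.
Context (R : realType) (X : ptopologicalType) (d : X -> X -> R) (a : nat -> X).
Hypothesis Hd : sep_metric d a.
Variable T : R.
Hypothesis T0 : 0 < T.

Let Om := skorokhod X T.

Lemma path_right_cts f (xi : Om) t : bounded_cts f ->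
  pairing f (path_of xi r) @[r --> t^'+] --> pairing f (path_of xi t).
Proof.
move=> bf; have [[rc _] _ _] := svalP (xi : DT X T).
apply: cvg_comp (rc t) _; exact: pairing_continuous.
Qed.

(** A strictly increasing bijection of [0, T] cannot send T below the image of another point.
    Skorokhod neighbourhoods therefore control the value at T itself. *)
Lemma time_changeT lam : time_change T lam -> lam T = T.
Proof.
move=> [[lf _ ls] lm]; have TT : `[0, T]%classic T by rewrite /= in_itv/= lexx ltW.
have [s /= sT e] := ls T TT.
have /= := lf T TT; rewrite in_itv/= => /andP[_ lT].
move: sT; rewrite in_itv/= => /andP[s0]; rewrite le_eqVlt => /orP[/eqP sT|sT]; first by rewrite -{1}sT.
have sI : s \in `[0, T] by rewrite in_itv/= s0 ltW.
have TI : T \in `[0, T] by rewrite in_itv/= lexx ltW.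
have := lm _ _ sI TI sT.
by rewrite e ltNge lT.
Qed.

(** Allowing a whole window of times makes the event open in the Skorokhod topology: a time change
    that moves r by less than its distance to u and v leaves it in the window. *)
Definition exceed f (u v b : R) : set Om :=
  [set xi | exists2 r, (u < r < v) && (0 <= r <= T) & b < pairing f (path_of xi r)].

Lemma exceed_measurable f u v b : bounded_cts f -> measurable (exceed f u v b).
Proof.
move=> bf; apply: sub_sigma_algebra => xi [r /andP[/andP[ur rv] rT] br].
pose e := Num.min (pairing f (path_of xi r) - b) (Num.min (r - u) (v - r)).
exists 1%N, (fun=> exist _ f bf : Cb R X), e; split.
  by rewrite !lt_min !subr_gt0 br ur rv.
move=> eta [lam [[lf _ _] _] H]; exists (lam r).
  have [+ _] := H r rT; rewrite !lt_min => /and3P[_].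
  have /= := (lf r); rewrite in_itv/= => /(_ rT); rewrite in_itv/= => ->.
  by rewrite andbT !ltr_norml => /andP[h1 _] /andP[_ h2]; apply/andP; split; lra.
have [_ /(_ ord0)] := H r rT; rewrite /= lt_min => /andP[+ _].
by rewrite ltr_norml => /andP[h1 _]; lra.
Qed.

Lemma measurable_pairing_eval f t : bounded_cts f ->
  measurable_fun setT (fun xi : Om => pairing f (path_of xi t)).
Proof.
move=> bf.
have H0 s : 0 <= s < T -> measurable_fun setT (fun xi : Om => pairing f (path_of xi s)).
  move=> /andP[s0 sT] mD; apply: (measurability _ (RGenOInfty.measurableE R)) => //.
  move=> _ [_ [x ->] <-]; rewrite setTI.
  (* By right continuity the value at s exceeds x exactly when, for some rational q > x, values
     above q occur arbitrarily soon after s. *)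
  rewrite (_ : _ @^-1` _ = \bigcup_(q : rat) \bigcap_n
     (if x < ratr q then exceed f s (s + n.+1%:R^-1) (ratr q) else set0)).
    apply: bigcupT_measurable_rat => q; apply: bigcapT_measurable => n.
    by case: ifP => // _; exact: exceed_measurable.
  apply/seteqP; split => xi /=; rewrite in_itv/= andbT.
    move=> /rat_in_itvoo[q]; rewrite in_itv/= => /andP[q1 q2].
    exists q => // n _; rewrite q1.
    have sn : s < s + n.+1%:R^-1 by rewrite ltrDl.
    have near1 := path_right_cts (xi := xi) (t := s) bf.
    have near2 : \forall r \near s^'+, ratr q < pairing f (path_of xi r).
      exact: (cvgr_gt _ near1).
    near (at_right s) => r.
    exists r; last by near: r.
    have sr : s < r by near: r; exact: nbhs_right_gt.
    rewrite sr (le_trans s0 (ltW sr))/=; apply/andP; split.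
      by near: r; exact: nbhs_right_lt.
    by near: r; exact: nbhs_right_le.
  move=> [q _ Hq]; have qx : x < ratr q.
    by have := Hq 0%N I; case: ifP.
  rewrite ltNge; apply/negP => le.
  have near1 := path_right_cts (xi := xi) (t := s) bf.
  have : \forall r \near s^'+, pairing f (path_of xi r) < ratr q.
    by apply: (cvgr_lt _ near1); exact: le_lt_trans le qx.
  move=> [e /= e0 He].
  pose n := Num.truncn e^-1.
  have ne : n.+1%:R^-1 < e by rewrite invf_plt ?posrE// truncnS_gt.
  have := Hq n I; rewrite qx => -[r /andP[/andP[sr rs] _]].
  have : ball s e r by rewrite /ball/= distrC gtr0_norm ?subr_gt0// (lt_trans _ ne)// ltrBlDl.
  by move=> /He /(_ sr) h1 /lt_trans /(_ h1); rewrite ltxx.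
have HT : measurable_fun setT (fun xi : Om => pairing f (path_of xi T)).
  move=> mD; apply: (measurability _ (RGenOInfty.measurableE R)) => //.
  move=> _ [_ [x ->] <-]; rewrite setTI; apply: sub_sigma_algebra => xi.
  rewrite /= in_itv/= andbT => hx.
  exists 1%N, (fun=> exist _ f bf : Cb R X), (pairing f (path_of xi T) - x); split.
    by rewrite subr_gt0.
  move=> eta [lam lamT H]; have [] := H T; first by rewrite lexx ltW.
  rewrite (time_changeT lamT) => _ /(_ ord0) /=; rewrite in_itv/= andbT ltr_norml => /andP[+ _].
  by lra.
have [t0|t0] := ltP t 0.
  apply: eq_measurable_fun (H0 0 _); last by rewrite lexx.
  move=> xi _; apply: pairing_measure_eq.
  have [_ e _] := svalP (xi : DT X T); exact: measure_eq_sym (e t (ltW t0)).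
have [tT|tT] := ltP t T; first by apply: H0; rewrite t0.
apply: eq_measurable_fun HT => xi _; apply: pairing_measure_eq.
by have [_ _ e] := svalP (xi : DT X T); exact: measure_eq_sym (e t tT).
Unshelve. all: by end_near.
Qed.

Lemma measurable_path t : measurable_fun setT (fun xi : Om => path_of xi t : borel (Mplus R X)).
Proof.
apply: (measurable_Mplus Hd) => f bf; exact: measurable_pairing_eval.
Qed.

Lemma natural_filtration_sub t :
  @natural_filtration R X T t `<=` (measurable : set (set Om)).
Proof.
apply: smallest_sub; first exact: sigma_algebra_measurable.
move=> _ [r _ [B mB ->]]; rewrite -[X in measurable X]setTI.
exact: measurable_path.
Qed.

End skorokhod_evaluation.

(** * Splitting configurations and jump rates *)

Section finite_kernels.
Context d1 d2 (T1 : measurableType d1) (T2 : measurableType d2) (R : realType).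
Variable k : T1 -> {measure set T2 -> \bar R}.

Definition finite_kernel_fun of
    (forall U, measurable U -> measurable_fun [set: T1] (k ^~ U)) &
    measure_fam_uub k := k.

Hypothesis mk : forall U, measurable U -> measurable_fun [set: T1] (k ^~ U).
Hypothesis uk : measure_fam_uub k.

HB.instance Definition _ :=
  isKernel.Build _ _ _ _ _ (finite_kernel_fun mk uk) mk.
HB.instance Definition _ :=
  Kernel_isFinite.Build _ _ _ _ _ (finite_kernel_fun mk uk) uk.

Definition finite_kernel : R.-fker T1 ~> T2 := finite_kernel_fun mk uk.

Lemma finite_kernelE x : finite_kernel x = k x. Proof. by []. Qed.

End finite_kernels.

Section splitting.
Context (X : ptopologicalType).

(** An arbitrary labelling takes the place of the enumeration [pts x], which does not vary regularly
    with x. *)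
Definition sublabel n (v : 'I_n -> X) (I : {set 'I_n}) : SX X :=
  seq_mset [seq v i | i in I].

Lemma subconfE (x : SX X) (I : {set 'I_(card x)}) :
  subconf I = sublabel (tnth (in_tuple (pts x))) I.
Proof. by []. Qed.

Lemma card_sublabel n (v : 'I_n -> X) I : card (sublabel v I) = #|I|.
Proof. by rewrite card_seq_mset size_map -cardE. Qed.

Lemma sublabelD n (v : 'I_n -> X) I :
  (sublabel v I `+` sublabel v (~: I))%mset = unordered v.
Proof.
rewrite -seq_mset_cat unorderedE; apply/eq_seq_msetP; rewrite -map_cat; apply: perm_map.
apply: uniq_perm; first 1 last; [exact: enum_uniq|move=> i|]; last first.
  rewrite cat_uniq !enum_uniq/= andbT; apply/hasPn => i.
  by rewrite !mem_enum inE.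
by rewrite mem_cat !mem_enum !inE orbN.
Qed.

Lemma subconf_compl (x : SX X) (I : {set 'I_(card x)}) :
  (x `\` subconf I)%mset = sublabel (tnth (in_tuple (pts x))) (~: I).
Proof.
have {1}-> : x = (sublabel (tnth (in_tuple (pts x))) I `+`
    sublabel (tnth (in_tuple (pts x))) (~: I))%mset.
  by rewrite sublabelD unordered_tnth/= seq_mset_pts.
by rewrite subconfE msetDKB.
Qed.

Lemma card_subconf (x : SX X) (I : {set 'I_(card x)}) : card (subconf I) = #|I|.
Proof. exact: card_sublabel. Qed.

Lemma subconfK (x : SX X) (I : {set 'I_(card x)}) :
  (subconf I `+` (x `\` subconf I))%mset = x.
Proof. by rewrite subconf_compl subconfE sublabelD unordered_tnth/= seq_mset_pts. Qed.

Lemma sublabel_perm n (v : 'I_n -> X) (s : {perm 'I_n}) I :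
  sublabel (v \o s) I = sublabel v (s @: I).
Proof.
rewrite /sublabel /image_mem [X in seq_mset X = _](map_comp v s).
apply/eq_seq_msetP; apply: perm_map.
apply: uniq_perm; first 1 last; [exact: enum_uniq|move=> i|]; last first.
  by rewrite map_inj_uniq ?enum_uniq//; exact: perm_inj.
apply/mapP/idP => [[j + ->]|]; rewrite mem_enum.
  by move=> jI; rewrite mem_enum; apply/imsetP; exists j.
by move=> /imsetP[j jI ->]; exists j => //; rewrite mem_enum.
Qed.

Lemma unordered_eqP n (v w : 'I_n -> X) : unordered v = unordered w ->
  exists s : {perm 'I_n}, w = v \o s.
Proof.
rewrite !unorderedE => /eq_seq_msetP; rewrite perm_sym => h.
have : perm_eq [tuple w i | i < n] [tuple v i | i < n] by [].
move=> /tuple_permP[s hs]; exists s; apply/funext => i.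
have : [tuple w i | i < n] = [tuple tnth [tuple v i | i < n] (s i) | i < n].
  exact/val_inj.
by move=> /(congr1 (fun t => tnth t i)); rewrite !tnth_mktuple.
Qed.

(* Sums over the sub-configurations do not depend on the labelling. *)
Lemma sum_splits (V : nmodType) (F : SX X -> SX X -> V) x n (v : 'I_n -> X) :
  unordered v = x ->
  \sum_(I : {set 'I_(card x)}) F (subconf I) (x `\` subconf I)%mset =
  \sum_(I : {set 'I_n}) F (sublabel v I) (sublabel v (~: I)).
Proof.
move=> vx; have nx : n = card x by rewrite -vx card_unordered.
subst n; under eq_bigr do rewrite subconf_compl subconfE.
have [s vs] : exists s : {perm 'I_(card x)}, tnth (in_tuple (pts x)) = v \o s.
  by apply: unordered_eqP; rewrite vx unordered_tnth/= seq_mset_pts.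
rewrite vs [RHS](reindex_inj (imset_inj (@perm_inj _ s))); apply: eq_bigr => I _.
rewrite !sublabel_perm; congr (F _ (sublabel v _)).
apply/setP => i; rewrite inE; apply/imsetP/idP => [[j + ->]|].
  by rewrite inE mem_imset//; exact: perm_inj.
move=> h; exists ((s^-1)%g i); last by rewrite permKV.
rewrite inE; apply: contra h => h; apply/imsetP; exists ((s^-1)%g i) => //.
by rewrite permKV.
Qed.

(** The number of such I is moved by [sum_splits] to the labelling that lists z before v, for which
    the initial indices provide one. *)
Lemma subconf_exists (x z v : SX X) : x = (z `+` v)%mset ->
  exists2 I : {set 'I_(card x)}, subconf I = z & (x `\` subconf I)%mset = v.
Proof.
move=> xzv.
suff : (\sum_(I : {set 'I_(card x)})
    ((subconf I == z) && ((x `\` subconf I)%mset == v) : nat))%N != 0%N.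
  rewrite sum_nat_eq0 negb_forall => /existsP[I]; rewrite eqb0 negbK => /andP[/eqP h1 /eqP h2].
  by exists I.
pose s := pts z ++ pts v; pose w : 'I_(size s) -> X := tnth (in_tuple s).
have wx : unordered w = x.
  by rewrite unordered_tnth/= seq_mset_cat !seq_mset_pts.
rewrite (@sum_splits nat (fun a b => ((a == z) && (b == v) : nat)) x _ w wx).
rewrite sum_nat_eq0 negb_forall; apply/existsP.
pose I : {set 'I_(size s)} := [set i : 'I_(size s) | (i < size (pts z))%N]%SET.
exists I; rewrite eqb0 negbK.
have hI : sublabel w I = z.
  rewrite /sublabel -[RHS]seq_mset_pts; congr seq_mset.
  have -> : [seq w i | i in I] = map (nth point s) (map (@nat_of_ord _) (enum I)).
    by rewrite -map_comp; apply: eq_map => i; rewrite /= /w (tnth_nth point).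
  rewrite (_ : map (@nat_of_ord _) (enum I) = iota 0 (size (pts z))); last first.
    rewrite (_ : enum I = seq.filter (fun i : 'I_(size s) => (i < size (pts z))%N) (enum 'I_(size s))).
      rewrite -(@filter_map _ _ (@nat_of_ord _) (fun j => (j < size (pts z))%N)) val_enum_ord.
      rewrite size_cat iotaD filter_cat (all_filterP _); last first.
        by apply/allP => j; rewrite mem_iota add0n.
      rewrite (@eq_in_filter _ _ pred0) ?filter_pred0 ?cats0// => j.
      by rewrite mem_iota add0n => /andP[]; rewrite leqNgt => /negbTE.
    by rewrite {1}/enum_mem -enumT; apply: eq_filter => i; rewrite /= inE.
  rewrite /s (@map_nth_iota0 _ point (pts z ++ pts v) (size (pts z))) ?take_size_cat//.
  by rewrite size_cat leq_addr.
rewrite hI eqxx/=; apply/eqP; have := sublabelD w I.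
by rewrite hI wx xzv => /(can_inj (@msetDKB _ z)).
Qed.

End splitting.

(** * Measurability of splittings of configurations *)

Section configuration_measurability.
Context (R : realType) (X : ptopologicalType) (d : X -> X -> R) (a : nat -> X).
Hypothesis Hd : sep_metric d a.

Local Notation S := (borel (SX X)).
Local Notation SS := (S * S)%type.

Lemma measurable_borel_continuous (f : SX X -> R) : continuous f ->
  measurable_fun [set: S] (f : S -> R).
Proof. exact: continuous_borel. Qed.

Lemma measurable_sum_conf (f : X -> R) : continuous f ->
  measurable_fun [set: S] (sum_conf f : S -> R).
Proof.
by move=> cf; apply: measurable_borel_continuous; exact: sum_conf_continuous.
Qed.

Lemma measurable_card_le n : measurable ([set x | (card x <= n)%N] : set S).
Proof.
rewrite (_ : [set x | _] = (sum_conf (fun=> 1) : S -> R) @^-1` `]-oo, n%:R]%classic).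
  by rewrite -[X in measurable X]setTI; apply: measurable_sum_conf => //; exact: cst_continuous.
by apply/seteqP; split => x; rewrite /= in_itv/= -card_sum_conf ler_nat.
Qed.

Lemma measurable_card_eq n : measurable ([set x | card x = n] : set S).
Proof.
rewrite (_ : [set x | _] = [set x | (card x <= n)%N] `\` (if n is m.+1 then [set x | (card x <= m)%N] else set0)).
  by case: n => [|n]; apply: measurableD => //; exact: measurable_card_le.
case: n => [|n]; apply/seteqP; split => x /=.
- by move=> ->; split.
- by move=> [+ _]; rewrite leqn0 => /eqP.
- by move=> ->; split => //; rewrite ltnn.
- by move=> [h1 /negP]; rewrite -ltnNge => h2; apply/eqP; rewrite eqn_leq h1.
Qed.

Lemma finite_radius (I : finType) (Q : I -> R -> Prop) :
  (forall i e e', e' <= e -> Q i e -> Q i e') ->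
  (forall i, exists2 e, 0 < e & Q i e) -> exists2 e, 0 < e & forall i, Q i e.
Proof.
move=> Qle H; have [e He] : {e : I -> R & forall i, 0 < e i /\ Q i (e i)}.
  by apply: (@boolp.choice _ _ (fun i e => 0 < e /\ Q i e)) => i; have [e] := H i; exists e.
exists (\big[Num.min/1]_i e i).
  by elim/big_rec: _ => // i x _ x0; rewrite lt_min x0 (He i).1.
move=> i; apply: Qle (He i).2; rewrite (bigD1 i)//= ge_min lexx //.
Qed.

(** A nearby y is labelled along its matching with x. Every index set whose two parts lie in the
    open sets A and B for x also does for y, so the count cannot drop. *)
Lemma open_split_count (A B : set (SX X)) j : open A -> open B ->
  open [set x : SX X | (j <= \sum_(I : {set 'I_(card x)})
     (`[< A (subconf I) >] && `[< B (x `\` subconf I)%mset >] : nat))%N].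
Proof.
move=> oA oB; apply/(SX_openP Hd) => x jx.
pose v := tnth (in_tuple (pts x)).
have [e e0 He] : exists2 e, 0 < e & forall I : {set 'I_(card x)},
    (A (sublabel v I) -> forall y, close d e (sublabel v I) y -> A y) /\
    (B (sublabel v I) -> forall y, close d e (sublabel v I) y -> B y).
  apply: (@finite_radius _ (fun I e =>
    (A (sublabel v I) -> forall y, close d e (sublabel v I) y -> A y) /\
    (B (sublabel v I) -> forall y, close d e (sublabel v I) y -> B y))).
    move=> I e e' ee' [h1 h2]; split=> [/h1|/h2] h y /(close_le ee'); exact: h.
  have H (D : set (SX X)) x' : open D -> exists2 e, 0 < e & D x' -> forall y, close d e x' y -> D y.
    move=> oD; have [Dx|Dx] := pselect (D x'); last by exists 1.
    by have [e e0 eD] := (proj1 (SX_openP Hd D) oD) _ Dx; exists e.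
  move=> I; have [e1 e10 H1] := H A (sublabel v I) oA; have [e2 e20 H2] := H B (sublabel v I) oB.
  exists (Num.min e1 e2); first by rewrite lt_min e10.
  split=> [/H1|/H2] h y hy; apply: h; apply: close_le hy; first by rewrite ge_min lexx.
  by rewrite ge_min lexx orbT.
exists e => // y xy; apply: leq_trans jx _.
have [p [p1 -> pe]] := close_from xy (esym (seq_mset_pts x)).
have sp : size p = card x by rewrite -(size_map fst) -/(unzip1 p) p1.
pose w (i : 'I_(card x)) := nth point (unzip2 p) i.
have wy : unordered w = seq_mset (unzip2 p).
  rewrite unorderedE; congr seq_mset.
  rewrite (_ : [seq w i | i <- _] = map (nth point (unzip2 p)) (map (@nat_of_ord _) (enum 'I_(card x)))).
    by rewrite val_enum_ord map_nth_iota0 ?size_map ?sp// take_oversize// size_map sp.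
  by rewrite -map_comp.
rewrite (@sum_splits _ nat (fun z u => (`[< A z >] && `[< B u >] : nat)) _ _ _ wy) /=.
apply: leq_sum => I _; rewrite subconf_compl subconfE -/v.
have vw (J : {set 'I_(card x)}) : close d e (sublabel v J) (sublabel w J).
  apply: close_unordered => i; rewrite /v /w (tnth_nth point)/=.
  have ip : (i < size p)%N by rewrite sp.
  rewrite (nth_map (point, point))// (_ : nth _ _ _ = (nth (point, point) p i).1).
    by apply: pe; exact: mem_nth.
  have := @nth_map _ (point, point) _ point fst i p ip; rewrite -/(unzip1 p) p1; exact.
case: asboolP => // Av; case: asboolP => // Bv.
have hA : A (sublabel w I) by exact: (He I).1 Av _ (vw I).
have hB : B (sublabel w (~: I)) by exact: (He _).2 Bv _ (vw _).
by rewrite (asboolT hA) (asboolT hB).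
Qed.

Definition splits (x : SX X) : seq SS :=
  map (fun I : {set 'I_(card x)} => (subconf I, (x `\` subconf I)%mset) : SS) (enum {set 'I_(card x)}).

Definition split_measure (x : SX X) : {measure set SS -> \bar R} :=
  msum (fun i => \d_(nth (point : SS) (splits x) i)) (size (splits x)).

Lemma split_measureE x C : (split_measure x C = \sum_(I : {set 'I_(card x)})
  (\1_C (subconf I, (x `\` subconf I)%mset))%:E)%E.
Proof.
transitivity (\sum_(i < size (splits x)) (\d_(nth (point : SS) (splits x) i) C : \bar R))%E => //.
rewrite -(big_mkord xpredT (fun i => \d_(nth (point : SS) (splits x) i) C : \bar R)).
by rewrite -(big_nth (point : SS) xpredT (fun p => \d_p C : \bar R)) /splits big_map big_enum.
Qed.

Lemma integral_split_measure x (f : SS -> \bar R) : measurable_fun setT f ->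
  (forall p, 0 <= f p)%E ->
  (\int[split_measure x]_p f p = \sum_(I : {set 'I_(card x)})
     f (subconf I, (x `\` subconf I)%mset))%E.
Proof.
move=> mf f0; rewrite ge0_integral_measure_sum//.
under eq_bigr do rewrite integral_dirac// diracT mul1e.
rewrite -(big_mkord xpredT (fun i => f (nth (point : SS) (splits x) i))).
by rewrite -(big_nth (point : SS) xpredT f) /splits big_map big_enum.
Qed.

Lemma split_measure_fin x : fin_num_fun (split_measure x).
Proof. by move=> C mC; rewrite split_measureE sumEFin. Qed.

(** On open rectangles the count is lower semicontinuous by [open_split_count]. These rectangles are
    stable under intersection and generate the product sigma-algebra, so Dynkin's theorem
    applies. *)
Lemma measurable_split_measure (C : set SS) : measurable C ->
  measurable_fun [set: S] (fun x : S => split_measure x C).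
Proof.
have moo (A B : set (SX X)) : open A -> open B ->
    measurable_fun [set: S] (fun x : S => split_measure x (A `*` B)).
  move=> oA oB; pose N (x : S) := (\sum_(I : {set 'I_(card x)})
     (`[< A (subconf I) >] && `[< B (x `\` subconf I)%mset >] : nat))%N.
  rewrite (_ : (fun _ => _) = EFin \o (fun x => (N x)%:R)).
    apply/measurable_EFinP => mD.
    apply: (measurability _ (RGenOInfty.measurableE R)) => //.
    move=> _ [_ [q ->] <-]; rewrite setTI.
    rewrite (_ : _ @^-1` _ = \bigcup_j (if q < j%:R then [set x : S | (j <= N x)%N] else set0)).
      apply: bigcupT_measurable => j; case: ifP => // _.
      exact: sub_sigma_algebra (open_split_count _ oA oB).
    apply/seteqP; split => x /=; rewrite in_itv/= andbT.
      by move=> qN; exists (N x) => //; rewrite qN /=.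
    by move=> [j _]; case: ifP => // qj jN; apply: (lt_le_trans qj); rewrite ler_nat.
  apply/funext => x; rewrite split_measureE /N /= natr_sum -sumEFin.
  apply: eq_bigr => I _; rewrite indicE; congr (_%:R%:E); congr nat_of_bool.
  by apply/idP/andP => [/set_mem[/= h1 h2]|[/asboolP h1 /asboolP h2]];
    [split; apply/asboolP|apply/mem_set; split].
have SSE : @measurable _ SS = <<s [set A `*` B | A in @open (SX X) & B in @open (SX X)] >>.
  pose RR : set (set (SX X * SX X)) := [set A `*` B | A in @open (SX X) & B in @open (SX X)].
  rewrite eqEsubset; split; last first.
    apply: smallest_sub; first exact: sigma_algebra_measurable.
    by move=> _ [A oA [B oB <-]]; apply: measurableX; exact: sub_sigma_algebra.
  apply: smallest_sub; first exact: smallest_sigma_algebra.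
  rewrite subUset; split.
    have mf : measurable_fun setT (fst : g_sigma_algebraType RR -> S).
      move=> mD; apply: (@measurability _ _ (g_sigma_algebraType RR) S setT _ (@open (SX X))) => //.
      move=> _ [A oA <-]; apply: sub_sigma_algebra; exists A => //; exists setT; first exact: openT.
      by rewrite setTI; apply/seteqP; split => [p []|p].
    by move=> _ [A mA <-]; exact: mf.
  have mf : measurable_fun setT (snd : g_sigma_algebraType RR -> S).
    move=> mD; apply: (@measurability _ _ (g_sigma_algebraType RR) S setT _ (@open (SX X))) => //.
    move=> _ [A oA <-]; apply: sub_sigma_algebra; exists setT; first exact: openT.
    exists A => //; rewrite setTI; apply/seteqP; split => [p []|p] //.
  by move=> _ [A mA <-]; exact: mf.
rewrite SSE; move: C; apply: (@dynkin_induction _ SS [set A `*` B | A in @open (SX X) & B in @open (SX X)]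
   (fun C => measurable_fun [set: S] (fun x : S => split_measure x C))).
- exact: SSE.
- move=> _ _ [A oA [B oB <-]] [A' oA' [B' oB' <-]]; rewrite -setXI.
  by exists (A `&` A'); [exact: openI|exists (B `&` B') => //; exact: openI].
- by rewrite -setXTT; apply: moo; exact: openT.
- by move=> _ [A oA [B oB <-]]; exact: moo.
- move=> C mC mf; rewrite (_ : (fun _ => _) = (fun x : S => (split_measure x setT - split_measure x C)%E)).
    apply: emeasurable_funB => //.
    by rewrite -setXTT; apply: moo; exact: openT.
  apply/funext => x; rewrite -setTD measureD ?setTI//.
  by rewrite ltey_eq split_measure_fin.
- move=> F mF tF H.
  rewrite (_ : (fun _ => _) = (fun x : S => (\sum_(0 <= i <oo) split_measure x (F i))%E)).
    by apply: ge0_emeasurable_sum => // i nu _ _; exact: measure_ge0.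
  apply/funext => x; rewrite measure_bigcup//; apply: eq_eseriesl => i.
  by rewrite in_setT.
Qed.

(* Truncating the number of points makes the splitting measure a finite
   kernel. *)
Definition truncated_split (n : nat) d0 (Om : measurableType d0) (p : Om * S) :
    {measure set SS -> \bar R} :=
  if (card p.2 <= n)%N then split_measure p.2 else mzero.

Lemma measurable_truncated_split n d0 (Om : measurableType d0) U : measurable U ->
  measurable_fun [set: Om * S] (fun p => truncated_split n p U).
Proof.
move=> mU; rewrite (_ : (fun _ => _) = (fun p : Om * S =>
   if (card p.2 <= n)%N then split_measure p.2 U else 0%E)).
  apply: measurable_fun_if => //.
  - apply: (measurable_fun_bool true).
    rewrite setTI (_ : _ @^-1` _ = snd @^-1` [set x : S | (card x <= n)%N]).
      by rewrite -[X in measurable X]setTI; apply: measurable_snd => //; exact: measurable_card_le.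
    by apply/seteqP; split.
  - apply: measurable_funTS; apply: (measurableT_comp (measurable_split_measure mU)).
    exact: measurable_snd.
by apply/funext => p; rewrite /truncated_split; case: ifP.
Qed.

Lemma truncated_split_uub n d0 (Om : measurableType d0) :
  measure_fam_uub (@truncated_split n d0 Om).
Proof.
(* There are at most 2^n index sets; one is added because the uniform bound is strict. *)
exists (2 ^ n).+1%:R => p; rewrite /truncated_split; case: ifP => pn; last by rewrite /mzero lte_fin.
rewrite split_measureE sumEFin lte_fin.
under eq_bigr do rewrite indicT.
by rewrite sumr_const -cardsT -powersetT card_powerset cardsT card_ord ltr_nat ltnS leq_exp2l.
Qed.

(** The index type of the sum varies with w; reading the sum as an integral against the kernel of
    splittings makes it measurable. *)
Lemma measurable_split_sum n d0 (Om : measurableType d0) (phi : Om -> S)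
    (g : Om * SS -> \bar R) :
  measurable_fun setT phi -> measurable_fun setT g -> (forall p, 0 <= g p)%E ->
  (forall w, (card (phi w) <= n)%N) ->
  measurable_fun setT (fun w => (\sum_(I : {set 'I_(card (phi w))})
    g (w, (subconf I, (phi w `\` subconf I)%mset)))%E).
Proof.
move=> mphi mg g0 phin.
pose K := finite_kernel (@measurable_truncated_split n d0 Om) (@truncated_split_uub n d0 Om).
pose g' (q : (Om * S) * SS) := g (q.1.1, q.2).
have mg' : measurable_fun setT g'.
  apply: (measurableT_comp mg); apply: measurable_fun_pair => //.
  exact: measurableT_comp.
have := @measurable_fun_integral_finite_kernel _ _ _ _ R g' K (fun z => g0 _) mg'.
move=> H; have mw : measurable_fun setT (fun w : Om => (w, phi w)).
  exact: measurable_fun_pair.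
have := measurableT_comp H mw; apply: eq_measurable_fun => w _ /=.
rewrite /K finite_kernelE /truncated_split/= phin integral_split_measure//; last first.
  by move=> p; exact: g0.
by apply: (measurableT_comp mg); exact: measurable_pair1.
Qed.

(** The countable base makes each open set of the product a countable union of open rectangles, so
    Borel sets of the product belong to the product of the Borel sigma-algebras. *)
Lemma measurable_open_prod (U : set (SX X * SX X)) : borelJ U -> measurable (U : set SS).
Proof.
apply: smallest_sub; first exact: sigma_algebra_measurable.
move=> V oV; have Hc := sep_metric_SX Hd.
pose co n : set (SX X) := [set x | 0 < cozero (conf_dist d) (conf_dense a) n x].
have -> : V = \bigcup_(p : nat * nat) (if `[< co p.1 `*` co p.2 `<=` V >] then co p.1 `*` co p.2 else set0).
  apply/seteqP; split => [[x y] Vxy|z [p _]]; last by case: asboolP => // pV /pV.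
  have : nbhs (x, y) V by exact: open_nbhs_nbhs.
  move=> [[A B]] /= [nA nB] ABV.
  have [n nx nA'] := cozero_base Hc (@open_interior _ A) nA.
  have [m my mB'] := cozero_base Hc (@open_interior _ B) nB.
  exists (n, m) => //=; case: asboolP => //.
  case=> -[x' y'] /= [hx hy]; apply: ABV; split => /=.
    exact: interior_subset (nA' _ hx).
  exact: interior_subset (mB' _ hy).
apply: countable_bigcupT_measurable => [|p]; first exact: countableP.
case: asboolP => // _; apply: measurableX; apply: sub_sigma_algebra; exact: (cozero_open Hc).
Qed.

Lemma measurable_continuous_prod (f : SX X * SX X -> SX X) : continuous f ->
  measurable_fun [set: SS] (f : SS -> S).
Proof.
move=> /continuousP cf mD; apply: (@measurability _ _ SS S setT f (@open (SX X))) => //.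
move=> _ [V oV <-]; rewrite setTI; apply: measurable_open_prod.
by apply: sub_sigma_algebra; exact: cf.
Qed.

Lemma measurable_addm : measurable_fun [set: SS] (fun p : SS => (p.1 `+` p.2)%mset : S).
Proof. exact: measurable_continuous_prod (add_continuous Hd). Qed.

Hypothesis dsep : forall b c, d b c = 0 -> b = c.

(** Configurations in the same members of the countable base have the same sums of continuous
    functions, hence coincide; so the diagonal is cut out by countably many rectangles. *)
Lemma measurable_diagonal : measurable [set p : SS | p.1 = p.2].
Proof.
have Hc := sep_metric_SX Hd.
pose co n : set (SX X) := [set x | 0 < cozero (conf_dist d) (conf_dense a) n x].
rewrite (_ : [set p | _] = ~` \bigcup_n ((co n `*` ~` co n) `|` (~` co n `*` co n))).
  apply: measurableC; apply: bigcupT_measurable => n.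
  have mc : measurable (co n : set S) by apply: sub_sigma_algebra; exact: (cozero_open Hc).
  by apply: measurableU; apply: measurableX => //; exact: measurableC.
apply/seteqP; split => -[x y] /=.
  by move=> -> [n _ [[]|[]]].
move=> H; apply: (sum_conf_inj Hd dsep) => f cf bf; apply/eqP/negPn/negP => fxy.
have oV : open (sum_conf f @^-1` [set~ sum_conf f y]).
  have /continuousP cs := sum_conf_continuous cf; apply: cs.
  by apply: closed_openC; exact: closed_eq.
have [n nx nV] := cozero_base Hc oV (elimN eqP fxy).
apply: H; exists n => //; left; split => //= ny.
by have := nV _ ny; exact.
Qed.

End configuration_measurability.

Section translated_measure.
Context (R : realType) (X : ptopologicalType).
Local Notation S := (borel (SX X)).
Variables (m : {measure set S -> \bar R}) (v : S).

Definition translate_fun of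
    measurable_fun [set: S] (fun y : S => (v `+` y)%mset : S) :=
  fun B : set S => m [set y : S | B (v `+` y)%mset].

Hypothesis madd : measurable_fun [set: S] (fun y : S => (v `+` y)%mset : S).
Local Notation tr := (translate_fun madd).

Let tr0 : tr set0 = 0%E.
Proof. by rewrite /tr; exact: measure0. Qed.

Let tr_ge0 B : (0 <= tr B)%E. Proof. exact: measure_ge0. Qed.

Let tr_sigma_additive : semi_sigma_additive tr.
Proof.
move=> F mF tF mUF.
have mp (B : set S) : measurable B -> measurable ([set y : S | B (v `+` y)%mset] : set S).
  by move=> mB; rewrite -[X in measurable X]setTI; exact: madd.
rewrite /translate_fun (_ : [set y : S | (\bigcup_n F n) (v `+` y)%mset] =
  \bigcup_n [set y : S | F n (v `+` y)%mset])//.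
apply: measure_semi_sigma_additive.
- by move=> n; exact: mp.
- apply/trivIsetP => i j _ _ ij; move/trivIsetP : tF => /(_ _ _ I I ij) h.
  apply/seteqP; split => // y hy.
  by have : (F i `&` F j) (v `+` y)%mset by []; rewrite h.
- exact: (mp _ mUF).
Qed.

HB.instance Definition _ := isMeasure.Build _ _ _ tr tr0 tr_ge0 tr_sigma_additive.

Definition translate_measure : {measure set S -> \bar R} := tr.

End translated_measure.

(** * The kernel of jump rates, truncated in energy and cardinality *)

Section jump_kernel.
Context (R : realType) (X : ptopologicalType) (d : X -> X -> R) (a : nat -> X).
Hypothesis Hd : sep_metric d a.
Variables (k : nat) (T : R) (E : X -> R) (h : {posnum R}).
Variable P : R -> SX X -> Mplus R (SX X).
Variables (c C : R) (n : nat).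

Local Notation S := (borel (SX X)).
Local Notation SS := (S * S)%type.
Local Notation RS := (measurableTypeR R * S)%type.

Hypothesis cE : continuous E.
Hypothesis E0 : forall b, 0 <= E b.
Hypothesis mP : measurable_fun (`[0, T]%classic `*` [set: S])
  (fun q : RS => P q.1 q.2 : borel (Mplus R (SX X))).
Hypothesis PC : forall t x, 0 <= t <= T -> (1 <= card x <= k)%N ->
  fine (P t x [set: S]) / prod_conf (fun b => 1 + E b) x <= C.

Definition kernel_domain : set RS := [set p | (0 <= p.1 <= T) /\
  ((1 <= card p.2 <= k)%N /\ sum_conf E p.2 <= c)].

(** Assumption (5) bounds the kernel only relative to products of 1 + E. Cutting at energy c yields
    a uniform bound, and the cut is invisible on the configurations that the process visits. *)
Definition truncated_P (p : RS) : {measure set S -> \bar R} :=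
  if `[< kernel_domain p >] then (P p.1 p.2 : {measure set S -> \bar R}) else mzero.

Lemma measurable_kernel_domain : measurable kernel_domain.
Proof.
rewrite (_ : kernel_domain = `[0, T]%classic `*` ([set x : S | (card x <= k)%N] `&`
   (~` [set x : S | card x = 0%N] `&` [set x : S | sum_conf E x <= c]))).
  apply: measurableX => //; apply: measurableI; first exact: measurable_card_le.
  apply: measurableI; first by apply: measurableC; exact: measurable_card_eq.
  rewrite (_ : [set x | _] = (sum_conf E : S -> R) @^-1` `]-oo, c]%classic).
    by rewrite -[X in measurable X]setTI; exact: measurable_sum_conf.
  by apply/seteqP; split => x; rewrite /= in_itv/=.
apply/seteqP; split => -[t x]; rewrite /kernel_domain /= in_itv/=.
  by move=> [-> [/andP[h1 ->] ->]]; split => //; split => //; split => // e; rewrite e in h1.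
by move=> [-> [-> [h1 ->]]]; split => //; split => //; rewrite andbT lt0n; apply/eqP.
Qed.

Lemma measurable_truncated_P U : measurable U ->
  measurable_fun [set: RS] (truncated_P ^~ U).
Proof.
move=> mU; have mQ := measurable_kernel_domain.
rewrite (_ : (fun _ => _) = ((fun p : RS => P p.1 p.2 U) \_ kernel_domain)); last first.
  apply/funext => p; rewrite /truncated_P patchE; case: asboolP => hp.
    by rewrite mem_set.
  by rewrite memNset.
apply/(measurable_restrictT _ mQ).
apply: (@measurable_funS _ _ _ _ (`[0, T]%classic `*` [set: S])) => //.
- by apply: measurableX.
- by move=> p [] /=; rewrite in_itv/=.
exact: (measurableT_comp (measurable_eval (sep_metric_SX Hd) mU) mP).
Qed.

Lemma prod_conf_le (x : SX X) : sum_conf E x <= c -> prod_conf (fun b => 1 + E b) x <= (1 + c) ^+ card x.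
Proof.
rewrite -[x]seq_mset_pts prod_conf_seq_mset sum_conf_seq_mset card_seq_mset.
elim: (pts x) c => [|b s IH] c'; first by rewrite !big_nil.
rewrite !big_cons exprS => h1; have s0 : 0 <= \sum_(i <- s) E i by apply: sumr_ge0.
apply: ler_pM.
- by rewrite addr_ge0.
- by apply: prodr_ge0 => i _; rewrite addr_ge0.
- by have := E0 b; lra.
- by apply: IH; have := E0 b; lra.
Qed.

(** The absolute values are there because the signs of C and c are not known. *)
Definition P_bound : R := `|C| * (1 + `|c|) ^+ k.

Lemma P_bound_ge0 : 0 <= P_bound.
Proof. by rewrite mulr_ge0// exprn_ge0// addr_ge0. Qed.

Lemma truncated_P_le p : (truncated_P p setT <= P_bound%:E)%E.
Proof.
rewrite /truncated_P; case: asboolP => [[tT [xk xc]]|_]; last first.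
  by rewrite /mzero lee_fin P_bound_ge0.
rewrite -[leLHS]fineK ?fin_num_measure// lee_fin.
have p0 : 0 < prod_conf (fun b => 1 + E b) p.2.
  by apply: prodr_gt0 => b _; rewrite ltr_wpDr.
have := PC tT xk; rewrite ler_pdivrMr// => /le_trans; apply.
apply: (@le_trans _ _ (`|C| * prod_conf (fun b => 1 + E b) p.2)).
  by rewrite ler_wpM2r ?(ltW p0)// ler_norm.
rewrite ler_wpM2l//; apply: le_trans (prod_conf_le xc) _.
apply: (@le_trans _ _ ((1 + `|c|) ^+ card p.2)).
  apply: lerXn2r; rewrite ?nnegrE ?addr_ge0//.
    by apply: le_trans xc; apply: sumr_ge0.
  by rewrite lerD2l ler_norm.
by apply: ler_weXn2l; [rewrite lerDl|have /andP[] := xk].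
Qed.

Lemma truncated_P_uub : measure_fam_uub truncated_P.
Proof.
exists (P_bound + 1) => p; apply: le_lt_trans (truncated_P_le p) _.
by rewrite lte_fin ltrDl.
Qed.

Definition P_kernel : R.-fker RS ~> S :=
  finite_kernel measurable_truncated_P truncated_P_uub.

Lemma measurable_translate v :
  measurable_fun [set: S] (fun y : S => (v `+` y)%mset : S).
Proof.
have := measurableT_comp (measurable_addm Hd) (@measurable_pair1 _ _ S S v); exact.
Qed.

Definition weight (z : SX X) : R := h%:num ^+ (card z).-1.

Lemma weight_ge0 z : 0 <= weight z. Proof. exact: exprn_ge0. Qed.

Lemma measurable_weight : measurable_fun [set: S] (weight : S -> R).
Proof.
apply: measurable_borel_continuous; apply: SX_continuous => j.
rewrite (_ : _ \o _ = fun=> h%:num ^+ j.-1); first exact: cst_continuous.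
by apply/funext => v; rewrite /weight /= card_unordered.
Qed.

(** Given a split into an interacting part z and a rest v, the target is v + y with y distributed by
    the kernel at z; the weight h^(l - 1) is that of the generator. *)
Definition jump_measure (w : RS * SS) : {measure set S -> \bar R} :=
  mscale (NngNum (weight_ge0 w.2.1))
    (translate_measure (P_kernel (w.1.1, w.2.1)) (measurable_translate w.2.2)).

Lemma jump_measureE w B : jump_measure w B = ((weight w.2.1)%:E *
  P_kernel (w.1.1, w.2.1) [set y : S | B (w.2.2 `+` y)%mset])%E.
Proof. by []. Qed.

Lemma measurable_jump_measure B : measurable B ->
  measurable_fun [set: RS * SS] (fun w => jump_measure w B).
Proof.
move=> mB; pose D : set SS := [set p | B (p.1 `+` p.2)%mset].
have mD : measurable D.
  by rewrite -[X in measurable X]setTI; exact: (measurable_addm Hd).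
apply: emeasurable_funM.
  apply/measurable_EFinP; apply: (measurableT_comp measurable_weight).
  exact: measurableT_comp.
have mf : measurable_fun setT (fun w : RS * SS => ((w.1.1, w.2.1) : RS, w.2.2)).
  apply: measurable_fun_pair; last exact: measurableT_comp.
  by apply: measurable_fun_pair; exact: measurableT_comp.
exact: (measurableT_comp (measurable_kernel_section P_kernel mD) mf).
Qed.

Definition jump_bound : R := (1 + h%:num) ^+ k * P_bound.

Lemma jump_bound_ge0 : 0 <= jump_bound.
Proof. by rewrite mulr_ge0 ?P_bound_ge0// exprn_ge0// addr_ge0. Qed.

Lemma jump_measure_le w : (jump_measure w setT <= jump_bound%:E)%E.
Proof.
rewrite jump_measureE /P_kernel finite_kernelE.
rewrite (_ : [set y : S | _] = setT)//.
have [zk|zk] := leqP (card w.2.1) k.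
  rewrite EFinM; apply: lee_pmul => //; first by rewrite lee_fin weight_ge0.
    rewrite lee_fin; apply: (@le_trans _ _ ((1 + h%:num) ^+ (card w.2.1).-1)).
      by apply: lerXn2r; rewrite ?nnegrE ?addr_ge0// lerDr.
    apply: ler_weXn2l; first by rewrite lerDl.
    exact: leq_trans (leq_pred _) zk.
  exact: truncated_P_le.
rewrite /truncated_P; case: asboolP => [[_ [/andP[_]]]|_]; first by rewrite leqNgt zk.
by rewrite /mzero mule0 lee_fin jump_bound_ge0.
Qed.

Lemma jump_measure_uub : measure_fam_uub jump_measure.
Proof.
exists (jump_bound + 1) => p; apply: le_lt_trans (jump_measure_le p) _.
by rewrite lte_fin ltrDl.
Qed.

Definition jump_given_split : R.-fker (RS * SS)%type ~> S :=
  finite_kernel measurable_jump_measure jump_measure_uub.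

Definition split_kernel : R.-fker RS ~> SS :=
  finite_kernel (@measurable_truncated_split R X d a Hd n _ (measurableTypeR R))
    (@truncated_split_uub R X n _ (measurableTypeR R)).

(** Composition of two kernels: the counting measure of all splittings, then the jump of the chosen
    part. *)
Definition rate_measure : RS -> {measure set S -> \bar R} :=
  mkcomp split_kernel jump_given_split.

Lemma rate_measureE p B : measurable B -> rate_measure p B =
  (if (card p.2 <= n)%N then \sum_(I : {set 'I_(card p.2)})
     jump_measure (p, (subconf I, (p.2 `\` subconf I)%mset)) B else 0)%E.
Proof.
move=> mB; rewrite /rate_measure /= /kcomp /split_kernel finite_kernelE /truncated_split.
case: ifP => pn; last by rewrite integral_measure_zero.
rewrite integral_split_measure//.
exact: (measurableT_comp (measurable_jump_measure mB) (measurable_pair1 p)).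
Qed.

Lemma measurable_rate_measure B : measurable B ->
  measurable_fun [set: RS] (rate_measure ^~ B).
Proof. exact: KCOMP_FINITE_KERNEL.measurable_fun_kcomp_finite. Qed.

Definition rate_bound : R := (2 ^ n)%:R * jump_bound.

Lemma rate_bound_ge0 : 0 <= rate_bound.
Proof. by rewrite mulr_ge0 ?jump_bound_ge0. Qed.

Lemma rate_measure_le p : (rate_measure p setT <= rate_bound%:E)%E.
Proof.
rewrite rate_measureE//; case: ifP => pn; last by rewrite lee_fin rate_bound_ge0.
apply: (@le_trans _ _ (\sum_(I : {set 'I_(card p.2)}) jump_bound%:E)%E).
  by apply: lee_sum => I _; exact: jump_measure_le.
rewrite sumEFin lee_fin sumr_const -cardsT -powersetT card_powerset cardsT card_ord.
rewrite -mulr_natl ler_wpM2r ?jump_bound_ge0// ler_nat leq_exp2l//.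
Qed.

Lemma rate_measure_uub : measure_fam_uub rate_measure.
Proof.
exists (rate_bound + 1) => p; apply: le_lt_trans (rate_measure_le p) _.
by rewrite lte_fin ltrDl.
Qed.

Definition jump_rates : R.-fker RS ~> S :=
  finite_kernel measurable_rate_measure rate_measure_uub.

Lemma jump_rates_le p : (jump_rates p setT <= rate_bound%:E)%E.
Proof. exact: rate_measure_le. Qed.

Lemma sum_conf_subconf x (I : {set 'I_(card x)}) : sum_conf E (subconf I) <= sum_conf E x.
Proof.
rewrite -[in leRHS](subconfK I) sum_confD lerDl; exact: sumr_ge0.
Qed.

(** Since E is nonnegative, no part of x has more energy than x, so the truncation does not act. *)
Lemma jump_ratesE r x B : 0 <= r <= T -> (card x <= n)%N -> sum_conf E x <= c ->
  measurable B ->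
  jump_rates (r, x) B = (\sum_(I : {set 'I_(card x)} | (1 <= #|I| <= k)%N)
    (h%:num ^+ #|I|.-1)%:E * P r (subconf I) [set y : S | B ((x `\` subconf I) `+` y)%mset])%E.
Proof.
move=> rT xn xc mB; rewrite /jump_rates finite_kernelE rate_measureE// [X in if X then _ else _](_ : _ = true)//.
rewrite [RHS]big_mkcond; apply: eq_bigr => I _; rewrite jump_measureE /P_kernel finite_kernelE /=.
rewrite /weight card_subconf /truncated_P; case: (boolP (1 <= #|I| <= k)%N) => Ik.
  rewrite asboolT//; split => //=; rewrite card_subconf; split => //.
  exact: le_trans (sum_conf_subconf I) xc.
by rewrite asboolF ?mule0// => -[_ []] /=; rewrite card_subconf (negbTE Ik).
Qed.

End jump_kernel.

(** * Displacements of pairs of configurations *)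

Section displacements.
Context (R : realType) (X : ptopologicalType) (d : X -> X -> R) (a : nat -> X).
Hypothesis Hd : sep_metric d a.
Hypothesis dsep : forall b c, d b c = 0 -> b = c.
Variable k : nat.
Hypothesis k1 : (1 <= k)%N.

Local Notation S := (borel (SX X)).
Local Notation SS := (S * S)%type.

Lemma signed_deltaE (p : SX X * SX X) B :
  signed_delta R p B = (sum_conf (\1_B) p.2 - sum_conf (\1_B) p.1)%:E.
Proof. by rewrite /signed_delta !deltapE EFinB. Qed.

(** Moving the negative parts across turns an equality of signed measures into one of counting
    measures, hence of multisets by [hdelta_inj]. *)
Lemma signed_delta_eqP (p q : SX X * SX X) :
  (forall B : set (borel X), measurable B -> signed_delta R p B = signed_delta R q B) <->
  (p.2 `+` q.1)%mset = (p.1 `+` q.2)%mset.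
Proof.
split=> [H|e B mB].
  apply: (hdelta_inj Hd dsep (h := 1%:pos)) => B mB.
  change (1%:E * deltap R (p.2 `+` q.1)%mset B = 1%:E * deltap R (p.1 `+` q.2)%mset B)%E.
  rewrite !mul1e !deltapE !sum_confD; congr EFin.
  have := H B mB; rewrite !signed_deltaE => -[].
  by move: (sum_conf _ _) (sum_conf _ _) (sum_conf _ _) (sum_conf _ _) => u v w z; lra.
rewrite !signed_deltaE; congr EFin.
have := congr1 (sum_conf (\1_B : X -> R)) e; rewrite !sum_confD.
by move: (sum_conf _ _) (sum_conf _ _) (sum_conf _ _) (sum_conf _ _) => u v w z; lra.
Qed.

Definition displacement (U : set (SX X * SX X)) : set (SX X * SX X) :=
  [set p | delta_of U (signed_delta R p)].

Lemma displacementP U p :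
  displacement U p <-> exists2 q, U q & (p.2 `+` q.1)%mset = (p.1 `+` q.2)%mset.
Proof. by split=> -[q Uq /signed_delta_eqP]; exists q. Qed.

Lemma displacement_shift U x z y : displacement U (x `+` z, x `+` y)%mset <-> displacement U (z, y).
Proof.
split=> /displacementP[q Uq e]; apply/displacementP; exists q => //; apply/msetP => b;
  by move/msetP: e => /(_ b); rewrite /= !msetE2; lia.
Qed.

Lemma mset_neq_card (z y : SX X) : card (y `\` z)%mset = 0%N -> card (z `\` y)%mset = 0%N -> z = y.
Proof.
have H (u v : SX X) : card (u `\` v)%mset = 0%N -> forall b, (u b <= v b)%N.
  move=> /size0nil e b; rewrite -subn_eq0 -msetE2 -count_mem_mset.
  by rewrite -/(pts (u `\` v)%mset) e.
by move=> /H h1 /H h2; apply/msetP => b; apply/eqP; rewrite eqn_leq h1 h2.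
Qed.

(** Measurability is available for [saturation], so the displacement of (x, x') has to be read off a
    member of [jumps]. Cancelling the common points of (z, y) leaves parts z0 and y0, to be removed
    from x and x' with the same remainder. If z0 is empty, an auxiliary point is added on both
    sides, because the first component of a jump is nonempty. *)
Lemma displacement_split U x x' : U `<=` jumps k -> (forall p, U p -> p.1 <> p.2) ->
  displacement U (x, x') <->
  (exists I I', (x `\` @subconf X x I = x' `\` @subconf X x' I')%mset /\
      saturation R k U (subconf I, subconf I')) \/
  (exists I', x = (x' `\` @subconf X x' I')%mset /\
      saturation R k U (seq_mset [:: point], seq_mset [:: point] `+` subconf I')%mset).
Proof.
move=> Uj Une; split; last first.
  move=> [[I [I' [e [_ h]]]]|[I' [e [_ h]]]].
    rewrite -(subconfK I) -(subconfK I') -e msetDC [X in (_, X)]msetDC.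
    exact/displacement_shift.
  rewrite -{1}[x]mset0D -(subconfK I') -e msetDC [X in (_, X)]msetDC.
  apply/displacement_shift; apply/displacementP.
  move/displacementP : h => [q Uq h]; exists q => //.
  by apply/msetP => b; move/msetP: h => /(_ b); rewrite /= !msetE2 mset0E; lia.
move=> /displacementP[[z y] Uzy /= e].
pose w := (z `&` y)%mset; pose z0 := (z `\` y)%mset; pose y0 := (y `\` z)%mset.
have zE : z = (z0 `+` w)%mset by apply/msetP => b; rewrite !msetE2; lia.
have yE : y = (y0 `+` w)%mset by apply/msetP => b; rewrite !msetE2; lia.
pose v := (x `\` z0)%mset.
have xE : x = (z0 `+` v)%mset.
  by apply/msetP => b; move/msetP: e => /(_ b); rewrite !msetE2; lia.
have x'E : x' = (y0 `+` v)%mset.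
  by apply/msetP => b; move/msetP: e => /(_ b); rewrite !msetE2; lia.
have cz : card z = (card z0 + card w)%N by rewrite {1}zE card_add.
have cy : card y = (card y0 + card w)%N by rewrite {1}yE card_add.
have [/andP[z1 zk] yd] := Uj _ Uzy; rewrite /= in z1 zk yd.
have zy : ~ (card y0 = 0%N /\ card z0 = 0%N).
  by move=> [h1 h2]; apply: (Une _ Uzy); exact: mset_neq_card.
have dU : displacement U (z0, y0).
  apply/displacementP; exists (z, y) => //=; apply/msetP => b; rewrite !msetE2; lia.
have [I' hI' vI'] := subconf_exists x'E.
have [z00|z00] := eqVneq (card z0) 0%N.
  right; exists I'; rewrite vI' hI'; split.
    rewrite xE; suff -> : z0 = mset0 by rewrite mset0D.
    by rewrite -(seq_mset_pts z0) (size0nil z00); apply/msetP => b; rewrite mset_seqE mset0E.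
  split; last first.
    rewrite (_ : (seq_mset [:: point], _) = (seq_mset [:: point] `+` z0, seq_mset [:: point] `+` y0)%mset).
      exact/displacement_shift.
    congr pair; suff -> : z0 = mset0 by rewrite msetD0.
    by rewrite -(seq_mset_pts z0) (size0nil z00); apply/msetP => b; rewrite mset_seqE mset0E.
  (* If z had at least two points, y would have no more points than z, and an empty z0 would force
     y0 to be empty as well, which is excluded. So z is a single point, for which [dmax] is k. *)
  rewrite /jumps/= card_add !card_seq_mset /= k1; split => //.
  by move: yd; rewrite /dmax /=; case: ifP => /eqP; lia.
left; have [I hI vI] := subconf_exists xE; exists I, I'; rewrite vI vI' hI hI'; split => //.
split => //; rewrite /jumps/=; split; first by apply/andP; split; lia.
by move: yd; rewrite /dmax; case: ifP => /eqP; case: ifP => /eqP; lia.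
Qed.

Lemma displacement_off U : (forall p, U p -> p.1 <> p.2) -> off_diagonal (displacement U).
Proof.
move=> Une x /displacementP[[z w] Uzw /= e]; apply: (Une _ Uzw) => /=.
by apply/msetP => b; move/msetP: e => /(_ b); rewrite !msetE2; lia.
Qed.

Definition truncate (n : nat) (x : SX X) : SX X := if (card x <= n)%N then x else mset0.

Lemma card_truncate n x : (card (truncate n x) <= n)%N.
Proof.
rewrite /truncate; case: ifP => // _; rewrite -[mset0]seq_mset_pts card_seq_mset.
by rewrite /pts enum_mset0.
Qed.

Lemma measurable_truncate n : measurable_fun [set: S] (truncate n : S -> S).
Proof.
apply: measurable_fun_if => //.
apply: (measurable_fun_bool true).
rewrite setTI (_ : _ @^-1` _ = [set x : S | (card x <= n)%N]).
  exact: measurable_card_le.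
by apply/seteqP; split.
Qed.

(** A suitable split exists when the sum of an indicator over all splits is positive, and such sums
    are measurable for configurations of bounded cardinality. *)
Lemma measurable_exists_split n d0 (Om : measurableType d0) (C : set ((Om * S) * SS)) :
  measurable C ->
  measurable [set p : Om * S | (card p.2 <= n)%N /\ exists I : {set 'I_(card p.2)},
    C (p, (subconf I, (p.2 `\` subconf I)%mset))].
Proof.
move=> mC.
pose phi (p : Om * S) : S := truncate n p.2.
have mphi : measurable_fun setT phi by exact: (measurableT_comp (measurable_truncate n)).
pose g (q : (Om * S) * SS) : \bar R := (\1_C q)%:E.
have mg : measurable_fun setT g by apply/measurable_EFinP; exact: measurable_indic.
pose F w := (\sum_(I : {set 'I_(card (phi w))}) g (w, (subconf I, (phi w `\` subconf I)%mset)))%E.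
have mF : measurable_fun setT F.
  apply: (@measurable_split_sum R X d a Hd n _ _ phi g) => //.
  - by move=> q; rewrite /g lee_fin.
  - by move=> w; exact: (card_truncate n w.2).
rewrite (_ : [set p | _] = (snd @^-1` [set x : S | (card x <= n)%N]) `&` (F @^-1` `]0%E, +oo[%classic)).
  apply: measurableI; rewrite -[X in measurable X]setTI.
    by apply: measurable_snd => //; exact: measurable_card_le.
  by apply: mF => //; exact: emeasurable_itv.
apply/seteqP; split => -[w x] /=.
  move=> [xn [I CI]]; split => //; rewrite in_itv/= andbT /F.
  have -> : phi (w, x) = x by rewrite /phi /truncate/= xn.
  rewrite (bigD1 I)//= {1}/g indicE mem_set//.
  apply: (@lt_le_trans _ _ 1%E) => //; rewrite leeDl// sume_ge0// => J _.
  by rewrite /g lee_fin.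
move=> [xn]; rewrite in_itv/= andbT /F.
have -> : phi (w, x) = x by rewrite /phi /truncate/= xn.
move=> h; split => //; apply: contrapT => nex.
move: h; rewrite big1 ?ltxx// => I _; rewrite /g indicE memNset// => CI.
by apply: nex; exists I.
Qed.

Lemma measurable_displacement n U : U `<=` jumps k -> (forall p, U p -> p.1 <> p.2) ->
  borelJ (saturation R k U) ->
  measurable [set p : SS | [/\ (card p.1 <= n)%N, (card p.2 <= n)%N & displacement U p]].
Proof.
move=> Uj Une /(measurable_open_prod Hd) mU.
have mdiag := measurable_diagonal Hd dsep.
(* The two existential quantifiers are treated one at a time: in C1 the split of x is a parameter,
   A1 quantifies over the splits of x', and A2 over those of x. *)
pose C1 : set ((SS * S) * SS) := [set q | q.1.1.2 = q.2.2 /\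
  saturation R k U (q.1.1.1, q.2.1)].
have mC1 : measurable C1.
  rewrite (_ : C1 = ((fun q : (SS * S) * SS => (q.1.1.2, q.2.2)) @^-1` [set p : SS | p.1 = p.2]) `&`
      ((fun q : (SS * S) * SS => (q.1.1.1, q.2.1)) @^-1` saturation R k U))//.
  apply: measurableI.
    rewrite -[X in measurable X]setTI; apply: measurable_fun_pair => //; last exact: measurableT_comp.
    by apply: measurableT_comp => //; exact: measurableT_comp.
  rewrite -[X in measurable X]setTI; apply: measurable_fun_pair => //; last exact: measurableT_comp.
  by apply: measurableT_comp => //; exact: measurableT_comp.
pose A1 := [set p : SS * S | (card p.2 <= n)%N /\ exists I : {set 'I_(card p.2)},
    C1 (p, (subconf I, (p.2 `\` subconf I)%mset))].
have mA1 : measurable A1 by exact: measurable_exists_split.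
pose C2 : set ((S * S) * SS) := [set q | A1 (q.2, q.1.1)].
have mC2 : measurable C2.
  rewrite (_ : C2 = (fun q : (S * S) * SS => (q.2, q.1.1)) @^-1` A1)//.
  rewrite -[X in measurable X]setTI; apply: measurable_fun_pair => //.
  exact: measurableT_comp.
pose A2 := [set p : S * S | (card p.2 <= n)%N /\ exists I : {set 'I_(card p.2)},
    C2 (p, (subconf I, (p.2 `\` subconf I)%mset))].
have mA2 : measurable A2 by exact: measurable_exists_split.
pose pt : S := seq_mset [:: point].
(* The case in which nothing is removed from x and the auxiliary point stands in for the removed
   part. *)
pose C3 : set ((S * S) * SS) := [set q | q.1.1 = q.2.2 /\
  saturation R k U (pt, pt `+` q.2.1)%mset].
have mC3 : measurable C3.
  rewrite (_ : C3 = ((fun q : (S * S) * SS => (q.1.1, q.2.2)) @^-1` [set p : SS | p.1 = p.2]) `&`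
      ((fun q : (S * S) * SS => (pt, (pt `+` q.2.1)%mset : S)) @^-1` saturation R k U))//.
  apply: measurableI.
    rewrite -[X in measurable X]setTI; apply: measurable_fun_pair => //; exact: measurableT_comp.
  rewrite -[X in measurable X]setTI; apply: measurable_fun_pair => //.
  apply: (measurableT_comp (measurable_translate Hd pt)); exact: measurableT_comp.
pose A3 := [set p : S * S | (card p.2 <= n)%N /\ exists I : {set 'I_(card p.2)},
    C3 (p, (subconf I, (p.2 `\` subconf I)%mset))].
have mA3 : measurable A3 by exact: measurable_exists_split.
rewrite (_ : [set p : SS | _] = ((fun p : SS => (p.2, p.1)) @^-1` A2) `|`
  (([set x : S | (card x <= n)%N] `*` setT) `&` A3)).
  apply: measurableU.
    rewrite -[X in measurable X]setTI; apply: measurable_fun_pair => //.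
  by apply: measurableI => //; apply: measurableX => //; exact: measurable_card_le.
apply/seteqP; split => -[x x'] /=.
  move=> [xn x'n /(displacement_split _ _ Uj Une)[[I [I' [e s]]]|[I' [e s]]]]; [left|right].
    by split => //; exists I; split => //; exists I'.
  by split; [split|split => //; exists I'].
move=> [[xn [I [x'n [I' [e s]]]]]|[[xn _] [x'n [I' [e s]]]]]; split => //;
  apply/(displacement_split _ _ Uj Une).
  by left; exists I, I'.
by right; exists I'.
Qed.

End displacements.

(** * The martingale problem for configurations *)

(* The integrals below are of functions that are not assumed measurable. *)
Section almost_everywhere_integrals.
Import HBNNSimple.
Context d (T : measurableType d) (R : realType) (mu : {measure set T -> \bar R}).
Variables (D N : set T).
Hypothesis mN : measurable N.
Hypothesis N0 : mu N = 0%E.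
Local Open Scope ereal_scope.

(** The integral of a nonnegative function is a supremum over simple functions below it. Multiplying
    such a function by the indicator of the complement of N keeps its integral and puts it below
    g. *)
Lemma le_integral_ae (f g : T -> \bar R) : (forall x, D x -> 0 <= f x) ->
  (forall x, D x -> 0 <= g x) -> (forall x, D x -> ~ N x -> f x <= g x) ->
  \int[mu]_(x in D) f x <= \int[mu]_(x in D) g x.
Proof.
move=> f0 g0 fg; rewrite !ge0_integralE//; apply: ge_ereal_sup => _ [u hu <-].
pose u' := proj_nnsfun u (measurableC mN).
have -> : sintegral mu u = sintegral mu u'.
  have H (v : {nnsfun T >-> R}) : sintegral mu v = \int[mu]_x (v x)%:E.
    rewrite integral_nnsfun//; congr (sintegral mu _); apply/funext => x.
    by rewrite patchE in_setT.
  rewrite !H; apply: ae_eq_integral => //.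
  - by apply/measurable_EFinP; exact: measurable_funP.
  - by apply/measurable_EFinP; exact: measurable_funP.
  - exists N; split => // x /= ux; apply: contrapT => Nx; apply: ux => _.
    by rewrite /u' /= /mindic indicE mem_set// mulr1.
apply: ereal_sup_ubound; exists u' => // x; rewrite /u' /= /mindic indicE.
have [Nx|Nx] := pselect (N x).
  rewrite memNset ?mulr0//.
  by rewrite patchE; case: ifPn => // /set_mem /g0.
rewrite mem_set// mulr1; apply: le_trans (hu x) _; rewrite !patchE.
by case: ifPn => // /set_mem Dx; exact: fg.
Qed.

Lemma eq_integral_ae (f g : T -> \bar R) : (forall x, D x -> ~ N x -> f x = g x) ->
  \int[mu]_(x in D) f x = \int[mu]_(x in D) g x.
Proof.
move=> fg; rewrite integralE [RHS]integralE; congr (_ - _); apply/eqP; rewrite eq_le;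
  apply/andP; split; apply: le_integral_ae => // x Dx Nx;
  by rewrite ?funeposE ?funenegE fg.
Qed.

End almost_everywhere_integrals.

Lemma polish_sep_metric (R : realType) (X : ptopologicalType) : polish R X ->
  exists d a, @sep_metric R X d a /\ (forall b c, d b c = 0 -> b = c).
Proof.
move=> [d [[d0 de] [ds dt] dn _ [D cD dD]]].
have /pcard_surjP[f fD] := cD; exists d, f; split; last by move=> b c /de.
split => //.
- by move=> x; apply/de.
- move=> y e e0; have [|z [/= yz /fD[n _ nz]]] := dD (interior [set z | d y z < e]) _ (@open_interior _ _).
    by exists y; apply/(dn y); exists e.
  by exists n; rewrite nz ds; exact: interior_subset yz.
Qed.

(** * The generator on indicator functions *)

Section generator_of_indicator.
Context (R : realType) (X : ptopologicalType) (d : X -> X -> R) (a : nat -> X).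
Hypothesis Hd : sep_metric d a.
Variables (k : nat) (T : R) (h : {posnum R}).
Variable P : R -> SX X -> Mplus R (SX X).
Hypothesis Pd : forall t x, 0 <= t <= T -> (1 <= card x <= k)%N ->
  P t x (~` [set y | (card y <= dmax k (card x))%N]) = 0%E.

Local Notation S := (borel (SX X)).

(** The kernel is carried by targets of admissible cardinality, so the sum over m in the generator
    and in kappa restores the whole mass. *)
Lemma measure_card_sum (mu : Mplus R (SX X)) (A : set S) n : measurable A ->
  mu (~` [set y | (card y <= n)%N]) = 0%E ->
  \sum_(0 <= m < n.+1) fine (mu (@SXn X m `&` A)) = fine (mu A).
Proof.
move=> mA mu0; have mle j := @measurable_card_le R X j.
have mn j : measurable (@SXn X j : set S) by exact: (@measurable_card_eq R).
have H j : \sum_(0 <= m < j.+1) fine (mu (@SXn X m `&` A)) =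
    fine (mu ([set y | (card y <= j)%N] `&` A)).
  elim: j => [|j IH].
    rewrite big_nat1; congr (fine (mu (_ `&` _))); apply/seteqP; split => y.
      by rewrite /SXn /= => ->.
    by rewrite /SXn /= leqn0 => /eqP.
  rewrite big_nat_recr//= IH -fineD ?fin_num_measure//; try exact: measurableI.
  rewrite -measureU; try exact: measurableI.
    congr (fine (mu _)); rewrite -setIUl; congr (_ `&` _); apply/seteqP; split => y /=.
      by move=> [/leqW//|]; rewrite /SXn /= => ->.
    by rewrite leq_eqVlt ltnS => /orP[/eqP|]; [right|left].
  apply/seteqP; split => // y [[/= y1 _] [y2 _]]; move: y1; rewrite y2 ltnn //.
rewrite H; have -> : mu A = (mu ([set y | (card y <= n)%N] `&` A) +
    mu (~` [set y | (card y <= n)%N] `&` A))%E.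
  rewrite -measureU; [by rewrite -setIUl setUCr setTI|exact: measurableI|
    by apply: measurableI => //; exact: measurableC|].
  by rewrite setIACA setICr set0I.
rewrite [X in (_ + X)%E](_ : _ = 0%E) ?adde0//; apply/eqP; rewrite -measure_le0 -mu0.
by apply: le_measure; rewrite ?inE//; [apply: measurableI => //|]; exact: measurableC.
Qed.

Lemma Rintegral_indic_sub (mu : Mplus R (SX X)) (D A : set S) b : measurable D -> measurable A ->
  \int[mu]_(y in D) (\1_A y - b) = fine (mu (D `&` A)) - b * fine (mu D).
Proof.
move=> mD mA.
have i1 : mu.-integrable D (EFin \o (\1_A : S -> R)).
  apply: measurable_bounded_integrable => //; first by rewrite ltey_eq fin_num_measure.
  exists 1; split; first exact: num_real.
  by move=> M M1 y _; rewrite /= indicE ger0_norm// (le_trans _ (ltW M1))// lern1 leq_b1.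
have i2 : mu.-integrable D (EFin \o (fun=> b)).
  by apply: finite_measure_integrable_cst.
rewrite RintegralB//; congr (_ - _).
  by rewrite /Rintegral integral_indic// setIC.
by rewrite /Rintegral integral_cst// fineM ?fin_num_measure.
Qed.

Lemma big_card_split (V : nmodType) n (F : {set 'I_n} -> V) :
  \sum_(1 <= l < (minn k n).+1) \sum_(I : {set 'I_n} | #|I| == l) F I =
  \sum_(I : {set 'I_n} | (1 <= #|I| <= k)%N) F I.
Proof.
under eq_bigr do rewrite big_mkcond/=.
rewrite exchange_big/= [RHS]big_mkcond; apply: eq_bigr => I _.
have H M (v : V) : \sum_(1 <= l < M.+1) (if #|I| == l then v else 0) =
    if (1 <= #|I| <= M)%N then v else 0.
  elim: M => [|M IH]; first by rewrite big_geq//; case: (#|I|).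
  rewrite big_nat_recr//= IH; have [->|IM] := eqVneq #|I| M.+1.
    by rewrite ltnn leqnn !andbF add0r.
  by rewrite addr0 [in RHS](leq_eqVlt _ M.+1) (negbTE IM).
rewrite H leq_min; congr (if _ then _ else _); rewrite andbA andbC.
by rewrite -[n in (_ <= n)%N]card_ord max_card.
Qed.

Lemma generator_indic (B' : set (borel (Mplus R X))) (r : R) x : measurable B' ->
  measurable (hdelta h @^-1` B' : set S) -> 0 <= r <= T ->
  generator k h P r (\1_B') x =
  \sum_(I : {set 'I_(card x)} | (1 <= #|I| <= k)%N) h%:num ^+ #|I|.-1 *
    (fine (P r (subconf I) [set y : S | B' (hdelta h ((x `\` subconf I) `+` y)%mset)]) -
     \1_B' (hdelta h x) * fine (P r (subconf I) setT)).
Proof.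
move=> mB' mB rT; rewrite /generator.
rewrite -(@big_card_split _ _ (fun I : {set 'I_(card x)} => h%:num ^+ #|I|.-1 *
    (fine (P r (subconf I) [set y : S | B' (hdelta h ((x `\` subconf I) `+` y)%mset)]) -
     \1_B' (hdelta h x) * fine (P r (subconf I) setT)))).
apply: eq_big_nat => l /andP[l1]; rewrite ltnS leq_min => /andP[lk _].
rewrite mulr_sumr; apply: eq_bigr => I /eqP Il; rewrite Il; congr (_ * _).
pose A : set S := [set y : S | B' (hdelta h ((x `\` subconf I) `+` y)%mset)].
have mA : measurable A.
  rewrite -[A]setTI; exact: (measurable_translate Hd (x `\` subconf I)%mset measurableT mB).
have AE y : \1_B' (hdelta h ((x `\` subconf I) `+` y)%mset) = \1_A y :> R by [].
have P0 : P r (subconf I) (~` [set y | (card y <= dmax k l)%N]) = 0%E.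
  by have := Pd (x := subconf I) rT; rewrite card_subconf Il l1 lk; exact.
have mn j : measurable (@SXn X j : set S) by exact: (@measurable_card_eq R).
under eq_bigr => m _ do rewrite (Rintegral_indic_sub _ _ (mn m) mA).
rewrite sumrB -mulr_sumr measure_card_sum//; congr (_ - _ * _).
rewrite -(measure_card_sum measurableT P0); apply: eq_bigr => m _.
by rewrite setIT.
Qed.

End generator_of_indicator.

(** * Sets of configurations that the process does not leave *)

Section invariant_configurations.
Context (R : realType) (X : ptopologicalType) (d : X -> X -> R) (a : nat -> X).
Hypothesis Hd : sep_metric d a.
Hypothesis dsep : forall b c, d b c = 0 -> b = c.
Variables (k : nat) (T : R) (h : {posnum R}).
Variable P : R -> SX X -> Mplus R (SX X).
Hypothesis Pd : forall t x, 0 <= t <= T -> (1 <= card x <= k)%N ->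
  P t x (~` [set y | (card y <= dmax k (card x))%N]) = 0%E.
Hypothesis T0 : 0 < T.
Variables (mu0 : Mplus R X) (PP : probability (skorokhod X T) R).
Hypothesis law : markov_jump_law k h P mu0 PP.

Local Notation S := (borel (SX X)).
Local Notation Om := (skorokhod X T).

Lemma bounded_measurable_indic (B' : set (borel (Mplus R X))) : measurable B' ->
  bounded_measurable (\1_B' : Mplus R X -> R).
Proof.
move=> mB'; split; first exact: measurable_indic.
by exists 1 => nu; rewrite indicE ger0_norm// lern1 leq_b1.
Qed.

Lemma conf_mem (B' : set (borel (Mplus R X))) (nu : Mplus R X) : measurable B' ->
  Mhdelta h nu -> B' nu <-> B' (hdelta h (conf h nu)).
Proof.
move=> mB' /conf_measure_eq e; split; first exact: borel_saturated.
exact: borel_saturated (measure_eq_sym e).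
Qed.

Definition preserved (B : set (SX X)) (r : R) := forall x, B x ->
  forall I : {set 'I_(card x)}, (1 <= #|I| <= k)%N ->
  P r (subconf I) [set y : S | ~ B ((x `\` subconf I) `+` y)%mset] = 0%E.

(** Outside B only gains remain; inside B the jumps stay in B and gains and losses cancel. *)
Lemma generator_ge0 (B' : set (borel (Mplus R X))) (r : R) x : measurable B' ->
  measurable (hdelta h @^-1` B' : set S) -> 0 <= r <= T ->
  preserved (hdelta h @^-1` B') r -> 0 <= generator k h P r (\1_B') x.
Proof.
move=> mB' mB rT HB; rewrite (generator_indic Hd Pd)//; apply: sumr_ge0 => I Ik.
apply: mulr_ge0; first exact: exprn_ge0.
have [Bx|Bx] := pselect (B' (hdelta h x)); last first.
  by rewrite indicE memNset// mul0r subr0 fine_ge0.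
rewrite indicE mem_set// mul1r subr_ge0.
set A : set S := [set y | _].
have mA : measurable A.
  rewrite -[A]setTI; exact: (measurable_translate Hd (x `\` subconf I)%mset measurableT mB).
have -> : P r (subconf I) setT = P r (subconf I) A; last by [].
rewrite -(setUv A) measureU ?setICr//; last exact: measurableC.
by rewrite [X in (_ + X)%E](_ : _ = 0%E) ?adde0//; exact: HB.
Qed.

Lemma as_valued : {ae PP, forall xi, Mhdelta_valued h xi /\ measure_eq (path_of xi 0) mu0}.
Proof.
have h1 := law_jump law; have h2 := law_init law.
by apply: filterS2 h1 h2 => xi [].
Qed.

(** The generator of the indicator of B is nonnegative along the path, so the martingale started in
    B is at most the indicator of B at time t minus 1, hence nonpositive. Its mean is zero, so it
    vanishes almost surely and the path is in B. *)
Lemma as_preserved (B : set S) x0 t : measurable B ->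
  {ae @lebesgue_measure R, forall r, 0 <= r <= T -> preserved B r} ->
  measure_eq mu0 (hdelta h x0) -> B x0 -> 0 <= t <= T ->
  {ae PP, forall xi : Om, B (conf h (path_of xi t))}.
Proof.
move=> mB [NL [mNL NL0 HNL]] e0 Bx0 tT.
have [B' mB' BE] := hdelta_ext Hd dsep h mB.
have mB2 : measurable (hdelta h @^-1` B' : set S) by rewrite BE.
have [mad mint mart] := law_generator law (bounded_measurable_indic mB').
pose M (t : R) (xi : Om) : R := \1_B' (path_of xi t) - \1_B' (path_of xi 0) -
       \int[lebesgue_measure]_(s in `]0, t])
          generator k h P s (\1_B') (conf h (path_of xi s)).
have M0 : (\int[PP]_(xi in setT) (M t xi)%:E = 0)%E.
  have /andP[t0 tT'] := tT.
  have FT : @right_filtration R X T 0 setT.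
    move=> s _; rewrite -setC0.
    have [_ H _] := @smallest_sigma_algebra _ (setT : set Om) [set A | exists2 r, 0 <= r <= s &
      exists2 B0 : set (borel (Mplus R X)), measurable B0 & A = [set xi : Om | B0 (path_of xi r)]].
    by rewrite -setTD; apply: H; exact: sigma_algebra0.
  rewrite (mart 0 t setT (lexx _) t0 tT' FT).
  under eq_integral => xi _ do rewrite subrr set_itvoc0 Rintegral_set0 subr0.
  exact: integral0.
have [N [mN N0 HN]] := as_valued.
have MN xi : ~ N xi -> M t xi <= \1_B' (path_of xi t) - 1.
  move=> Nxi; have [vxi ixi] : Mhdelta_valued h xi /\ measure_eq (path_of xi 0) mu0.
    by apply: contrapT => H; apply: Nxi; exact: HN.
  rewrite /M; have -> : \1_B' (path_of xi 0) = 1 :> R.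
    rewrite indicE mem_set//; apply: (borel_saturated mB' (measure_eq_sym ixi)).
    apply: (borel_saturated mB' (measure_eq_sym e0)).
    by rewrite -[B' _]/((hdelta h @^-1` B') x0) BE.
  rewrite lerBlDr lerDl /Rintegral fine_ge0//.
  (* For almost every s the generator equals its positive part, whose integral is nonnegative even
     though its measurability in s is not known. *)
  rewrite (@eq_integral_ae _ _ _ _ _ NL mNL NL0 _ (fun s =>
    (Num.max 0 (generator k h P s (\1_B') (conf h (path_of xi s))))%:E)).
    by apply: integral_ge0 => s _; rewrite lee_fin le_max lexx.
  move=> s /= st Ns; rewrite max_r//; apply: generator_ge0 => //.
    by move: st; rewrite in_itv/= => /andP[s0 st]; rewrite (ltW s0) (le_trans st); case/andP: tT.
  rewrite BE; have sT : 0 <= s <= T.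
    by move: st; rewrite in_itv/= => /andP[s0 st]; rewrite (ltW s0) (le_trans st); case/andP: tT.
  suff H : 0 <= s <= T -> preserved B s by exact: H.
  by apply: contrapT => H; apply: Ns; exact: HNL.
pose Z : set Om := [set xi | ~ B' (path_of xi t)].
have mZ : measurable Z.
  rewrite (_ : Z = ~` ((fun xi : Om => path_of xi t) @^-1` B')); last by [].
  by apply: measurableC; rewrite -[X in measurable X]setTI; exact: (measurable_path Hd T0 t).
have Z0 : PP Z = 0%E.
  move: M0; rewrite integralE.
  rewrite [X in (X - _)%E](@eq_integral_ae _ _ _ _ setT N mN N0 _ (cst 0%E)); last first.
    move=> xi _ Nxi; rewrite funeposE /=; apply/max_idPr; rewrite lee_fin.
    by apply: le_trans (MN _ Nxi) _; rewrite subr_le0 indicE lern1 leq_b1.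
  rewrite integral0 sub0e => /eqP; rewrite oppe_eq0 => /eqP H.
  suff : (PP Z <= 0)%E by rewrite measure_le0 => /eqP.
  rewrite -[leRHS]H.
  have -> : PP Z = (\int[PP]_(xi in setT) (\1_Z xi)%:E)%E by rewrite integral_indic// setIT.
  (* Where the path is outside B at time t, the negative part of M is at least 1. *)
  apply: (@le_integral_ae _ _ _ _ setT N) => // xi _ Nxi.
  rewrite funenegE le_max; apply/orP; left; rewrite -EFinN lee_fin lerNr.
  apply: le_trans (MN _ Nxi) _; rewrite !indicE /Z.
  have [h1|h1] := pselect (B' (path_of xi t)).
    by rewrite mem_set// memNset ?subrr ?oppr0//; exact.
  by rewrite memNset// mem_set// sub0r.
exists (N `|` Z); split; first exact: measurableU.
  by rewrite measureU0.
move=> xi /= nB; have [Nxi|Nxi] := pselect (N xi); [by left|right].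
have [vxi _] : Mhdelta_valued h xi /\ measure_eq (path_of xi 0) mu0.
  by apply: contrapT => H; apply: Nxi; exact: HN.
move=> B'xi; apply: nB; rewrite -BE; exact/(conf_mem mB' (vxi _ tT)).
Qed.

(** After each t < T the path stays constant up to some later rational time, so rational times and T
    suffice. T is treated apart because no time of the interval follows it. *)
Lemma as_all_times (B : set (SX X)) :
  (forall t, 0 <= t <= T -> {ae PP, forall xi : Om, B (conf h (path_of xi t))}) ->
  {ae PP, forall xi : Om, forall t, 0 <= t <= T -> B (conf h (path_of xi t))}.
Proof.
move=> HB.
have HQ : {ae PP, forall xi : Om, forall n : nat,
    let q := ratr (odflt 0 (choice.unpickle n : option rat)) in
    0 <= q <= T -> B (conf h (path_of xi q))}.
  apply: ae_foralln => n /=; set q := ratr _.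
  have [qT|qT] := boolP (0 <= q <= T); last by apply: aeW => xi.
  by apply: filterS (HB q qT) => xi.
have TT : 0 <= T <= T by rewrite lexx ltW.
apply: filterS3 (law_jump law) HQ (HB T TT) => xi [vxi [s hs]] hq hT t tT.
have [tT'|tT'] := ltP t T; last first.
  by have -> : t = T by apply/eqP; rewrite eq_le tT'; case/andP: tT => _ ->.
have [u tu hu] : exists2 u, t < u & forall r, r \in s -> ~~ (t < r <= u).
  elim: (s) => [|r s' [u tu hu]]; first by exists (t + 1) => //; rewrite ltrDl.
  have [rt|tr] := leP r t.
    exists u => // r'; rewrite inE => /orP[/eqP ->|/hu//].
    by rewrite ltNge rt.
  exists (Num.min u ((t + r) / 2)) => [|r']; first by rewrite lt_min tu midf_lt.
  rewrite inE => /orP[/eqP ->|/hu].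
    by rewrite le_min [r <= _ / 2]leNgt midf_lt// ?andbF.
  by apply: contra => /andP[-> ]; rewrite le_min => /andP[->].
have tm : t < Num.min u T by rewrite lt_min tu.
have [q] := rat_in_itvoo tm; rewrite in_itv/= lt_min => /and3P[tq qu qT].
have /andP[t0 _] := tT.
have e : measure_eq (path_of xi t) (path_of xi (ratr q)).
  apply: hs => //; [exact: ltW|exact: ltW|move=> r rs; apply: contra (hu r rs)].
  by move=> /andP[-> rq]; exact: le_trans rq (ltW qu).
have qT' : 0 <= (ratr q : R) <= T by apply/andP; split; [exact: le_trans t0 (ltW tq)|exact: ltW].
rewrite (conf_hdelta Hd dsep (measure_eq_trans e (conf_measure_eq (vxi _ qT')))).
by have := hq (choice.pickle q); rewrite choice.pickleK /=; exact.
Qed.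

End invariant_configurations.

(** * Completion of the filtration by null sets *)

Section completed_filtration.
Context (R : realType) d (Om : measurableType d) (PP : probability Om R).
Variable F : R -> set (set Om).
Hypothesis Fsig : forall t, sigma_algebra setT (F t).
Hypothesis Fmono : forall s t, s <= t -> F s `<=` F t.

(** [augmented] also contains non-measurable sets that differ from an event inside a null set; the
    intersection keeps the measurable ones, over which integrals can be manipulated. *)
Definition completion (t : R) : set (set Om) := measurable `&` augmented PP (F t).

Lemma augmented_sigma_algebra t : sigma_algebra setT (augmented PP (F t)).
Proof.
have [F0 FC FU] := Fsig t; split.
- by exists set0 => //; rewrite !setDv setU0; exact: negligible_set0.
- move=> A [B FB AB]; exists (~` B); first by rewrite -setTD; exact: FC.
  by rewrite setTD !setDE !setCK setUC [X in X `|` _]setIC [X in _ `|` X]setIC -!setDE.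
- move=> A HA.
  have [B HB] : {B : nat -> set Om & forall n, F t (B n) /\
      PP.-negligible ((A n `\` B n) `|` (B n `\` A n))}.
    by apply: (@boolp.choice _ _ (fun n B => F t B /\
      PP.-negligible ((A n `\` B) `|` (B `\` A n)))) => n; have [B FB nB] := HA n; exists B.
  exists (\bigcup_n B n); first by apply: FU => n; exact: (HB n).1.
  apply: (@negligibleS _ _ _ _ (\bigcup_n ((A n `\` B n) `|` (B n `\` A n)))).
    move=> w [[[n _ An] nB]|[[n _ Bn] nA]]; exists n => //; [left|right]; split => //.
      by move=> Bn; apply: nB; exists n.
    by move=> An; apply: nA; exists n.
  by apply: negligible_bigcup => n; exact: (HB n).2.
Qed.

Lemma completion_sigma_algebra t : sigma_algebra setT (completion t).
Proof.
have [A0 AC AU] := augmented_sigma_algebra t; split.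
- by split => //; exact: measurable0.
- by move=> A [mA aA]; split; [exact: measurableD|exact: AC].
- by move=> A HA; split; [apply: bigcupT_measurable => n|apply: AU => n]; case: (HA n).
Qed.

Lemma completion_mono s t : s <= t -> completion s `<=` completion t.
Proof.
by move=> st A [mA [B FB nB]]; split => //; exists B => //; exact: Fmono FB.
Qed.

Lemma completion_measurable t : completion t `<=` measurable.
Proof. by move=> A []. Qed.

Lemma augmented_ae t (A B : set Om) (N : set Om) : measurable N -> PP N = 0%E ->
  completion t A -> (forall w, ~ N w -> A w <-> B w) -> augmented PP (F t) B.
Proof.
move=> mN N0 [_ [A' FA' nA]] AB; exists A' => //.
apply: (@negligibleS _ _ _ _ (((A `\` A') `|` (A' `\` A)) `|` N)).
  move=> w Hw; have [Nw|Nw] := pselect (N w); [by right|left].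
  have [AwB BwA] := AB w Nw.
  by case: Hw => -[h1 h2]; [left|right]; split => //; [exact: BwA|move=> /AwB].
by apply: negligibleU; [exact: nA|exists N; split].
Qed.

(** A change on a null set is absorbed by [augmented], whatever the values of g there; this gives
    adaptedness of counts and of kappa from that of their versions. *)
Lemma wrt_augmented t (f : Om -> \bar R) (g : Om -> \bar R) (N : set Om) :
  measurable N -> PP N = 0%E ->
  measurable_fun [set: g_sigma_algebraType (completion t)] (f : g_sigma_algebraType (completion t) -> \bar R) ->
  (forall w, ~ N w -> f w = g w) -> wrt (augmented PP (F t)) g.
Proof.
move=> mN N0 mf fg B mB; apply: (augmented_ae (A := f @^-1` B) mN N0) => [|w Nw].
  have := mf measurableT _ mB; rewrite setTI.
  by rewrite /measurable/= sigma_algebra_id//; exact: completion_sigma_algebra.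
by rewrite /= fg.
Qed.

End completed_filtration.

Lemma Rintegral_balance (R : realType) d (T : measurableType d) (mu : {measure set T -> \bar R})
    (A : set T) (f1 f2 g1 g2 M1 M2 : T -> R) : measurable A ->
  mu.-integrable A (EFin \o f1) -> mu.-integrable A (EFin \o f2) ->
  mu.-integrable A (EFin \o g1) -> mu.-integrable A (EFin \o g2) ->
  mu.-integrable A (EFin \o M1) -> mu.-integrable A (EFin \o M2) ->
  (forall x, f1 x + f2 x = g1 x + g2 x + (M1 x - M2 x)) ->
  \int[mu]_(x in A) M1 x = \int[mu]_(x in A) M2 x ->
  \int[mu]_(x in A) f1 x + \int[mu]_(x in A) f2 x =
  \int[mu]_(x in A) g1 x + \int[mu]_(x in A) g2 x.
Proof.
move=> mA if1 if2 ig1 ig2 iM1 iM2 e eM.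
rewrite -RintegralD// -RintegralD//; under eq_Rintegral do rewrite e.
have iM : mu.-integrable A (EFin \o (fun x => M1 x - M2 x)) by exact: (integrableB mA iM1 iM2).
have ig : mu.-integrable A (EFin \o (fun x => g1 x + g2 x)) by exact: (integrableD mA ig1 ig2).
by rewrite (RintegralD mA ig iM) (RintegralB mA iM1 iM2) eM subrr addr0.
Qed.

(** * The configuration process and its martingale problem *)

Section configuration_process.
Context (R : realType) (X : ptopologicalType) (d : X -> X -> R) (a : nat -> X).
Hypothesis Hd : sep_metric d a.
Hypothesis dsep : forall b c, d b c = 0 -> b = c.
Variables (k : nat) (T : R) (h : {posnum R}).
Variable P : R -> SX X -> Mplus R (SX X).
Hypothesis Pd : forall t x, 0 <= t <= T -> (1 <= card x <= k)%N ->
  P t x (~` [set y | (card y <= dmax k (card x))%N]) = 0%E.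
Hypothesis T0 : 0 < T.
Variables (mu0 : Mplus R X) (PP : probability (skorokhod X T) R).
Hypothesis law : markov_jump_law k h P mu0 PP.

Local Notation S := (borel (SX X)).
Local Notation Om := (skorokhod X T).
Local Notation RS := (measurableTypeR R * S)%type.

Variables (q : R.-fker RS ~> S) (C0 : R) (K : set (SX X)).
Hypothesis q_le : forall p, (q p setT <= C0%:E)%E.
Hypothesis qE : forall r x (B : set S), 0 <= r <= T -> K x -> measurable B ->
  q (r, x) B = (\sum_(I : {set 'I_(card x)} | (1 <= #|I| <= k)%N)
    (h%:num ^+ #|I|.-1)%:E * P r (subconf I) [set y : S | B ((x `\` subconf I) `+` y)%mset])%E.
Variable N : set Om.
Hypothesis mN : measurable N.
Hypothesis N0 : PP N = 0%E.
Hypothesis HN : forall xi, ~ N xi -> [/\ Mhdelta_valued h xi, pure_jump xi &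
  forall t, 0 <= t <= T -> K (conf h (path_of xi t))].

(** Constant on the null set N and clamped to [0, T], so that it is a pure jump process for every
    path and all real times, as the general results on jump processes ask. *)
Definition configuration (t : R) (xi : Om) : S :=
  if `[< N xi >] then mset0 else conf h (path_of xi (clamp T t)).

Local Notation Y := configuration.
Local Notation F := (@right_filtration R X T).
Local Notation G := (completion PP F).

Lemma configurationE t xi : ~ N xi -> 0 <= t <= T -> Y t xi = conf h (path_of xi t).
Proof. by move=> Nxi tT; rewrite /Y asboolF// clamp_id. Qed.

Lemma clamp_range t : 0 <= clamp T t <= T.
Proof. by rewrite /clamp le_min ge_min lexx/= (ltW T0) le_max lexx. Qed.

Lemma configuration_mem t xi : ~ N xi -> K (Y t xi).
Proof.
move=> Nxi; have [_ _] := HN Nxi; rewrite /Y asboolF//; apply; exact: clamp_range.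
Qed.

(** Clamping is monotone and creates no move: a listed time between two clamped times lies between
    the original ones. *)
Lemma configuration_pure xi : exists l : seq R, forall t u, t <= u ->
  (forall r, r \in l -> ~~ (t < r <= u)) -> Y t xi = Y u xi.
Proof.
have [Nxi|Nxi] := pselect (N xi); first by exists [::] => t u _ _; rewrite /Y asboolT.
have [vxi [l hl] _] := HN Nxi; exists l => t u tu hr; rewrite /Y asboolF//.
apply: (conf_hdelta Hd dsep); apply: measure_eq_trans (conf_measure_eq (vxi _ (clamp_range u))).
have /andP[t0 tT] := clamp_range t; have /andP[u0 uT] := clamp_range u.
apply: hl => //; first by rewrite /clamp le_min2// le_max2.
move=> r rl; apply: contra (hr r rl) => /andP[tr ru]; apply/andP; split.
  rewrite ltNge; apply/negP => rt; move: tr; rewrite /clamp ltNge le_min.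
  by rewrite (le_trans ru uT) le_max rt orbT.
have r0 := le_lt_trans t0 tr; move: ru; rewrite /clamp le_min le_max => /andP[_ /orP[|//]].
by rewrite leNgt r0.
Qed.

Lemma natural_filtration_sigma t : sigma_algebra setT (@natural_filtration R X T t).
Proof. exact: smallest_sigma_algebra. Qed.

Lemma right_filtration_sigma t : sigma_algebra setT (F t).
Proof.
split.
- by move=> s _; have [] := natural_filtration_sigma s.
- by move=> A FA s ts; have [_ H _] := natural_filtration_sigma s; apply: H; exact: FA.
- by move=> A FA s ts; have [_ _ H] := natural_filtration_sigma s; apply: H => n; exact: FA.
Qed.

Lemma right_filtration_mono s t : s <= t -> F s `<=` F t.
Proof. by move=> st A FA u /(le_lt_trans st)/FA. Qed.

Lemma right_filtration_measurable t : F t `<=` (measurable : set (set Om)).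
Proof.
move=> A /(_ (t + 1)) H; apply: (natural_filtration_sub Hd T0); apply: H.
by rewrite /= ltrDl.
Qed.

Lemma path_right_filtration t (B' : set (borel (Mplus R X))) : 0 <= t -> measurable B' ->
  F t [set xi : Om | B' (path_of xi t)].
Proof.
move=> t0 mB' s /= ts; apply: sub_sigma_algebra; exists t; first by rewrite t0 ltW.
by exists B'.
Qed.

Lemma configuration_path t (B' : set (borel (Mplus R X))) xi : measurable B' ->
  ~ N xi -> 0 <= t <= T -> (hdelta h @^-1` B') (Y t xi) <-> B' (path_of xi t).
Proof.
move=> mB' Nxi tT; rewrite configurationE//; have [vxi _ _] := HN Nxi.
by split => /(conf_mem mB' (vxi _ tT)).
Qed.

Lemma configuration_adapted t : 0 <= t -> forall B : set S, measurable B ->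
  G t (Y t @^-1` B).
Proof.
move=> t0 B mB; have [B' mB' BE] := hdelta_ext Hd dsep h mB.
have /andP[c0 cT] := clamp_range t.
(* For nonnegative t clamping never looks ahead. *)
have ct : clamp T t <= t by rewrite /clamp ge_min ge_max t0 lexx orbT.
apply: (completion_mono right_filtration_mono ct).
have Yc xi : Y (clamp T t) xi = Y t xi by rewrite /Y (@clamp_id R T (clamp T t)) ?c0.
have E0 xi : ~ N xi -> (Y t @^-1` B) xi <-> B' (path_of xi (clamp T t)).
  by move=> Nxi; rewrite /= -Yc -BE; apply: configuration_path => //; rewrite c0.
pose A := [set xi : Om | B' (path_of xi (clamp T t))].
have FA : F (clamp T t) A by exact: path_right_filtration.
have mA := right_filtration_measurable FA.
split.
  rewrite (_ : Y t @^-1` B = (A `&` ~` N) `|` (N `&` (if `[< B mset0 >] then setT else set0))).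
    apply: measurableU; first by apply: measurableI => //; exact: measurableC.
    by apply: measurableI => //; case: asboolP.
  apply/seteqP; split => xi.
    have [Nxi|Nxi] := pselect (N xi); last by move=> /(E0 _ Nxi); left.
    by rewrite /= {1}/Y asboolT// => h1; right; split => //; rewrite asboolT.
  by move=> [[h1 h2]|[h1]]; [exact/(E0 _ h2)|case: asboolP => // h2 _; rewrite /= /Y asboolT].
exists A => //; exists N; split => //.
move=> xi; have [//|Nxi] := pselect (N xi).
by move=> [[/(E0 _ Nxi)]|[h1]]; [|move=> h2; case: h2; exact/(E0 _ Nxi)].
Qed.

Let Ysig := completion_sigma_algebra PP right_filtration_sigma.
Let Ymono := @completion_mono R _ Om PP F right_filtration_mono.
Let Ymeas := @completion_measurable R _ Om PP F.
Let Ybetween := fun t t0 => @configuration_adapted t t0.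

Local Notation comp := (compensation Y q).

Let compE := @compensationE R _ Om _ S G Ysig Ymono Y Ybetween configuration_pure q C0 q_le.
Let compD := @compensationD R _ Om _ S G Ysig Ymono Y Ybetween configuration_pure q C0 q_le.
Let comp_le := @compensation_le R _ Om _ S G Ysig Ymono Y Ybetween configuration_pure q C0 q_le.

Lemma measurable_compensation_process (D : set (S * S)) s t : measurable D -> 0 <= s -> s <= t ->
  measurable_fun [set: Om] (comp D s t).
Proof.
move=> mD s0 st; apply: (measurable_sub_sigma (Ysig t) (Ymeas (t := t))).
exact: (@measurable_compensation R _ Om _ S G Ysig Ymono Y Ybetween configuration_pure q C0 q_le).
Qed.

Lemma measurable_configuration t : 0 <= t -> measurable_fun [set: Om] (Y t).
Proof. exact: (@process_measurable R _ Om _ S G Ysig Ymono Ymeas Y Ybetween). Qed.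

Lemma rateX (B B' : set S) r w : measurable B -> measurable B' ->
  rate Y q (B `*` B') r w = (q (r, Y r w) B' * (\1_B (Y r w))%:E)%E.
Proof.
move=> mB mB'; rewrite /rate indicE; have [BY|BY] := pselect (B (Y r w)).
  by rewrite mem_set// mule1; congr (q _ _); apply/seteqP; split => x //= -[].
rewrite memNset// mule0 (_ : [set x | _] = set0) ?measure0//.
by apply/seteqP; split => x // -[].
Qed.

(** The generator of an indicator is the rate of jumping into B minus the total rate on B; these are
    the rates of the pair sets having B as second and as first factor. Jumps inside B count in both
    and cancel. *)
Lemma generator_compensation (B' : set (borel (Mplus R X))) xi t : measurable B' ->
  measurable (hdelta h @^-1` B' : set S) -> ~ N xi -> 0 <= t <= T ->
  \int[lebesgue_measure]_(s in `]0, t]) generator k h P s (\1_B') (conf h (path_of xi s)) =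
  comp (setT `*` (hdelta h @^-1` B')) 0 t xi - comp ((hdelta h @^-1` B') `*` setT) 0 t xi.
Proof.
move=> mB' mB Nxi /andP[t0 tT]; set B : set S := hdelta h @^-1` B'.
have q_fin p (A : set S) : measurable A -> q p A \is a fin_num.
  move=> mA; rewrite ge0_fin_numE//; apply: (@le_lt_trans _ _ (C0%:E)); last exact: ltry.
  by apply: le_trans (q_le p); apply: le_measure; rewrite ?inE.
pose g1 r := fine (rate Y q (setT `*` B) r xi); pose g2 r := fine (rate Y q (B `*` setT) r xi).
have rfin D r : measurable D -> rate Y q D r xi \is a fin_num.
  move=> mD; apply: q_fin; rewrite -[X in measurable X]setTI.
  exact: (measurable_pair1 (Y r xi) measurableT mD).
transitivity (\int[lebesgue_measure]_(s in `]0, t]) (g1 s - g2 s)).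
  apply: eq_Rintegral => r; rewrite inE/= in_itv/= => /andP[r0 rt].
  have rT : 0 <= r <= T by rewrite (ltW r0) (le_trans rt).
  rewrite (generator_indic Hd Pd)// /g1 /g2 !rateX// -configurationE//.
  have KY := configuration_mem r Nxi.
  rewrite indicT mule1 fineM ?q_fin//.
  have qf A : measurable A -> fine (q (r, Y r xi) A) =
      \sum_(I : {set 'I_(card (Y r xi))} | (1 <= #|I| <= k)%N) h%:num ^+ #|I|.-1 *
        fine (P r (subconf I) [set y : S | A ((Y r xi `\` subconf I) `+` y)%mset]).
    move=> mA; rewrite qE// -[RHS]/(fine (_)%:E) -sumEFin; congr fine; apply: eq_bigr => I _.
    rewrite EFinM fineK// fin_num_measure// -[X in measurable X]setTI.
    exact: (measurable_translate Hd (Y r xi `\` subconf I)%mset measurableT mA).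
  rewrite !qf// mulr_suml -sumrB; apply: eq_bigr => I _.
  have -> : [set y : S | [set: S] ((Y r xi `\` subconf I) `+` y)%mset] = setT by [].
  have -> : [set y : S | (hdelta h @^-1` B') ((Y r xi `\` subconf I) `+` y)%mset] =
    [set y : S | B' (hdelta h ((Y r xi `\` subconf I) `+` y)%mset)] by [].
  rewrite -[fine (\1__ _)%:E]/(\1_(hdelta h @^-1` B') (Y r xi)).
  rewrite -[\1_B' (hdelta h (Y r xi))]/(\1_(hdelta h @^-1` B') (Y r xi)).
  by move: (fine _) (fine _) (\1__ _) (_ ^+ _) => u v x y; ring.
have mDs (D : set (S * S)) : measurable D -> comp D 0 t xi =
    \int[lebesgue_measure]_(s in `]0, t]) fine (rate Y q D s xi) /\
    lebesgue_measure.-integrable `]0, t] (EFin \o (fun s => fine (rate Y q D s xi))).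
  move=> mD.
  have e : EFin \o (fun s => fine (rate Y q D s xi)) = (fun s => rate Y q D s xi).
    by apply/funext => s; rewrite /= fineK// rfin.
  split; first by rewrite /Rintegral -[in RHS]/(EFin \o _) e.
  rewrite e; apply/integrableP; split.
    exact: (measurable_time_section xi (@meas_rate R _ Om _ S G Ysig Ymono Y Ybetween
      configuration_pure q D 0 t mD (lexx 0) t0)).
  under eq_integral do rewrite gee0_abs//.
  by rewrite compE// ltry.
have [-> i1] := mDs (setT `*` B) (measurableX measurableT mB).
have [-> i2] := mDs (B `*` setT) (measurableX mB measurableT).
by rewrite RintegralB.
Qed.

Lemma configuration_martingale s t A (B : set S) : 0 <= s -> s <= t -> t <= T ->
  G s A -> measurable B ->
  (PP (A `&` Y t @^-1` B) +
     \int[PP]_(w in A) \int[lebesgue_measure]_(r in `]s, t]) (q (r, Y r w) setT * (\1_B (Y r w))%:E) =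
   PP (A `&` Y s @^-1` B) +
     \int[PP]_(w in A) \int[lebesgue_measure]_(r in `]s, t]) q (r, Y r w) B)%E.
Proof.
move=> s0 st tT [mA [A0 FA0 [N1 [mN1 N10 HN1]]]] mB; have [B' mB' BE] := hdelta_ext Hd dsep h mB.
have [_ _ mart] := law_generator law (bounded_measurable_indic mB').
have mB2 : measurable (hdelta h @^-1` B' : set S) by rewrite BE.
pose c1 s t := comp (B `*` setT) s t; pose c2 s t := comp (setT `*` B) s t.
pose f u xi : R := \1_B (Y u xi).
pose M u xi := f u xi - f 0 xi - (c2 0 u xi - c1 0 u xi).
(* The law gives the martingale property on events of F s only, so A is exchanged for the event A0,
   which differs from it by a null set; off N the path is exchanged for Y. *)
have MA u : 0 <= u <= T -> (\int[PP]_(xi in A0) (\1_B' (path_of xi u) - \1_B' (path_of xi 0) -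
       \int[lebesgue_measure]_(s in `]0, u])
          generator k h P s (\1_B') (conf h (path_of xi s)))%:E = \int[PP]_(xi in A) (M u xi)%:E)%E.
  move=> uT; rewrite integral_mkcond [RHS]integral_mkcond.
  apply: (@eq_integral_ae _ _ _ PP setT (N `|` N1)); first exact: measurableU.
    by rewrite measureU0.
  move=> xi _ /not_orP[Nxi N1xi]; rewrite !patchE.
  have -> : (xi \in A0) = (xi \in A).
    apply/idP/idP => /set_mem h1; apply/mem_set; apply: contrapT => h2; apply: N1xi; apply: HN1.
      by right; split.
    by left; split.
  case: ifP => // _; congr EFin; rewrite (generator_compensation mB' mB2 Nxi uT) BE.
  have fE v : 0 <= v <= T -> \1_B' (path_of xi v) = f v xi.
    move=> vT; rewrite /f -BE !indicE; congr (_%:R); congr nat_of_bool.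
    have H := configuration_path mB' Nxi vT.
    by apply/idP/idP => /set_mem h1; apply/mem_set; apply/H.
  by rewrite !fE// lexx ltW.
have t0 := le_trans s0 st; have sT := le_trans st tT.
have mc1 u v : 0 <= u -> u <= v -> measurable_fun setT (c1 u v).
  by move=> u0 uv; apply: measurable_compensation_process => //; exact: measurableX.
have mc2 u v : 0 <= u -> u <= v -> measurable_fun setT (c2 u v).
  by move=> u0 uv; apply: measurable_compensation_process => //; exact: measurableX.
have mf u : 0 <= u -> measurable_fun setT (f u).
  have mi : measurable_fun [set: S] (\1_B : S -> R) by exact: measurable_indic.
  move=> u0; exact: (measurableT_comp mi (measurable_configuration u0)).
have int_bd (g : Om -> R) b : measurable_fun setT g -> (forall xi, `|g xi| <= b) ->
    PP.-integrable A (EFin \o g).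
  move=> mg gb; apply: measurable_bounded_integrable => //.
  - by apply: le_lt_trans (probability_le1 _ mA) _; rewrite ltry.
  - exact: measurable_funTS.
  - exists b; split; first exact: num_real.
    by move=> b' bb' xi _; apply: le_trans (gb xi) (ltW bb').
have ic1 u v : 0 <= u -> u <= v -> PP.-integrable A (EFin \o c1 u v).
  move=> u0 uv; apply: (int_bd _ (C0 * (v - u))); first exact: mc1.
  by move=> xi; rewrite ger0_norm ?compensation_ge0//; apply: comp_le => //; exact: measurableX.
have ic2 u v : 0 <= u -> u <= v -> PP.-integrable A (EFin \o c2 u v).
  move=> u0 uv; apply: (int_bd _ (C0 * (v - u))); first exact: mc2.
  by move=> xi; rewrite ger0_norm ?compensation_ge0//; apply: comp_le => //; exact: measurableX.
have if_ u : 0 <= u -> PP.-integrable A (EFin \o f u).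
  move=> u0; apply: (int_bd _ 1); first exact: mf.
  by move=> xi; rewrite /f indicE ger0_norm// lern1 leq_b1.
have := mart s t A0 s0 st tT FA0.
have tT' : 0 <= t <= T by rewrite t0.
have sT' : 0 <= s <= T by rewrite s0.
rewrite (MA t tT') (MA s sT') => /(congr1 fine) MM.
have {}MM : \int[PP]_(xi in A) M t xi = \int[PP]_(xi in A) M s xi by exact: MM.
have iD u : 0 <= u -> PP.-integrable A (EFin \o M u).
  move=> u0; exact: (integrableB mA (integrableB mA (if_ u u0) (if_ 0 (lexx 0)))
    (integrableB mA (ic2 0 u (lexx 0) u0) (ic1 0 u (lexx 0) u0))).
have H : \int[PP]_(xi in A) f t xi + \int[PP]_(xi in A) c1 s t xi =
    \int[PP]_(xi in A) f s xi + \int[PP]_(xi in A) c2 s t xi.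
  apply: (Rintegral_balance mA (if_ _ t0) (ic1 _ _ s0 st) (if_ _ s0) (ic2 _ _ s0 st) (iD _ t0) (iD _ s0) _ MM).
  move=> xi; rewrite /M /c1 /c2 (@compD _ 0 s t _ (measurableX measurableT mB) (lexx 0) s0 st).
  rewrite (@compD _ 0 s t _ (measurableX mB measurableT) (lexx 0) s0 st).
  by move: (f t xi) (f s xi) (f 0 xi) (comp _ _ _ _) (comp _ _ _ _) (comp _ _ _ _) (comp _ _ _ _) => *; ring.
have iE (g : Om -> R) : PP.-integrable A (EFin \o g) ->
    ((\int[PP]_(xi in A) g xi)%:E = \int[PP]_(xi in A) (g xi)%:E)%E.
  by move=> ig; exact: (fineK (integrable_fin_num mA ig)).
have {}H := congr1 EFin H; move: H; rewrite EFinD [in X in _ = X -> _]EFinD (iE _ (if_ _ t0)) (iE _ (ic1 _ _ s0 st)) (iE _ (if_ _ s0)).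
rewrite (iE _ (ic2 _ _ s0 st)).
have fE u : 0 <= u -> (\int[PP]_(xi in A) (f u xi)%:E = PP (A `&` Y u @^-1` B))%E.
  move=> u0; have mYB : measurable (Y u @^-1` B).
    by rewrite -[X in measurable X]setTI; apply: measurable_configuration.
  by rewrite setIC -(@integral_indic _ _ _ PP A mA _ mYB).
rewrite (fE t t0) (fE s s0).
have c1E : (\int[PP]_(xi in A) (c1 s t xi)%:E = \int[PP]_(w in A)
    \int[lebesgue_measure]_(r in `]s, t]) (q (r, Y r w) setT * (\1_B (Y r w))%:E))%E.
  apply: eq_integral => w _; rewrite /c1 -(compE _ (measurableX mB measurableT) s0 st).
  by apply: eq_integral => r _; rewrite (rateX r w mB measurableT).
have c2E : (\int[PP]_(xi in A) (c2 s t xi)%:E = \int[PP]_(w in A)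
    \int[lebesgue_measure]_(r in `]s, t]) q (r, Y r w) B)%E.
  apply: eq_integral => w _; rewrite /c2 -(compE _ (measurableX measurableT mB) s0 st).
  by apply: eq_integral => r _; rewrite (rateX r w measurableT mB) indicT mule1.
by rewrite c1E c2E.
Qed.

End configuration_process.

(** * Random measures of jumps *)

Section jumps_of_paths.
Context (R : realType) (S : Type) (y : R -> S) (l : seq R).
Hypothesis yl : forall t u, t <= u -> (forall r, r \in l -> ~~ (t < r <= u)) ->
  y t = y u.

Lemma left_gap (r : R) : exists2 e : R, 0 < e & forall x, x \in l -> x < r -> x <= r - e.
Proof.
elim: (l) => [|x s [e e0 IH]]; first by exists 1.
have [rx|xr] := leP r x.
  exists e => // z; rewrite inE => /orP[/eqP->|]; last exact: IH.
  by rewrite ltNge rx.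
exists (Num.min e (r - x)) => [|z]; first by rewrite lt_min e0 subr_gt0.
rewrite inE => /orP[/eqP-> _|/IH /[apply] H].
  have : Num.min e (r - x) <= r - x by rewrite ge_min lexx orbT.
  by lra.
have : Num.min e (r - x) <= e by rewrite ge_min lexx.
by lra.
Qed.

Lemma left_constant (r : R) : exists2 e : R, 0 < e & forall u v, r - e < u < r ->
  r - e < v < r -> y u = y v.
Proof.
have [e e0 He] := left_gap r; exists e => //.
have H u v : r - e < u < r -> r - e < v < r -> u <= v -> y u = y v.
  move=> /andP[u1 u2] /andP[v1 v2] uv; apply: yl => // x xl; apply/negP => /andP[x1 x2].
  by have := He x xl (le_lt_trans x2 v2); rewrite leNgt (lt_trans u1 x1).
by move=> u v hu hv; have [uv|/ltW vu] := leP u v; [|apply/esym]; exact: H.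
Qed.

Lemma jump_in_mem (D : set (S * S)) r : off_diagonal D -> jump_in y D r -> r \in l.
Proof.
move=> oD [e e0 He]; apply/negPn/negP => rl.
have [e' e'0 He'] := left_gap r; pose u := r - Num.min e e' / 2.
have m0 : 0 < Num.min e e' by rewrite lt_min e0.
have m1 : Num.min e e' <= e by rewrite ge_min lexx.
have m2 : Num.min e e' <= e' by rewrite ge_min lexx orbT.
have ur : r - e < u < r by apply/andP; split; rewrite /u; lra.
have := He u ur; rewrite (_ : y u = y r); first exact: oD.
apply: yl => [|x xl]; first by case/andP: ur => _ /ltW.
apply/negP => /andP[x1 x2]; move: x2; rewrite le_eqVlt => /orP[/eqP xr|xr].
  by rewrite xr (negbTE rl) in xl.
have := He' x xl xr; rewrite leNgt (_ : r - e' < x)//.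
by apply: lt_trans x1; rewrite /u; lra.
Qed.

Lemma jump_inP (D : set (S * S)) r e u : 0 < e ->
  (forall u v, r - e < u < r -> r - e < v < r -> y u = y v) -> r - e < u < r ->
  jump_in y D r <-> D (y u, y r).
Proof.
move=> e0 He ur; split=> [[e' e'0 He']|Du]; last first.
  by exists e => // v vr; rewrite (He v u).
have m0 : 0 < Num.min e e' by rewrite lt_min e0.
have m1 : Num.min e e' <= e by rewrite ge_min lexx.
have m2 : Num.min e e' <= e' by rewrite ge_min lexx orbT.
rewrite (He u (r - Num.min e e' / 2))//; last by apply/andP; split; lra.
by apply: He'; apply/andP; split; lra.
Qed.

(** The sum over uncountably many times is finite because off-diagonal jumps occur at listed times
    only. *)
Lemma esum_jumps (D : set (S * S)) t : off_diagonal D ->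
  (\esum_(s in `]0%R, t]%classic) (`[< jump_in y D s >]%:R : R)%:E)%E =
  ((num_jumps y l D 0 t)%:R)%:E.
Proof.
move=> oD; rewrite esum_mkcond.
pose A : set R := [set` undup l].
rewrite (_ : (\esum_(i in setT) _)%E = (\esum_(i in A) (if i \in `]0%R, t]%classic then
    (`[< jump_in y D i >]%:R : R)%:E else 0))%E); last first.
  rewrite [RHS]esum_mkcond; apply: eq_esum => s _; case: ifPn => // st.
    case: ifPn => // sA; rewrite asboolF// => /(jump_in_mem oD) sl; move/negP: sA; apply.
    by apply/mem_set; rewrite /A /= mem_undup.
  by case: ifP.
have fA : finite_set A by exact: finite_seq.
rewrite (esum_fset fA); last by move=> s _; case: ifP => // _; rewrite lee_fin.
rewrite -fsbig_seq ?undup_uniq// /num_jumps natr_sum -sumEFin [RHS]big_mkcond/=.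
apply: eq_bigr => s _; congr (if _ then _ else _).
by apply/idP/idP => [/set_mem|h]; [|apply/mem_set]; rewrite /= in_itv.
Qed.

End jumps_of_paths.

(** * Sets of jumps determined by their displacements *)

Section displacement_algebra.
Context (R : realType) (X : ptopologicalType) (d : X -> X -> R) (a : nat -> X).
Hypothesis Hd : sep_metric d a.
Hypothesis dsep : forall b c, d b c = 0 -> b = c.
Variable k : nat.
Hypothesis k1 : (1 <= k)%N.
Variable J0 : set (SX X * SX X).
Hypothesis J0j : J0 `<=` jumps k.
Hypothesis J0b : borelJ J0.
Hypothesis J0s : borelJ (saturation R k J0).
Hypothesis J0n : forall p, J0 p -> p.1 <> p.2.

Local Notation S := (borel (SX X)).
Local Notation SS := (S * S)%type.
Local Notation Alg := (jump_algebra R k J0).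
Local Notation displacement := (displacement R).

Lemma jump_algebra_sub U : Alg U -> U `<=` J0. Proof. by case. Qed.

Lemma jump_algebra_measurable U : Alg U -> measurable (U : set SS).
Proof. by move=> [_ bU _ _]; exact: (measurable_open_prod Hd). Qed.

Lemma jump_algebraT : Alg J0.
Proof. by split => // p []. Qed.

Lemma displacement_mono (U V : set (SX X * SX X)) : U `<=` V -> displacement U `<=` displacement V.
Proof. by move=> UV p [q Uq e]; exists q => //; exact: UV. Qed.

(** The last condition in [jump_algebra] put to use: within J0, membership in U is decided by the
    displacement. *)
Lemma displacement_sat U p : Alg U -> J0 p -> displacement U p -> U p.
Proof.
by move=> [_ _ _ HU] Jp dU; apply: HU; split => //; split => //; exact: J0j.
Qed.

(** For arbitrary sets the left side may be larger, as different members of U and V can share a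
    displacement. Saturation within J0 makes the member of V belong to U too. *)
Lemma displacementI U V : Alg U -> Alg V ->
  displacement U `&` displacement V = displacement (U `&` V).
Proof.
move=> AU AV; apply/seteqP; split => [p [[q Uq e] [q' Vq' e']]|p [q [Uq Vq] e]].
  exists q' => //; split => //; apply: (displacement_sat AU (jump_algebra_sub AV Vq')).
  by exists q => // B mB; rewrite -e// -e'.
by split; exists q.
Qed.

Lemma saturationE (U : set (SX X * SX X)) : saturation R k U = jumps k `&` displacement U. Proof. by []. Qed.

Lemma jump_algebraI U V : Alg U -> Alg V -> Alg (U `&` V).
Proof.
move=> AU AV; have [UJ bU sU HU] := AU; have [VJ bV sV HV] := AV.
have bI (A B : set (SX X * SX X)) : borelJ A -> borelJ B -> borelJ (A `&` B).
  exact: (@measurableI _ (g_sigma_algebraType (@open (SX X * SX X)%type))).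
have sE : saturation R k (U `&` V) = saturation R k U `&` saturation R k V.
  by rewrite !saturationE -displacementI// setIACA setIid.
split => //.
- by move=> p [/UJ].
- exact: bI.
- by rewrite sE; exact: bI.
- by rewrite sE => p [[h1 h2] Jp]; split; [apply: HU|apply: HV].
Qed.

Lemma displacementU (U V : set (SX X * SX X)) : displacement (U `|` V) = displacement U `|` displacement V.
Proof.
apply/seteqP; split => [p [q [Uq|Vq] e]|p [[q Uq e]|[q Vq e]]].
- by left; exists q.
- by right; exists q.
- by exists q => //; left.
- by exists q => //; right.
Qed.

Lemma jump_algebraU U V : Alg U -> Alg V -> Alg (U `|` V).
Proof.
move=> AU AV; have [UJ bU sU HU] := AU; have [VJ bV sV HV] := AV.
have bU' (A B : set (SX X * SX X)) : borelJ A -> borelJ B -> borelJ (A `|` B).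
  exact: (@measurableU _ (g_sigma_algebraType (@open (SX X * SX X)%type))).
have sE : saturation R k (U `|` V) = saturation R k U `|` saturation R k V.
  by rewrite !saturationE displacementU setIUr.
split => //.
- by move=> p [/UJ|/VJ].
- exact: bU'.
- by rewrite sE; exact: bU'.
- by rewrite sE => p [[h1|h1] Jp]; [left; apply: HU|right; apply: HV].
Qed.

Lemma displacement_measurable U : Alg U -> measurable (displacement U : set SS).
Proof.
move=> [UJ bU sU HU].
rewrite (_ : displacement U = \bigcup_n [set p : SX X * SX X | [/\ (card p.1 <= n)%N,
    (card p.2 <= n)%N & displacement U p]]).
  apply: bigcupT_measurable => n; apply: (measurable_displacement Hd dsep k1) => //.
  - by move=> p /UJ/J0j.
  - by move=> p /UJ/J0n.
apply/seteqP; split => [p dU|p [n _ []]//].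
by exists (maxn (card p.1) (card p.2)) => //; split => //; rewrite leq_max leqnn ?orbT.
Qed.

Lemma displacement_off_diagonal U : Alg U -> off_diagonal (displacement U).
Proof. by move=> [UJ _ _ _]; apply: (displacement_off Hd dsep k1) => p /UJ/J0n. Qed.

End displacement_algebra.

(** * Jumps of the path of measures as jumps of the configuration *)

Section jump_identification.
Context (R : realType) (X : ptopologicalType) (d : X -> X -> R) (a : nat -> X).
Hypothesis Hd : sep_metric d a.
Hypothesis dsep : forall b c, d b c = 0 -> b = c.
Variables (k : nat) (T : R) (h : {posnum R}).
Hypothesis k1 : (1 <= k)%N.
Hypothesis T0 : 0 < T.
Variable J0 : set (SX X * SX X).
Hypothesis J0j : J0 `<=` jumps k.
Hypothesis J0n : forall p, J0 p -> p.1 <> p.2.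

Local Notation S := (borel (SX X)).
Local Notation Om := (skorokhod X T).
Local Notation Alg := (jump_algebra R k J0).

Variables (K : set (SX X)) (N : set Om).
Hypothesis HN : forall xi, ~ N xi -> [/\ Mhdelta_valued h xi, pure_jump xi &
  forall t, 0 <= t <= T -> K (conf h (path_of xi t))].

Local Notation Y := (configuration h N).
Local Notation pure := (configuration_pure Hd dsep T0 HN).

Lemma path_configuration xi s : ~ N xi -> 0 <= s <= T ->
  measure_eq (path_of xi s) (hdelta h (Y s xi)).
Proof.
move=> Nxi sT; rewrite configurationE//; have [vxi _ _] := HN Nxi.
exact: conf_measure_eq (vxi _ sT).
Qed.

(** A weak limit is determined only up to [measure_eq], so the left limit is identified by its
    pairings, which are constant just before s. *)
Lemma left_limit_configuration xi s e u : ~ N xi -> 0 < s <= T -> 0 < e ->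
  (forall u v, s - e < u < s -> s - e < v < s -> Y u xi = Y v xi) ->
  s - e < u < s -> 0 <= u -> measure_eq (left_limit xi s) (hdelta h (Y u xi)).
Proof.
move=> Nxi /andP[s0 sT] e0 Ye us u0.
have [[_ /(_ s)[L HL]] _ _] := svalP (xi : DT X T).
have cl : path_of xi r @[r --> s^'-] --> left_limit xi s by apply: cvgP HL.
apply: (measure_eq_pairing Hd) => f bf.
have c1 : pairing f (path_of xi r) @[r --> s^'-] --> pairing f (left_limit xi s).
  by apply: cvg_comp cl _; exact: pairing_continuous.
apply: (cvg_unique _ c1) => //; apply: cvg_near_cst.
have /andP[us1 us2] := us.
near=> r.
have rs : r < s by near: r; exact: nbhs_left_lt.
have ur : u < r by near: r; exact: nbhs_left_gt.
have rT : 0 <= r <= T by rewrite (le_trans u0 (ltW ur)) (le_trans (ltW rs)).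
rewrite (pairing_measure_eq f (path_configuration Nxi rT)) (Ye r u)//.
by rewrite rs (lt_trans us1 ur).
Unshelve. all: by end_near.
Qed.

Lemma scaled_jump_delta xi s e u (U : set (SX X * SX X)) : ~ N xi -> 0 < s <= T -> 0 < e ->
  (forall u v, s - e < u < s -> s - e < v < s -> Y u xi = Y v xi) ->
  s - e < u < s -> 0 <= u ->
  delta_of U (scaled_jump h xi s) <-> displacement R U (Y u xi, Y s xi).
Proof.
move=> Nxi sT e0 Ye us u0.
have H B : measurable B -> scaled_jump h xi s B = signed_delta R (Y u xi, Y s xi) B.
  move=> mB; rewrite /scaled_jump (left_limit_configuration Nxi sT e0 Ye us u0 mB).
  have sT' : 0 <= s <= T by case/andP: sT => /ltW -> ->.
  rewrite (path_configuration Nxi sT' mB) signed_deltaE.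
  change ((h%:num^-1)%:E * ((h%:num)%:E * deltap R (Y s xi) B - (h%:num)%:E * deltap R (Y u xi) B) =
    (sum_conf (\1_B) (Y s xi) - sum_conf (\1_B) (Y u xi))%:E)%E.
  have H2 (b c : R) : h%:num^-1 * (h%:num * b - h%:num * c) = b - c.
    by rewrite -mulrBr mulKf// gt_eqF.
  by rewrite !deltapE; exact: (congr1 EFin (H2 _ _)).
by split=> -[p Up e']; exists p => // B mB; rewrite -e'// H.
Qed.

Lemma jump_countE xi t U : ~ N xi -> 0 <= t <= T -> Alg U ->
  jump_count h xi t U = (jump_number pure (displacement R U) 0 t xi)%:E.
Proof.
move=> Nxi /andP[t0 tT] AU; have [vxi _ _] := HN Nxi.
have pl := svalP (cid (pure xi)).
have oD := displacement_off_diagonal Hd dsep k1 J0n AU.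
rewrite /jump_count asboolT// /jump_number /jumps_between.
rewrite -(esum_jumps pl t oD); apply: eq_esum => s /=; rewrite in_itv/= => /andP[s0 st].
have [e1 e10 He1] := left_constant pl s.
(* The window is cut at s so that it contains only nonnegative times, where the path and Y
   correspond. *)
pose e := Num.min e1 s; have e0 : 0 < e by rewrite lt_min e10.
have ee1 : e <= e1 by rewrite ge_min lexx.
have es : e <= s by rewrite ge_min lexx orbT.
have sub u : s - e < u < s -> s - e1 < u < s.
  by move=> /andP[h1 ->]; rewrite andbT (le_lt_trans _ h1)// lerD2l lerN2.
have He u v : s - e < u < s -> s - e < v < s -> Y u xi = Y v xi.
  by move=> /sub hu /sub hv; exact: He1.
pose u := s - e / 2.
have us : s - e < u < s by apply/andP; split; rewrite /u; lra.
have u0 : 0 <= u by rewrite /u; lra.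
have sT : 0 < s <= T by rewrite s0 (le_trans st).
congr (_%:R%:E); congr nat_of_bool.
have h1 := scaled_jump_delta U Nxi sT e0 He us u0.
have h2 := jump_inP (displacement R U) e0 He us.
by apply/asboolP/asboolP => [/h1/h2|/h2/h1].
Qed.

End jump_identification.

(* A family of measures on time and jumps is measurable once its values on the
   sets ]-oo, t] x U are. *)
Section measurable_families.
Context (R : realType) (X : ptopologicalType) d (Om : measurableType d).
Variable (Alg : set (set (SX X * SX X))).
Hypothesis AlgI : setI_closed Alg.
Variables (J0 : set (SX X * SX X)) (AlgT : Alg J0) (AlgS : forall U, Alg U -> U `<=` J0).
Local Notation J := (g_sigma_algebraType Alg).
Local Notation RJ := (measurableTypeR R * J)%type.
Variables (m : Om -> {measure set RJ -> \bar R}) (c T : R).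
Hypothesis m0 : forall w, m w (~` (`]0, T]%classic `*` J0)) = 0%E.
Hypothesis mfin : forall w B, measurable B -> m w B \is a fin_num.
Hypothesis mm : forall t U, Alg U -> measurable_fun [set: Om] (fun w => m w (`]-oo, t]%classic `*` U)).

Lemma measurable_jump_strip : measurable (`]0, T]%classic `*` J0 : set RJ).
Proof. by apply: measurableX => //; exact: sub_sigma_algebra. Qed.

Lemma measure_strip w (B : set RJ) : measurable B -> m w B = m w (B `&` (`]0, T]%classic `*` J0)).
Proof.
move=> mB; have mS := measurable_jump_strip.
rewrite {1}(_ : B = (B `&` (`]0, T]%classic `*` J0)) `|` (B `&` ~` (`]0, T]%classic `*` J0))).
  rewrite measureU; [|exact: measurableI|by apply: measurableI => //; exact: measurableC|].
    rewrite [X in (_ + X)%E](_ : _ = 0%E) ?adde0//; apply/eqP; rewrite -measure_le0 -(m0 w).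
    apply: le_measure; rewrite ?inE//; last exact: measurableC.
    by apply: measurableI => //; exact: measurableC.
  by rewrite setIACA setICr setI0.
by rewrite -setIUr setUCr setIT.
Qed.

Lemma measurable_measures (B : set RJ) : measurable B -> measurable_fun [set: Om] (fun w => m w B).
Proof.
pose G : set (set RJ) := [set C | exists t (U : set (SX X * SX X)), (Alg U \/ U = setT) /\ C = `]-oo, t]%classic `*` U].
have GE : @measurable _ RJ = <<s G >>.
  rewrite eqEsubset; split; last first.
    apply: smallest_sub; first exact: sigma_algebra_measurable.
    move=> _ [t [U [[AU|->] ->]]]; apply: measurableX => //; exact: sub_sigma_algebra.
  apply: smallest_sub; first exact: smallest_sigma_algebra.
  rewrite subUset; split.
    have mf : measurable_fun setT (fst : g_sigma_algebraType G -> measurableTypeR R).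
      move=> mD; apply: (measurability _ (RGenOInfty.measurableE R)) => //.
      move=> _ [_ [x ->] <-]; rewrite setTI -[X in measurable X]setCK; apply: measurableC.
      apply: sub_sigma_algebra; exists x, setT; split; first by right.
      apply/seteqP; split => p /=; rewrite !in_itv/= andbT.
        by move=> /negP; rewrite -leNgt.
      by move=> [+ _]; rewrite leNgt => /negP.
    by move=> _ [A mA <-]; exact: mf.
  have mf : measurable_fun setT (snd : g_sigma_algebraType G -> J).
    move=> mD; apply: (@measurability _ _ (g_sigma_algebraType G) J setT _ Alg) => //.
    move=> _ [A AA <-]; rewrite setTI.
    rewrite (_ : snd @^-1` A = \bigcup_n (`]-oo, n%:R]%classic `*` A)).
      apply: bigcupT_measurable => n; apply: sub_sigma_algebra; exists n%:R, A; split => //.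
      by left.
    apply/seteqP; split => [p Ap|p [n _ []]//].
    exists (Num.truncn `|p.1|).+1 => //; split => //=; rewrite in_itv/=.
    by apply: le_trans (ltW (truncnS_gt _)); exact: ler_norm.
  by move=> _ [A mA <-]; exact: mf.
have mT t : measurable_fun [set: Om] (fun w => m w (`]-oo, t]%classic `*` setT)).
  apply: eq_measurable_fun (mm t AlgT) => w _.
  rewrite measure_strip; last by apply: measurableX => //; exact: sub_sigma_algebra.
  rewrite [RHS]measure_strip; last exact: measurableX.
  by congr (m w _); rewrite -!setXI setIid setTI.
rewrite GE; move: B; apply: (@dynkin_induction _ RJ G (fun B => measurable_fun [set: Om] (fun w => m w B))).
- exact: GE.
- move=> _ _ [t [U [AU ->]]] [s [V [AV ->]]]; exists (Num.min t s), (U `&` V); split.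
    case: AU AV => [AU|->] [AV|->]; rewrite ?setIT ?setTI; [left; exact: AlgI|by left|by left|by right].
  rewrite -setXI; congr (_ `*` _); apply/seteqP; split => x /=; rewrite !in_itv/= le_min.
    by move=> [-> ->].
  by move=> /andP[].
- apply: eq_measurable_fun (mm T AlgT) => w _.
  rewrite measure_strip; last by apply: measurableX => //; exact: sub_sigma_algebra.
  rewrite [RHS]measure_strip//; congr (m w _); rewrite setTI -setXI setIid; congr (_ `*` _).
  by apply/seteqP; split => x /=; rewrite !in_itv/=; [case|move=> /andP[x0 xT]; rewrite x0 xT].
- by move=> _ [t [U [[AU|->] ->]]]; [exact: mm|exact: mT].
- move=> C mC mf; rewrite (_ : (fun _ => _) = (fun w => (m w setT - m w C)%E)).
    apply: emeasurable_funB => //.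
    apply: eq_measurable_fun (mm T AlgT) => w _.
    rewrite measure_strip; last by apply: measurableX => //; exact: sub_sigma_algebra.
    rewrite [RHS]measure_strip//; congr (m w _); rewrite setTI -setXI setIid; congr (_ `*` _).
    by apply/seteqP; split => x /=; rewrite !in_itv/=; [case|move=> /andP[x0 xT]; rewrite x0 xT].
  apply/funext => w; rewrite -setTD measureD ?setTI//.
  by rewrite ltey_eq mfin.
- move=> F mF tF H.
  rewrite (_ : (fun _ => _) = (fun w => (\sum_(0 <= i <oo) m w (F i))%E)).
    by apply: ge0_emeasurable_sum => // i w _ _; exact: measure_ge0.
  apply/funext => w; rewrite measure_bigcup//; apply: eq_eseriesl => i.
  by rewrite in_setT.
Qed.

End measurable_families.

(** * Predictability of monotone processes *)

Section predictable_monotone.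
Context (R : realType) d (Om : measurableType d) (PP : probability Om R) (T : R).
Variable F : R -> set (set Om).
Hypothesis Fsig : forall t, sigma_algebra setT (F t).
Variable N : set Om.
Hypothesis mN : measurable N.
Hypothesis N0 : PP N = 0%E.
Variable g : R -> Om -> \bar R.
Hypothesis T0 : 0 < T.
Hypothesis g_adapted : forall t, 0 <= t <= T -> wrt (augmented PP (F t)) (g t).
Hypothesis g_nd : forall w s t, 0 <= s -> s <= t -> t <= T -> (g s w <= g t w)%E.
Hypothesis g_left : forall w t (b : R), ~ N w -> 0 < t <= T -> (b%:E < g t w)%E ->
  exists2 s, 0 <= s < t & (b%:E < g s w)%E.

Local Notation PT := (g_sigma_algebraType (predictable_rectangles PP T F)).

Let null_augmented (A : set Om) t : A `<=` N -> augmented PP (F t) A.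
Proof.
move=> AN; exists set0; first by have [] := Fsig t.
by exists N; split => // w [[/AN]|[]].
Qed.

Let strip (A : set Om) s t : 0 <= s -> s < t -> t <= T -> augmented PP (F s) A ->
  measurable (`]s, t]%classic `*` A : set PT).
Proof. by move=> s0 st tT FA; apply: sub_sigma_algebra; left; exists s, t, A. Qed.

Let augT t : augmented PP (F t) setT.
Proof. by have [A0 AD _] := augmented_sigma_algebra PP Fsig t; rewrite -setC0 -setTD; exact: AD. Qed.

(* For each path the set {t | b < g t} is an up-set of [0, T].  Off N it has no
   least element, so rational times suffice; the least elements over N are
   recovered from the fact that all subsets of N are adapted at time 0. *)
Lemma predictable_nondecreasing : predictable PP T F g.
Proof.
have TT : augmented PP (F 0) setT by exact: augT.
pose E : set PT := [set p | 0 <= p.1 <= T].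
have mE : measurable E.
  rewrite (_ : E = ([set 0] `*` setT) `|` (`]0, T]%classic `*` setT)).
    apply: measurableU; last exact: strip.
    by apply: sub_sigma_algebra; right; exists setT.
  apply/seteqP; split => -[t w]; rewrite /E /= in_itv/=.
    rewrite [0 <= t]le_eqVlt => /andP[/orP[/eqP<-|t0] tT]; first by left.
    by right; rewrite t0 tT.
  by move=> [[-> _]|[/andP[/ltW -> ->]]]//; rewrite lexx ltW.
suff mg : measurable_fun E (fun p : PT => g p.1 p.2).
  move=> B mB; have := mg mE _ mB; rewrite (_ : E `&` _ = [set tw | 0 <= tw.1 <= T /\ B (g tw.1 tw.2)])//.
move=> _; apply: (measurability _ (ErealGenOInfty.measurableE R)) => //.
move=> _ [_ [b ->] <-].
(* The exceptional paths for which the level b is first exceeded at a least positive time. *)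
pose N1 := [set w | N w /\ exists t, [/\ 0 < t <= T, (b%:E < g t w)%E &
  forall s, 0 <= s < t -> (g s w <= b%:E)%E]].
have N1N : N1 `<=` N by move=> w [].
have mup t : 0 <= t <= T -> augmented PP (F t) [set w | (b%:E < g t w)%E].
  move=> tT; have := g_adapted tT (emeasurable_itv `]b%:E, +oo[ : measurable _).
  by congr (augmented _ _ _); apply/seteqP; split => w /=; rewrite in_itv/= andbT.
(* Three pieces: time 0; the times after a rational q at which b is already exceeded; and, over N1,
   what remains of ]0, T] once ]0, q] is removed for each rational q at which b is not yet exceeded,
   that is, the times from the least one on. *)
rewrite (_ : _ `&` _ = ([set 0] `*` [set w | (b%:E < g 0 w)%E]) `|`
  ((\bigcup_(q : rat) (if (0 <= (ratr q : R)) && (ratr q < T)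
      then `]ratr q, T]%classic `*` [set w | (b%:E < g (ratr q) w)%E] else set0)) `|`
   ((`]0, T]%classic `*` N1) `\` \bigcup_(q : rat) (if (0 < (ratr q : R)) && (ratr q <= T)
      then `]0, ratr q]%classic `*` [set w | N1 w /\ (g (ratr q) w <= b%:E)%E] else set0)))).
  apply: measurableU.
    apply: sub_sigma_algebra; right; exists [set w | (b%:E < g 0 w)%E] => //.
    by apply: mup; rewrite lexx ltW.
  apply: measurableU.
    apply: bigcupT_measurable_rat => q; case: ifP => // /andP[q0 qT].
    by apply: strip => //; apply: mup; rewrite q0 ltW.
  apply: measurableD; first by apply: strip => //; exact: null_augmented.
  apply: bigcupT_measurable_rat => q; case: ifP => // /andP[q0 qT].
  by apply: strip => //; apply: null_augmented => w [/N1N].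
apply/seteqP; split => -[t w] /=.
  rewrite in_itv/= andbT => -[/andP[t0 tT] bg].
  move: t0; rewrite le_eqVlt => /orP[/eqP t0|t0]; first by left; rewrite t0.
  right; have [[s /andP[s0 st] bs]|nos] := pselect (exists2 s, 0 <= s < t & (b%:E < g s w)%E).
    left; have [q] := rat_in_itvoo st; rewrite in_itv/= => /andP[sq qt].
    exists q => //; rewrite (le_trans s0 (ltW sq)) (lt_le_trans qt tT)/=.
    split; first by rewrite /= in_itv/= qt.
    by apply: (lt_le_trans bs); apply: g_nd => //; rewrite ltW// (lt_le_trans qt tT).
  right; split.
    split; first by rewrite /= in_itv/= t0.
    split; first by apply: contrapT => Nw; apply: nos; apply: (g_left Nw) bg; rewrite t0.
    exists t; split => //; first by rewrite t0.
    by move=> s st; rewrite leNgt; apply/negP => bs; apply: nos; exists s.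
  move=> [q _]; case: ifP => // /andP[q0 qT] [] /=; rewrite in_itv/= => /andP[_ tq] [_].
  by rewrite leNgt => /negP; apply; apply: (lt_le_trans bg); apply: g_nd => //; exact: ltW.
move=> [[-> bg]|[[q _]|]].
- by split; [rewrite /E/= lexx ltW|rewrite in_itv/= bg].
- case: ifP => // /andP[q0 qT] [] /=; rewrite in_itv/= => /andP[qt tT] bg.
  split; first by rewrite /E/= (le_trans q0 (ltW qt)).
  by rewrite in_itv/= andbT; apply: (lt_le_trans bg); apply: g_nd => //; exact: ltW.
move=> [[/= + [Nw [u [/andP[u0 uT] bu ub]]]] nC]; rewrite in_itv/= => /andP[t0 tT].
split; first by rewrite /E/= (ltW t0).
rewrite in_itv/= andbT; have [ut|tu] := leP u t.
  by apply: (lt_le_trans bu); apply: g_nd => //; exact: ltW.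
exfalso; apply: nC; have [q] := rat_in_itvoo tu; rewrite in_itv/= => /andP[tq qu].
exists q => //; rewrite (lt_trans t0 tq) (le_trans (ltW qu) uT)/=.
split; first by rewrite /= in_itv/= t0 ltW.
have q0 := lt_trans t0 tq.
split; last by apply: ub; rewrite (ltW q0).
by split => //; exists u; split => //; rewrite u0.
Qed.

End predictable_monotone.

Lemma big_card_range (V : nmodType) n M (F : {set 'I_n} -> V) :
  \sum_(1 <= l < M.+1) \sum_(I : {set 'I_n} | #|I| == l) F I =
  \sum_(I : {set 'I_n} | (1 <= #|I| <= M)%N) F I.
Proof.
under eq_bigr do rewrite big_mkcond/=.
rewrite exchange_big/= [RHS]big_mkcond; apply: eq_bigr => I _.
elim: M => [|M IH]; first by rewrite big_geq//; case: (#|I|).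
rewrite big_nat_recr//= IH; have [->|IM] := eqVneq #|I| M.+1.
  by rewrite ltnn leqnn !andbF add0r.
by rewrite addr0 [in RHS](leq_eqVlt _ M.+1) (negbTE IM).
Qed.

Section image_measure.
Context d1 d2 (T1 : measurableType d1) (T2 : measurableType d2) (R : realType).
Variables (f : T1 -> T2) (m : {measure set T1 -> \bar R}).

Definition image_fun of measurable_fun [set: T1] f := fun B : set T2 => m (f @^-1` B).

Hypothesis mf : measurable_fun [set: T1] f.
Local Notation im := (image_fun mf).

Let im0 : im set0 = 0%E. Proof. by rewrite /im preimage_set0 measure0. Qed.
Let im_ge0 B : (0 <= im B)%E. Proof. exact: measure_ge0. Qed.
Let im_sigma_additive : semi_sigma_additive im.
Proof.
move=> F mF tF mUF; rewrite /image_fun preimage_bigcup.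
have mp B : measurable B -> measurable (f @^-1` B).
  by move=> mB; rewrite -[X in measurable X]setTI; exact: mf.
apply: measure_semi_sigma_additive.
- by move=> n; exact: mp.
- apply/trivIsetP => i j _ _ ij; rewrite -preimage_setI.
  by move/trivIsetP : tF => /(_ i j I I ij) ->; rewrite preimage_set0.
- by rewrite -preimage_bigcup; exact: mp.
Qed.

HB.instance Definition _ := isMeasure.Build _ _ _ im im0 im_ge0 im_sigma_additive.

Definition image_measure : {measure set T2 -> \bar R} := im.

End image_measure.

(** * Identification of kappa, and the two random measures *)

Section rate_identification.
Context (R : realType) (X : ptopologicalType) (d : X -> X -> R) (a : nat -> X).
Hypothesis Hd : sep_metric d a.
Hypothesis dsep : forall b c, d b c = 0 -> b = c.
Variables (k n : nat) (T : R) (h : {posnum R}).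
Hypothesis k1 : (1 <= k)%N.
Hypothesis T0 : 0 < T.
Variable P : R -> SX X -> Mplus R (SX X).
Hypothesis Pd : forall t x, 0 <= t <= T -> (1 <= card x <= k)%N ->
  P t x (~` [set y | (card y <= dmax k (card x))%N]) = 0%E.
Variable J0 : set (SX X * SX X).
Hypothesis J0s : jump_space k T P J0.

Local Notation S := (borel (SX X)).
Local Notation SS := (S * S)%type.
Local Notation RS := (measurableTypeR R * S)%type.
Local Notation Om := (skorokhod X T).
Local Notation Alg := (jump_algebra R k J0).

Variables (PP : probability (skorokhod X T) R) (K : set (SX X)) (N : set Om).
Hypothesis mN : measurable N.
Hypothesis N0 : PP N = 0%E.
Hypothesis HN : forall xi, ~ N xi -> [/\ Mhdelta_valued h xi, pure_jump xi &
  forall t, 0 <= t <= T -> K (conf h (path_of xi t))].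
Hypothesis Kn : forall x, K x -> (card x <= n)%N.

Variables (q Pk : R.-fker RS ~> S) (C0 : R).
Hypothesis q_le : forall p, (q p setT <= C0%:E)%E.
Hypothesis qE : forall r x (B : set S), 0 <= r <= T -> K x -> measurable B ->
  q (r, x) B = (\sum_(I : {set 'I_(card x)} | (1 <= #|I| <= k)%N)
    (h%:num ^+ #|I|.-1)%:E * P r (subconf I) [set y : S | B ((x `\` subconf I) `+` y)%mset])%E.
Hypothesis PkE : forall r x (I : {set 'I_(card x)}) (B : set S), 0 <= r <= T -> K x ->
  (1 <= #|I| <= k)%N -> Pk (r, subconf I) B = P r (subconf I) B.

Local Notation Y := (configuration h N).
Local Notation F := (@right_filtration R X T).
Local Notation G := (completion PP F).
Local Notation pure := (configuration_pure Hd dsep T0 HN).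
Local Notation displacement := (displacement R).

Let J0j : J0 `<=` jumps k. Proof. by case: J0s. Qed.
Let J0b : borelJ J0. Proof. by case: J0s. Qed.
Let J0sb : borelJ (saturation R k J0). Proof. by case: J0s. Qed.
Let J0n : forall p, J0 p -> p.1 <> p.2. Proof. by case: J0s. Qed.

Let Ysig := completion_sigma_algebra PP (@right_filtration_sigma R X T).
Let Ymono := @completion_mono R _ Om PP F (@right_filtration_mono R X T).
Let Ybetween := @configuration_adapted R X d a Hd dsep T h T0 PP K N mN N0 HN.

Local Notation comp := (compensation Y q).
Let compE := @compensationE R _ Om _ S G Ysig Ymono Y Ybetween pure q C0 q_le.

Definition kernel_rate (V : set (SX X * SX X)) (r : R) (x : SX X) : \bar R :=
  (\sum_(I : {set 'I_(card x)} | (1 <= #|I| <= k)%N)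
    (h%:num ^+ #|I|.-1)%:E * P r (subconf I) [set y : S | V (subconf I, y)])%E.

Let measurable_section (V : set SS) z : measurable V -> measurable ([set y : S | V (z, y)] : set S).
Proof.
by move=> mV; rewrite -[X in measurable X]setTI; exact: (measurable_pair1 z measurableT mV).
Qed.

(** If (z, y) has the displacement of a member of U, then it is in the saturation of J0 off the null
    set of inadmissible cardinalities, in J0 off a second null set, and then in U by
    [displacement_sat]. *)
Lemma kernel_section_ae r z U : 0 <= r <= T -> (1 <= card z <= k)%N -> Alg U ->
  {ae P r z, forall y, saturation R k J0 (z, y) -> J0 (z, y)} ->
  P r z [set y : S | displacement U (z, y)] = P r z [set y : S | U (z, y)].
Proof.
move=> rT zk AU [M [mM M0 HM]].
have mD := measurable_section z (displacement_measurable Hd dsep k1 J0j J0n AU).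
have mU := measurable_section z (jump_algebra_measurable Hd AU).
pose L : set S := [set y | (card y <= dmax k (card z))%N].
have mL : measurable L by exact: measurable_card_le.
apply/eqP; rewrite eq_le; apply/andP; split; last first.
  by apply: le_measure; rewrite ?inE// => y Uy; exists (z, y).
apply: (@le_trans _ _ (P r z ([set y : S | U (z, y)] `|` (M `|` ~` L)))).
  apply: le_measure; rewrite ?inE//.
    by apply: measurableU => //; apply: measurableU => //; exact: measurableC.
  move=> y dU; have [My|My] := pselect (M y); first by right; left.
  have [Ly|Ly] := pselect (L y); last by right; right.
  left; have jz : jumps k (z, y) by split.
  have Jy : J0 (z, y).
    have : saturation R k J0 (z, y) -> J0 (z, y) by apply: contrapT => H; apply: My; exact: HM.
    by apply; split => //; apply: displacement_mono dU; exact: jump_algebra_sub AU.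
  exact: (displacement_sat J0j AU Jy dU).
have mC : measurable (M `|` ~` L) by apply: measurableU => //; exact: measurableC.
apply: le_trans (measureU2 _ _ _) _ => //.
rewrite [X in (_ + X)%E](_ : _ = 0%E) ?adde0//.
by apply: null_set_setU => //; [exact: measurableC|exact: Pd].
Qed.

(** The exceptional times come from the condition on J0 alone, so one null set serves all
    configurations and all U. *)
Lemma rate_displacement : exists NL : set (measurableTypeR R), [/\ measurable NL,
    @lebesgue_measure R NL = 0%E & forall r x U, ~ NL r -> 0 <= r <= T -> K x -> Alg U ->
    q (r, x) [set x' : S | displacement U (x, x')] = kernel_rate U r x].
Proof.
have [_ _ _ _ [NL [mNL NL0 HNL]]] := J0s; exists NL; split => // r x U Nr rT Kx AU.
have mD := displacement_measurable Hd dsep k1 J0j J0n AU.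
rewrite qE//; last exact: measurable_section.
apply: eq_bigr => I Ik; congr (_ * _)%E.
rewrite -(kernel_section_ae rT _ AU) ?card_subconf//; last first.
  have H : 0 <= r <= T -> forall z, {ae P r z, forall y, saturation R k J0 (z, y) -> J0 (z, y)}.
    by apply: contrapT => H; apply: Nr; exact: HNL.
  exact: H.
(* The points of x that do not take part appear on both sides and leave the displacement
   unchanged. *)
congr (P r _ _); apply/seteqP; split => y /=;
  have := displacement_shift Hd dsep k1 U (x `\` subconf I)%mset (subconf I) y;
  by rewrite [X in displacement U (X, _)]msetDC subconfK => -[].
Qed.

Lemma measurable_configuration_path xi :
  measurable_fun [set: measurableTypeR R] (fun r : measurableTypeR R => Y r xi : S).
Proof.
have H := @progressively_measurable R _ Om _ S G Ysig Ymono Y Ybetween pure T (ltW T0).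
have mpair : measurable_fun [set: measurableTypeR R]
    (fun r : measurableTypeR R => (r, xi : g_sigma_algebraType (G T))).
  exact: measurable_fun_pair.
move=> mD B mB; have := H measurableT B mB; rewrite setTI => mHB.
have := mpair measurableT _ mHB; rewrite !setTI.
congr (measurable _); apply/seteqP; split => r; rewrite /= /configuration; case: asboolP => //= _;
  by rewrite (@clamp_id R T (clamp T r)) ?(clamp_range T0).
Qed.

(** Stated with the finite kernel [Pk], which is measurable over all real times; the weight phi
    covers both the terms of kappa and those of the total rate. *)
Definition kernel_sum (phi : nat -> R) (V : set (SX X * SX X)) (r : R) (x : SX X) : \bar R :=
  (\sum_(I : {set 'I_(card x)}) (phi #|I|)%:E * Pk (r, subconf I) [set y : S | V (subconf I, y)])%E.

Lemma kernel_sum_ge0 phi V r x : (forall j, 0 <= phi j) -> (0 <= kernel_sum phi V r x)%E.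
Proof. by move=> phi0; apply: sume_ge0 => I _; rewrite mule_ge0// lee_fin. Qed.

Lemma measurable_kernel_sum (phi : nat -> R) (V : set SS) xi : (forall j, 0 <= phi j) ->
  measurable V -> ~ N xi ->
  measurable_fun [set: measurableTypeR R] (fun r : measurableTypeR R => kernel_sum phi V r (Y r xi)).
Proof.
move=> phi0 mV Nxi.
pose g (p : measurableTypeR R * SS) : \bar R :=
  ((phi (card p.2.1))%:E * Pk (p.1, p.2.1) [set y : S | V (p.2.1, y)])%E.
have mg : measurable_fun setT g.
  apply: emeasurable_funM.
    apply/measurable_EFinP.
    have mphi : measurable_fun [set: S] (fun x : S => phi (card x)).
      apply: measurable_borel_continuous; apply: SX_continuous => j.
      rewrite (_ : _ \o _ = fun=> phi j); first exact: cst_continuous.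
      by apply/funext => v; rewrite /= card_unordered.
    by apply: (measurableT_comp mphi); exact: measurableT_comp.
  have mf : measurable_fun setT (fun p : measurableTypeR R * SS => ((p.1, p.2.1) : RS, p.2.1)).
    apply: measurable_fun_pair; last exact: measurableT_comp.
    by apply: measurable_fun_pair => //; exact: measurableT_comp.
  exact: (measurableT_comp (measurable_kernel_section Pk mV) mf).
have g0 p : (0 <= g p)%E by rewrite mule_ge0// lee_fin.
have := @measurable_split_sum R X d a Hd n _ (measurableTypeR R) (fun r => Y r xi) g
  (measurable_configuration_path xi) mg g0 (fun r => Kn (configuration_mem T0 HN r Nxi)).
apply: eq_measurable_fun => r _; apply: eq_bigr => I _.
by rewrite /g/= card_subconf.
Qed.

Definition jump_weight (j : nat) : R := if (1 <= j <= k)%N then h%:num ^+ j.-1 else 0.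

Lemma jump_weight_ge0 j : 0 <= jump_weight j.
Proof. by rewrite /jump_weight; case: ifP => // _; exact: exprn_ge0. Qed.

Lemma kernel_rateE V r x : 0 <= r <= T -> K x -> kernel_rate V r x = kernel_sum jump_weight V r x.
Proof.
move=> rT Kx; rewrite /kernel_rate /kernel_sum big_mkcond; apply: eq_bigr => I _.
by rewrite /jump_weight; case: ifP => Ik; rewrite ?mul0e// PkE.
Qed.

Lemma integral_kernel_rate xi t U : ~ N xi -> 0 <= t <= T -> Alg U ->
  (\int[lebesgue_measure]_(r in `]0%R, t]) kernel_rate U r (Y r xi) =
   (comp (displacement U) 0 t xi)%:E)%E.
Proof.
move=> Nxi /andP[t0 tT] AU; have [NL [mNL NL0 HNL]] := rate_displacement.
have mD := displacement_measurable Hd dsep k1 J0j J0n AU.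
rewrite -(compE _ mD (lexx 0) t0); apply: (eq_integral_ae mNL NL0) => r /=.
rewrite in_itv/= => /andP[r0 rt] Nr; rewrite /rate HNL//; last exact: (configuration_mem T0 HN).
by rewrite (ltW r0) (le_trans rt).
Qed.

(** The cardinalities m exhaust the support of the kernel, so the sum over m removes the constraint
    on y; the factor 1 / h turns h^l into the h^(l - 1) of the generator. *)
Lemma kappaE xi t U : ~ N xi -> 0 <= t <= T -> Alg U ->
  scaled_kappa k h P xi t U = (comp (displacement U) 0 t xi)%:E.
Proof.
move=> Nxi tT AU; rewrite -integral_kernel_rate//.
have [vxi _ _] := HN Nxi; have /andP[t0 tT'] := tT.
have mU := jump_algebra_measurable Hd AU.
pose V m : set SS := [set p | U p /\ SXn m p.2].
have mV m : measurable (V m).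
  apply: measurableI => //; rewrite -[X in measurable X]setTI.
  by apply: measurable_snd => //; exact: (@measurable_card_eq R).
pose phi l (j : nat) : R := if j == l then h%:num ^+ l else 0.
have phi0 l j : 0 <= phi l j by rewrite /phi; case: ifP => // _; exact: exprn_ge0.
rewrite /scaled_kappa /kappa asboolT//.
have -> : (\sum_(1 <= l < k.+1) \sum_(0 <= m < (dmax k l).+1)
      \int[lebesgue_measure]_(s in `]0%R, t])
        ((h%:num ^+ l)%:E *
         \sum_(I : {set 'I_(card (conf h (path_of xi s)))} | #|I| == l)
           P s (subconf I) [set y | U (subconf I, y) /\ SXn m y]))%E =
  (\sum_(1 <= l < k.+1) \sum_(0 <= m < (dmax k l).+1)
      \int[lebesgue_measure]_(s in `]0%R, t]) kernel_sum (phi l) (V m) s (Y s xi))%E.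
  apply: eq_big_nat => l /andP[l1 lk]; apply: eq_bigr => m _; apply: eq_integral => s.
  rewrite inE/= in_itv/= => /andP[s0 st].
  have sT : 0 <= s <= T by rewrite (ltW s0) (le_trans st).
  rewrite -(configurationE h Nxi sT) /kernel_sum ge0_sume_distrr// big_mkcond; apply: eq_bigr => I _.
  rewrite /phi; case: eqP => [Il|_]; last by rewrite mul0e.
  rewrite PkE//; first exact: (configuration_mem T0 HN).
  by rewrite Il l1.
have mks l m : measurable_fun (`]0%R, t]%classic : set (measurableTypeR R))
    (fun s : measurableTypeR R => kernel_sum (phi l) (V m) s (Y s xi)).
  by apply: measurable_funTS; exact: measurable_kernel_sum.
under eq_bigr => l _.
  rewrite -ge0_integral_sum//; [|by move=> m s _; exact: kernel_sum_ge0].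
  over.
rewrite -ge0_integral_sum//; last 2 first.
- by move=> l; apply: emeasurable_sum => m; exact: mks.
- by move=> l s _; apply: sume_ge0 => m _; exact: kernel_sum_ge0.
transitivity ((h%:num^-1)%:E * \int[lebesgue_measure]_(s in `]0%R, t])
    ((h%:num)%:E * kernel_rate U s (Y s xi)))%E.
  congr (_ * _)%E; apply: eq_integral => s; rewrite inE/= in_itv/= => /andP[s0 st].
  have sT : 0 <= s <= T by rewrite (ltW s0) (le_trans st).
  have KY := configuration_mem T0 HN s Nxi.
  have step l : (1 <= l <= k)%N -> (\sum_(0 <= m < (dmax k l).+1) kernel_sum (phi l) (V m) s (Y s xi) =
      \sum_(I : {set 'I_(card (Y s xi))} | #|I| == l)
        (h%:num ^+ #|I|)%:E * P s (subconf I) [set y : S | U (subconf I, y)])%E.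
    move=> lk; rewrite /kernel_sum exchange_big/= [RHS]big_mkcond; apply: eq_bigr => I _.
    rewrite /phi; have [Il|_] := eqVneq #|I| l; last by rewrite big1// => m _; rewrite mul0e.
    have Ik : (1 <= #|I| <= k)%N by rewrite Il.
    rewrite -ge0_sume_distrr// Il; congr (_ * _)%E.
    have P0 : P s (subconf I) (~` [set y | (card y <= dmax k l)%N]) = 0%E.
      by have := Pd (x := subconf I) sT; rewrite card_subconf Il lk; exact.
    have mA := measurable_section (subconf I) mU.
    rewrite -[RHS]fineK ?fin_num_measure// -(measure_card_sum mA P0) -sumEFin.
    apply: eq_bigr => m _; rewrite PkE// fineK ?fin_num_measure//.
      by rewrite setIC.
    by apply: measurableI => //; exact: (@measurable_card_eq R).
  transitivity (\sum_(1 <= l < k.+1) \sum_(I : {set 'I_(card (Y s xi))} | #|I| == l)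
        (h%:num ^+ #|I|)%:E * P s (subconf I) [set y : S | U (subconf I, y)])%E.
    by apply: eq_big_nat => l; rewrite ltnS; exact: step.
  rewrite (@big_card_range _ _ k (fun I : {set 'I_(card (Y s xi))} =>
    (h%:num ^+ #|I|)%:E * P s (subconf I) [set y : S | U (subconf I, y)])%E).
  rewrite /kernel_rate ge0_sume_distrr; last by move=> I _; rewrite mule_ge0// lee_fin exprn_ge0.
  apply: eq_bigr => I /andP[I1 _].
  by rewrite muleA -EFinM -exprS prednK.
have mkr : measurable_fun (`]0%R, t]%classic : set (measurableTypeR R))
    (fun s : measurableTypeR R => kernel_rate U s (Y s xi)).
  have H := measurable_kernel_sum jump_weight_ge0 mU Nxi.
  apply: eq_measurable_fun (measurable_funTS H) => s; rewrite inE/= in_itv/= => /andP[s0 st].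
  rewrite kernel_rateE//; last exact: (configuration_mem T0 HN).
  by rewrite (ltW s0) (le_trans st).
rewrite ge0_integralZl//; last by move=> s _; apply: sume_ge0 => I _; rewrite mule_ge0// lee_fin exprn_ge0.
by rewrite muleA -EFinM mulVf ?gt_eqF// mul1e.
Qed.

Local Notation J := (g_sigma_algebraType Alg).
Local Notation RJ := (measurableTypeR R * J)%type.
Local Notation strip := (`]0, T]%classic `*` J0 : set RJ).

Lemma measurable_to_jumps : measurable_fun [set: SS] (fun p : SS => p : J).
Proof.
move=> mD; apply: (@measurability _ _ SS J setT _ Alg) => // _ [U AU <-].
by rewrite setTI; exact: (jump_algebra_measurable Hd AU).
Qed.

Lemma measurable_jump_point (r : measurableTypeR R) (z : S) :
  measurable_fun [set: S] (fun y : S => (r, (z, y)) : RJ).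
Proof.
apply: measurable_fun_pair; first exact: measurable_cst.
exact: (measurableT_comp measurable_to_jumps (g := fun y : S => (z, y)) (measurable_pair1 z)).
Qed.

Definition jump_point_measure (w : measurableTypeR R * SS) : {measure set RJ -> \bar R} :=
  mscale (NngNum (jump_weight_ge0 (card w.2.1)))
    (image_measure (Pk (w.1, w.2.1)) (measurable_jump_point w.1 w.2.1)).

Lemma jump_point_measureE w B : jump_point_measure w B =
  ((jump_weight (card w.2.1))%:E * Pk (w.1, w.2.1) [set y : S | B (w.1, (w.2.1, y))])%E.
Proof. by []. Qed.

Lemma measurable_jump_point_measure B : measurable B ->
  measurable_fun [set: measurableTypeR R * SS] (jump_point_measure ^~ B).
Proof.
move=> mB; pose D : set (RS * S) := [set p | B (p.1.1, (p.1.2, p.2))].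
have mD : measurable D.
  have mf : measurable_fun setT (fun p : RS * S => (p.1.1, (p.1.2, p.2)) : RJ).
    apply: measurable_fun_pair; first exact: measurableT_comp.
    apply: (measurableT_comp measurable_to_jumps (g := fun p : RS * S => (p.1.2, p.2))).
    by apply: measurable_fun_pair => //; exact: measurableT_comp.
  by rewrite -[X in measurable X]setTI; exact: mf.
apply: emeasurable_funM.
  apply/measurable_EFinP.
  have mphi : measurable_fun [set: S] (fun x : S => jump_weight (card x)).
    apply: measurable_borel_continuous; apply: SX_continuous => j.
    rewrite (_ : _ \o _ = fun=> jump_weight j); first exact: cst_continuous.
    by apply/funext => v; rewrite /= card_unordered.
  by apply: (measurableT_comp mphi); exact: measurableT_comp.
have mf : measurable_fun setT (fun p : measurableTypeR R * SS =>
    ((p.1, p.2.1) : RS, (p.1, p.2.1) : RS)).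
  have m1 : measurable_fun setT (fun p : measurableTypeR R * SS => (p.1, p.2.1) : RS).
    by apply: measurable_fun_pair => //; exact: measurableT_comp.
  exact: measurable_fun_pair.
exact: (measurableT_comp (measurable_kernel_section Pk mD) mf).
Qed.

Lemma jump_point_measure_uub : measure_fam_uub jump_point_measure.
Proof.
have [b Hb] := measure_uub Pk; exists ((1 + h%:num) ^+ k * b + 1) => w.
have b0 : 0 <= b.
  by rewrite -lee_fin; apply: le_trans (ltW (Hb (0, point))); exact: measure_ge0.
apply: (@le_lt_trans _ _ (((1 + h%:num) ^+ k * b)%:E)); last by rewrite lte_fin ltrDl.
rewrite jump_point_measureE EFinM; apply: lee_pmul => //.
- by rewrite lee_fin jump_weight_ge0.
- rewrite lee_fin /jump_weight; case: ifP => [/andP[_ zk]|_]; last by rewrite exprn_ge0// addr_ge0.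
  apply: (@le_trans _ _ ((1 + h%:num) ^+ (card w.2.1).-1)).
    by apply: lerXn2r; rewrite ?nnegrE ?addr_ge0// lerDr.
  apply: ler_weXn2l; first by rewrite lerDl.
  exact: leq_trans (leq_pred _) zk.
- by apply: ltW; rewrite (_ : [set y | _] = setT).
Qed.

Definition jump_point_kernel : R.-fker (measurableTypeR R * SS)%type ~> RJ :=
  finite_kernel measurable_jump_point_measure jump_point_measure_uub.

Definition path_split (xi : Om) (r : measurableTypeR R) : {measure set SS -> \bar R} :=
  truncated_split R n ((r, Y r xi) : RS).

Lemma measurable_path_split xi U : measurable U ->
  measurable_fun [set: measurableTypeR R] (path_split xi ^~ U).
Proof.
move=> mU; have mf : measurable_fun setT (fun r : measurableTypeR R => (r, Y r xi) : RS).
  by apply: measurable_fun_pair => //; exact: measurable_configuration_path.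
exact: (measurableT_comp (measurable_truncated_split Hd n mU) mf).
Qed.

Lemma path_split_uub xi : measure_fam_uub (path_split xi).
Proof.
by have [b Hb] := @truncated_split_uub R X n _ (measurableTypeR R); exists b => r; exact: Hb.
Qed.

Definition path_jump_kernel (xi : Om) : measurableTypeR R -> {measure set RJ -> \bar R} :=
  mkcomp (finite_kernel (measurable_path_split xi) (path_split_uub xi)) jump_point_kernel.

Lemma measurable_path_jump_kernel xi B : measurable B ->
  measurable_fun (`]0, T]%classic : set (measurableTypeR R)) (path_jump_kernel xi ^~ B).
Proof.
move=> mB; apply: measurable_funTS.
exact: KCOMP_FINITE_KERNEL.measurable_fun_kcomp_finite.
Qed.

Lemma path_jump_kernelE xi r B : measurable B -> ~ N xi -> path_jump_kernel xi r B =
  kernel_sum jump_weight [set p | B (r, p)] r (Y r xi).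
Proof.
move=> mB Nxi; rewrite /path_jump_kernel /= /kcomp finite_kernelE /path_split /truncated_split/=.
rewrite (Kn (configuration_mem T0 HN r Nxi)) integral_split_measure//; last first.
  exact: (measurableT_comp (measurable_jump_point_measure mB) (measurable_pair1 r)).
by apply: eq_bigr => I _; rewrite -[LHS]/(jump_point_measure
  (r, (subconf I, (Y r xi `\` subconf I)%mset)) B) jump_point_measureE/= card_subconf.
Qed.

Lemma measurable_strip : measurable strip.
Proof.
by apply: measurableX => //; apply: sub_sigma_algebra; exact: jump_algebraT.
Qed.

(** Restricted to the strip because the kernel may also charge jumps outside J0, and set to zero on
    N. *)
Definition compensator_measure (xi : Om) : {measure set RJ -> \bar R} :=
  if `[< N xi >] then (mzero : {measure set RJ -> \bar R}) else
  mrestr (@mixture_measure _ _ (measurableTypeR R) RJ R lebesgue_measure `]0, T]%classic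
    (path_jump_kernel xi) (measurable_itv _) (@measurable_path_jump_kernel xi)) measurable_strip.

Lemma clamp_itv t : `]-oo, t]%classic `&` `]0, T]%classic = `]0, clamp T t]%classic :> set R.
Proof.
apply/seteqP; split => r /=; rewrite !in_itv/= /clamp le_min le_max.
  by move=> [-> /andP[-> ->]]; rewrite orbT.
by move=> /andP[r0 /andP[rT /orP[|rt]]]; [rewrite leNgt r0|rewrite r0 rT rt].
Qed.

Lemma compensator_measure_off xi B : ~ N xi -> compensator_measure xi B =
  (\int[lebesgue_measure]_(r in `]0%R, T]%classic) path_jump_kernel xi r (B `&` strip))%E.
Proof. by move=> Nxi; rewrite /compensator_measure asboolF. Qed.

(** Half-lines rather than ]0, t] match the generating sets of [measurable_measures]; the
    restriction to the strip produces the clamped time. *)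
Lemma compensator_measureE xi t U : ~ N xi -> Alg U ->
  compensator_measure xi (`]-oo, t]%classic `*` U) =
  (comp (displacement U) 0 (clamp T t) xi)%:E.
Proof.
move=> Nxi AU; rewrite (compensator_measure_off _ Nxi) -setXI clamp_itv.
rewrite (setIidl (jump_algebra_sub AU)).
have cT := clamp_range T0 t; have /andP[_ cT'] := cT.
rewrite -integral_kernel_rate// integral_mkcond [RHS]integral_mkcond.
apply: eq_integral => r _; rewrite !patchE.
have mB : measurable (`]0, clamp T t]%classic `*` U : set RJ).
  by apply: measurableX => //; exact: sub_sigma_algebra.
case: ifPn => [/set_mem/=|]; rewrite ?in_itv/=; last first.
  move=> /negP rT; case: ifPn => // /set_mem /=; rewrite in_itv/= => /andP[r0 rt].
  by exfalso; apply: rT; apply/mem_set; rewrite /= in_itv/= r0 (le_trans rt).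
move=> /andP[r0 rT]; rewrite path_jump_kernelE//.
have rT' : 0 <= r <= T by rewrite (ltW r0).
case: ifPn => [/set_mem/=|/negP rt].
  rewrite in_itv/= => rt; rewrite kernel_rateE//; last exact: (configuration_mem T0 HN).
  by congr (kernel_sum _ _ _ _); apply/seteqP; split => [p []//|p Up]; split => //=; rewrite in_itv.
rewrite (_ : [set p | _] = set0); first by apply: big1 => I _; rewrite measure0 mule0.
apply/seteqP; split => // p [/= h1 _]; apply: rt; exact/mem_set.
Qed.

Definition jump_list (xi : Om) : seq R :=
  [seq r <- undup (jump_times pure xi) | (0 < r <= T) &&
     `[< jump_in (Y^~ xi) (displacement J0) r >]].

(* A member of J0 with the displacement of the jump at time r. *)
Definition jump_representative (xi : Om) (r : R) : SX X * SX X :=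
  get [set p | J0 p /\ exists2 e, 0 < e & forall u, r - e < u < r ->
    (Y r xi `+` p.1)%mset = (Y u xi `+` p.2)%mset].

Definition counting_measure (xi : Om) : {measure set RJ -> \bar R} :=
  if `[< N xi >] then (mzero : {measure set RJ -> \bar R}) else
  msum (fun i => \d_((nth 0 (jump_list xi) i, jump_representative xi (nth 0 (jump_list xi) i)) : RJ))
    (size (jump_list xi)).

(** Members of J0 with a common displacement are all in U or all outside U, so the choice of a
    representative is immaterial on the algebra. *)
Lemma jump_representativeP xi r U : Alg U ->
  jump_in (Y^~ xi) (displacement J0) r ->
  J0 (jump_representative xi r) /\ (U (jump_representative xi r) <-> jump_in (Y^~ xi) (displacement U) r).
Proof.
move=> AU; have pl := svalP (cid (pure xi)).
have [e e0 He] := left_constant pl r; pose u := r - e / 2.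
have ur : r - e < u < r by apply/andP; split; rewrite /u; lra.
move=> /(jump_inP _ e0 He ur)/(displacementP Hd dsep)[p Jp ep].
have : J0 (jump_representative xi r) /\ exists2 e, 0 < e & forall u, r - e < u < r ->
    (Y r xi `+` (jump_representative xi r).1)%mset = (Y u xi `+` (jump_representative xi r).2)%mset.
  apply: (@getPex _ [set p | J0 p /\ exists2 e, 0 < e & forall u, r - e < u < r ->
    (Y r xi `+` p.1)%mset = (Y u xi `+` p.2)%mset]).
  by exists p; split => //; exists e => // v vr; rewrite (He v u).
set p0 := jump_representative xi r => -[Jp0 [e' e'0 He']]; split => //.
have e0' : (Y r xi `+` p0.1)%mset = (Y u xi `+` p0.2)%mset.
  have m0 : 0 < Num.min e e' by rewrite lt_min e0.
  have m1 : Num.min e e' <= e by rewrite ge_min lexx.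
  have m2 : Num.min e e' <= e' by rewrite ge_min lexx orbT.
  rewrite (He u (r - Num.min e e' / 2))//; last by apply/andP; split; lra.
  by apply: He'; apply/andP; split; lra.
split=> [Up0|/(jump_inP _ e0 He ur)/(displacementP Hd dsep)[p1 Up1 ep1]].
  by apply/(jump_inP _ e0 He ur)/(displacementP Hd dsep); exists p0.
apply: (displacement_sat J0j AU Jp0); apply/(displacementP Hd dsep); exists p1 => //.
apply/msetP => b; move/msetP: e0' => /(_ b); move/msetP: ep1 => /(_ b).
by rewrite /= !msetE2; lia.
Qed.

Lemma counting_measureE xi t U : ~ N xi -> Alg U ->
  counting_measure xi (`]-oo, t]%classic `*` U) =
  (jump_number pure (displacement U) 0 (clamp T t) xi)%:E.
Proof.
move=> Nxi AU; rewrite /counting_measure asboolF//.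
pose x0 i : RJ := (i, jump_representative xi i).
pose B : set RJ := `]-oo, t]%classic `*` U.
transitivity (\sum_(i < size (jump_list xi)) (\d_(x0 (nth 0%R (jump_list xi) i)) B : \bar R))%E => //.
rewrite -(big_mkord xpredT (fun i => \d_(x0 (nth 0%R (jump_list xi) i)) B : \bar R)).
rewrite -(big_nth 0%R xpredT (fun r => \d_(x0 r) B : \bar R)) /jump_list big_filter.
rewrite /jump_number /jumps_between /num_jumps natr_sum -sumEFin.
rewrite big_mkcond [RHS]big_mkcond; apply: eq_bigr => r _; rewrite diracE.
have cl : (0 < r <= clamp T t) = (0 < r <= T) && (r <= t).
  have := clamp_itv t => /seteqP[h1 h2].
  apply/idP/idP => [hr|/andP[hT ht]].
    by have := h2 r; rewrite /= !in_itv/= => /(_ hr)[-> ->].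
  by have := h1 r; rewrite /= !in_itv/=; apply; split.
rewrite cl; have [rT|//] := boolP (0 < r <= T).
case: asboolP => [jr|njr]; last first.
  rewrite /= asboolF ?if_same//.
  move=> [e e0 He]; apply: njr; exists e => // u /He.
  by apply: displacement_mono; exact: jump_algebra_sub AU.
have [_ Uiff] := jump_representativeP AU jr.
rewrite /=; case: ifPn => rt.
  congr (_%:R%:E); congr nat_of_bool; apply/idP/asboolP => [/set_mem[_ /= /Uiff]//|/Uiff Ur].
  by apply/mem_set; split => //=; rewrite in_itv.
by rewrite memNset// => -[]; rewrite /= in_itv/= (negbTE rt).
Qed.

End rate_identification.

Lemma integral_mono_domain d (T : measurableType d) (R : realType)
    (mu : {measure set T -> \bar R}) (A B : set T) (f : T -> \bar R) :
  A `<=` B -> (forall x, 0 <= f x)%E ->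
  (\int[mu]_(x in A) f x <= \int[mu]_(x in B) f x)%E.
Proof.
move=> AB f0; rewrite integral_mkcond [leRHS]integral_mkcond.
apply: (le_integral_ae measurable0 (measure0 mu)) => x _ *; rewrite ?patchE; try by case: ifP.
case: ifPn => [/set_mem/AB Bx|_]; first by rewrite mem_set.
by case: ifP.
Qed.

(** Holds on every path, including those of the null set where kappa has no measurable version at
    hand: [predictable_nondecreasing] asks for monotonicity everywhere. *)
Lemma scaled_kappa_mono (R : realType) (X : ptopologicalType) k (T : R) (h : {posnum R})
    (P : R -> SX X -> Mplus R (SX X)) (xi : skorokhod X T) s t (U : set (SX X * SX X)) :
  s <= t -> (scaled_kappa k h P xi s U <= scaled_kappa k h P xi t U)%E.
Proof.
move=> st; rewrite /scaled_kappa /kappa; case: asboolP => // _.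
apply: lee_pmul => //.
- by apply: sume_ge0 => l _; apply: sume_ge0 => m _; apply: integral_ge0 => r _;
    rewrite mule_ge0// ?lee_fin ?exprn_ge0// sume_ge0.
- apply: lee_sum => l _; apply: lee_sum => m _; apply: integral_mono_domain => r.
    by rewrite /= !in_itv/= => /andP[-> /le_trans ->].
  by rewrite mule_ge0// ?lee_fin ?exprn_ge0// sume_ge0.
Qed.

(** * The martingale measure and its covariation *)

Section conclusion.
Context (R : realType) (X : ptopologicalType) (d : X -> X -> R) (a : nat -> X).
Hypothesis Hd : sep_metric d a.
Hypothesis dsep : forall b c, d b c = 0 -> b = c.
Variables (k n : nat) (T : R) (h : {posnum R}).
Hypothesis k1 : (1 <= k)%N.
Hypothesis T0 : 0 < T.
Variable P : R -> SX X -> Mplus R (SX X).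
Hypothesis Pd : forall t x, 0 <= t <= T -> (1 <= card x <= k)%N ->
  P t x (~` [set y | (card y <= dmax k (card x))%N]) = 0%E.
Variable J0 : set (SX X * SX X).
Hypothesis J0s : jump_space k T P J0.

Local Notation S := (borel (SX X)).
Local Notation SS := (S * S)%type.
Local Notation RS := (measurableTypeR R * S)%type.
Local Notation Om := (skorokhod X T).
Local Notation Alg := (jump_algebra R k J0).

Variables (mu0 : Mplus R X) (PP : probability (skorokhod X T) R).
Hypothesis law : markov_jump_law k h P mu0 PP.
Variables (K : set (SX X)) (N : set Om).
Hypothesis mN : measurable N.
Hypothesis N0 : PP N = 0%E.
Hypothesis HN : forall xi, ~ N xi -> [/\ Mhdelta_valued h xi, pure_jump xi &
  forall t, 0 <= t <= T -> K (conf h (path_of xi t))].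
Hypothesis Kn : forall x, K x -> (card x <= n)%N.

Variables (q Pk : R.-fker RS ~> S) (C0 : R).
Hypothesis C00 : 0 <= C0.
Hypothesis q_le : forall p, (q p setT <= C0%:E)%E.
Hypothesis qE : forall r x (B : set S), 0 <= r <= T -> K x -> measurable B ->
  q (r, x) B = (\sum_(I : {set 'I_(card x)} | (1 <= #|I| <= k)%N)
    (h%:num ^+ #|I|.-1)%:E * P r (subconf I) [set y : S | B ((x `\` subconf I) `+` y)%mset])%E.
Hypothesis PkE : forall r x (I : {set 'I_(card x)}) (B : set S), 0 <= r <= T -> K x ->
  (1 <= #|I| <= k)%N -> Pk (r, subconf I) B = P r (subconf I) B.

Local Notation Y := (configuration h N).
Local Notation F := (@right_filtration R X T).
Local Notation G := (completion PP F).
Local Notation pure := (configuration_pure Hd dsep T0 HN).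
Local Notation disp := (displacement R).
Local Notation Nt := (fun t U xi => compensated_count k h P xi t U).
Local Notation Kt := (fun t U xi => scaled_kappa k h P xi t U).
Local Notation Nc := (fun t U xi => jump_count h xi t U).

Let J0j : J0 `<=` jumps k. Proof. by case: J0s. Qed.
Let J0b : borelJ J0. Proof. by case: J0s. Qed.
Let J0sb : borelJ (saturation R k J0). Proof. by case: J0s. Qed.
Let J0n : forall p, J0 p -> p.1 <> p.2. Proof. by case: J0s. Qed.

Let Fsig := @right_filtration_sigma R X T.
Let Ysig := completion_sigma_algebra PP Fsig.
Let Ymono := @completion_mono R _ Om PP F (@right_filtration_mono R X T).
Let Ymeas := @completion_measurable R _ Om PP F.
Let Yad := @configuration_adapted R X d a Hd dsep T h T0 PP K N mN N0 HN.
Let mdiag := measurable_diagonal Hd dsep.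
Let mart := @configuration_martingale R X d a Hd dsep k T h P Pd T0 mu0 PP law q C0 K q_le qE N mN N0 HN.

Local Notation comp U := (compensation Y q (disp U)).
Local Notation count U := (jump_number pure (disp U)).
Local Notation M U := (compensated_jumps pure q (disp U)).

Let jm := @jumps_martingale R _ Om PP _ S T G Ysig Ymono Ymeas Y Yad pure q C0 C00 q_le mdiag
  mart (ltW T0).
Let jc := @jumps_covariation R _ Om PP _ S T G Ysig Ymono Ymeas Y Yad pure q C0 C00 q_le mdiag
  mart (ltW T0).
Let im := @integrable_compensated_jumps R _ Om PP _ S T G Ysig Ymono Ymeas Y Yad pure q C0 C00 q_le
  mdiag mart (ltW T0).
Let imM := @integrable_compensated_jumpsM R _ Om PP _ S T G Ysig Ymono Ymeas Y Yad pure q C0 C00 q_le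
  mdiag mart (ltW T0).
Let ic := @integrable_compensation R _ Om PP _ S G Ysig Ymono Ymeas Y Yad pure q C0 C00 q_le.
Let mcomp := @measurable_compensation R _ Om _ S G Ysig Ymono Y Yad pure q C0 q_le.
Let mcount := @measurable_jump_number R _ Om _ S G Ysig Ymono Y Yad pure.
Let comp_le := @compensation_le R _ Om _ S G Ysig Ymono Y Yad pure q C0 q_le.
Let compD := @compensationD R _ Om _ S G Ysig Ymono Y Yad pure q C0 q_le.

Let mD U : Alg U -> measurable (disp U : set SS).
Proof. exact: (displacement_measurable Hd dsep k1 J0j J0n). Qed.

Let oD U : Alg U -> off_diagonal (disp U : set SS).
Proof. exact: (displacement_off_diagonal Hd dsep k1 J0n). Qed.

Let KtE xi t U : ~ N xi -> 0 <= t <= T -> Alg U -> Kt t U xi = (comp U 0 t xi)%:E.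
Proof. exact: (kappaE Hd dsep k1 T0 Pd J0s mN N0 HN Kn q_le qE PkE). Qed.

Let NcE xi t U : ~ N xi -> 0 <= t <= T -> Alg U -> Nc t U xi = (count U 0 t xi)%:E.
Proof. exact: jump_countE. Qed.

Let NtE xi t U : ~ N xi -> 0 <= t <= T -> Alg U -> Nt t U xi = (M U t xi)%:E.
Proof. by move=> Nxi tT AU; rewrite /compensated_count NcE// KtE. Qed.

Let GF s A : F s A -> G s A.
Proof.
move=> FA; split; first exact: (right_filtration_measurable Hd T0) FA.
by exists A => //; rewrite setDv setU0; exact: negligible_set0.
Qed.

Let GN t : G t N.
Proof.
split => //; exists set0; first by have [] := Fsig t.
by exists N; split => // w [[]|[]].
Qed.

(** Transfers the martingale property from a real-valued version f to the process g, which is known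
    only off N and need not be measurable there. *)
Lemma version_martingale (f : R -> Om -> R) (g : R -> Om -> \bar R) :
  (forall t, 0 <= t <= T ->
     measurable_fun [set: g_sigma_algebraType (G t)] (f t : g_sigma_algebraType (G t) -> R)) ->
  (forall t A, 0 <= t <= T -> measurable A -> PP.-integrable A (EFin \o f t)) ->
  (forall s t A, 0 <= s -> s <= t -> t <= T -> G s A ->
     \int[PP]_(w in A) f t w = \int[PP]_(w in A) f s w) ->
  (forall w t, ~ N w -> 0 <= t <= T -> g t w = (f t w)%:E) ->
  martingale PP T F g.
Proof.
move=> mf intf ef gf; split.
- move=> t tT; apply: (wrt_augmented Fsig mN N0 (f := fun w => (f t w)%:E)).
    by apply/measurable_EFinP; exact: mf.
  by move=> w Nw; rewrite gf.
- move=> t tT; rewrite (@eq_integral_ae _ _ _ PP setT N mN N0 _ (fun w => `|(f t w)%:E|%E)).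
    by have /integrableP[] := intf t setT tT measurableT.
  by move=> w _ Nw; rewrite gf.
- move=> s t A s0 st tT FA; have [mA _] := GF FA.
  have t0 := le_trans s0 st; have sT := le_trans st tT.
  have e u : 0 <= u <= T -> (\int[PP]_(w in A) g u w = (\int[PP]_(w in A) f u w)%:E)%E.
    move=> uT; rewrite (@eq_integral_ae _ _ _ PP A N mN N0 _ (fun w => (f u w)%:E)); last first.
      by move=> w _ Nw; rewrite gf.
    by rewrite /Rintegral fineK//; exact: (integrable_fin_num mA (intf u A uT mA)).
  rewrite e ?t0// e ?s0//; congr EFin; apply: ef => //; exact: GF.
Qed.

Let mM U t : Alg U -> 0 <= t <= T ->
  measurable_fun [set: g_sigma_algebraType (G t)] (M U t : g_sigma_algebraType (G t) -> R).
Proof.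
move=> AU /andP[t0 tT]; apply: measurable_funB.
  by apply: mcount => //; [exact: mD|exact: oD].
by apply: mcomp => //; exact: mD.
Qed.

Lemma compensated_martingale U : Alg U -> martingale PP T F (fun t => Nt t U).
Proof.
move=> AU; apply: (@version_martingale (M U)).
- by move=> t; exact: mM.
- by move=> t A /andP[t0 tT] mA; apply: im => //; [exact: mD|exact: oD].
- by move=> s t A s0 st tT GA; apply: jm => //; [exact: mD|exact: oD].
- by move=> w t Nw tT; rewrite NtE.
Qed.

Lemma covariation_martingale U V : Alg U -> Alg V ->
  martingale PP T F (fun t w => Nt t U w * Nt t V w - Kt t (U `&` V) w)%E.
Proof.
move=> AU AV; have AI := jump_algebraI J0j AU AV.
have eI : disp U `&` disp V = disp (U `&` V) := displacementI J0j AU AV.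
apply: (@version_martingale (fun t w => M U t w * M V t w - comp (U `&` V) 0 t w)).
- move=> t tT; apply: measurable_funB; first by apply: measurable_funM; exact: mM.
  by case/andP: tT => t0 _; apply: mcomp => //; exact: mD.
- move=> t A /andP[t0 tT] mA.
  have i1 : PP.-integrable A (EFin \o (fun w => M U t w * M V t w)).
    by apply: imM => //; [exact: mD|exact: oD|exact: mD|exact: oD].
  have i2 : PP.-integrable A (EFin \o comp (U `&` V) 0 t) by apply: ic => //; exact: mD.
  exact: (integrableB mA i1 i2).
- move=> s t A s0 st tT GA; rewrite -eI.
  by apply: jc => //; [exact: mD|exact: oD|exact: mD|exact: oD].
- by move=> w t Nw tT; rewrite !NtE// KtE// -EFinM -EFinB.
Qed.

Lemma comp_set0 t w : comp set0 0 t w = 0.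
Proof.
rewrite /compensation (_ : (fun r => rate Y q (disp set0) r w) = cst 0%E).
  by rewrite integral_cst// mul0e.
apply/funext => r; rewrite /rate (_ : [set x | _] = set0) ?measure0//.
by apply/seteqP; split => // x [p []].
Qed.

(** Disjoint sets of the algebra have disjoint displacement sets, so the compensation in
    [jumps_covariation] is that of the empty set. *)
Lemma orthogonality U V : Alg U -> Alg V -> U `&` V = set0 ->
  martingale PP T F (fun t w => Nt t U w * Nt t V w)%E.
Proof.
move=> AU AV UV; have AI := jump_algebraI J0j AU AV.
have eI : disp U `&` disp V = disp (U `&` V) := displacementI J0j AU AV.
apply: (@version_martingale (fun t w => M U t w * M V t w)).
- by move=> t tT; apply: measurable_funM; exact: mM.
- move=> t A /andP[t0 tT] mA.
  by apply: imM => //; [exact: mD|exact: oD|exact: mD|exact: oD].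
- move=> s t A s0 st tT GA.
  have := jc (mD AU) (oD AU) (mD AV) (oD AV) s0 st tT GA.
  rewrite eI UV; under eq_Rintegral do rewrite comp_set0 subr0.
  by under [in X in _ = X -> _]eq_Rintegral do rewrite comp_set0 subr0.
- by move=> w t Nw tT; rewrite !NtE// -EFinM.
Qed.

Lemma comp00 U w : comp U 0 0 w = 0.
Proof. by rewrite /compensation set_itvoc0 integral_set0. Qed.

(** The covariation identity with both sets equal to U, between the times 0 and t. *)
Lemma sqnormE U t : Alg U -> 0 <= t <= T ->
  sqnorm PP (Nt t U) = (\int[PP]_w (comp U 0 t w)%:E)%E.
Proof.
move=> AU tT; have /andP[t0 tT'] := tT; rewrite /sqnorm.
rewrite (@eq_integral_ae _ _ _ PP setT N mN N0 _ (fun w => (M U t w * M U t w)%:E)); last first.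
  by move=> w _ Nw; rewrite NtE.
have i1 : PP.-integrable setT (EFin \o (fun w => M U t w * M U t w)).
  by apply: imM => //; [exact: mD|exact: oD|exact: mD|exact: oD].
have i2 : PP.-integrable setT (EFin \o comp U 0 t) by apply: ic => //; exact: mD.
have GT : G 0 setT by apply: GF; have [A0 AD _] := Fsig 0; rewrite -setC0 -setTD; exact: AD.
have := jc (mD AU) (oD AU) (mD AU) (oD AU) (lexx 0) t0 tT' GT.
rewrite setIid (RintegralB measurableT i1 i2) => H.
have {}H : \int[PP]_w (M U t w * M U t w) - \int[PP]_w comp U 0 t w = 0.
  rewrite H (_ : (fun w => _) = cst 0).
    by rewrite Rintegral_cst// mul0r.
  by apply/funext => w; rewrite compensated_jumps0 comp00 mul0r subr0.
move/eqP: H; rewrite subr_eq0 => /eqP H; have := congr1 EFin H.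
rewrite /Rintegral !fineK//; [exact: (integrable_fin_num measurableT i2)|].
exact: (integrable_fin_num measurableT i1).
Qed.

Lemma comp_le_max U t w : Alg U -> 0 <= t <= T -> 0 <= comp U 0 t w <= C0 * T.
Proof.
move=> AU /andP[t0 tT]; rewrite compensation_ge0/=.
apply: le_trans (comp_le _ (mD AU) (lexx 0) t0) _.
by rewrite subr0; exact: ler_wpM2l.
Qed.

Lemma sqnorm_le U t : Alg U -> 0 <= t <= T -> (sqnorm PP (Nt t U) <= (C0 * T)%:E)%E.
Proof.
move=> AU tT; rewrite sqnormE//; apply: (@le_trans _ _ (\int[PP]_w (C0 * T)%:E)%E).
  apply: (le_integral_ae measurable0 (measure0 PP)) => w *;
    have /andP[c0 cT] := comp_le_max w AU tT; by rewrite ?lee_fin// (le_trans c0).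
by rewrite integral_cst// [X in (_ * X)%E](_ : _ = 1%E) ?mule1//; exact: probability_setT.
Qed.

Local Notation CM := (compensator_measure Hd dsep n T0 J0s mN N0 HN Pk).
Local Notation NM := (counting_measure Hd dsep k T0 J0 HN).
Local Notation J := (g_sigma_algebraType Alg).
Local Notation RJ := (measurableTypeR R * J)%type.
Local Notation strip := (`]0, T]%classic `*` J0 : set RJ).

Let CME xi t U : ~ N xi -> Alg U ->
  CM xi (`]-oo, t]%classic `*` U) = (comp U 0 (clamp T t) xi)%:E.
Proof. exact: (compensator_measureE Hd dsep k1 T0 Pd J0s mN N0 HN Kn q_le qE PkE). Qed.

Let NME xi t U : ~ N xi -> Alg U ->
  NM xi (`]-oo, t]%classic `*` U) = (count U 0 (clamp T t) xi)%:E.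
Proof. exact: (counting_measureE Hd dsep k1 T0 J0s HN). Qed.

Let mX t U : Alg U -> measurable (`]-oo, t]%classic `*` U : set RJ).
Proof. by move=> AU; apply: measurableX => //; exact: sub_sigma_algebra. Qed.

(** Additivity is read off the random measure, whose values on products of ]-oo, t] with sets of the
    algebra are the compensations. *)
Lemma compU U V t w : ~ N w -> 0 <= t <= T -> Alg U -> Alg V -> U `&` V = set0 ->
  comp (U `|` V) 0 t w = comp U 0 t w + comp V 0 t w.
Proof.
move=> Nw tT AU AV UV; have H W : Alg W -> (comp W 0 t w)%:E = CM w (`]-oo, t]%classic `*` W).
  by move=> AW; rewrite CME// clamp_id.
apply: EFin_inj; rewrite EFinD !H//; last exact: jump_algebraU.
rewrite (_ : _ `*` (U `|` V) = (`]-oo, t]%classic `*` U) `|` (`]-oo, t]%classic `*` V)).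
  by rewrite measureU//; [exact: mX|exact: mX|rewrite -setXI UV setX0].
by apply/seteqP; split => p /= => [[h1 [Up|Vp]]|[[h1 Up]|[h1 Vp]]]; [left|right|split=> //; left|split=> //; right].
Qed.

Lemma countU U V t w : ~ N w -> 0 <= t <= T -> Alg U -> Alg V -> U `&` V = set0 ->
  count (U `|` V) 0 t w = count U 0 t w + count V 0 t w.
Proof.
move=> Nw tT AU AV UV; have H W : Alg W -> (count W 0 t w)%:E = NM w (`]-oo, t]%classic `*` W).
  by move=> AW; rewrite NME// clamp_id.
apply: EFin_inj; rewrite EFinD !H//; last exact: jump_algebraU.
rewrite (_ : _ `*` (U `|` V) = (`]-oo, t]%classic `*` U) `|` (`]-oo, t]%classic `*` V)).
  by rewrite measureU//; [exact: mX|exact: mX|rewrite -setXI UV setX0].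
by apply/seteqP; split => p /= => [[h1 [Up|Vp]]|[[h1 Up]|[h1 Vp]]]; [left|right|split=> //; left|split=> //; right].
Qed.

Lemma ae_off (Q : Om -> Prop) : (forall w, ~ N w -> Q w) -> {ae PP, forall w, Q w}.
Proof. by move=> NQ; exists N; split => // w nQ; apply: contrapT => /NQ. Qed.

(** By [sqnormE] these are means of a finite random measure along sets decreasing to the empty set,
    and they are dominated by C0 T. *)
Lemma sqnorm_continuous t (U : (set (SX X * SX X))^nat) : 0 <= t <= T ->
  (forall j, Alg (U j)) -> (forall j, U j.+1 `<=` U j) -> \bigcap_j U j = set0 ->
  (fun j => sqnorm PP (Nt t (U j))) @ \oo --> 0%E.
Proof.
move=> tT AU Und U0; have /andP[t0 tT'] := tT.
have [|||||_ _] := @dominated_convergence _ _ _ PP setT measurableT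
   (fun j => EFin \o comp (U j) 0 t) (cst 0%E) (cst (C0 * T)%:E).
- by move=> j; apply/measurable_EFinP; have /integrableP[/measurable_EFinP] :=
    ic measurableT (mD (AU j)) (lexx 0) t0.
- by [].
- apply: ae_off => w Nw _.
  have -> : (fun j => (EFin \o comp (U j) 0 t) w) = CM w \o (fun j => `]-oo, t]%classic `*` U j).
    by apply/funext => j; rewrite /= CME// clamp_id.
  have e0 : \bigcap_j (`]-oo, t]%classic `*` U j : set RJ) = set0.
    apply/seteqP; split => // p Hp; have : (\bigcap_j U j) p.2 by move=> j _; have [] := Hp j I.
    by rewrite U0.
  rewrite -(measure0 (CM w)) -e0; apply: nonincreasing_cvg_mu.
  + by rewrite CME// ltry.
  + by move=> j; exact: mX.
  + by rewrite e0; exact: measurable0.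
  + by apply/nonincreasing_seqP => j; apply/subsetPset => p [? /Und].
- exact: finite_measure_integrable_cst.
- apply: ae_off => w _ j _; rewrite /= lee_fin ger0_norm.
    by have /andP[] := comp_le_max w (AU j) tT.
  by have /andP[] := comp_le_max w (AU j) tT.
- rewrite integral_cst// mul0e; apply: cvg_trans; apply: near_eq_cvg; apply: nearW => j.
  by rewrite sqnormE.
Qed.

Lemma sigma_finite_count t : 0 < t <= T -> sigma_finite_L2_measure PP J0 Alg (Nt t).
Proof.
move=> /andP[t0 tT]; have tT' : 0 <= t <= T by rewrite ltW.
split.
- by move=> U AU; apply: le_lt_trans (sqnorm_le AU tT') (ltry _).
- move=> U V AU AV UV; apply: ae_off => w Nw.
  rewrite !NtE//; last exact: jump_algebraU.
  rewrite -EFinD; congr EFin; rewrite /compensated_jumps compU// countU//.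
  by rewrite opprD addrACA.
(* The second moments are bounded on all of J0, so a constant exhausting sequence will do. *)
- exists (fun=> J0); split.
  + by move=> _; exact: jump_algebraT.
  + by move=> _ p.
  + by apply/seteqP; split => [p [_ _]//|p Jp]; exists 0%N.
  + by move=> _; exists (C0 * T) => U AU _; exact: sqnorm_le.
  + by move=> _ U AU _; exact: sqnorm_continuous.
Qed.

Lemma count_orthogonal_martingale_measure : orthogonal_martingale_measure PP T F J0 Alg Nt.
Proof.
split; last by move=> U V; exact: orthogonality.
split; [|exact: sigma_finite_count|exact: compensated_martingale].
move=> U AU; apply: ae_off => w Nw; rewrite NtE ?compensated_jumps0//.
by rewrite lexx ltW.
Qed.

(** Only the values on products are known to be adapted; [measurable_measures], applied over the
    completed sigma-algebra at time T, extends this to all measurable sets. *)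
Lemma random_measure_version (m : Om -> {measure set RJ -> \bar R}) (f : set (SX X * SX X) -> R -> Om -> R)
    (nu : R -> set (SX X * SX X) -> Om -> \bar R) :
  (forall w B, N w -> m w B = 0%E) ->
  (forall w, ~ N w -> m w (~` strip) = 0%E) ->
  (forall w t U, ~ N w -> Alg U -> m w (`]-oo, t]%classic `*` U) = (f U (clamp T t) w)%:E) ->
  (forall U t, Alg U -> 0 <= t <= T ->
     measurable_fun [set: g_sigma_algebraType (G t)] (f U t : g_sigma_algebraType (G t) -> R)) ->
  (forall w t U, ~ N w -> 0 <= t <= T -> Alg U -> nu t U w = (f U t w)%:E) ->
  random_measure PP T F J0 Alg nu.
Proof.
move=> mN0 ms mE mf nuE.
have AT := jump_algebraT J0b J0sb.
have ms' w : m w (~` strip) = 0%E by have [/mN0->|/ms] := pselect (N w).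
have mstrip := measurable_jump_strip AT T.
have mfin w B : measurable B -> m w B \is a fin_num.
  move=> mB; have [/mN0->//|Nw] := pselect (N w).
  rewrite (measure_strip AT ms' w mB) ge0_fin_numE//.
  apply: (@le_lt_trans _ _ (m w (`]-oo, T]%classic `*` J0))); last by rewrite mE// ltry.
  apply: le_measure; rewrite ?inE; [exact: measurableI|exact: mX|].
  by move=> p [_ [/= ]]; rewrite !in_itv/= => /andP[_ ->].
have mm t U : Alg U -> measurable_fun [set: g_sigma_algebraType (G T)]
    (fun w : g_sigma_algebraType (G T) => m w (`]-oo, t]%classic `*` U)).
  move=> AU; have cT := clamp_range T0 t.
  (* The indicator of the complement of N is inserted because m vanishes on N whereas f need not. *)
  have e w : m w (`]-oo, t]%classic `*` U) = ((f U (clamp T t) w) * \1_(~` N) w)%:E.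
    rewrite indicE; have [Nw|Nw] := pselect (N w).
      by rewrite mN0// memNset ?mulr0//; exact.
    by rewrite mem_set// mulr1 mE.
  under eq_fun do rewrite e; apply/measurable_EFinP; apply: measurable_funM.
    move=> _ B mB; have := mf U _ AU cT measurableT B mB.
    rewrite /measurable/= !sigma_algebra_id//; apply: Ymono.
    by case/andP: cT.
  by apply: measurable_indic; apply: measurableC; apply: sub_sigma_algebra; exact: GN.
exists m; split.
  move=> B mB; apply: (wrt_augmented Fsig mN N0 (f := fun w => m w B)) => //.
  have H := (@measurable_measures R X _ (g_sigma_algebraType (G T)) Alg _ J0 AT m T ms' mfin mm B mB).
  by apply: H => U V; exact: jump_algebraI.
apply: ae_off => w Nw; split; first exact: ms'.
move=> t U tT AU; rewrite nuE//.
have mXp : measurable (`]0, t]%classic `*` U : set RJ).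
  by apply: measurableX => //; exact: sub_sigma_algebra.
rewrite -[in LHS](clamp_id tT) -mE// (measure_strip AT ms' w (mX t AU)).
by rewrite -setXI clamp_itv clamp_id// (setIidl (jump_algebra_sub AU)).
Qed.

Lemma count_random_measure : random_measure PP T F J0 Alg Nc.
Proof.
apply: (@random_measure_version NM (fun U => count U 0)).
- by move=> w B Nw; rewrite /counting_measure asboolT.
- move=> w Nw; rewrite /counting_measure asboolF// /msum/=; apply: big1 => i _.
  rewrite [LHS](_ : _ = (((nth 0 (jump_list Hd dsep T0 J0 HN w) i, jump_representative h J0 N w
    (nth 0 (jump_list Hd dsep T0 J0 HN w) i)) \in ~` strip)%:R)%:E)//.
  rewrite memNset// => -[]; split.
    have : nth 0 (jump_list Hd dsep T0 J0 HN w) i \in jump_list Hd dsep T0 J0 HN w by exact: mem_nth.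
    by rewrite mem_filter => /andP[/andP[+ _] _] /=; rewrite in_itv.
  have : nth 0 (jump_list Hd dsep T0 J0 HN w) i \in jump_list Hd dsep T0 J0 HN w by exact: mem_nth.
  rewrite mem_filter => /andP[/andP[_ /asboolP jr] _] /=.
  by have [] := jump_representativeP Hd dsep k1 T0 J0s HN (jump_algebraT J0b J0sb) jr.
- by move=> w t U; exact: NME.
- by move=> U t AU /andP[t0 tT]; apply: mcount => //; [exact: mD|exact: oD].
- by move=> w t U; exact: NcE.
Qed.

Lemma kappa_random_measure : random_measure PP T F J0 Alg Kt.
Proof.
apply: (@random_measure_version CM (fun U => comp U 0)).
- by move=> w B Nw; rewrite /compensator_measure asboolT.
- move=> w Nw; rewrite compensator_measure_off// setICl.
  by under eq_integral do rewrite measure0; rewrite integral0.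
- by move=> w t U; exact: CME.
- by move=> U t AU /andP[t0 tT]; apply: mcomp => //; exact: mD.
- by move=> w t U; exact: KtE.
Qed.

Lemma kappa_predictable U : Alg U -> predictable PP T F (fun t => Kt t U).
Proof.
move=> AU; apply: (predictable_nondecreasing Fsig mN N0 T0).
- move=> t tT; have /andP[t0 _] := tT.
  apply: (wrt_augmented Fsig mN N0 (f := fun w => (comp U 0 t w)%:E)).
    by apply/measurable_EFinP; apply: mcomp => //; exact: mD.
  by move=> w Nw; rewrite KtE.
- by move=> w s t _ st _; exact: scaled_kappa_mono.
- move=> w t b Nw /andP[t0 tT]; rewrite KtE ?(ltW t0)// lte_fin => bt.
  (* Stepping back by at most (comp - b) / (C0 + 1) loses at most C0 times that length, hence less
     than the excess over b. The denominator is positive even if C0 is 0, and the maximum keeps s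
     nonnegative. *)
  pose s := Num.max 0 (t - (comp U 0 t w - b) / (C0 + 1)).
  have C1 : 0 < C0 + 1 by rewrite ltr_wpDl.
  have r0 : 0 < (comp U 0 t w - b) / (C0 + 1) by rewrite divr_gt0// subr_gt0.
  have s0 : 0 <= s by rewrite le_max lexx.
  have st : s < t by rewrite gt_max t0/= ltrBlDr ltrDl.
  exists s; first by rewrite s0.
  rewrite KtE ?s0 ?(le_trans (ltW st))// lte_fin.
  have := compD w (mD AU) (lexx 0) s0 (ltW st).
  have := comp_le w (mD AU) s0 (ltW st).
  have ts : t - s <= (comp U 0 t w - b) / (C0 + 1).
    by rewrite lerBlDr -lerBlDl le_max lexx orbT.
  have H1 : C0 * (t - s) < comp U 0 t w - b.
    apply: (@lt_le_trans _ _ ((C0 + 1) * (t - s))).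
      by rewrite ltr_pM2r ?subr_gt0// ltrDl.
    by rewrite mulrC -ler_pdivlMr.
  by move=> H2 H3; lra.
Qed.

Lemma kappa_compensator : compensator PP T F J0 Alg Nc Kt.
Proof.
split; first exact: kappa_random_measure.
by move=> U AU; split; [exact: kappa_predictable|exact: compensated_martingale].
Qed.

Lemma kappa_covariation U V : Alg U -> Alg V ->
  predictable_covariation PP T F (fun t => Nt t U) (fun t => Nt t V) (fun t => Kt t (U `&` V)).
Proof.
move=> AU AV; have AI := jump_algebraI J0j AU AV; split.
- exact: kappa_predictable.
- by apply: ae_off => w Nw; rewrite KtE ?comp00// lexx ltW.
- apply: ae_off => w Nw; split; first by move=> t tT; rewrite KtE.
  apply: nondecreasing_bounded_variation => s t.
  rewrite !in_itv/= => sT tT st; rewrite !KtE//= -lee_fin -!KtE//.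
  exact: scaled_kappa_mono.
- exact: covariation_martingale.
Qed.

End conclusion.

(** * Invariance of the configurations of low energy *)

Section energy_bound.
Context (R : realType) (X : ptopologicalType) (d : X -> X -> R) (a : nat -> X).
Hypothesis Hd : sep_metric d a.
Variables (k : nat) (T : R) (E : X -> R) (P : R -> SX X -> Mplus R (SX X)).
Hypothesis cE : continuous E.
Variables (c : R) (n : nat).

Local Notation S := (borel (SX X)).

Definition low_energy : set (SX X) := [set x | sum_conf E x <= c /\ (card x <= n)%N].

Lemma measurable_low_energy : measurable (low_energy : set S).
Proof.
rewrite (_ : low_energy = ((sum_conf E : S -> R) @^-1` `]-oo, c]%classic) `&`
    [set x : S | (card x <= n)%N]).
  apply: measurableI; last exact: (@measurable_card_le R).
  by rewrite -[X in measurable X]setTI; apply: measurable_sum_conf.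
by apply/seteqP; split => x; rewrite /low_energy/= in_itv/=.
Qed.

(** A jump changes the total energy by that of y minus that of the part removed, the other points
    being untouched. The cardinality is handled alike, or is bounded through the energy. *)
Lemma low_energy_preserved :
  {ae @lebesgue_measure R, forall t, 0 <= t <= T -> forall x,
     {ae P t x, forall y, sum_conf E y - sum_conf E x <= 0}} ->
  {ae @lebesgue_measure R, forall t, 0 <= t <= T -> forall x,
     {ae P t x, forall y, (card y)%:R - (card x)%:R <= 0 :> R}} \/
  (forall x, sum_conf E x <= c -> (card x <= n)%N) ->
  {ae @lebesgue_measure R, forall r, 0 <= r <= T -> preserved k P low_energy r}.
Proof.
move=> aeE aeC.
have step r : (forall z, {ae P r z, forall y, sum_conf E y - sum_conf E z <= 0}) ->
    (forall z, {ae P r z, forall y, (card y)%:R - (card z)%:R <= 0 :> R}) \/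
      (forall x, sum_conf E x <= c -> (card x <= n)%N) -> preserved k P low_energy r.
  move=> rE rC x [xc xn] I Ik.
  have mA : measurable ([set y : S | ~ low_energy ((x `\` subconf I) `+` y)%mset] : set S).
    rewrite -[X in measurable X]setTI.
    exact: (measurable_translate Hd (x `\` subconf I)%mset measurableT (measurableC measurable_low_energy)).
  apply/(negligibleP (P r (subconf I)) mA).
  have sE y : sum_conf E y - sum_conf E (subconf I) <= 0 ->
      sum_conf E ((x `\` subconf I) `+` y)%mset <= c.
    by rewrite subr_le0 => yz; apply: le_trans xc; rewrite -[in leRHS](subconfK I) !sum_confD addrC lerD2r.
  case: rC => [rC|rC]; last first.
    apply: negligibleS (rE (subconf I)) => y /= nA h1; apply: nA; split; first exact: sE.
    by apply: rC; exact: sE.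
  apply: negligibleS (negligibleU (rE (subconf I)) (rC (subconf I))) => y /= nA.
  apply: contrapT => /not_orP[/contrapT h1 /contrapT]; rewrite subr_le0 ler_nat => h2.
  apply: nA; split; first exact: sE.
  by apply: leq_trans xn; rewrite -[in leqRHS](subconfK I) !card_add addnC leq_add2r.
case: aeC => [aeC|nC].
  by apply: (@filterS2 _ _ (ae_filter_ringOfSetsType _) _ _ _ _ aeE aeC) => r rE rC rT; apply: step; [exact: rE|left; exact: rC].
by apply: (@filterS _ _ (ae_filter_ringOfSetsType _) _ _ _ aeE) => r rE rT; apply: step; [exact: rE|right].
Qed.

End energy_bound.

Theorem proposition2 (R : realType) (X : ptopologicalType) (k : nat) (T : R)
    (E : X -> R) (P : R -> SX X -> Mplus R (SX X)) (h : {posnum R})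
    (mu0 : Mplus R X) (PP : probability (skorokhod X T) R)
    (J0 : set (SX X * SX X)) :
  polish R X -> (1 <= k)%N -> 0 < T ->
  (forall a, 0 <= E a) -> continuous E ->
  (forall c : R, compact [set a | E a <= c]) ->
  kernel_assumptions k T E P ->
  Mhdelta h mu0 ->
  markov_jump_law k h P mu0 PP ->
  jump_space k T P J0 ->
  let F := @right_filtration R X T in
  let Alg := @jump_algebra R X k J0 in
  let N := fun t U (xi : skorokhod X T) => jump_count h xi t U in
  let K := fun t U (xi : skorokhod X T) => scaled_kappa k h P xi t U in
  let Nt := fun t U (xi : skorokhod X T) => compensated_count k h P xi t U in
  [/\ random_measure PP T F J0 Alg N,
      compensator PP T F J0 Alg N K,
      orthogonal_martingale_measure PP T F J0 Alg Nt &
      forall U1 U2, Alg U1 -> Alg U2 ->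
        predictable_covariation PP T F (fun t => Nt t U1) (fun t => Nt t U2)
          (fun t => K t (U1 `&` U2))].
Proof.
move=> /polish_sep_metric[d [a [Hd dsep]]] k1 T0 E0 cE _ [mP [_ Pd] PE PN [C PC]] [x0 mu0E] law J0s F Alg N K Nt.
pose c := sum_conf E x0.
(* In the first case of assumption (4) the initial cardinality is never exceeded; in the second each
   point has energy at least e, so at most c / e points fit. *)
have [n [nx0 nC]] : exists n, (card x0 <= n)%N /\
    ({ae @lebesgue_measure R, forall t, 0 <= t <= T -> forall x,
       {ae P t x, forall y, (card y)%:R - (card x)%:R <= 0 :> R}} \/
     (forall x, sum_conf E x <= c -> (card x <= n)%N)).
  case: PN => [PN|[e e0 Ee]]; first by exists (card x0); split => //; left.
  have H x : sum_conf E x <= c -> (card x <= Num.truncn (c / e))%N.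
    move=> xc; have ce : e * (card x)%:R <= sum_conf E x.
      by rewrite (card_sum_conf R) /sum_conf mulr_sumr; apply: ler_sum => b _; rewrite mulr1.
    have c0 : 0 <= c / e.
      by rewrite divr_ge0 ?(ltW e0)// (le_trans _ xc)// (le_trans _ ce)// mulr_ge0// ltW.
    by rewrite truncn_ge_nat// ler_pdivlMr// mulrC (le_trans ce).
  by exists (Num.truncn (c / e)); split; [exact: H|right].
pose B := low_energy E c n.
have [M [mM M0 HM]] : {ae PP, forall xi, [/\ Mhdelta_valued h xi, pure_jump xi &
    forall t, 0 <= t <= T -> B (conf h (path_of xi t))]}.
  have aeB : {ae PP, forall xi : skorokhod X T, forall t, 0 <= t <= T -> B (conf h (path_of xi t))}.
    apply: (as_all_times Hd dsep T0 law) => t tT.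
    apply: (as_preserved Hd dsep Pd T0 law _ _ mu0E _ tT).
    - exact: (measurable_low_energy cE).
    - exact: (low_energy_preserved Hd k cE PE nC).
    - by split => //; exact: lexx.
  by apply: filterS2 (law_jump law) aeB => xi [h1 h2] h3.
have HN xi : ~ M xi -> [/\ Mhdelta_valued h xi, pure_jump xi &
    forall t, 0 <= t <= T -> B (conf h (path_of xi t))].
  by move=> Mxi; apply: contrapT => H; apply: Mxi; exact: HM.
have Bn x : B x -> (card x <= n)%N by case.
(* Both kernels are truncated at energy c, and [q] also at n points; this changes nothing on B,
   which almost every path never leaves. *)
pose q := jump_rates Hd h c n cE E0 mP PC; pose Pk := P_kernel Hd c cE E0 mP PC.
have qE r x (A : set (borel (SX X))) : 0 <= r <= T -> B x -> measurable A ->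
    q (r, x) A = (\sum_(I : {set 'I_(card x)} | (1 <= #|I| <= k)%N)
    (h%:num ^+ #|I|.-1)%:E * P r (subconf I) [set y | A ((x `\` subconf I) `+` y)%mset])%E.
  by move=> rT [xc xn]; exact: jump_ratesE.
have PkE r x (I : {set 'I_(card x)}) (A : set (borel (SX X))) : 0 <= r <= T -> B x ->
    (1 <= #|I| <= k)%N -> Pk (r, subconf I) A = P r (subconf I) A.
  move=> rT [xc _] Ik; rewrite /Pk /P_kernel finite_kernelE /truncated_P asboolT//.
  by split => //=; rewrite card_subconf; split => //; apply: le_trans (sum_conf_subconf E0 I) xc.
have C0 := rate_bound_ge0 k h c C n; have q_le := jump_rates_le Hd h c n cE E0 mP PC.
split.
- exact: (count_random_measure Hd dsep k1 T0 J0s mM M0 HN).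
- exact: (kappa_compensator Hd dsep k1 T0 Pd J0s law mM M0 HN Bn C0 q_le qE PkE).
- exact: (count_orthogonal_martingale_measure Hd dsep k1 T0 Pd J0s law mM M0 HN Bn C0 q_le qE PkE).
- by move=> U1 U2; exact: (kappa_covariation Hd dsep k1 T0 Pd J0s law mM M0 HN Bn C0 q_le qE PkE).
Qed.
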